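(* Let $n\ge 2$, $p\ge 2$, and let $f$ satisfy condition (F) of the context. For each $\ell>0$ let $u_\ell$ be a weak solution of $\Delta_p u_\ell=f(u_\ell)$ in $S_\ell$ with $u_\ell(x)\to\infty$ as $x\to\partial S_\ell$, and for $x\in S$ define $u(x)=\inf_{\ell\ge \ell(x)}u_\ell(x)$, where $\ell(x)>0$ is such that $x\in S_{\ell(x)}$. Then $u$ is independent of the $n$-th variable, i.e. $u(x)=u(x')$ where $x=(x',x_n)$. Moreover, if $v(x')=u(x',x_n)$ for a fixed $x_n$, then $v$ is a weak solution of $$\Delta_p v-f(v)=0\ \text{ in } B^{n-1}_1(0),\qquad v(x')\to\infty\ \text{ as } \operatorname{dist}(x',\partial B^{n-1}_1(0))\to0 .$$
   Context: Here $S=B^{n-1}_1(0)\times\mathbb{R}\subset\mathbb{R}^n$, where $B^{n-1}_1(0)$ is the open unit ball of $\mathbb{R}^{n-1}$, and for $\ell>0$ $$S_\ell=\Big\{x\in\mathbb{R}^n:\ \sum_{i=1}^{n-1}x_i^2<1,\ -\ell<x_n<\ell\Big\}\cup\Big\{x\in\mathbb{R}^n:\ \Big(\sum_{i=1}^{n-1}x_i^2\Big)^2+(x_n\pm\ell)^4<1\Big\}$$ (the second set denotes the union of the two sets obtained from the two signs). $S_\ell$ is a bounded domain with $C^2$ boundary, and $S_\ell\to S$ as $\ell\to\infty$. $\Delta_p u=\operatorname{div}(|\nabla u|^{p-2}\nabla u)$ (in $\mathbb{R}^n$ for $u$, in $\mathbb{R}^{n-1}$ for $v$). Condition (F): $f:[0,\infty)\to[0,\infty)$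 is continuous, increasing, positive on $(0,\infty)$, $f(0)=0$, and satisfies the Keller–Osserman condition: for every $r>0$, $\Psi_p(r):=\left(1-\frac1p\right)^{1/p}\int_r^\infty \frac{ds}{F(s)^{1/p}}<\infty$, where $F(x)=\int_0^x f(s)\,ds$. Weak solution: for a domain $\Omega$, $u\in W^{1,p}_{loc}(\Omega)$ is a weak solution of $\Delta_p u=f(u)$ in $\Omega$ if for every $\Omega'\subset\subset\Omega$, $-\int_{\Omega'}|\nabla u|^{p-2}\nabla u\cdot\nabla\phi\,dx=\int_{\Omega'}f(u)\phi\,dx$ for all $\phi\in W^{1,p}_0(\Omega')$. *)

(* Defs.v *)
From HB Require Import structures.
From mathcomp Require Import all_boot all_order all_algebra.
From mathcomp Require Import all_classical all_reals all_analysis.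
Import Order.TTheory GRing.Theory Num.Theory.
Import numFieldNormedType.Exports.

Set Implicit Arguments.
Unset Strict Implicit.
Unset Printing Implicit Defensive.

Local Open Scope classical_set_scope.
Local Open Scope ring_scope.

(* R^n is 'rV[R]_n.  It carries the product sigma-algebra generated by the     *)
(* coordinates (the Borel sets), exactly as the library does for n.-tuple.     *)
Definition rV_display : measure_display. Proof. exact: default_measure_display. Qed.

Section measurable_rV.
Context {R : realType} {n : nat}.

Let coor (i : 'I_n) (x : 'rV[R]_n) : measurableTypeR R := x 0 i.

Let rV_set0 : g_sigma_preimage coor set0.
Proof. exact: sigma_algebra0. Qed.

Let rV_setC A : g_sigma_preimage coor A -> g_sigma_preimage coor (~` A).
Proof. exact: sigma_algebraC. Qed.

Let rV_bigcup (F : (set 'rV[R]_n)^nat) :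
  (forall i, g_sigma_preimage coor (F i)) ->
  g_sigma_preimage coor (\bigcup_i (F i)).
Proof. exact: sigma_algebra_bigcup. Qed.

HB.instance Definition _ := @isMeasurable.Build rV_display
  'rV[R]_n (g_sigma_preimage coor) rV_set0 rV_setC rV_bigcup.

Lemma measurable_coor (i : 'I_n) :
  measurable_fun [set: 'rV[R]_n] (fun x => x 0 i : measurableTypeR R).
Proof.
move=> _ Y mY; rewrite setTI; apply: sub_sigma_algebra => /=.
rewrite -bigcup_seq/=; exists i => /=; first by rewrite mem_index_enum.
by exists Y => //; rewrite setTI.
Qed.

Lemma measurable_rVP d (T : measurableType d) (f : T -> 'rV[R]_n) :
  (forall i, measurable_fun [set: T] (fun t => f t 0 i : measurableTypeR R)) ->
  measurable_fun [set: T] f.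
Proof.
move=> mf; have H : g_sigma_preimage (fun i => coor i \o f) `<=` measurable.
  apply: smallest_sub; first exact: sigma_algebra_measurable.
  elim/big_ind : _ => //= [A B sA sB|i _]; first by rewrite subUset; split.
  by move=> _ [B mB <-]; exact: mf.
rewrite g_sigma_preimage_comp in H => _ A mA.
by apply: H; exists A.
Qed.

End measurable_rV.

Section lebesgue_step.
Context {R : realType} {n : nat}.
Variable mu : {sigma_finite_measure set 'rV[R]_n -> \bar R}.

Definition rV_cons (z : measurableTypeR R * 'rV[R]_n) : 'rV[R]_n.+1 :=
  row_mx (z.1 : R)%:M z.2 : 'rV[R]_(1 + n).

Let measurable_rV_cons : measurable_fun setT rV_cons.
Proof.
apply: measurable_rVP => i; rewrite /rV_cons /=.
have -> : (fun z : measurableTypeR R * 'rV[R]_n =>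
    (row_mx (z.1 : R)%:M z.2 : 'rV[R]_(1 + n)) 0 i) =
  (fun z => match @fintype.split 1 n i with
     inl _ => z.1 | inr j => z.2 0 j end).
  apply/funext => z; rewrite mxE; case: fintype.split => // j.
  by rewrite ord1 mxE eqxx.
case: fintype.split => j; first exact: measurable_fst.
exact: (measurableT_comp (measurable_coor j) measurable_snd).
Qed.

Definition lebesgue_step : set 'rV[R]_n.+1 -> \bar R :=
  pushforward (@lebesgue_measure R \x mu)%E rV_cons.

Let step0 : lebesgue_step set0 = 0%E.
Proof. by rewrite /lebesgue_step /pushforward preimage_set0 measure0. Qed.

Let step_ge0 A : (0 <= lebesgue_step A)%E.
Proof. exact: measure_ge0. Qed.

Let step_sigma_additive : semi_sigma_additive lebesgue_step.
Proof.
move=> F mF tF mUF; rewrite /lebesgue_step /pushforward preimage_bigcup.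
have mP A : measurable A -> measurable (rV_cons @^-1` A).
  by move=> mA; rewrite -[X in measurable X]setTI; exact: measurable_rV_cons.
apply: measure_semi_sigma_additive.
- by move=> k; exact: mP.
- apply/trivIsetP => /= i j _ _ ij; rewrite -preimage_setI.
  by move/trivIsetP : tF => /(_ _ _ _ _ ij) ->//; rewrite preimage_set0.
- by rewrite -preimage_bigcup; exact: mP.
Qed.

HB.instance Definition _ := isMeasure.Build _ _ _ lebesgue_step
  step0 step_ge0 step_sigma_additive.

Let step_sigma_finite : sigma_finite setT lebesgue_step.
Proof.
have /sigma_finiteP[F [FT ndF Foo]] := sigma_finiteT (@lebesgue_measure R).
have /sigma_finiteP[G [GT ndG Goo]] := sigma_finiteT mu.
pose g (x : 'rV[R]_n.+1) : measurableTypeR R * 'rV[R]_n :=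
  (x 0 0, \row_j x 0 (lift 0 j)).
have mg : measurable_fun setT g.
  apply/measurable_fun_pairP; split; first exact: measurable_coor.
  apply: measurable_rVP => i /=; apply: eq_measurable_fun (measurable_coor (lift 0 i)).
  by move=> x _ /=; rewrite mxE.
have gK : cancel rV_cons g.
  move=> [t y]; rewrite /g /rV_cons; congr pair.
    by rewrite mxE; case: fintype.splitP => // j _; rewrite ord1 mxE eqxx.
  apply/rowP => j; rewrite !mxE; case: fintype.splitP => k /=.
    by rewrite ord1.
  by rewrite /bump leq0n => -[/val_inj ->].
exists (fun k => g @^-1` (F k `*` G k)).
  rewrite -preimage_bigcup; apply/esym/seteqP; split=> // x _ /=.
  have [k _ Fk] : (\bigcup_k F k) (g x).1 by rewrite -FT.
  have [l _ Gl] : (\bigcup_l G l) (g x).2 by rewrite -GT.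
  exists (maxn k l) => //; split.
  - by move: Fk; exact/subsetPset/ndF/leq_maxl.
  - by move: Gl; exact/subsetPset/ndG/leq_maxr.
move=> k; have [mF Fk] := Foo k; have [mG Gk] := Goo k.
have mFG : measurable (F k `*` G k) by exact: measurableX.
split; first by rewrite -[X in measurable X]setTI; exact: mg.
rewrite /lebesgue_step /pushforward -comp_preimage.
rewrite (_ : g \o rV_cons = id) ?preimage_id; last first.
  by apply/funext => z /=; rewrite gK.
by rewrite product_measure1E// lte_mul_pinfty// ge0_fin_numE.
Qed.

HB.instance Definition _ := @Measure_isSigmaFinite.Build _ _ _ lebesgue_step
  step_sigma_finite.

End lebesgue_step.

Fixpoint lebesgue_rV {R : realType} (n : nat) :
    {sigma_finite_measure set 'rV[R]_n -> \bar R} :=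
  match n with
  | 0 => \d_(0%R : 'rV[R]_0)
  | n'.+1 => lebesgue_step (lebesgue_rV n')
  end.

Section euclidean.
Context {R : realType} {n : nat}.
Implicit Types (v w x : 'rV[R]_n) (A : set 'rV[R]_n).

Definition dot v w : R := \sum_(i < n) v 0 i * w 0 i.

(* The library's norm `|x| on 'rV[R]_n is the sup norm, hence this one. *)
Definition enorm v : R := Num.sqrt (dot v v).

Definition unit_ball : set 'rV[R]_n := [set x | enorm x < 1].

Definition boundary A : set 'rV[R]_n := closure A `\` interior A.

Definition dist x A : R := inf [set enorm (x - y) | y in A].

Definition blows_up (Omega : set 'rV[R]_n) (u : 'rV[R]_n -> R) : Prop :=
  forall M : R, exists2 delta : R, 0 < delta &
    forall x, Omega x -> dist x (boundary Omega) < delta -> M < u x.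

End euclidean.

Section sobolev.
Context {R : realType} {n : nat}.
Implicit Types (p : R) (D Omega : set 'rV[R]_n) (u phi : 'rV[R]_n -> R).
Implicit Types (Du Dphi : 'rV[R]_n -> 'rV[R]_n) (i : 'I_n).

Local Notation mu := (lebesgue_rV n).

Definition pderiv i phi : 'rV[R]_n -> R := fun x => 'D_(delta_mx 0 i) phi x.

Definition iter_pderiv (s : seq 'I_n) phi : 'rV[R]_n -> R := foldr pderiv phi s.

(* C^oo: every iterated partial derivative is (Frechet) differentiable. *)
Definition smooth phi : Prop :=
  forall (s : seq 'I_n) x, differentiable (iter_pderiv s phi) x.

Definition support phi : set 'rV[R]_n := closure [set x | phi x != 0].

Definition test_function D phi : Prop :=
  [/\ smooth phi, compact (support phi) & support phi `<=` D].

Definition compactly_inside D Omega : Prop :=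
  [/\ open D, compact (closure D) & closure D `<=` Omega].

Definition in_Lp p D u : Prop := u \_ D \in Lfun mu p%:E.

Definition Lp_dist p D u phi : \bar R :=
  ('N[mu]_(p%:E)[EFin \o ((fun x => u x - phi x)%R \_ D)])%E.

Definition weak_pderiv D i u (g : 'rV[R]_n -> R) : Prop :=
  forall phi, test_function D phi ->
    (\int[mu]_(x in D) (u x * pderiv i phi x)%:E
     = - \int[mu]_(x in D) (g x * phi x)%:E)%E.

(* u belongs to W^{1,p}(D) and Du represents its weak gradient there. *)
Definition W1p p D u Du : Prop :=
  in_Lp p D u /\
  forall i, in_Lp p D (fun x => Du x 0 i) /\
            weak_pderiv D i u (fun x => Du x 0 i).

Definition W1p_loc p Omega u Du : Prop :=
  forall D, compactly_inside D Omega -> W1p p D u Du.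

(* W^{1,p}_0(D): the closure of C_c^oo(D) in W^{1,p}(D). *)
Definition W1p_0 p D phi Dphi : Prop :=
  W1p p D phi Dphi /\
  exists psi : nat -> 'rV[R]_n -> R,
    [/\ forall k, test_function D (psi k),
        Lp_dist p D (psi k) phi @[k --> \oo] --> 0%E &
        forall i, Lp_dist p D (pderiv i (psi k)) (fun x => Dphi x 0 i)
                    @[k --> \oo] --> 0%E].

(* Weak solutions of Delta_p u = f(u).  They take values in [0, +oo[, the      *)
(* domain of f.  The identity is between extended reals: its left-hand side    *)
(* is finite by Hoelder's inequality, so it forces f(u) phi to be integrable.  *)
Definition weak_solution p (f : R -> R) Omega u : Prop :=
  (forall x, Omega x -> 0 <= u x) /\
  exists2 Du, W1p_loc p Omega u Du &
    forall D, compactly_inside D Omega ->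
    forall phi Dphi, W1p_0 p D phi Dphi ->
      (- (\int[mu]_(x in D)
            (enorm (Du x) `^ (p - 2) * dot (Du x) (Dphi x))%:E)
       = \int[mu]_(x in D) (f (u x) * phi x)%:E)%E.

End sobolev.

Section keller_osserman.
Context {R : realType}.
Implicit Types (p r x : R) (f : R -> R).

Definition primitive f x : R :=
  (\int[@lebesgue_measure R]_(s in `[0, x]) f s)%R.

Definition Psi p f r : \bar R :=
  (((1 - p^-1) `^ p^-1)%:E *
   \int[@lebesgue_measure R]_(s in `]r, +oo[)
     ((primitive f s `^ p^-1)^-1)%:E)%E.

(* f : [0, +oo[ -> [0, +oo[ is represented by a function on R of which only    *)
(* the values on [0, +oo[ are used; "increasing" is taken non-strictly.        *)
Record condition_F p f : Prop := ConditionF {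
  F_continuous : {within `[0, +oo[, continuous f};
  F_increasing : forall s t : R, 0 <= s -> s <= t -> f s <= f t;
  F_zero : f 0 = 0;
  F_positive : forall s : R, 0 < s -> 0 < f s;
  F_keller_osserman : forall r : R, 0 < r -> (Psi p f r < +oo)%E }.

End keller_osserman.

(* The ambient space is R^n with n = m + 1, and x = (x', x_n) = row_mx x' x_n. *)
Section cylinder.
Context {R : realType} {m : nat}.
Implicit Types (x : 'rV[R]_(m + 1)) (y : 'rV[R]_m) (l t : R).

Definition point_of y t : 'rV[R]_(m + 1) := row_mx y t%:M.
Definition base x : 'rV[R]_m := lsubmx x.
Definition height x : R := rsubmx x 0 0.

Definition cylinder : set 'rV[R]_(m + 1) := [set x | unit_ball (base x)].

Definition capped_cylinder l : set 'rV[R]_(m + 1) :=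
  [set x | \sum_(i < m) base x 0 i ^+ 2 < 1 /\ - l < height x < l]
  `|` ([set x | (\sum_(i < m) base x 0 i ^+ 2) ^+ 2 + (height x + l) ^+ 4 < 1]
   `|` [set x | (\sum_(i < m) base x 0 i ^+ 2) ^+ 2 + (height x - l) ^+ 4 < 1]).

Definition lower_envelope (u : R -> 'rV[R]_(m + 1) -> R)
    (ell : 'rV[R]_(m + 1) -> R) x : R :=
  inf [set u l x | l in [set l | ell x <= l]].

End cylinder.

(* Main.v *)
(* The envelope is the function V(|x'|), where V is the radial large solution of the unit ball of
   R^m.  No uniqueness of the solutions on the capped cylinders is used, only a comparison
   principle between a weak solution and a C^1 barrier satisfying a strict inequality.

   Below: V is the supremum of bounded radial solutions with a slightly larger right-hand side,
   and each of these, extended to be constant in x_n, lies below every u_l, because u_l blows up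
   on the whole boundary.

   Above: let R < 1 and let V_R be the large solution of the ball of radius R.  The Keller-Osserman
   bound controls u_l on {|x'| <= R'}, R' < 1, independently of l.  A small regularization of
   V_R(lambda |x'|) + c + M (x_n - t)^2 / L^2 is then a strict supersolution for L large, above u_l
   near the boundary of {|x'| < R/lambda, |x_n - t| < L}; hence u(x) <= V_R(|x'|) + c.  Finally V_R
   decreases to a large solution of the unit ball as R increases to 1, and that solution is unique. *)
From HB Require Import structures.
Require Import Defs.
From mathcomp Require Import all_boot all_order all_algebra.
From mathcomp Require Import all_classical all_reals all_analysis.
From mathcomp Require Import measurable_realfun lebesgue_stieltjes_measure.
From mathcomp Require Import ring lra.
Import Order.TTheory GRing.Theory Num.Theory.
Import numFieldNormedType.Exports.

Set Implicit Arguments.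
Unset Strict Implicit.
Unset Printing Implicit Defensive.

Local Open Scope classical_set_scope.
Local Open Scope ring_scope.


(** * Lebesgue measure on row vectors *)

(** The weakness of the hypotheses on [f] shapes the proof. As [f] is continuous and nondecreasing
    only, [f(u)] supplies no strict monotonicity, so comparison rests on a strict gap between
    right-hand sides. This is the origin of the surplus 1/(n+1) in the radial subsolutions and of
    the dilation by a factor below 1 in the supersolutions. Testing with the square of the positive
    part of the difference, a C^1 function of it, keeps the chain rule within reach of plain
    mollification. An initial value problem with such an [f] need not depend continuously on its
    data, so the subsolutions come from shooting for an equation with a small delay, which is
    integrated step by step. Nothing is known of [u l] at the caps beyond blow-up. The parabola in
    x_n exceeds the interior bound M at distance L, so the upper barrier never looks at the caps;
    its cost, a curvature of order M / L^2, is paid by the strict gap. Keller-Osserman gives no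
    regular growth of [f], so uniqueness of the radial large solution is not read off from an
    asymptotic rate. Both solutions are written as functions of their common value v, where the same
    f(v) drives both energies and only the positions differ. *)

Lemma ball_rV {R : realType} {n : nat} (x y : 'rV[R]_n) (e : R) : 0 < e ->
  ball x e y <-> forall i, `|x 0 i - y 0 i| < e.
Proof.
move=> e0; split=> [[_ h] i|h]; first exact: h.
by split=> // i j; rewrite ord1; exact: h.
Qed.

(** The sigma-algebra is the one generated by the coordinates, so an open set has to be a countable
    union of boxes: cubes with rational centre and half-side 1/(k+1). *)
Lemma open_measurable_rV {R : realType} {n : nat} (A : set 'rV[R]_n) :
  open A -> measurable A.
Proof.
move=> oA.
pose box (qk : 'rV[rat]_n * nat) := [set x : 'rV[R]_n |
  forall i, `|ratr (qk.1 0 i) - x 0 i| < (qk.2.+1%:R)^-1].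
have mbox qk : measurable (box qk).
  rewrite (_ : box qk = \big[setI/setT]_(i < n)
     ((fun x : 'rV[R]_n => x 0 i) @^-1` ball (ratr (qk.1 0 i) : R) (qk.2.+1%:R^-1))).
    apply: bigsetI_measurable => i _; rewrite -[X in measurable X]setTI.
    by apply: measurable_coor => //; exact: measurable_ball.
  apply/seteqP; split => x.
    by move=> xb; rewrite -bigcap_seq => i _; exact: xb.
  by rewrite -bigcap_seq => xb i; apply: (xb i); rewrite /= mem_index_enum.
have -> : A = \bigcup_qk [set x | box qk x /\ box qk `<=` A].
  apply/seteqP; split => [x Ax|x [qk _ [xqk]]]; last by apply.
  have /nbhs_ballP[e /= e0 xeA] := oA x Ax.
  have [k ke] : exists k : nat, (k.+1%:R)^-1 < e / 2 :> R.
    have /cvgrPdist_lt/(_ (e / 2)) := @cvg_harmonic R.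
    rewrite divr_gt0// => /(_ isT)[k _ /(_ k (leqnn k))]/=.
    by rewrite sub0r normrN ger0_norm; [exists k|rewrite invr_ge0].
  have /choice[q xq] : forall i : 'I_n, exists q : rat, `|ratr q - x 0 i| < (k.+1%:R)^-1 :> R.
    move=> i; have := @rat_in_itvoo R (x 0 i - k.+1%:R^-1) (x 0 i + k.+1%:R^-1).
    case; first by rewrite ltrD2l gtrN // invr_gt0.
    by move=> q; rewrite in_itv/= => ?; exists q; rewrite distrC ltr_distlC.
  exists (\row_i q i, k) => //=; split => [i|]; first by rewrite mxE.
  move=> y yb; apply: xeA; apply/ball_rV => // i.
  have := yb i; have := xq i; rewrite mxE/= => h1 h2.
  rewrite (splitr e) (_ : _ - _ = (x 0 i - ratr (q i)) + (ratr (q i) - y 0 i)); last by rewrite addrA subrK.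
  rewrite (le_lt_trans (ler_normD _ _))// ltrD//; last exact: lt_trans ke.
  by rewrite distrC; exact: lt_trans ke.
apply: countable_bigcupT_measurable => // qk.
have [h|h] := pselect (box qk `<=` A).
  by rewrite (_ : [set x | _] = box qk)//; apply/seteqP; split => [x []|x].
by rewrite (_ : [set x | _] = set0)//; apply/seteqP; split => [x []|x].
Qed.

Lemma continuous_measurable_rV {R : realType} {n : nat} (D : set 'rV[R]_n)
    (f : 'rV[R]_n -> R) :
  open D -> (forall x, D x -> {for x, continuous f}) -> measurable_fun D f.
Proof.
move=> oD cf mD; apply: (measurability _ (RGenOpens.measurableE R)) => //.
move=> _ [_ [a [b ->] <-]]; apply: open_measurable_rV.
rewrite openE => x [Dx fx]; apply: filterI; first exact: oD.
by apply: (cf x Dx); exact: interval_open.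
Qed.

Lemma measurable_fun_rV_cons {R : realType} {n : nat} :
  measurable_fun setT (@rV_cons R n).
Proof.
apply: measurable_rVP => i; rewrite /rV_cons /=.
have -> : (fun z : measurableTypeR R * 'rV[R]_n =>
    (row_mx (z.1 : R)%:M z.2 : 'rV[R]_(1 + n)) 0 i) =
  (fun z => match @fintype.split 1 n i with
     inl _ => z.1 | inr j => z.2 0 j end).
  apply/funext => z; rewrite mxE; case: fintype.split => // j.
  by rewrite ord1 mxE eqxx.
case: fintype.split => j; first exact: measurable_fst.
exact: (measurableT_comp (measurable_coor j) measurable_snd).
Qed.

Lemma rV_consE0 {R : realType} {n : nat} (z : measurableTypeR R * 'rV[R]_n) :
  rV_cons z 0 0 = z.1.
Proof.
by rewrite mxE; case: fintype.splitP => // j _; rewrite ord1 mxE eqxx.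
Qed.

Lemma rV_consE {R : realType} {n : nat} (z : measurableTypeR R * 'rV[R]_n) j :
  rV_cons z 0 (lift 0 j) = z.2 0 j.
Proof.
rewrite mxE; case: fintype.splitP => k /=; first by rewrite ord1.
by rewrite /bump leq0n => -[/val_inj ->].
Qed.

Lemma rV_consD {R : realType} {n : nat} (t s : R) (y h : 'rV[R]_n) :
  rV_cons ((t : measurableTypeR R), y) + rV_cons ((s : measurableTypeR R), h) =
  rV_cons ((t + s : measurableTypeR R), y + h).
Proof.
apply/rowP => i; rewrite [LHS]mxE; have [j ->|->] := unliftP 0 i.
  by rewrite !rV_consE/= mxE.
by rewrite !rV_consE0.
Qed.

Lemma rV_cons_surj {R : realType} {n : nat} (x : 'rV[R]_n.+1) :
  x = rV_cons ((x 0 0 : measurableTypeR R), \row_j x 0 (lift 0 j)).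
Proof.
apply/rowP => i; have [j ->|->] := unliftP 0 i; last by rewrite rV_consE0.
by rewrite rV_consE mxE.
Qed.

Section integration_rV.
Context {R : realType}.
Local Notation mu n := (@lebesgue_rV R n).
Local Notation leb := (@lebesgue_measure R).
Local Open Scope ereal_scope.

Lemma ge0_integral_rVS n (f : 'rV[R]_n.+1 -> \bar R) :
  measurable_fun setT f -> (forall x, 0 <= f x) ->
  \int[mu n.+1]_x f x = \int[leb]_t \int[mu n]_y f (rV_cons (t, y)).
Proof.
move=> mf f0.
rewrite (@ge0_integral_pushforward _ _ _ _ _ _ measurable_fun_rV_cons
  (leb \x mu n) setT f measurableT mf) ?preimage_setT//.
rewrite fubini_tonelli1//; first exact: measurableT_comp measurable_fun_rV_cons.
by move=> z /=.
Qed.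

Lemma integrable_rV_cons n (f : 'rV[R]_n.+1 -> \bar R) :
  (mu n.+1).-integrable setT f -> (leb \x mu n).-integrable setT (f \o @rV_cons R n).
Proof.
move=> /integrableP[mf fi]; apply/integrableP; split.
  exact: measurableT_comp measurable_fun_rV_cons.
apply: le_lt_trans fi; rewrite (@ge0_integral_pushforward _ _ _ _ _ _ measurable_fun_rV_cons
  (leb \x mu n) setT (abse \o f) measurableT) ?preimage_setT//.
  exact: measurableT_comp.
by move=> y _ /=; exact: abse_ge0.
Qed.

(** Both orders of integration are recorded: integration by parts wants the differentiated
    coordinate innermost when it is the first one, and outermost otherwise to recurse on the
    slices. *)
Lemma integral_rVS n (f : 'rV[R]_n.+1 -> \bar R) :
  (mu n.+1).-integrable setT f ->
  \int[mu n.+1]_x f x = \int[leb]_t \int[mu n]_y f (rV_cons (t, y)) /\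
  \int[mu n.+1]_x f x = \int[mu n]_y \int[leb]_t f (rV_cons (t, y)).
Proof.
move=> fi; have mf := measurable_int _ fi.
rewrite (@integral_pushforward _ _ _ _ _ _ measurable_fun_rV_cons
  (leb \x mu n) setT f mf) ?preimage_setT//; last exact: integrable_rV_cons.
have h := integrable_rV_cons fi.
split; first by rewrite -(integral12_prod_meas1 h).
by rewrite -(integral21_prod_meas1 h).
Qed.

Lemma lebesgue_measureD (h : R) (A : set R) : measurable A ->
  pushforward leb (+%R^~ h : _ -> measurableTypeR R) A = leb A.
Proof.
move=> mA.
have mh : measurable_fun setT (+%R^~ h : measurableTypeR R -> measurableTypeR R).
  exact: measurable_funD.
apply/esym/lebesgue_measure_unique => //= _ [[a b]] _ <-.
rewrite /pushforward.
rewrite (_ : _ @^-1` _ = `](a - h)%R, (b - h)%R]%classic).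
  rewrite !lebesgue_measure_itv/= !lte_fin ltrD2r.
  by case: ifP => // _; rewrite -!EFinD opprB addrA subrK.
by apply/seteqP; split => x /=; rewrite !in_itv/= ltrBlDr lerBrDr.
Qed.

Lemma ge0_integral_leb_shift (f : R -> \bar R) (h : R) :
  measurable_fun setT f -> (forall x, 0 <= f x) ->
  \int[leb]_x f (x + h)%R = \int[leb]_x f x.
Proof.
move=> mf f0.
have mh : measurable_fun setT (+%R^~ h : measurableTypeR R -> measurableTypeR R).
  exact: measurable_funD.
rewrite -(@ge0_integral_pushforward _ _ _ _ _ _ mh leb setT f)//.
by apply: eq_measure_integral => A mA _; exact: lebesgue_measureD.
Qed.

Lemma measurable_fun_rV_shift n (h : 'rV[R]_n) :
  measurable_fun setT (fun x : 'rV[R]_n => (x + h)%R).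
Proof.
apply: measurable_rVP => i.
rewrite (_ : (fun _ => _) = (fun t : 'rV[R]_n => (t 0 i + h 0 i)%R)).
  by apply: measurable_funD => //; exact: measurable_coor.
by apply/funext => x; rewrite mxE.
Qed.

(** Translation invariance by induction on the dimension; it shows that every translate of a
    mollifier has mass one. *)
Lemma ge0_integral_rV_shift n (f : 'rV[R]_n -> \bar R) (h : 'rV[R]_n) :
  measurable_fun setT f -> (forall x, 0 <= f x) ->
  \int[mu n]_x f (x + h)%R = \int[mu n]_x f x.
Proof.
elim: n f h => [|n IH] f h mf f0.
  by apply: eq_integral => x _; rewrite [(x + h)%R](thinmx0) [x]thinmx0.
rewrite !ge0_integral_rVS//; last first.
  exact: measurableT_comp (measurable_fun_rV_shift h).
rewrite [h]rV_cons_surj; set h0 := h _ _; set h1 := \row_j _.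
have mf2 t : measurable_fun setT (fun y => f (rV_cons (t, y))).
  apply: measurableT_comp => //.
  exact: measurableT_comp measurable_fun_rV_cons (pair1_measurable _).
under eq_integral => t _.
  under eq_integral do rewrite rV_consD.
  rewrite (IH (fun y => f (rV_cons ((t + h0)%R, y))) h1)//.
  over.
rewrite (@ge0_integral_leb_shift (fun t => \int[mu n]_y f (rV_cons (t, y))) h0)//.
  have := @measurable_fun_fubini_tonelli_F _ _ _ _ _ (mu n) (f \o @rV_cons R n).
  by apply; [exact: measurableT_comp measurable_fun_rV_cons|move=> ?; exact: f0].
by move=> t; exact: integral_ge0.
Qed.

End integration_rV.

(** * Approximation in L^p by smooth functions *)

(** Balls of the sup norm are cubes, so their indicator is a product over the coordinates and the
    integral factors. *)
Lemma lebesgue_rV_ball {R : realType} n (x : 'rV[R]_n) (e : R) : 0 < e ->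
  lebesgue_rV n (ball x e) = ((2 * e) ^+ n)%:E.
Proof.
move=> e0; have mb k (y : 'rV[R]_k) : measurable (ball y e).
  by apply: open_measurable_rV; exact: ball_open.
elim: n x => [|n IH] x.
  by rewrite /= diracE mem_set//; apply/ball_rV => // -[].
have E k (y : 'rV[R]_k) : lebesgue_rV k (ball y e) =
    (\int[lebesgue_rV k]_z (\1_(ball y e) z)%:E)%E.
  by rewrite (integral_indic _ measurableT (mb k y)) setIT.
rewrite E ge0_integral_rVS//; last first.
  by apply/measurable_EFinP; apply: measurable_indic; exact: mb.
under eq_integral => t _.
  under eq_integral => y _.
    rewrite (_ : \1_(ball x e) (rV_cons (t, y)) =
      \1_(ball (x 0 0) e) t * \1_(ball (\row_j x 0 (lift 0 j)) e) y :> R); last first.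
      rewrite !indicE -natrM mulnb; congr (nat_of_bool _)%:R.
      apply/idP/andP; rewrite !inE => h.
        split.
          by move/ball_rV : h => /(_ e0 0); rewrite rV_consE0.
        apply/ball_rV => // i; move/ball_rV : h => /(_ e0 (lift 0 i)).
        by rewrite rV_consE mxE.
      case: h => h1 h2; apply/ball_rV => // i.
      have [j ->|->] := unliftP 0 i; last by rewrite rV_consE0.
      by rewrite rV_consE; move/ball_rV : h2 => /(_ e0 j); rewrite mxE.
    rewrite EFinM.
    over.
  rewrite ge0_integralZl//; last first.
    by apply/measurable_EFinP; apply: measurable_indic; exact: mb.
  rewrite -E IH muleC.
  over.
rewrite ge0_integralZl//; last 2 first.
- by apply/measurable_EFinP; apply: measurable_indic; exact: measurable_ball.
- by rewrite lee_fin exprn_ge0// mulr_ge0// ltW.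
have H (c : R) : (\int[@lebesgue_measure R]_t (\1_(ball c e) t)%:E)%E = (e *+ 2)%:E.
  have := @integral_indic _ _ R (@lebesgue_measure R) setT measurableT _ (measurable_ball c e).
  by rewrite setIT => ->; exact: (lebesgue_measure_ball c (ltW e0)).
transitivity (((2 * e) ^+ n)%:E * (e *+ 2)%:E)%E; first by congr (_ * _)%E; exact: H.
by rewrite -EFinM exprSr mulr_natl.
Qed.

Lemma lebesgue_rV_bounded {R : realType} n (A : set 'rV[R]_n) (M : R) :
  0 < M -> measurable A -> A `<=` ball 0 M -> (lebesgue_rV n A < +oo)%E.
Proof.
move=> M0 mA AM; apply: (@le_lt_trans _ _ (lebesgue_rV n (ball (0 : 'rV[R]_n) M))).
  by apply: le_measure; rewrite ?inE//; apply: open_measurable_rV; exact: ball_open.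
by rewrite lebesgue_rV_ball// ltry.
Qed.

Lemma open_lebesgue_rV_gt0 {R : realType} n (A : set 'rV[R]_n) x :
  open A -> A x -> (0 < lebesgue_rV n A)%E.
Proof.
move=> oA Ax; have /nbhs_ballP[e /= e0 xeA] := oA x Ax.
apply: (@lt_le_trans _ _ (lebesgue_rV n (ball x e))).
  by rewrite lebesgue_rV_ball// lte_fin exprn_gt0// mulr_gt0.
by apply: le_measure; rewrite ?inE//; apply: open_measurable_rV => //; exact: ball_open.
Qed.

Lemma ecvg_lt {R : realType} (u : nat -> \bar R) (l r : \bar R) :
  u @ \oo --> l -> (l < r)%E -> \forall k \near \oo, (u k < r)%E.
Proof. by move=> ul lr; exact: (ul _ (open_ereal_lt' lr)). Qed.

(** The constant 2^p comes from |a + b| <= 2 max(|a|, |b|), which avoids convexity. *)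
Lemma powRD_le {R : realType} (p a b : R) : 0 <= p ->
  `|a + b| `^ p <= 2 `^ p * (`|a| `^ p + `|b| `^ p).
Proof.
move=> p0; apply: (@le_trans _ _ ((2 * Num.max `|a| `|b|) `^ p)).
  apply: ge0_ler_powR => //; rewrite ?nnegrE ?mulr_ge0 ?le_max ?normr_ge0//.
  rewrite (le_trans (ler_normD _ _))// mulr_natl mulr2n lerD// le_max lexx// orbT//.
rewrite powRM ?le_max ?normr_ge0// ler_wpM2l ?powR_ge0//.
by case: (leP `|a| `|b|) => _; rewrite ?lerDl ?lerDr powR_ge0.
Qed.

(** Truncation at 0 gives a function continuous on the whole line, so powers compose with continuous
    functions even at 0, where an exponent below 1 destroys differentiability. *)
Lemma continuous_powR_pos {R : realType} (a : R) : 0 < a ->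
  continuous (fun t : R => Num.max t 0 `^ a).
Proof.
move=> a0 t; have [t0|t0] := ltP 0 t.
  have h : {for t, continuous (fun t : R => t `^ a)}.
    apply: differentiable_continuous; apply/derivable1_diffP.
    by apply: derivable_powR; rewrite in_itv/= andbT.
  rewrite /continuous_at [X in _ --> X](_ : _ = t `^ a); last by rewrite max_l// ltW.
  apply: cvg_trans h; apply: near_eq_cvg; near=> s.
  rewrite max_l//; apply: ltW; near: s; exact: lt_nbhsr.
rewrite /continuous_at [X in _ --> X](_ : _ = 0); last first.
  by rewrite max_r// powR0// gt_eqF.
apply/cvgrPdist_lt => e e0; near=> s.
rewrite sub0r normrN ger0_norm ?powR_ge0//.
have : Num.max s 0 < e `^ a^-1.
  rewrite gt_max powR_gt0// andbT (le_lt_trans (_ : s <= s - t))//; first by rewrite lerBrDl gerDr.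
  rewrite (le_lt_trans (ler_norm _))//; near: s.
  apply/nbhs_ballP; exists (e `^ a^-1) => /=; first by rewrite powR_gt0.
  by move=> z; rewrite /ball/= distrC.
move=> /(gt0_ltr_powR a0); rewrite -powRrM mulVf ?gt_eqF// powRr1 ?ltW//; apply.
  by rewrite nnegrE le_max lexx orbT.
by rewrite nnegrE powR_ge0.
Unshelve. all: by end_near. Qed.

Lemma cvg_norm_powR {R : realType} (T : Type) (F : set_system T) (FF : Filter F)
    (f : T -> R) (l a : R) : 0 < a ->
  f @ F --> l -> (`|f x| `^ a @[x --> F]) --> `|l| `^ a.
Proof.
move=> a0 fl; have E (z : R) : `|z| `^ a = Num.max `|z| 0 `^ a by rewrite max_l.
rewrite E; under eq_cvg do rewrite E.
by apply: (@cvg_comp _ _ _ (fun x => `|f x|) (fun z : R => Num.max z 0 `^ a));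
  [exact: cvg_norm fl|exact: continuous_powR_pos].
Unshelve. all: by end_near. Qed.

Section density.
Context {R : realType} {n : nat}.
Variables (M : R) (M0 : 0 < M).
Local Notation mu := (@lebesgue_rV R n).
Local Notation Q := (ball (0 : 'rV[R]_n) M).
Implicit Types (f g h : 'rV[R]_n -> R) (A : set 'rV[R]_n).

Let mQ : measurable Q.
Proof. by apply: open_measurable_rV; exact: ball_open. Qed.

Let muQ : (mu Q < +oo)%E.
Proof. by rewrite lebesgue_rV_ball// ltry. Qed.

Let mc g : continuous g -> measurable_fun setT g.
Proof. by move=> cg; exact: (continuous_measurable_rV openT (fun x _ => cg x)). Qed.

Lemma measurable_norm_powR d (T : measurableType d) (D : set T) (f : T -> R) (p : R) :
  measurable_fun D f -> measurable_fun D (fun x => (`|f x| `^ p)%:E).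
Proof.
move=> mf; apply/measurable_EFinP.
have mn : measurable_fun D (fun x => `|f x|) by exact: measurableT_comp.
exact: (measurableT_comp (measurable_powR p) mn).
Qed.

Let bounded_cvg (f_ : nat -> 'rV[R]_n -> R) f (C : R) :
  (forall k, measurable_fun setT (f_ k)) -> (forall k x, `|f_ k x| <= C) ->
  (forall x, f_ ^~ x @ \oo --> f x) ->
  (\int[mu]_(x in Q) `|f_ k x - f x|%:E)%E @[k --> \oo] --> 0%E.
Proof.
move=> mf_ fC ff.
have mf : measurable_fun setT f.
  exact: (measurable_fun_cvg mf_ (fun x _ => ff x)).
have [|||||_ h _] := @dominated_convergence _ _ _ mu Q mQ (fun k => EFin \o f_ k)
  (EFin \o f) (cst C%:E).
- by move=> k; apply/measurable_EFinP; exact: measurable_funTS.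
- by apply/measurable_EFinP; exact: measurable_funTS.
- by apply: aeW => x _; apply: cvg_EFin; [exact: nearW|exact: ff].
- by apply: measurable_bounded_integrable => //; exact: bounded_cst.
- by apply: aeW => x k _; rewrite /= lee_fin.
exact: h.
Qed.

(** The property propagated along the generation of the sigma-algebra. The bounds 0 <= g <= 1 are
    carried along because they later turn smallness in L^1 into smallness in L^p. *)
Definition ind_approx A := measurable A /\ forall eta : R, 0 < eta ->
  exists g, [/\ continuous g, forall x, 0 <= g x <= 1 &
    (\int[mu]_(x in Q) `|\1_A x - g x|%:E < eta%:E)%E].

Let normB1 (a b : R) : 0 <= a <= 1 -> 0 <= b <= 1 -> `|a - b| <= 1.
Proof. by move=> ab bb; rewrite ler_norml; lra. Qed.

Let ind01 A x : 0 <= (\1_A x : R) <= 1.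
Proof. by rewrite indicE; case: (_ \in _); rewrite ?lexx ler01. Qed.

Let ind_approx_lim A (g_ : nat -> 'rV[R]_n -> R) : measurable A ->
  (forall k, measurable_fun setT (g_ k)) -> (forall k x, 0 <= g_ k x <= 1) ->
  (forall x, g_ ^~ x @ \oo --> (\1_A x : R)) ->
  (forall k (eta : R), 0 < eta -> exists g, [/\ continuous g, forall x, 0 <= g x <= 1 &
    (\int[mu]_(x in Q) `|g_ k x - g x|%:E < eta%:E)%E]) -> ind_approx A.
Proof.
move=> mA mg g01 gA gap; split => // eta eta0.
have /ecvg_lt : (\int[mu]_(x in Q) `|g_ k x - \1_A x|%:E)%E @[k --> \oo] --> 0%E.
  apply: (bounded_cvg (C := 1)) => // k x.
  by have /andP[? ?] := g01 k x; rewrite ger0_norm.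
move=> /(_ (eta / 2)%:E); rewrite lte_fin divr_gt0// => /(_ isT)[k _ /(_ k (leqnn k)) hk].
have e2 : 0 < eta / 2 by rewrite divr_gt0.
have [g [cg gg hg]] := gap k _ e2.
exists g; split => //.
have mk : measurable_fun setT (g_ k) by [].
have mg' := mc cg.
have mI : measurable_fun setT (\1_A : _ -> R) by exact: measurable_indic.
have mB (f1 f2 : 'rV[R]_n -> R) : measurable_fun setT f1 -> measurable_fun setT f2 ->
    measurable_fun Q (fun x => `|f1 x - f2 x|%:E).
  move=> m1 m2; apply: measurable_funTS; apply/measurable_EFinP.
  by apply: measurableT_comp => //; exact: measurable_funB.
apply: (@le_lt_trans _ _ (\int[mu]_(x in Q) (`|g_ k x - \1_A x|%:E + `|g_ k x - g x|%:E))%E).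
  apply: ge0_le_integral => //; [exact: mB|apply: emeasurable_funD; exact: mB|].
  move=> x _; rewrite -EFinD lee_fin (distrC (g_ k x)).
  by rewrite (le_trans _ (ler_normD _ _))// addrA subrK.
rewrite ge0_integralD//; try exact: mB.
by rewrite (splitr eta) EFinD lteD.
Qed.

Let ind_approx_coor (i : 'I_n) (c : R) : ind_approx [set x | c < x 0 i].
Proof.
(* For k > 0, a ramp of slope k rising from 0 at x_i = c to 1 at c + 1/k; the ramps tend to the
   indicator of the open half-space. *)
pose g_ k (x : 'rV[R]_n) : R := Num.min 1 (Num.max 0 (k%:R * (x 0 i - c))).
have cg k : continuous (g_ k).
  move=> x.
  have h : {for x, continuous (fun x : 'rV[R]_n => k%:R * (x 0 i - c))}.
    apply: continuousM; first exact: cst_continuous.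
    by apply: continuousB; [exact: coord_continuous|exact: cst_continuous].
  apply: (@continuous_min R _ (cst 1) (fun x : 'rV[R]_n => Num.max 0 (k%:R * (x 0 i - c)))).
    exact: cst_continuous.
  apply: (@continuous_max R _ (cst 0) (fun x : 'rV[R]_n => k%:R * (x 0 i - c))) => //.
  exact: cst_continuous.
apply: (@ind_approx_lim _ g_).
- rewrite [X in measurable X](_ : _ = (fun x : 'rV[R]_n => x 0 i : measurableTypeR R) @^-1` `]c, +oo[%classic).
    by rewrite -[X in measurable X]setTI; apply: measurable_coor => //; exact: measurable_itv.
  by apply/seteqP; split => x /=; rewrite in_itv/= andbT.
- by move=> k; apply: mc; exact: cg.
- by move=> k x; rewrite /g_ le_min ge_min lexx le_max lexx ler01.
- move=> x; rewrite indicE; have [cx|xc] := ltP c (x 0 i).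
    rewrite mem_set//; apply: cvg_near_cst; near=> k.
    rewrite /g_; suff : 1 <= k%:R * (x 0 i - c).
      by move=> h; rewrite max_r ?min_l// (le_trans ler01).
    rewrite -ler_pdivrMr ?subr_gt0// div1r; near: k.
    exact: nbhs_infty_ger.
  rewrite memNset; last by move=> /=; apply/negP; rewrite -leNgt.
  apply: cvg_near_cst; apply: nearW => k; rewrite /g_ max_l; first by rewrite min_r.
  by rewrite mulr_ge0_le0// subr_le0.
- move=> k eta eta0; exists (g_ k); split; first exact: cg.
    by move=> x; rewrite /g_ le_min ge_min lexx le_max lexx ler01.
  under eq_integral do rewrite subrr normr0.
  by rewrite integral0 lte_fin.
Unshelve. all: by end_near. Qed.

Let ind_approxC A : ind_approx A -> ind_approx (~` A).
Proof.
move=> [mA hA]; split; first exact: measurableC.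
move=> eta /hA[g [cg g01 hg]]; exists (fun x => 1 - g x); split.
- by move=> x; apply: continuousB; [exact: cst_continuous|exact: cg].
- by move=> x; have := g01 x; lra.
- under eq_integral => x _.
    rewrite (_ : `|\1_(~` A) x - (1 - g x)| = `|\1_A x - g x|); last first.
      rewrite -normrN; congr (`| _ |); rewrite !indicE in_setC.
      by case: (x \in A) => /=; lra.
    over.
  exact: hg.
Qed.

Let ind_approxU A B : ind_approx A -> ind_approx B -> ind_approx (A `|` B).
Proof.
move=> [mA hA] [mB hB]; split; first exact: measurableU.
move=> eta eta0.
have e2 : 0 < eta / 2 by rewrite divr_gt0.
have [g [cg g01 hg]] := hA _ e2; have [h [ch h01 hh]] := hB _ e2.
have mm (C : set 'rV[R]_n) (k : 'rV[R]_n -> R) : measurable C -> continuous k ->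
    measurable_fun Q (fun x => `|\1_C x - k x|%:E).
  move=> mC ck; apply: measurable_funTS; apply/measurable_EFinP.
  apply: measurableT_comp => //; apply: measurable_funB; last exact: mc.
  exact: measurable_indic.
have cm : continuous (fun x => Num.max (g x) (h x)).
  by move=> x; apply: (@continuous_max R _ g h); [exact: cg|exact: ch].
exists (fun x => Num.max (g x) (h x)); split => //.
  move=> x; have := g01 x; have := h01 x; case: (leP (g x) (h x)); lra.
apply: (@le_lt_trans _ _ (\int[mu]_(x in Q) (`|\1_A x - g x|%:E + `|\1_B x - h x|%:E))%E).
  apply: ge0_le_integral => //.
  - by apply: mm => //; exact: measurableU.
  - by apply: emeasurable_funD; exact: mm.
  move=> x _; rewrite -EFinD lee_fin !indicE in_setU.
  have := g01 x; have := h01 x.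
  have F (z : R) : z <= `|z| /\ - z <= `|z| by rewrite ler_norm -normrN ler_norm.
  have [] := F ((x \in A)%:R - g x); have [] := F ((x \in B)%:R - h x).
  rewrite ler_norml.
  case: (x \in A); case: (x \in B) => /=; case: (leP (g x) (h x)); lra.
rewrite ge0_integralD//; try exact: mm.
by rewrite (splitr eta) EFinD lteD.
Qed.

(** The approximable sets form a sigma-algebra: complements through 1 - g, finite unions through a
    maximum, countable unions as limits of finite ones. It contains the half-spaces x_i > c, which
    generate. *)
Lemma measurable_ind_approx A : measurable A -> ind_approx A.
Proof.
have S : sigma_algebra setT ind_approx.
  split.
  - split => // eta eta0; exists (cst 0); split; first exact: cst_continuous.
      by move=> x; rewrite lexx ler01.
    under eq_integral do rewrite indic0 subrr normr0.
    by rewrite integral0 lte_fin.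
  - by move=> B; rewrite setTD; exact: ind_approxC.
  - move=> F hF.
    have hB k : ind_approx (\big[setU/set0]_(i < k) F i).
      elim: k => [|k IH]; last by rewrite big_ord_recr/=; exact: ind_approxU.
      rewrite big_ord0; split => // eta eta0; exists (cst 0); split; first exact: cst_continuous.
        by move=> x; rewrite lexx ler01.
      under eq_integral do rewrite indic0 subrr normr0.
      by rewrite integral0 lte_fin.
    apply: (@ind_approx_lim _ (fun k => \1_(\big[setU/set0]_(i < k) F i))).
    + by apply: bigcupT_measurable => k; case: (hF k).
    + by move=> k; apply: measurable_indic; case: (hB k).
    + by move=> k x; exact: ind01.
    + move=> x; apply: cvg_near_cst; have [[k _ Fx]|nF] := pselect ((\bigcup_k F k) x).
        near=> l; rewrite !indicE !mem_set//; first by exists k.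
        rewrite -bigcup_mkord; exists k => //=; near: l; exact: nbhs_infty_gt.
      apply: nearW => l; rewrite !indicE !memNset// -bigcup_mkord => -[k _ Fx].
      by apply: nF; exists k.
    + by move=> k eta eta0; case: (hB k) => _ /(_ eta eta0).
apply: smallest_sub => //.
elim/big_ind : _ => //= [B C sB sC|i _]; first by rewrite subUset; split.
move=> _ [Y mY <-]; rewrite setTI.
suff : measurable `<=` [set Y : set (measurableTypeR R) | ind_approx ((fun x : 'rV[R]_n => x 0 i) @^-1` Y)].
  by apply.
rewrite (RGenOInfty.measurableE R).
apply: smallest_sub; last first.
  move=> _ [c ->] /=.
  suff <- : [set x : 'rV[R]_n | c < x 0 i] = (fun x : 'rV[R]_n => x 0 i) @^-1` `]c, +oo[%classic by exact: ind_approx_coor.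
  by apply/seteqP; split => x /=; rewrite in_itv/= andbT.
case: S => S0 SC SU; split => /=.
- by rewrite preimage_set0.
- by move=> B hB; rewrite setTD preimage_setC; exact: ind_approxC.
- by move=> F hF; rewrite preimage_bigcup; exact: SU.
Unshelve. all: by end_near. Qed.


Section Lp_density.
Variables (p : R) (p1 : 1 <= p).

Let p0 : 0 <= p. Proof. exact: le_trans p1. Qed.

Let Lp_approx f := forall eta : R, 0 < eta -> exists g, continuous g /\
    (\int[mu]_(x in Q) (`|f x - g x| `^ p)%:E < eta%:E)%E.

Let mB f g : measurable_fun setT f -> measurable_fun setT g ->
  measurable_fun Q (fun x => (`|f x - g x| `^ p)%:E).
Proof.
move=> mf mg; apply: measurable_norm_powR; apply: measurable_funTS.
exact: measurable_funB.
Qed.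

Let Lp_triangle f g h (eta : R) : 
  measurable_fun setT f -> measurable_fun setT g -> measurable_fun setT h ->
  (\int[mu]_(x in Q) (`|f x - g x| `^ p)%:E < (eta / 2 / 2 `^ p)%:E)%E ->
  (\int[mu]_(x in Q) (`|g x - h x| `^ p)%:E < (eta / 2 / 2 `^ p)%:E)%E ->
  (\int[mu]_(x in Q) (`|f x - h x| `^ p)%:E < eta%:E)%E.
Proof.
move=> mf mg mh fg gh.
have m1 := mB mf mg; have m2 := mB mg mh.
have c0 : 0 < 2 `^ p :> R by rewrite powR_gt0.
apply: (@le_lt_trans _ _ (\int[mu]_(x in Q) ((2 `^ p)%:E * ((`|f x - g x| `^ p)%:E + (`|g x - h x| `^ p)%:E)))%E).
  apply: ge0_le_integral => //.
  - exact: mB.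
  - by apply: measurable_funeM; exact: emeasurable_funD.
  move=> x _; rewrite -EFinD -EFinM lee_fin (le_trans _ (powRD_le _ _ p0))//.
  by rewrite addrA subrK.
rewrite ge0_integralZl//; first last.
- by move=> x _; rewrite adde_ge0// lee_fin powR_ge0.
- exact: emeasurable_funD.
rewrite ge0_integralD//; try by move=> x _; rewrite lee_fin powR_ge0.
rewrite -lte_pdivlMl// (_ : (_ * eta%:E)%E = (eta / 2 / 2 `^ p)%:E + (eta / 2 / 2 `^ p)%:E)%E.
  exact: (lteD fg gh).
by rewrite -EFinD -EFinM; congr EFin; field; rewrite gt_eqF.
Qed.

Let Lp_approxD f g : measurable_fun setT f -> measurable_fun setT g ->
  Lp_approx f -> Lp_approx g -> Lp_approx (fun x => f x + g x).
Proof.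
move=> mf mg hf hg eta eta0.
have e2 : 0 < eta / 2 / 2 `^ p by rewrite !divr_gt0// powR_gt0.
have [u [cu hu]] := hf _ e2; have [v [cv hv]] := hg _ e2.
have cuv : continuous (fun x => u x + v x).
  by move=> x; apply: continuousD; [exact: cu|exact: cv].
exists (fun x => u x + v x); split => //.
apply: (@Lp_triangle _ (fun x => u x + g x)); [| |exact: mc| |].
- exact: measurable_funD.
- by apply: measurable_funD => //; exact: mc.
- under eq_integral do rewrite opprD addrACA subrr addr0.
  exact: hu.
- under eq_integral do rewrite opprD addrACA subrr add0r.
  exact: hv.
Qed.

Let Lp_approx_ind A (c : R) : measurable A -> Lp_approx (fun x => c * \1_A x).
Proof.
move=> mA eta eta0; have [_ hA] := measurable_ind_approx mA.
have c0 : 0 < `|c| `^ p + 1 by rewrite ltr_wpDl// powR_ge0.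
have e2 : 0 < eta / (`|c| `^ p + 1) by rewrite divr_gt0.
have [g [cg g01 hg]] := hA _ e2.
have cg' : continuous (fun x => c * g x).
  by move=> x; apply: continuousM; [exact: cst_continuous|exact: cg].
exists (fun x => c * g x); split => //.
have mI : measurable_fun setT (\1_A : _ -> R) by exact: measurable_indic.
have mI' : measurable_fun Q (fun x => (`|\1_A x - g x|)%:E).
  apply: measurable_funTS; apply/measurable_EFinP; apply: measurableT_comp => //.
  by apply: measurable_funB => //; exact: mc.
apply: (@le_lt_trans _ _ (\int[mu]_(x in Q) ((`|c| `^ p)%:E * `|\1_A x - g x|%:E))%E).
  apply: ge0_le_integral => //.
  - by apply: mB; [exact: measurable_funM|exact: mc].
  - exact: measurable_funeM.
  move=> x _; rewrite -EFinM lee_fin -mulrBr normrM powRM// ler_wpM2l ?powR_ge0//.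
  have : `|\1_A x - g x| <= 1 by exact: normB1.
  have [->|n0 n1] := eqVneq (`|\1_A x - g x|) 0; first by rewrite powR0// gt_eqF// (lt_le_trans _ p1).
  by rewrite ge1r_powR// lt0r n0 normr_ge0.
rewrite ge0_integralZl// ?lee_fin ?powR_ge0//.
apply: (@le_lt_trans _ _ ((`|c| `^ p + 1)%:E * (\int[mu]_(x in Q) `|\1_A x - g x|%:E))%E).
  by rewrite lee_wpmul2r ?integral_ge0// lee_fin lerDl.
by rewrite -lte_pdivlMl// muleC -EFinM.
Qed.

Let Lp_approx_fsum (s : seq R) (A : R -> set 'rV[R]_n) : (forall y, measurable (A y)) ->
  Lp_approx (fun x => \sum_(y <- s) y * \1_(A y) x).
Proof.
move=> mA; have mT c : measurable_fun setT (fun x => c * \1_(A c) x : R).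
  by apply: measurable_funM => //; exact: measurable_indic.
elim: s => [|c s IH].
  move=> eta eta0; exists (cst 0); split; first exact: cst_continuous.
  under eq_integral do rewrite big_nil subrr normr0 powR0 ?gt_eqF ?(lt_le_trans _ p1)//.
  by rewrite integral0 lte_fin.
under [X in Lp_approx X]eq_fun do rewrite big_cons.
apply: Lp_approxD; [exact: mT|by apply: measurable_sum|exact: (Lp_approx_ind c (mA c))|exact: IH].
Qed.

Import HBNNSimple.

(** Simple functions increasing to f converge in L^p by dominated convergence, with |f|^p
    dominating; a simple function is a finite combination of indicators. *)
Let Lp_approx_ge0 f : measurable_fun setT f -> (forall x, 0 <= f x) ->
  (\int[mu]_(x in Q) (`|f x| `^ p)%:E < +oo)%E -> Lp_approx f.
Proof.
move=> mf f0 fi eta eta0.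
have mEf : measurable_fun setT (EFin \o f) by exact/measurable_EFinP.
pose s_ := nnsfun_approx measurableT mEf.
have sf x : s_ ^~ x @ \oo --> f x.
  have /= := @cvg_nnsfun_approx _ _ _ _ measurableT _ mEf (fun y _ => f0 y) x I.
  by move/fine_cvgP => [].
have s_le k x : s_ k x <= f x.
  have : s_ ^~ x @ \oo --> f x by exact: sf.
  move=> /cvgr_to_ge; apply; near=> l; apply/lefP/nd_nnsfun_approx.
  by near: l; exact: nbhs_infty_ge.
have e2 : 0 < eta / 2 / 2 `^ p by rewrite !divr_gt0// powR_gt0.
have ms k : measurable_fun setT (s_ k : _ -> R) by [].
have [|||||_ _] := @dominated_convergence _ _ _ mu Q mQ
  (fun k x => (`|f x - s_ k x| `^ p)%:E) (cst 0) (fun x => (`|f x| `^ p)%:E).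
- by move=> k; exact: mB.
- exact: measurable_cst.
- apply: aeW => x _; apply: cvg_EFin; first exact: nearW.
  have -> : 0 = `|f x - f x| `^ p by rewrite subrr normr0 powR0// gt_eqF// (lt_le_trans _ p1).
  apply: cvg_norm_powR; first exact: lt_le_trans p1.
  by apply: cvgB; [exact: cvg_cst|exact: sf].
- apply/integrableP; split; first by apply: measurable_norm_powR; exact: measurable_funTS.
  by under eq_integral do rewrite gee0_abs ?lee_fin ?powR_ge0//.
- apply: aeW => x k _; rewrite /= lee_fin ger0_norm ?powR_ge0//.
  apply: ge0_ler_powR => //; rewrite ?nnegrE ?normr_ge0//.
  have := s_le k x; have := f0 x; have : 0 <= s_ k x by []. 
  by move=> ? ? ?; rewrite !ger0_norm ?subr_ge0// gerBl.
have e2E : (0 < (eta / 2 / 2 `^ p)%:E)%E by rewrite lte_fin.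
rewrite integral0 => /ecvg_lt h; have {h}[k _ /(_ k (leqnn k)) hk] := h _ e2E.
have hg : Lp_approx (s_ k).
  rewrite (_ : (s_ k : _ -> R) = fun x => \sum_(y <- finmap.enum_fset (fset_set (range (s_ k)))) y * \1_(s_ k @^-1` [set y]) x).
    by apply: Lp_approx_fsum => y; exact: measurable_sfunP.
  by apply/funext => x; rewrite fimfunE fsbig_finite//.
have [g' [cg' hg']] := hg _ e2.
exists g'; split => //.
by apply: (Lp_triangle _ _ _ hk hg') => //; exact: mc.
Unshelve. all: by end_near. Qed.

Lemma Lp_dense_continuous f : measurable_fun setT f ->
  (\int[mu]_(x in Q) (`|f x| `^ p)%:E < +oo)%E ->
  forall eta : R, 0 < eta -> exists g, continuous g /\
    (\int[mu]_(x in Q) (`|f x - g x| `^ p)%:E < eta%:E)%E.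
Proof.
move=> mf fi.
have mp : measurable_fun setT (fun x => Num.max (f x) 0).
  by apply: measurable_maxr => //; exact: measurable_cst.
have mn : measurable_fun setT (fun x => Num.max (- f x) 0).
  by apply: measurable_maxr; [exact: measurableT_comp|exact: measurable_cst].
have h (g : 'rV[R]_n -> R) : measurable_fun setT g -> (forall x, `|g x| = `|f x|) ->
    Lp_approx (fun x => Num.max (g x) 0).
  move=> mg gf; have mg' : measurable_fun setT (fun x => Num.max (g x) 0).
    by apply: measurable_maxr => //; exact: measurable_cst.
  apply: Lp_approx_ge0; [exact: mg'|by move=> x; rewrite le_max lexx orbT|].
  apply: le_lt_trans fi; apply: ge0_le_integral => //.
  - by apply: measurable_norm_powR; exact: measurable_funTS.
  - by apply: measurable_norm_powR; exact: measurable_funTS.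
  move=> x _; rewrite lee_fin -gf; apply: ge0_ler_powR => //; rewrite ?nnegrE ?normr_ge0//.
  by case: (leP (g x) 0); rewrite ?normr0.
have mN : measurable_fun setT (fun x => - f x) by exact: measurableT_comp.
have -> : f = (fun x => Num.max (f x) 0 + (-1) * Num.max (- f x) 0).
  by apply/funext => x; case: (leP (f x) 0); case: (leP (- f x) 0); lra.
have hN : Lp_approx (fun x => (-1) * Num.max (- f x) 0).
  move=> eta /(h _ mN (fun x => normrN _))[g [cg hg]].
  exists (fun x => - g x); split; first by move=> x; apply: continuousN; exact: cg.
  under eq_integral do rewrite mulN1r -opprD normrN.
  exact: hg.
apply: Lp_approxD; [by []|by apply: measurable_funM|exact: (h f mf (fun=> erefl))|exact: hN].
Qed.

End Lp_density.
End density.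

(** Transfers one-variable calculus to directional derivatives: every later differentiation on row
    vectors is reduced to a real function along a line. *)
Lemma is_derive_line {R : realType} (V : normedModType R) (F : V -> R) (x h : V)
    (t df : R) :
  is_derive (x + t *: h) h F df <-> is_derive t 1 (fun s => F (x + s *: h)) df.
Proof.
have E : (fun k : R => k^-1 *: ((F \o shift (x + t *: h)) (k *: h) - F (x + t *: h))) =
  (fun k : R => k^-1 *: (((fun s => F (x + s *: h)) \o shift t) (k *: (1 : R)) - F (x + t *: h))).
  apply/funext => k /=; congr (_ *: (F _ - _)).
  by rewrite /shift/= -[k *: 1]/(k * 1) mulr1 scalerDl addrCA.
have ED : 'D_h F (x + t *: h) = 'D_1 (fun s : R => F (x + s *: h)) t.
  exact: (congr1 (fun q : R -> R => lim (q @ 0^')) E).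
have EV : derivable F (x + t *: h) h = derivable (fun s : R => F (x + s *: h)) t 1.
  exact: (congr1 (fun q : R -> R => cvg (q @ 0^') : Prop) E).
split=> -[h1 h2]; apply: DeriveDef.
- exact: (eq_ind _ id h1 _ EV).
- exact: etrans (esym ED) h2.
- exact: (eq_ind _ id h1 _ (esym EV)).
- exact: etrans ED h2.
Qed.

Lemma is_derive_along {R : realType} (V : normedModType R) (f : V -> R) (x h : V) (t : R) :
  differentiable f (x + t *: h) ->
  is_derive t 1 (fun s => f (x + s *: h)) ('D_h f (x + t *: h)).
Proof.
move=> df.
exact: (proj1 (is_derive_line f x h t _) (derivableP (diff_derivable df))).
Qed.

Lemma MVT01 {R : realType} (f df : R -> R) :
  (forall x : R, is_derive x 1 f (df x)) -> exists2 c, 0 < c < 1 & f 1 - f 0 = df c.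
Proof.
move=> fdf; have cf : {within `[0, 1], continuous f}.
  by apply: derivable_within_continuous => x _; case: (fdf x).
have [c c01 ->] := MVT ltr01 (fun x _ => fdf x) cf.
by exists c; rewrite ?subr0 ?mulr1//; move: c01; rewrite in_itv.
Qed.

Lemma norm_coord_le {R : realType} n (h : 'rV[R]_n) i : `|h 0 i| <= `|h|.
Proof. by rewrite /Num.norm/= mx_normrE; exact: (le_bigmax _ (fun ij => `|h ij.1 ij.2|) (0, i)). Qed.

Lemma exprn_expRN_le {R : realType} n (x : R) : 0 <= x -> x ^+ n * expR (- x) <= n`!%:R.
Proof.
move=> x0; rewrite expRN ler_pdivrMr ?expR_gt0//.
case: n => [|n]; first by rewrite expr0 fact0 mul1r (le_trans _ (expR_ge1Dx x))// lerDl.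
rewrite mulrC -ler_pdivrMr ?ltr0n ?fact_gt0//.
by rewrite (le_trans _ (expR_ge1Dxn n x0))// lerDr.
Qed.

(** * Bump functions and their derivatives *)

Section flat_exponential.
Context {R : realType}.
Implicit Types (Q : {poly R}) (t : R).

(** Letting [Q] range over all polynomials makes the family closed under differentiation, which acts
    as Q -> (Q - Q') X^2 in the variable 1/t; hence all its members are smooth. *)
Definition flat_exp Q t : R := if 0 < t then Q.[t^-1] * expR (- t^-1) else 0.

Lemma flat_exp_bounded Q : exists2 C, 0 <= C & forall t, `|flat_exp Q t| <= C.
Proof.
exists (\sum_(i < size Q) `|Q`_i| * i`!%:R); first by rewrite sumr_ge0// => i _; rewrite mulr_ge0.
move=> t; rewrite /flat_exp; case: ifPn => t0; last first.
  by rewrite normr0 sumr_ge0// => i _; rewrite mulr_ge0.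
rewrite horner_coef mulr_suml (le_trans (ler_norm_sum _ _ _))// ler_sum// => i _.
rewrite !normrM -mulrA ler_wpM2l//.
rewrite (ger0_norm (expR_ge0 _)) normrX ger0_norm ?invr_ge0 ?(ltW t0)//.
by apply: exprn_expRN_le; rewrite invr_ge0 ltW.
Qed.

Lemma flat_exp_mulX Q k t : t != 0 -> flat_exp (Q * 'X^k) t = flat_exp Q t / t ^+ k.
Proof.
move=> t0; rewrite /flat_exp; case: ifP => _; last by rewrite mul0r.
by rewrite hornerM hornerXn exprVn mulrAC.
Qed.

Lemma is_derive_flat_exp Q t :
  is_derive t 1 (flat_exp Q) (flat_exp ((Q - Q^`()) * 'X^2) t).
Proof.
have [t0|t0|->] := ltgtP t 0.
- have -> : flat_exp ((Q - Q^`()) * 'X^2) t = 0 by rewrite /flat_exp ltNge (ltW t0).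
  apply: (near_eq_is_derive _ (is_derive_cst (0 : R) (t : R) (1 : R))).
  near=> s; rewrite /flat_exp ltNge ltW//; near: s; exact: lt_nbhsl.
- have tn0 : t != 0 by rewrite gt_eqF.
  have h : is_derive t 1 (fun s : R => Q.[s^-1] * expR (- s^-1)) (flat_exp ((Q - Q^`()) * 'X^2) t).
    rewrite flat_exp_mulX// /flat_exp t0.
    have dV : is_derive t 1 (fun s : R => s^-1) (- t ^- 2).
      have := @is_deriveV R id t 1 1 tn0 (is_derive_id _ _).
      by rewrite /GRing.scale/= mulr1.
    have dQ : is_derive t 1 (fun s : R => Q.[s^-1]) (Q^`().[t^-1] * - t ^- 2).
      exact: (@is_derive1_comp R (horner Q) (fun s => s^-1) t _ _ (is_derive_poly Q t^-1) dV).
    have dE : is_derive t 1 (fun s : R => expR (- s^-1)) (expR (- t^-1) * t ^- 2).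
      have dVN : is_derive t 1 (fun s : R => - s^-1) (t ^- 2).
        by have := is_deriveN dV; rewrite opprK.
      exact: (@is_derive1_comp R expR (fun s => - s^-1) t _ _ (is_derive_expR _) dVN).
    apply: (is_derive_eq (is_deriveM dQ dE)).
    rewrite !scalerAl /GRing.scale/= hornerD hornerN.
    by field.
  apply: near_eq_is_derive h.
  near=> s; rewrite /flat_exp ifT//; near: s; exact: lt_nbhsr.
- have E0 Q' : flat_exp Q' 0 = 0 by rewrite /flat_exp ltxx.
  (* Boundedness for Q X^2 means that the function for Q is at most C k^2 near 0, so its difference
     quotient at 0 is at most C |k|. *)
  rewrite E0; have [C C0 hC] := flat_exp_bounded (Q * 'X^2).
  have h : (fun k : R => k^-1 *: ((flat_exp Q \o shift 0) (k *: 1) - flat_exp Q 0)) @ 0^' --> 0.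
    rewrite E0; apply/cvgr0Pnorm_le => e e0; near=> k.
    have k0 : k != 0 by near: k; exact: nbhs_dnbhs_neq.
    rewrite /shift/= addr0 subr0 -[k *: 1]/(k * 1) mulr1 -[_ *: _]/(_ * _).
    have := hC k; rewrite flat_exp_mulX// normrM normfV normrX => hk.
    rewrite normrM normfV.
    have nk : 0 < `|k| by rewrite normr_gt0.
    rewrite ler_pdivrMl//.
    move: hk; rewrite ler_pdivrMr ?exprn_gt0// => /le_trans; apply.
    rewrite expr2 mulrCA ler_wpM2l//.
    have : `|k| <= e / (C + 1).
      near: k; apply: dnbhs0_le; by rewrite divr_gt0// ltr_wpDl.
    rewrite ler_pdivlMr ?ltr_wpDl// => hk; apply: le_trans hk.
    by rewrite mulrC ler_wpM2l// lerDl.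
  by split; [apply/cvg_ex; exists 0|exact/cvg_lim].
Unshelve. all: by end_near. Qed.

End flat_exponential.

Section nice.
Context {R : realType} {n : nat}.
Implicit Types (f g : 'rV[R]_n -> R) (x h : 'rV[R]_n).

(* A class of bounded smooth functions, closed under partial derivatives and
   containing bump functions. *)
Inductive nice : ('rV[R]_n -> R) -> Prop :=
| nice_cst c : nice (cst c)
| nice_flat (Q : {poly R}) i (s c : R) : nice (fun x => flat_exp Q (c + s * x 0 i))
| nice_mul f g : nice f -> nice g -> nice (fun x => f x * g x)
| nice_add f g : nice f -> nice g -> nice (fun x => f x + g x).

Lemma nice_differentiable f x : nice f -> differentiable f x.
Proof.
elim=> {f} [c|Q i s c|f g _ df _ dg|f g _ df _ dg].
- exact: differentiable_cst.
- apply: (@differentiable_comp _ _ _ _ (fun x : 'rV[R]_n => c + s * x 0 i) (flat_exp Q)).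
    apply: differentiableD => //; apply: differentiableM => //.
    exact: differentiable_coord.
  by apply/derivable1_diffP; case: (is_derive_flat_exp Q (c + s * x 0 i)).
- exact: differentiableM.
- exact: differentiableD.
Qed.

Lemma nice_bounded f : nice f -> exists2 C, 0 <= C & forall x, `|f x| <= C.
Proof.
elim=> {f} [c|Q i s c|f g _ [C C0 hC] _ [D D0 hD]|f g _ [C C0 hC] _ [D D0 hD]].
- by exists `|c|.
- by have [C C0 hC] := flat_exp_bounded Q; exists C.
- by exists (C * D); [exact: mulr_ge0|move=> x; rewrite normrM ler_pM].
- by exists (C + D); [exact: addr_ge0|move=> x; rewrite (le_trans (ler_normD _ _))// lerD].
Qed.

Lemma nice_pderiv i f : nice f -> nice (pderiv i f).
Proof.
elim=> {f} [c|Q j s c|f g nf df ng dg|f g nf df ng dg].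
- rewrite (_ : pderiv i _ = cst 0); first exact: nice_cst.
  by apply/funext => x; rewrite /pderiv derive_cst.
- rewrite (_ : pderiv i _ = fun x => cst (s * (i == j)%:R) x *
      flat_exp ((Q - Q^`()) * 'X^2) (c + s * x 0 j)).
    by apply: nice_mul; [exact: nice_cst|exact: nice_flat].
  apply/funext => x; rewrite /pderiv.
  have dl : is_derive (0 : R) 1 (fun t : R => c + s * (x + t *: delta_mx 0 i) 0 j) (s * (i == j)%:R).
    rewrite (_ : (fun t : R => _) = (fun t : R => (c + s * x 0 j) + (s * (i == j)%:R) * t)).
      apply: (is_derive_eq (is_deriveD (is_derive_cst _ _ _) (is_deriveZ _ (is_derive_id _ _)))).
      by rewrite add0r /GRing.scale/= mulr1.
    apply/funext => t; rewrite !mxE eqxx/= (eq_sym j).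
    by rewrite mulrDr addrA -mulrA [t * _]mulrC.
  have : is_derive (x + 0 *: delta_mx 0 i) (delta_mx 0 i) (fun x : 'rV[R]_n => flat_exp Q (c + s * x 0 j))
      (flat_exp ((Q - Q^`()) * 'X^2) (c + s * (x + 0 *: delta_mx 0 i) 0 j) * (s * (i == j)%:R)).
    apply/is_derive_line.
    exact: (@is_derive1_comp R (flat_exp Q) (fun t : R => c + s * (x + t *: delta_mx 0 i) 0 j) 0 _ _ (is_derive_flat_exp _ _) dl).
  by rewrite scale0r addr0 => -[_ ->]; rewrite mulrC.
- rewrite (_ : pderiv i _ = fun x => f x * pderiv i g x + g x * pderiv i f x).
    by apply: nice_add; exact: nice_mul.
  apply/funext => x; rewrite /pderiv deriveM//; exact/diff_derivable/nice_differentiable.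
- rewrite (_ : pderiv i _ = fun x => pderiv i f x + pderiv i g x); first exact: nice_add.
  apply/funext => x; rewrite /pderiv deriveD//; exact/diff_derivable/nice_differentiable.
Qed.

Lemma nice_continuous f : nice f -> continuous f.
Proof. by move=> nf x; exact/differentiable_continuous/nice_differentiable. Qed.

Lemma derive_pderiv f x h : differentiable f x ->
  'D_h f x = \sum_i h 0 i * pderiv i f x.
Proof.
move=> df; rewrite deriveE// [in LHS](row_sum_delta h) linear_sum/=.
by apply: eq_bigr => i _; rewrite linearZ/= /pderiv deriveE.
Qed.

Lemma nice_lipschitz f : nice f -> exists2 C, 0 <= C &
  forall x h, `|f (x + h) - f x| <= C * `|h|.
Proof.
move=> nf; have /choice[C hC] : forall i : 'I_n, exists C : R, 0 <= C /\ forall x, `|pderiv i f x| <= C.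
  by move=> i; have [C C0 hC] := nice_bounded (nice_pderiv i nf); exists C.
exists (\sum_i C i); first by apply: sumr_ge0 => i _; case: (hC i).
move=> x h; have [t|t _] := @MVT01 R (fun t => f (x + t *: h)) (fun t => 'D_h f (x + t *: h)).
  by apply: is_derive_along; exact: nice_differentiable.
rewrite scale1r scale0r addr0 => ->.
rewrite derive_pderiv; last exact: nice_differentiable.
rewrite (le_trans (ler_norm_sum _ _ _))// mulr_suml ler_sum// => i _.
rewrite normrM mulrC ler_pM//; first by case: (hC i).
exact: norm_coord_le.
Qed.

(** The remainder is quadratic uniformly in x, which is what differentiation of a convolution under
    the integral requires. *)
Lemma nice_taylor f : nice f -> exists2 C, 0 <= C &
  forall x h, `|f (x + h) - f x - \sum_i h 0 i * pderiv i f x| <= C * `|h| ^+ 2.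
Proof.
move=> nf; have /choice[C hC] : forall i : 'I_n, exists C : R, 0 <= C /\
    forall x h, `|pderiv i f (x + h) - pderiv i f x| <= C * `|h|.
  by move=> i; have [C C0 hC] := nice_lipschitz (nice_pderiv i nf); exists C.
exists (\sum_i C i); first by apply: sumr_ge0 => i _; case: (hC i).
move=> x h; have [t|t /andP[t0 t1]] := @MVT01 R (fun t => f (x + t *: h)) (fun t => 'D_h f (x + t *: h)).
  by apply: is_derive_along; exact: nice_differentiable.
rewrite scale1r scale0r addr0 => ->.
rewrite derive_pderiv; last exact: nice_differentiable.
rewrite -sumrB (le_trans (ler_norm_sum _ _ _))// mulr_suml ler_sum// => i _.
rewrite -mulrBr normrM mulrC expr2 mulrA ler_pM ?norm_coord_le//.
have [Ci0 /(_ x (t *: h)) hi] := hC i; rewrite (le_trans hi)// ler_wpM2l//.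
by rewrite normrZ gtr0_norm// ler_piMl// ltW.
Qed.

End nice.

Section mollifier.
Context {R : realType} {n : nat}.
Local Notation mu := (@lebesgue_rV R n).
Implicit Types (f g : 'rV[R]_n -> R) (x h : 'rV[R]_n).

Lemma nice_measurable f : nice f -> measurable_fun setT f.
Proof.
move=> nf; apply: (continuous_measurable_rV openT) => x _.
exact: nice_continuous.
Qed.

Lemma nice_prod (I : Type) (s : seq I) (F : I -> 'rV[R]_n -> R) :
  (forall i, nice (F i)) -> nice (fun x => \prod_(i <- s) F i x).
Proof.
move=> nF; elim: s => [|i s IH].
  by under [X in nice X]eq_fun do rewrite big_nil; exact: nice_cst.
by under [X in nice X]eq_fun do rewrite big_cons; exact: nice_mul.
Qed.

Lemma flat_exp1_ge0 (t : R) : 0 <= flat_exp 1 t.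
Proof. by rewrite /flat_exp; case: ifP => // _; rewrite hornerC mul1r expR_ge0. Qed.

Lemma flat_exp1_gt0 (t : R) : (0 < flat_exp 1 t) = (0 < t).
Proof.
by rewrite /flat_exp; case: ifP => // _; rewrite ?ltxx// hornerC mul1r expR_gt0.
Qed.

Lemma flat_exp1_eq0 (t : R) : t <= 0 -> flat_exp 1 t = 0.
Proof. by move=> t0; rewrite /flat_exp ltNge t0. Qed.

Lemma integral_rV_gt0 (U : set 'rV[R]_n) f (c : R) x : open U -> U x -> 0 < c ->
  measurable_fun setT f -> (forall y, 0 <= f y) -> (forall y, U y -> c <= f y) ->
  (0 < \int[mu]_y (f y)%:E)%E.
Proof.
move=> oU Ux c0 mf f0 Uf; have mU := open_measurable_rV oU.
have mEf : measurable_fun setT (EFin \o f) by exact/measurable_EFinP.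
apply: (@lt_le_trans _ _ (\int[mu]_(y in U) (f y)%:E)%E); last first.
  by apply: ge0_subset_integral => // y _; rewrite lee_fin.
apply: (@lt_le_trans _ _ (\int[mu]_(y in U) (cst c%:E y))%E).
  by rewrite integral_cst//= mule_gt0// ?lte_fin// (open_lebesgue_rV_gt0 oU Ux).
apply: ge0_le_integral => //.
- by move=> y _; rewrite lee_fin ltW.
exact: measurable_funTS.
Qed.

Lemma mollifier (e : R) : 0 < e -> exists rho : 'rV[R]_n -> R,
  [/\ nice rho, forall x, 0 <= rho x, forall x, rho (- x) = rho x,
      forall x, ~ ball 0 e x -> rho x = 0 & (\int[mu]_x (rho x)%:E = 1)%E].
Proof.
move=> e0.
(* A product over the coordinates of factors positive exactly for |x_i| < e: an even bump carried by
   the open cube. *)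
pose b x : R := \prod_(i < n) (flat_exp 1 (e + 1 * x 0 i) * flat_exp 1 (e + (-1) * x 0 i)).
have nb : nice b by apply: nice_prod => i; apply: nice_mul; exact: nice_flat.
have b0 x : 0 <= b x by apply: prodr_ge0 => i _; rewrite mulr_ge0// flat_exp1_ge0.
have bN x : b (- x) = b x.
  by apply: eq_bigr => i _; rewrite mxE !mulNr !mulrN !opprK !mul1r mulrC.
have bn0 x : ball 0 e x -> 0 < b x.
  move=> /ball_rV => /(_ e0) xe; apply: prodr_gt0 => i _.
  have := xe i; rewrite mxE sub0r normrN ltr_norml => /andP[h1 h2].
  by rewrite mulr_gt0// flat_exp1_gt0; lra.
have bs x : ~ ball 0 e x -> b x = 0.
  move=> nx; have [i hi] : exists i, e <= `|x 0 i|.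
    apply: contrapT => h; apply: nx; apply/ball_rV => // i.
    rewrite mxE sub0r normrN ltNge; apply/negP => ?; apply: h; by exists i.
  rewrite /b (bigD1 i)//=; move: hi; rewrite ler_normr => /orP[hi|hi].
    by rewrite [X in _ * X * _]flat_exp1_eq0 ?mulr0 ?mul0r//; lra.
  by rewrite flat_exp1_eq0 ?mul0r//; lra.
have mb := nice_measurable nb.
have mB : measurable (ball (0 : 'rV[R]_n) e) by apply: open_measurable_rV; exact: ball_open.
have [C C0 hC] := nice_bounded nb.
have ib : (\int[mu]_x (b x)%:E = \int[mu]_(x in ball (0%R : 'rV[R]_n) e) (b x)%:E)%E.
  rewrite [RHS]integral_mkcond; apply: eq_integral => x _.
  rewrite patchE; case: ifPn => //; rewrite notin_setE => /bs ->//.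
have bfin : (\int[mu]_x (b x)%:E < +oo)%E.
  rewrite ib; apply: (@le_lt_trans _ _ (\int[mu]_(x in ball (0%R : 'rV[R]_n) e) (cst C%:E x))%E).
    apply: ge0_le_integral => //.
    - by move=> x _; rewrite lee_fin.
    - by apply/measurable_EFinP; exact: measurable_funTS.
    - by move=> x _; rewrite lee_fin (le_trans (ler_norm _)).
  by rewrite integral_cst//= lebesgue_rV_ball// -EFinM ltry.
have bpos : (0 < \int[mu]_x (b x)%:E)%E.
  have b00 : 0 < b 0 by apply: bn0; exact: ballxx.
  apply: (@integral_rV_gt0 [set x | b 0 / 2 < b x] _ (b 0 / 2) 0) => //=.
  - rewrite (_ : [set x | _] = b @^-1` `]b 0 / 2, +oo[%classic).
      by apply: open_comp; [move=> x _; exact: nice_continuous|exact: interval_open].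
    by apply/seteqP; split => x /=; rewrite in_itv/= andbT.
  - by rewrite ltr_pdivrMr// ltr_pMr// ltr1n.
  - by rewrite divr_gt0.
  - by move=> y /ltW.
have [c cE] : exists c : R, (\int[mu]_x (b x)%:E = c%:E)%E.
  exists (fine (\int[mu]_x (b x)%:E)); rewrite fineK//.
  by rewrite ge0_fin_numE// ltW.
have c0 : 0 < c by rewrite -lte_fin -cE.
exists (fun x => cst c^-1 x * b x); split.
- by apply: nice_mul => //; exact: nice_cst.
- by move=> x; rewrite mulr_ge0// invr_ge0 ltW.
- by move=> x; rewrite bN.
- by move=> x /bs ->; rewrite mulr0.
- transitivity (\int[mu]_x (c^-1%:E * (b x)%:E))%E.
    by apply: eq_integral => x _; rewrite EFinM.
  rewrite ge0_integralZl//.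
  + by rewrite cE -EFinM mulVf// gt_eqF.
  + exact/measurable_EFinP.
  + by move=> x _; rewrite lee_fin.
  + by rewrite lee_fin invr_ge0 ltW.
Qed.

End mollifier.

Section quadratic_differentiable.
Context {R : realType} {n : nat}.

Definition lin_form (a : 'I_n -> R) (h : 'rV[R]_n) : R := \sum_i h 0 i * a i.

Lemma lin_form_linear a : linear (lin_form a).
Proof.
move=> k u v; rewrite /lin_form scaler_sumr -big_split/=.
by apply: eq_bigr => i _; rewrite !mxE mulrDl -mulrA.
Qed.

HB.instance Definition _ a := GRing.isLinear.Build R 'rV[R]_n R _ (lin_form a) (lin_form_linear a).

Lemma lin_form_continuous a : continuous (lin_form a).
Proof.
move=> x; apply: differentiable_continuous.
rewrite (_ : (lin_form a : _ -> _) = \sum_i (fun h : 'rV[R]_n => h 0 i * a i)).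
  apply: differentiable_sum => i; apply: differentiableM => //.
  exact: differentiable_coord.
by apply/funext => h; rewrite fct_sumE.
Qed.

Lemma quadratic_differentiable (f : 'rV[R]_n -> R) x (a : 'I_n -> R) (C : R) :
  (forall h, `|f (x + h) - f x - \sum_i h 0 i * a i| <= C * `|h| ^+ 2) ->
  differentiable f x /\ forall i, pderiv i f x = a i.
Proof.
move=> fC.
have fo : f \o shift x = (cst (f x) + lin_form a : 'rV[R]_n -> R) +o_ (0 : 'rV[R]_n) id.
  apply/eqaddoP => e e0; near=> h.
  rewrite -[X in `|X|]/(f (h + x) - (f x + lin_form a h)) opprD addrA (addrC h).
  apply: le_trans (fC h) _; rewrite expr2 mulrA ler_wpM2r//.
  have c1 : 0 < `|C| + 1 by rewrite ltr_wpDl.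
  have : `|h| <= e / (`|C| + 1).
    near: h; apply/nbhs_ballP; exists (e / (`|C| + 1)) => /=; first by rewrite divr_gt0.
    by move=> z; rewrite -ball_normE/= sub0r normrN => /ltW.
  rewrite ler_pdivlMr// mulrC; apply: le_trans; rewrite ler_wpM2r//.
  by rewrite (le_trans (ler_norm _))// lerDl.
have dE : 'd f x = lin_form a :> ('rV[R]_n -> R).
  exact: (diff_unique (@lin_form_continuous a) fo).
have df : differentiable f x.
  apply/diff_locallyP; rewrite dE; split => //.
  exact: lin_form_continuous.
split => // i; rewrite /pderiv deriveE// dE /lin_form (bigD1 i)//= big1.
  by rewrite mxE !eqxx mul1r addr0.
by move=> j ji; rewrite mxE (negbTE ji) andbF mul0r.
Unshelve. all: by end_near. Qed.

End quadratic_differentiable.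

(** * Smoothness of convolutions *)

Section convolution.
Context {R : realType} {n : nat}.
Local Notation mu := (@lebesgue_rV R n).
Implicit Types (f eta : 'rV[R]_n -> R) (x h : 'rV[R]_n).

Definition conv f eta x : R := (\int[mu]_y (f y * eta (x - y)))%R.

Variables (g : 'rV[R]_n -> R) (ig : mu.-integrable setT (EFin \o g)).

Let mg : measurable_fun setT g.
Proof. by apply/measurable_EFinP; exact: measurable_int ig. Qed.

Lemma measurable_fun_rV_sub x : measurable_fun setT (fun y : 'rV[R]_n => x - y).
Proof.
apply: measurable_rVP => i.
rewrite (_ : (fun _ => _) = (fun t : 'rV[R]_n => (x 0 i - t 0 i)%R)).
  by apply: measurable_funB => //; exact: measurable_coor.
by apply/funext => y; rewrite !mxE.
Qed.

Lemma bounded_mul_integrable (eta : 'rV[R]_n -> R) C : measurable_fun setT eta ->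
  (forall y, `|eta y| <= C) -> mu.-integrable setT (EFin \o (fun y => g y * eta y)).
Proof.
move=> me eC.
apply: (@le_integrable _ _ _ mu setT measurableT _ (fun y => C%:E * (EFin \o g) y)%E).
- by apply/measurable_EFinP; exact: measurable_funM.
- move=> y _; rewrite /= lee_fin !normrM mulrC ler_wpM2r//.
  by rewrite (le_trans (eC y))// ler_norm.
- exact: integrableZl.
Qed.

Lemma conv_integrable eta x : nice eta ->
  mu.-integrable setT (EFin \o (fun y => g y * eta (x - y))).
Proof.
move=> ne; have [C C0 hC] := nice_bounded ne.
apply: (@bounded_mul_integrable (fun y => eta (x - y)) C) => //.
exact: measurableT_comp (nice_measurable ne) (measurable_fun_rV_sub x).
Qed.

(** Integrating the uniform expansion of [eta] against g leaves a quadratic error whose constant is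
    C times the L^1 norm of g; this yields differentiability and the partial derivatives at once. *)
Lemma conv_pderiv eta x : nice eta -> differentiable (conv g eta) x /\
  forall i, pderiv i (conv g eta) x = conv g (pderiv i eta) x.
Proof.
move=> ne; have [C C0 hC] := nice_taylor ne.
apply: (@quadratic_differentiable _ _ _ _ _ (C * \int[mu]_y `|g y|)%R) => h.
have ii z := @conv_integrable _ z ne.
have id' i := @conv_integrable _ x (nice_pderiv i ne).
have isum (s : seq 'I_n) : mu.-integrable setT
      (EFin \o (fun y => \sum_(i <- s) h 0 i * (g y * pderiv i eta (x - y)))) /\
    (\sum_(i <- s) h 0 i * conv g (pderiv i eta) x =
    \int[mu]_y (\sum_(i <- s) h 0 i * (g y * pderiv i eta (x - y))))%R.
  elim: s => [|i s [IH1 IH2]].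
    split.
      rewrite (_ : _ \o _ = cst 0); first exact: integrable0.
      by apply/funext => y /=; rewrite big_nil.
    rewrite big_nil; under eq_Rintegral do rewrite big_nil.
    by rewrite Rintegral_cst// mul0r.
  have i1 : mu.-integrable setT (EFin \o (fun y => h 0 i * (g y * pderiv i eta (x - y)))).
    exact: (integrableZl measurableT (h 0 i) (id' i)).
  split.
    under [X in _.-integrable _ (_ \o X)]eq_fun do rewrite big_cons.
    exact: (integrableD measurableT i1 IH1).
  rewrite big_cons; under eq_Rintegral do rewrite big_cons.
  by rewrite RintegralD// RintegralZl// IH2.
have [isumi ->] := isum (index_enum 'I_n).
have iB : mu.-integrable setT (EFin \o (fun y => g y * eta (x + h - y) - g y * eta (x - y))).
  by have := integrableB measurableT (ii (x + h)) (ii x).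
rewrite -[X in `|X - _|](RintegralB measurableT (ii (x + h)) (ii x)) -(RintegralB measurableT iB isumi).
have iBB : mu.-integrable setT (EFin \o (fun y => g y * eta (x + h - y) - g y * eta (x - y) -
    \sum_i h 0 i * (g y * pderiv i eta (x - y)))).
  by have := integrableB measurableT iB isumi.
apply: (le_trans (le_normr_Rintegral measurableT iBB)).
have ign : mu.-integrable setT (EFin \o (fun y => `|g y|)).
  by have := integrable_abse ig.
rewrite -mulrAC -RintegralZl//.
apply: le_Rintegral => //.
- by have := integrable_abse iBB.
- exact: (integrableZl measurableT (C * `|h| ^+ 2) ign).
move=> y _.
rewrite (_ : _ - _ = g y * (eta (x - y + h) - eta (x - y) - \sum_i h 0 i * pderiv i eta (x - y))).
  by rewrite normrM mulrC ler_wpM2r// hC.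
rewrite [x + h - y]addrAC !mulrBr mulr_sumr; congr (_ - _).
by apply: eq_bigr => i _; rewrite mulrCA.
Qed.

Lemma iter_pderiv_nice s (eta : 'rV[R]_n -> R) : nice eta -> nice (iter_pderiv s eta).
Proof. by elim: s => //= i s IH ne; apply: nice_pderiv; exact: IH. Qed.

Lemma conv_smooth eta : nice eta -> smooth (conv g eta).
Proof.
move=> ne; have E s : iter_pderiv s (conv g eta) = conv g (iter_pderiv s eta).
  elim: s => //= i s ->; apply/funext => x.
  by have [_ ->] := conv_pderiv x (iter_pderiv_nice s ne).
by move=> s x; rewrite E; case: (conv_pderiv x (iter_pderiv_nice s ne)).
Qed.

End convolution.

(** The convex function a^p lies above its tangent at b. For p > 1 this is Young's inequality with
    the exponents p and p/(p-1). *)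
Lemma powR_tangent {R : realType} (p a b : R) : 1 <= p -> 0 <= a -> 0 <= b ->
  p * (a * b `^ (p - 1)) <= a `^ p + (p - 1) * b `^ p.
Proof.
rewrite le_eqVlt => /predU1P[<- a0 b0|p1 a0 b0].
  by rewrite subrr powRr0 mulr1 mul1r mul0r addr0 powRr1.
have p0 : 0 < p by exact: lt_trans p1.
have q0 : 0 < p / (p - 1) by rewrite divr_gt0// subr_gt0.
have pn1 : p - 1 != 0 by rewrite subr_eq0 gt_eqF.
have pq : p^-1 + (p / (p - 1))^-1 = 1 by field; rewrite pn1 gt_eqF.
have := conjugate_powR a0 (powR_ge0 b (p - 1)) p0 q0 pq.
rewrite -powRrM (_ : (p - 1) * (p / (p - 1)) = p); last by field.
rewrite -(ler_pM2l p0) => /le_trans; apply.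
rewrite le_eqVlt; apply/orP; left; apply/eqP; field.
by rewrite pn1 gt_eqF.
Qed.

(** Stronger than uniform continuity on K: the second point may leave K. Mollification evaluates
    functions slightly outside the compact set under study. *)
Lemma compact_uniform {R : realType} n (K : set 'rV[R]_n) (c : 'rV[R]_n -> R) (d : R) :
  compact K -> (forall x, K x -> {for x, continuous c}) -> 0 < d ->
  exists2 e : R, 0 < e & forall x y, K x -> ball x e y -> `|c y - c x| <= d.
Proof.
move=> /compact_near_coveringP cK cc d0.
have : \forall e \near 0^'+, K `<=` [set x | forall y, ball x e y -> `|c y - c x| <= d].
  apply: cK => x Kx.
  have /cvgrPdist_lt/(_ (d / 2)) := cc x Kx.
  rewrite divr_gt0// => /(_ isT)/nbhs_ballP[r /= r0 hr].
  exists (ball x (r / 2), [set e : R | e < r / 2]).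
    split => /=; first by apply: nbhsx_ballx; rewrite divr_gt0.
    by apply: nbhs_right_lt; rewrite divr_gt0.
  move=> [z e] /= [xz er] y zy.
  have xz' : ball x r z by apply: le_ball xz; rewrite ler_pdivrMr// ler_pMr// ler1n.
  have xy' : ball x r y.
    rewrite (splitr r); apply: (ball_triangle xz).
    by apply: le_ball zy; exact: ltW.
  rewrite (splitr d) (_ : c y - c z = (c x - c z) - (c x - c y)); last by ring.
  by rewrite (le_trans (ler_normB _ _))// lerD// ltW// hr.
move=> /(filterI (nbhs_right_gt 0))/filter_ex[e [/= e0 he]].
by exists e => // x y Kx xy; exact: he.
Qed.

(** * Mollification: Jensen and Young inequalities *)

Section mollification.
Context {R : realType} {n : nat}.
Local Notation mu := (@lebesgue_rV R n).
Implicit Types (f g : 'rV[R]_n -> R) (x h : 'rV[R]_n).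

Definition mollifying (e : R) (rho : 'rV[R]_n -> R) :=
  [/\ nice rho, forall x, 0 <= rho x, forall x, rho (- x) = rho x,
      forall x, ~ ball 0 e x -> rho x = 0 & (\int[mu]_x (rho x)%:E = 1)%E].

Variables (e : R) (rho : 'rV[R]_n -> R) (hrho : mollifying e rho).

Let nrho : nice rho. Proof. by case: hrho. Qed.
Let rho0 x : 0 <= rho x. Proof. by case: hrho. Qed.
Let rhoN x : rho (- x) = rho x. Proof. by case: hrho. Qed.
Let mrho : measurable_fun setT rho. Proof. exact: nice_measurable. Qed.

Let rho_far x y : ~ ball x e y -> rho (x - y) = 0.
Proof.
case: hrho => _ _ _ + _ xy; apply => xy0; apply: xy.
move: xy0; rewrite -!ball_normE/= sub0r opprB.
by rewrite distrC.
Qed.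

Let int_rho x : (\int[mu]_y (rho (x - y))%:E = 1)%E.
Proof.
case: hrho => _ _ _ _ <-.
rewrite -(@ge0_integral_rV_shift _ _ (EFin \o rho) (- x))//.
- by apply: eq_integral => y _ /=; rewrite -rhoN opprB.
- exact/measurable_EFinP.
Qed.

Let Rint_rho x : (\int[mu]_y (rho (x - y)))%R = 1.
Proof. by rewrite /Rintegral int_rho. Qed.

Let mrhox x : measurable_fun setT (fun y : 'rV[R]_n => rho (x - y)).
Proof. exact: measurableT_comp mrho (measurable_fun_rV_sub x). Qed.

Lemma conv_eq0 g x : (forall y, ball x e y -> g y = 0) -> conv g rho x = 0.
Proof.
move=> gx; rewrite /conv (@eq_Rintegral _ _ _ mu setT (cst 0)).
  by rewrite Rintegral_cst// mul0r.
move=> y _; have [xy|xy] := pselect (ball x e y); first by rewrite gx// mul0r.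
by rewrite rho_far// mulr0.
Qed.

Let irho x : mu.-integrable setT (EFin \o (fun y : 'rV[R]_n => rho (x - y))).
Proof.
apply/integrableP; split; first exact/measurable_EFinP.
under eq_integral do rewrite gee0_abs ?lee_fin//.
by rewrite /= int_rho ltry.
Qed.

Lemma conv_near g x (c d : R) : mu.-integrable setT (EFin \o g) ->
  (forall y, ball x e y -> `|g y - c| <= d) -> `|conv g rho x - c| <= d.
Proof.
move=> ig gc; have ic := conv_integrable ig x nrho.
have irc : mu.-integrable setT (EFin \o (fun y => c * rho (x - y))).
  exact: (integrableZl measurableT c (irho x)).
have cE : c = (\int[mu]_y (c * rho (x - y)))%R.
  by rewrite RintegralZl// Rint_rho mulr1.
rewrite {1}cE -RintegralB//.
have iB : mu.-integrable setT (EFin \o (fun y => g y * rho (x - y) - c * rho (x - y))).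
  exact: (integrableB measurableT ic irc).
apply: (le_trans (le_normr_Rintegral measurableT iB)).
have -> : d = (\int[mu]_y (d * rho (x - y)))%R.
  by rewrite RintegralZl// Rint_rho mulr1.
apply: le_Rintegral => //; first exact: (integrable_abse iB).
  exact: (integrableZl measurableT d (irho x)).
move=> y _; rewrite -mulrBl normrM (ger0_norm (rho0 _)).
have [xy|xy] := pselect (ball x e y); first by rewrite ler_wpM2r// gc.
by rewrite rho_far// !mulr0.
Qed.

Lemma measurable_conv g : mu.-integrable setT (EFin \o g) -> measurable_fun setT (conv g rho).
Proof.
move=> ig; apply: (continuous_measurable_rV openT) => x _.
by apply: differentiable_continuous; case: (conv_pderiv ig x nrho).
Qed.

Variables (p : R) (p1 : 1 <= p).
Let p0 : 0 < p. Proof. exact: lt_le_trans p1. Qed.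

(** Jensen's inequality for the probability density y -> rho(x - y): integrate the tangent
    inequality of t^p at the point b = |conv g rho x|. An infinite right-hand side is set aside
    first. *)
Lemma conv_jensen g x : mu.-integrable setT (EFin \o g) ->
  ((`|conv g rho x| `^ p)%:E <= \int[mu]_y ((`|g y| `^ p) * rho (x - y))%:E)%E.
Proof.
move=> ig; have ic := conv_integrable ig x nrho.
have mg : measurable_fun setT g by apply/measurable_EFinP; exact: measurable_int ig.
have mgp : measurable_fun setT (fun y => `|g y| `^ p).
  by apply/measurable_EFinP; exact: measurable_norm_powR.
set b := `|conv g rho x|.
have iab : mu.-integrable setT (EFin \o (fun y => `|g y| * rho (x - y))).
  have := integrable_abse ic; apply: eq_integrable => // y _ /=.
  by rewrite normrM (ger0_norm (rho0 _)).
have bint : b <= (\int[mu]_y (`|g y| * rho (x - y)))%R.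
  apply: (le_trans (le_normr_Rintegral measurableT ic)).
  by under eq_Rintegral do rewrite normrM (ger0_norm (rho0 _)).
have [->|] := eqVneq (\int[mu]_y (`|g y| `^ p * rho (x - y))%:E)%E +oo%E; first by rewrite leey.
rewrite -ltey => ltoo.
have m1 : measurable_fun setT (fun y => `|g y| `^ p * rho (x - y)) by exact: measurable_funM.
have ip : mu.-integrable setT (EFin \o (fun y => `|g y| `^ p * rho (x - y))).
  apply/integrableP; split; first exact/measurable_EFinP.
  by under eq_integral do rewrite gee0_abs ?lee_fin ?mulr_ge0 ?powR_ge0//.
have irp : mu.-integrable setT (EFin \o (fun y => ((p - 1) * b `^ p) * rho (x - y))).
  exact: (integrableZl measurableT ((p - 1) * b `^ p) (irho x)).
have iL : mu.-integrable setT (EFin \o (fun y => (p * b `^ (p - 1)) * (`|g y| * rho (x - y)))).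
  exact: (integrableZl measurableT (p * b `^ (p - 1)) iab).
have : (p * b `^ (p - 1) * \int[mu]_y (`|g y| * rho (x - y)) <=
   \int[mu]_y (`|g y| `^ p * rho (x - y)) + (p - 1) * b `^ p)%R.
  rewrite -RintegralZl//.
  have -> : (p - 1) * b `^ p = (\int[mu]_y (((p - 1) * b `^ p) * rho (x - y)))%R.
    by rewrite RintegralZl// Rint_rho mulr1.
  rewrite -RintegralD//; apply: le_Rintegral => //; first exact: (integrableD measurableT ip irp).
  move=> y _; rewrite mulrA -mulrDl ler_wpM2r//.
  have := powR_tangent p1 (normr_ge0 (g y)) (normr_ge0 (conv g rho x)).
  by rewrite -/b -mulrA [_ * `|g y|]mulrC.
move=> h; rewrite -[leRHS]fineK; last by rewrite ge0_fin_numE// integral_ge0// => y _; rewrite lee_fin mulr_ge0// powR_ge0.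
rewrite lee_fin -[fine _]/(Rintegral _ _ _).
have h2 : p * b `^ p <= p * b `^ (p - 1) * (\int[mu]_y (`|g y| * rho (x - y)))%R.
  rewrite -mulrA ler_wpM2l ?(ltW p0)// -(mulr_powRB1 (normr_ge0 _) p0) mulrC ler_wpM2l// powR_ge0.
by have := le_trans h2 h; rewrite mulrBl mul1r; lra.
Qed.

(** The kernel has mass one in each of its two variables, so Tonelli applied to Jensen's bound gives
    constant 1. *)
Lemma conv_young g : mu.-integrable setT (EFin \o g) ->
  (\int[mu]_x (`|conv g rho x| `^ p)%:E <= \int[mu]_x (`|g x| `^ p)%:E)%E.
Proof.
move=> ig; have mg : measurable_fun setT g by apply/measurable_EFinP; exact: measurable_int ig.
have mgp : measurable_fun setT (fun y => `|g y| `^ p).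
  by apply/measurable_EFinP; exact: measurable_norm_powR.
pose F (z : 'rV[R]_n * 'rV[R]_n) : \bar R := (`|g z.2| `^ p * rho (z.1 - z.2))%:E.
have F0 z : (0 <= F z)%E by rewrite lee_fin mulr_ge0// powR_ge0.
have ms : measurable_fun setT (fun z : 'rV[R]_n * 'rV[R]_n => z.1 - z.2).
  apply: measurable_rVP => i.
  rewrite (_ : (fun _ => _) = (fun z : 'rV[R]_n * 'rV[R]_n => (z.1 0 i - z.2 0 i)%R)).
    apply: measurable_funB.
      exact: (measurableT_comp (measurable_coor i) measurable_fst).
    exact: (measurableT_comp (measurable_coor i) measurable_snd).
  by apply/funext => z; rewrite !mxE.
have mF : measurable_fun setT F.
  apply/measurable_EFinP; apply: measurable_funM.
    exact: (measurableT_comp mgp measurable_snd).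
  exact: (measurableT_comp mrho ms).
apply: (@le_trans _ _ (\int[mu]_x \int[mu]_y F (x, y))%E).
  apply: ge0_le_integral => //.
  - by apply: measurable_norm_powR; exact: measurable_conv.
  - by have := @measurable_fun_fubini_tonelli_F _ _ _ _ _ mu F; apply.
  - by move=> x _; exact: conv_jensen.
rewrite (@fubini_tonelli _ _ _ _ _ mu mu F mF F0).
apply: ge0_le_integral => //.
- by move=> y _; exact: integral_ge0.
- by have := @measurable_fun_fubini_tonelli_G _ _ _ _ _ mu F; apply.
- exact/measurable_EFinP.
move=> y _; rewrite /F/=.
have my : measurable_fun setT (fun x => rho (x - y)).
  exact: measurableT_comp mrho (measurable_fun_rV_shift (- y)).
under eq_integral do rewrite EFinM.
rewrite ge0_integralZl//.
- under eq_integral do rewrite -rhoN opprB.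
  by rewrite int_rho mule1.
- exact/measurable_EFinP.
- by move=> x _; rewrite lee_fin.
Qed.

End mollification.

Lemma compact_bounded_fun {R : realType} n (K : set 'rV[R]_n) (c : 'rV[R]_n -> R) :
  compact K -> (forall x, K x -> {for x, continuous c}) ->
  exists2 C : R, 0 <= C & forall x, K x -> `|c x| <= C.
Proof.
move=> /compact_near_coveringP cK cc.
have : \forall C \near +oo, K `<=` [set x | `|c x| <= C].
  apply: cK => x Kx.
  have /cvgrPdist_lt/(_ 1 ltr01)/= hx := cc x Kx.
  exists ([set y | `|c x - c y| < 1], [set C : R | `|c x| + 1 <= C]).
    by split => //=; exact: nbhs_pinfty_ge.
  move=> [y C] /= [xy xC]; rewrite (le_trans _ xC)//.
  rewrite (_ : c y = c x - (c x - c y)); last by ring.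
  by rewrite (le_trans (ler_normB _ _))// lerD2l ltW.
move=> /(filterI (nbhs_pinfty_ge (num_real 0)))/filter_ex[C [/= C0 hC]].
by exists C.
Qed.

Lemma cube_compact {R : realType} n (M : R) :
  compact [set x : 'rV[R]_n | forall i, `|x 0 i| <= M].
Proof.
have := @rV_compact R n (fun=> `[- M, M]%classic) (fun=> @segment_compact _ _ _).
congr compact; apply/seteqP; split => x /= h i; have := h i;
  by rewrite in_itv/= -ler_norml.
Qed.

Lemma ball_cube {R : realType} n (M : R) (x : 'rV[R]_n) : ball 0 M x -> forall i, `|x 0 i| < M.
Proof.
move=> xM i; have M0 : 0 < M by case: xM.
by move/ball_rV : xM => /(_ M0 i); rewrite mxE sub0r normrN.
Qed.

Lemma cube_ball {R : realType} n (M : R) (x : 'rV[R]_n) : 0 < M ->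
  (forall i, `|x 0 i| < M) -> ball 0 M x.
Proof. by move=> M0 h; apply/ball_rV => // i; rewrite mxE sub0r normrN. Qed.

Lemma bounded_supp_integrable {R : realType} n (f : 'rV[R]_n -> R) (C M : R) : 0 < M ->
  measurable_fun setT f -> (forall x, `|f x| <= C) ->
  (forall x, ~ ball 0 M x -> f x = 0) ->
  (lebesgue_rV n).-integrable setT (EFin \o f).
Proof.
move=> M0 mf fC f0; set B := ball (0 : 'rV[R]_n) M.
have mB : measurable B by apply: open_measurable_rV; exact: ball_open.
have iB : (lebesgue_rV n).-integrable B (EFin \o f).
  apply: measurable_bounded_integrable => //.
  - exact: (lebesgue_rV_bounded M0 mB).
  - exact: measurable_funTS.
  - by exists C; split; rewrite ?num_real// => D CD x _ /=; rewrite (le_trans (fC x))// ltW.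
move: iB; rewrite (integrable_mkcond _ mB).
apply: eq_integrable => // x _; rewrite patchE; case: ifPn => //.
by rewrite notin_setE => /f0 /= ->.
Qed.

Lemma continuous_supp_integrable {R : realType} n (f : 'rV[R]_n -> R) (M : R) : 0 < M ->
  continuous f -> (forall x, ~ ball 0 M x -> f x = 0) ->
  (lebesgue_rV n).-integrable setT (EFin \o f).
Proof.
move=> M0 cf f0.
have [C C0 hC] := compact_bounded_fun (@cube_compact R n M) (fun x _ => cf x).
apply: (@bounded_supp_integrable _ _ _ C M) => //.
  by apply: (continuous_measurable_rV openT) => x _; exact: cf.
move=> x; have [/ball_cube xM|/f0 ->] := pselect (ball 0 M x); last by rewrite normr0.
by apply: hC => i; exact: ltW.
Qed.

Section Lp_approximation.
Context {R : realType} {n : nat}.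
Local Notation mu := (@lebesgue_rV R n).
Implicit Types (f g : 'rV[R]_n -> R) (x h : 'rV[R]_n).

Lemma integral_supp (B : set 'rV[R]_n) (f : 'rV[R]_n -> \bar R) :
  (forall x, ~ B x -> f x = 0%E) -> (\int[mu]_x f x = \int[mu]_(x in B) f x)%E.
Proof.
move=> f0; rewrite [RHS]integral_mkcond; apply: eq_integral => x _.
by rewrite patchE; case: ifPn => //; rewrite notin_setE => /f0.
Qed.

(** With c continuous and close to g in L^p, the error is the sum of three terms: the mollification
    of g - c, bounded by Young; the mollification error of c, bounded by uniform continuity; and c -
    g itself. The threshold [e0] serves every mollifier of smaller scale, so it can be reused with
    several functions. *)
Lemma conv_Lp_approx (p M : R) g : 1 <= p -> 0 < M ->
  mu.-integrable setT (EFin \o g) -> (forall x, ~ ball 0 M x -> g x = 0) ->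
  (\int[mu]_x (`|g x| `^ p)%:E < +oo)%E -> forall eta : R, 0 < eta ->
  exists2 e0 : R, 0 < e0 & forall e rho, 0 < e -> e <= e0 -> mollifying e rho ->
    (\int[mu]_x (`|conv g rho x - g x| `^ p)%:E < eta%:E)%E.
Proof.
move=> p1 M0 ig g0 gp eta eta0.
have p0 : 0 < p by exact: lt_le_trans p1.
have pn0 : p != 0 by rewrite gt_eqF.
have mg : measurable_fun setT g by apply/measurable_EFinP; exact: measurable_int ig.
pose B (k : R) := ball (0 : 'rV[R]_n) k.
have mB k : measurable (B k) by apply: open_measurable_rV; exact: ball_open.
have M1 : 0 < M + 1 by rewrite addr_gt0.
have M2 : 0 < M + 2 by rewrite addr_gt0.
pose P : R := 2 `^ p * 2 `^ p.
have P0 : 0 < P by rewrite mulr_gt0// powR_gt0.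
pose V := (2 * (M + 1)) ^+ n.
have V0 : 0 < V by rewrite exprn_gt0// mulr_gt0.
(* Two uses of [powRD_le] cost the factor P; three terms of size e1 then leave 3/4 of eta. *)
pose e1 := eta / P / 4.
have e10 : 0 < e1 by rewrite !divr_gt0.
have gB2 : (\int[mu]_(x in B (M + 2)%R) (`|g x| `^ p)%:E < +oo)%E.
  apply: le_lt_trans gp; apply: ge0_subset_integral => //.
  exact: measurable_norm_powR.
have [c [cc hc]] := Lp_dense_continuous M2 p1 mg gB2 e10.
pose d := (e1 / V) `^ p^-1.
have d0 : 0 < d by rewrite powR_gt0// divr_gt0.
have dp : d `^ p = e1 / V by rewrite /d -powRrM mulVf// powRr1// ltW// divr_gt0.
have [r r0 hr] := compact_uniform (@cube_compact R n (M + 1)) (fun x _ => cc x) d0.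
exists (Num.min r 1); first by rewrite lt_min r0 ltr01.
move=> e rho e0; rewrite le_min => /andP[er e1'] hrho.
(* The function c need not be integrable on the whole space, so it is cut off at M + 2. Since e <=
   1, the convolution on the ball of radius M + 1 does not see the cut. *)
pose c' := c \_ (B (M + 2)).
have mc : measurable_fun setT c by apply: (continuous_measurable_rV openT) => x _; exact: cc.
have [C C0 hC] := compact_bounded_fun (@cube_compact R n (M + 2)) (fun x _ => cc x).
have mc' : measurable_fun setT c'.
  by apply/(measurable_restrictT _ (mB _)); exact: measurable_funTS.
have ic' : mu.-integrable setT (EFin \o c').
  apply: (@bounded_supp_integrable _ _ _ C (M + 2)) => //.
    move=> x; rewrite /c' patchE; case: ifPn => [/set_mem/ball_cube xM|_]; last by rewrite normr0.
    by apply: hC => i; exact: ltW.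
  by move=> x nx; rewrite /c' patchE memNset.
have igc : mu.-integrable setT (EFin \o (fun x => g x - c' x)).
  exact: (integrableB measurableT ig ic').
have near_out x : ~ B (M + 1) x -> forall y, ball x e y -> ~ B M y.
  move=> nx y xy yM; apply: nx; apply: cube_ball => // i.
  have := ball_cube yM i; move/ball_rV : xy => /(_ e0 i) h1 h2.
  rewrite -(subrK (y 0 i) (x 0 i)) (le_lt_trans (ler_normD _ _))//.
  by rewrite addrC ltrD// (lt_le_trans h1).
have Bsub : B (M + 1) `<=` B (M + 2).
  move=> x /ball_cube h; apply: cube_ball => // i.
  by rewrite (lt_trans (h i))// ltrD2l ltr1n.
have near_in x : B (M + 1) x -> forall y, ball x e y -> B (M + 2) y.
  move=> xM y xy; apply: cube_ball => // i.
  have := ball_cube xM i; move/ball_rV : xy => /(_ e0 i) h1 h2.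
  have -> : y 0 i = x 0 i - (x 0 i - y 0 i) by ring.
  rewrite (le_lt_trans (ler_normB _ _))// (_ : M + 2 = (M + 1) + 1); last by ring.
  by rewrite ltrD// (lt_le_trans h1).
have convE x : conv g rho x = conv (fun x => g x - c' x) rho x + conv c' rho x.
  have nr : nice rho by case: hrho.
  rewrite /conv -RintegralD; [|by []|exact: conv_integrable igc _ _ nr|exact: conv_integrable ic' _ _ nr].
  by apply: eq_Rintegral => y _; rewrite -mulrDl subrK.
have cnear x : B (M + 1) x -> `|conv c' rho x - c x| <= d.
  move=> xM; apply: (conv_near hrho ic') => y xy.
  rewrite /c' patchE mem_set; last exact: near_in xy.
  apply: hr; first by move=> i; apply: ltW; exact: ball_cube.
  by apply: le_ball xy.
rewrite (integral_supp (B := B (M + 1))); last first.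
  move=> x nx; rewrite (conv_eq0 hrho); last by move=> y /(near_out _ nx)/g0.
  rewrite g0 ?subrr ?normr0 ?powR0//.
  move=> /ball_cube h; apply: nx; apply: cube_ball => // i.
  by rewrite (lt_trans (h i))// ltrDl.
have mcv := measurable_conv hrho ig.
have mcv' := measurable_conv hrho igc.
have mI f : measurable_fun setT f -> measurable_fun (B (M + 1)) (fun x => (`|f x| `^ p)%:E).
  by move=> mf; apply: measurable_norm_powR; exact: measurable_funTS.
have mgc : measurable_fun setT (fun x => g x - c x) by exact: measurable_funB.
apply: (@le_lt_trans _ _ (\int[mu]_(x in B (M + 1)%R) (P%:E * ((`|conv (fun x => g x - c' x) rho x| `^ p)%:E
   + ((d `^ p)%:E + (`|g x - c x| `^ p)%:E))))%E).
  apply: ge0_le_integral => //.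
  - by apply: mI; exact: measurable_funB.
  - by apply: measurable_funeM; apply: emeasurable_funD; [exact: mI|apply: emeasurable_funD => //; exact: mI].
  move=> x xM; rewrite -!EFinD -EFinM lee_fin.
  rewrite convE -addrA (_ : conv c' rho x - g x = (conv c' rho x - c x) + - (g x - c x)); last by ring.
  rewrite (le_trans (powRD_le _ _ (ltW p0)))// -mulrA ler_wpM2l ?powR_ge0// mulrDr lerD//.
    rewrite ler_peMl ?powR_ge0//; apply: (@le_trans _ _ 2); first by rewrite ler1n.
    by rewrite le1r_powR// ler1n.
  rewrite (le_trans (powRD_le _ _ (ltW p0)))// ler_wpM2l ?powR_ge0// normrN lerD2r.
  by apply: ge0_ler_powR (cnear _ xM); rewrite ?nnegrE ?normr_ge0 ?ltW.
have mpos1 : measurable_fun (B (M + 1)) (fun x => (d `^ p)%:E + (`|g x - c x| `^ p)%:E)%E.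
  by apply: emeasurable_funD => //; exact: mI.
have mm1 := mI _ mcv'; have mm2 := mI _ mgc.
rewrite ge0_integralZl//; first last.
- by rewrite lee_fin ltW.
- by move=> x _; rewrite !adde_ge0// lee_fin powR_ge0.
- exact: emeasurable_funD.
rewrite ge0_integralD//; last by move=> x _; rewrite adde_ge0// lee_fin powR_ge0.
rewrite ge0_integralD//; last by move=> x _; rewrite lee_fin powR_ge0.
have -> : (\int[mu]_(x in B (M + 1)%R) (d `^ p)%:E = e1%:E)%E.
  have VB : mu (B (M + 1)) = V%:E := lebesgue_rV_ball _ M1.
  transitivity ((d `^ p)%:E * mu (B (M + 1)%R))%E; first exact: integral_cst.
  by rewrite VB -EFinM dp divfK ?gt_eqF.
have h1 : (\int[mu]_(x in B (M + 1)%R) (`|conv (fun x => g x - c' x) rho x| `^ p)%:E < e1%:E)%E.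
  apply: (@le_lt_trans _ _ (\int[mu]_x (`|conv (fun x => g x - c' x) rho x| `^ p)%:E)%E).
    by apply: ge0_subset_integral => //; exact: measurable_norm_powR.
  apply: (le_lt_trans (conv_young hrho p1 igc)).
  apply: le_lt_trans hc; rewrite (integral_supp (B := B (M + 2))); last first.
    move=> x nx; rewrite /c' patchE memNset// subr0 g0 ?normr0 ?powR0//.
    move=> /ball_cube h; apply: nx; apply: cube_ball => // i.
    by rewrite (lt_trans (h i))// ltrDl.
  rewrite le_eqVlt; apply/orP; left; apply/eqP; apply: eq_integral => x xM.
  by rewrite /c' patchE xM.
have h2 : (\int[mu]_(x in B (M + 1)%R) (`|g x - c x| `^ p)%:E < e1%:E)%E.
  apply: le_lt_trans hc; apply: ge0_subset_integral => //.
  by apply: measurable_norm_powR; exact: measurable_funTS.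
apply: (@le_lt_trans _ _ (P%:E * (e1%:E + (e1%:E + e1%:E)))%E).
  apply: lee_wpmul2l; first by rewrite lee_fin ltW.
  by apply: leeD; [exact: ltW h1|apply: leeD; [exact: lexx|exact: ltW h2]].
rewrite -!EFinD -EFinM lte_fin /e1.
have -> : P * (eta / P / 4 + (eta / P / 4 + eta / P / 4)) = eta * (3 / 4) by field; rewrite gt_eqF.
by rewrite gtr_pMr// ltr_pdivrMr// mul1r ltr_nat.
Qed.

End Lp_approximation.

(** * Test functions in Sobolev spaces *)

Lemma is_derive_continuous {R : realType} (f df : R -> R) :
  (forall t : R, is_derive t 1 f (df t)) -> continuous f.
Proof.
move=> h t; apply: differentiable_continuous; apply/derivable1_diffP.
by case: (h t).
Qed.

Lemma integral_is_derive_itv {R : realType} (f df : R -> R) (a b : R) : a < b ->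
  (forall t : R, is_derive t 1 f (df t)) -> continuous df ->
  (\int[@lebesgue_measure R]_(t in `[a, b]) (df t)%:E = (f b - f a)%:E)%E.
Proof.
move=> ab fdf cdf; have cf := is_derive_continuous fdf.
rewrite (@continuous_FTC2 _ df f)//.
- exact: continuous_subspaceT.
- split; first by move=> x _; case: (fdf x).
  + exact/cvg_at_right_filter/cf.
  + exact/cvg_at_left_filter/cf.
- by move=> x _; rewrite derive1E; case: (fdf x).
Qed.

Lemma integral_is_derive_supp {R : realType} (f df : R -> R) (M : R) : 0 < M ->
  (forall t : R, is_derive t 1 f (df t)) -> continuous df ->
  (forall t, M <= `|t| -> f t = 0) -> (forall t, M <= `|t| -> df t = 0) ->
  (\int[@lebesgue_measure R]_t (df t)%:E = 0)%E.
Proof.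
move=> M0 fdf cdf f0 df0.
transitivity (\int[@lebesgue_measure R]_(t in `[(- M)%R, M]) (df t)%:E)%E.
  rewrite [RHS]integral_mkcond; apply: eq_integral => x _.
  rewrite patchE; case: ifPn => //; rewrite notin_setE/= in_itv/= -ler_norml => /negP.
  by rewrite -ltNge => /ltW/df0 ->.
rewrite (integral_is_derive_itv _ fdf cdf) ?gtrN// !f0 ?subrr// ?normrN ?ger0_norm// ltW//.
Qed.

(** * Integration by parts against test functions *)

Section integration_by_parts.
Context {R : realType}.
Local Notation mu n := (@lebesgue_rV R n).
Local Notation e_ i := (delta_mx 0 i).

Lemma rV_cons_lineE n (t s : R) (y h : 'rV[R]_n) :
  rV_cons ((t : measurableTypeR R), y) + s *: rV_cons ((0 : measurableTypeR R), h) =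
  rV_cons ((t : measurableTypeR R), y + s *: h).
Proof.
apply/rowP => i; rewrite !mxE; case: fintype.splitP => // k _; rewrite !mxE//.
by rewrite ord1 eqxx !mulr1n mulr0 addr0.
Qed.

Lemma rV_cons_delta0 n : e_ 0 = rV_cons ((1 : measurableTypeR R), 0) :> 'rV[R]_n.+1.
Proof.
apply/rowP => i; have [j ->|->] := unliftP 0 i; last by rewrite rV_consE0 mxE !eqxx.
by rewrite rV_consE !mxE.
Qed.

Lemma rV_cons_deltaS n (j : 'I_n) :
  e_ (lift 0 j) = rV_cons ((0 : measurableTypeR R), e_ j) :> 'rV[R]_n.+1.
Proof.
apply/rowP => i; have [k ->|->] := unliftP 0 i; last by rewrite rV_consE0 mxE eqxx (negbTE (neq_lift _ _)).
by rewrite rV_consE !mxE eqxx /= (inj_eq lift_inj).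
Qed.

Lemma rV_cons_ball n (t s : R) (y h : 'rV[R]_n) (e : R) : 0 < e ->
  ball (rV_cons ((t : measurableTypeR R), y)) e (rV_cons ((s : measurableTypeR R), h)) <->
  `|t - s| < e /\ ball y e h.
Proof.
move=> e0; rewrite !ball_rV//; split=> [H|[H1 H2] i].
  split=> [|i]; first by have := H 0; rewrite !rV_consE0.
  by have := H (lift 0 i); rewrite !rV_consE.
have [k ->|->] := unliftP 0 i; last by rewrite !rV_consE0.
by rewrite !rV_consE; exact: H2.
Qed.

Lemma rV_cons_continuous2 n (t : R) :
  continuous (fun y : 'rV[R]_n => rV_cons ((t : measurableTypeR R), y)).
Proof.
move=> y A /nbhs_ballP[e /= e0 eA].
apply: (@filterS _ (nbhs y) (nbhs_filter y) _ _ _ (nbhsx_ballx y e e0)) => h yh.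
by apply: eA; apply/rV_cons_ball => //; rewrite subrr normr0.
Qed.

Lemma rV_cons_continuous1 n (y : 'rV[R]_n) :
  continuous (fun t : R => rV_cons ((t : measurableTypeR R), y)).
Proof.
move=> t; apply/cvg_ballP => e e0; apply: filterS (nbhsx_ballx t e e0) => s ts.
by apply/rV_cons_ball => //; split=> //; exact: ballxx.
Qed.

Lemma rV_ball0_cons n (t M : R) (y : 'rV[R]_n) : 0 < M ->
  ball 0 M (rV_cons ((t : measurableTypeR R), y)) -> `|t| < M /\ ball 0 M y.
Proof.
move=> M0 /ball_cube h; split; first by have := h 0; rewrite rV_consE0.
by apply: cube_ball => // i; have := h (lift 0 i); rewrite rV_consE.
Qed.

(** If the direction is the first coordinate, integrate along it first and the inner integral
    vanishes; otherwise fix the first coordinate and apply the induction hypothesis to the slice. *)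
Lemma integral_derive_supp n (F dF : 'rV[R]_n -> R) (i : 'I_n) (M : R) : 0 < M ->
  (forall x, is_derive x (e_ i) F (dF x)) -> continuous dF ->
  (forall x, ~ ball 0 M x -> F x = 0) -> (forall x, ~ ball 0 M x -> dF x = 0) ->
  (\int[mu n]_x (dF x)%:E = 0)%E.
Proof.
move=> M0; elim: n F dF i => [|n IH] F dF i; first by case: i.
move=> FdF cdF F0 dF0.
have idF := continuous_supp_integrable M0 cdF dF0.
have [I1 I2] := integral_rVS idF.
have [j ij|i0] := unliftP 0 i.
  rewrite I1; apply: integral0_eq => t _.
  apply: (IH (fun y => F (rV_cons (t, y))) (fun y => dF (rV_cons (t, y))) j).
  - move=> y; rewrite -[y]addr0 -[X in y + X](scale0r (e_ j)); apply/is_derive_line.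
    have := FdF (rV_cons (t, y)).
    rewrite -[X in is_derive X]addr0 -[X in _ + X](scale0r (e_ i)) => /is_derive_line.
    rewrite scale0r addr0 ij rV_cons_deltaS.
    have -> : (fun s => F (rV_cons (t, y) + s *: rV_cons ((0 : measurableTypeR R), e_ j))) =
        (fun s => F (rV_cons (t, y + s *: e_ j))).
      by apply/funext => s; rewrite rV_cons_lineE.
    by [].
  - move=> y; apply: continuous_comp; [exact: rV_cons_continuous2|exact: cdF].
  - by move=> y ny; apply: F0 => /rV_ball0_cons[].
  - by move=> y ny; apply: dF0 => /rV_ball0_cons[].
rewrite I2; apply: integral0_eq => y _.
apply: (@integral_is_derive_supp _ (fun t => F (rV_cons (t, y))) (fun t => dF (rV_cons (t, y))) M) => //.
- move=> t; have := FdF (rV_cons ((t : measurableTypeR R), y)).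
  have E s : rV_cons ((s : measurableTypeR R), y) = rV_cons ((0 : measurableTypeR R), y) + s *: e_ i.
    rewrite i0 rV_cons_delta0; apply/rowP => k; rewrite !mxE.
    by case: fintype.splitP => // l _; rewrite !mxE ?mulr0 ?addr0// ord1 eqxx !mulr1n mulr1 add0r.
  rewrite {1}E => /is_derive_line; congr is_derive.
  by apply/funext => s; congr F; rewrite -E.
- move=> t A /(cdF _) H; exact: (rV_cons_continuous1 H).
- by move=> t tM; apply: F0 => /(rV_ball0_cons M0)[]; rewrite ltNge tM.
- by move=> t tM; apply: dF0 => /(rV_ball0_cons M0)[]; rewrite ltNge tM.
Qed.

Local Notation supp := Defs.support.
Context {n : nat}.
Implicit Types (A phi : 'rV[R]_n -> R) (O : set 'rV[R]_n).

Lemma supportN phi x : ~ supp phi x -> phi x = 0.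
Proof.
by move=> nx; apply/eqP; apply/negPn/negP => h; apply: nx; exact: subset_closure.
Qed.

Lemma near_supportN phi x : ~ supp phi x -> \near x, phi x = 0.
Proof.
move=> nx; have /(_ x nx) : open (~` supp phi).
  by rewrite openC; exact: closed_closure.
by apply: filterS => y; exact: supportN.
Qed.

Lemma pderiv_supportN phi i x : ~ supp phi x -> pderiv i phi x = 0.
Proof.
move=> /near_supportN nx.
have := @near_eq_is_derive _ _ _ _ phi x (e_ i) 0 _ (is_derive_cst (0 : R) x (e_ i)).
case=> [|_ //]; by apply: filterS nx => y ->.
Qed.

Lemma near_pderiv_supportN phi i x : ~ supp phi x -> \near x, pderiv i phi x = 0.
Proof.
move=> nx; have /(_ x nx) : open (~` supp phi).
  by rewrite openC; exact: closed_closure.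
by apply: filterS => y; exact: pderiv_supportN.
Qed.

Lemma compact_ball0 (K : set 'rV[R]_n) : compact K -> exists2 M, 0 < M & K `<=` ball 0 M.
Proof.
move=> /compact_bounded_fun-/(_ (fun x => `|x|))[x _|C C0 h]; first exact: norm_continuous.
exists (C + 1); first by rewrite ltr_wpDl.
move=> x Kx; apply: cube_ball => [|i]; first by rewrite ltr_wpDl.
rewrite (le_lt_trans (norm_coord_le x i))// (le_lt_trans (le_trans (ler_norm _) (h _ Kx)))//.
by rewrite ltrDl.
Qed.

Lemma near_cst_continuous (T : topologicalType) (g : T -> R) c x :
  (\near x, g x = c) -> {for x, continuous g}.
Proof.
move=> E B; rewrite /= (nbhs_singleton E) => /nbhs_singleton Bc.
by apply: filterS E => y /= ->.
Qed.

(** The coefficient [A] is controlled on O only. Off the support the factor h vanishes in a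
    neighbourhood, so the product is continuous everywhere whatever the values of [A] outside O. *)
Lemma glue_continuous A O phi (h : 'rV[R]_n -> R) : supp phi `<=` O ->
  (forall x, O x -> {for x, continuous A}) ->
  (forall x, O x -> {for x, continuous h}) -> (forall x, ~ supp phi x -> \near x, h x = 0) ->
  continuous (fun x => A x * h x).
Proof.
move=> sO cA ch h0 x; have [/sO Ox|nx] := pselect (supp phi x).
  by apply: continuousM; [exact: cA|exact: ch].
by apply: (@near_cst_continuous _ _ 0); apply: filterS (h0 _ nx) => y ->; rewrite mulr0.
Qed.

Lemma integration_by_parts_rV A dA O phi i : test_function O phi ->
  (forall x, O x -> is_derive x (e_ i) A (dA x)) ->
  (forall x, O x -> {for x, continuous A}) -> (forall x, O x -> {for x, continuous dA}) ->
  [/\ (mu n).-integrable setT (fun x => (A x * pderiv i phi x)%:E),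
      (mu n).-integrable setT (fun x => (dA x * phi x)%:E) &
      (\int[mu n]_x (A x * pderiv i phi x)%:E = - \int[mu n]_x (dA x * phi x)%:E)%E].
Proof.
move=> [sphi cphi phiO] AdA cA cdA.
have [M M0 KM] := compact_ball0 cphi.
have dphi x : differentiable phi x by exact: (sphi [::] x).
have dpphi x : differentiable (pderiv i phi) x by exact: (sphi [:: i] x).
have c1 : continuous (fun x => A x * pderiv i phi x).
  apply: (glue_continuous phiO cA) => [x _|x]; last exact: near_pderiv_supportN.
  exact: differentiable_continuous.
have c2 : continuous (fun x => dA x * phi x).
  apply: (glue_continuous phiO cdA) => [x _|x]; last exact: near_supportN.
  exact: differentiable_continuous.
have z1 x : ~ ball 0 M x -> A x * pderiv i phi x = 0.
  by move=> nx; rewrite pderiv_supportN ?mulr0// => /KM.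
have z2 x : ~ ball 0 M x -> dA x * phi x = 0.
  by move=> nx; rewrite (@supportN phi) ?mulr0// => /KM.
have i1 := continuous_supp_integrable M0 c1 z1.
have i2 := continuous_supp_integrable M0 c2 z2.
split=> //.
have I0 : (\int[mu n]_x (A x * pderiv i phi x + dA x * phi x)%:E = 0)%E.
  apply: (@integral_derive_supp _ (fun x => A x * phi x) _ i M M0).
  - move=> x; have [/phiO Ox|nx] := pselect (supp phi x).
      have hp : is_derive x (e_ i) phi (pderiv i phi x).
        exact: derivableP (diff_derivable (dphi x)).
      by apply: is_derive_eq (is_deriveM (AdA x Ox) hp) _; rewrite /GRing.scale/= [phi x * _]mulrC.
    rewrite pderiv_supportN// (supportN nx) !mulr0 addr0.
    apply: near_eq_is_derive (is_derive_cst (0 : R) x (e_ i)).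
    by apply: filterS (near_supportN nx) => y ->; rewrite mulr0.
  - by move=> x; exact: (continuousD (c1 x) (c2 x)).
  - by move=> x nx; rewrite (@supportN phi) ?mulr0// => /KM.
  - by move=> x nx; rewrite z1// z2// addr0.
have := integralD_EFin measurableT i1 i2.
rewrite [LHS](_ : _ = 0%E); last by rewrite -[RHS]I0; apply: eq_integral.
have f1 := integrable_fin_num measurableT i1.
have f2 := integrable_fin_num measurableT i2.
move: f1 f2; rewrite /comp; move: (integral _ _ _) (integral _ _ _) => -[a||]// [b||]// _ _.
by rewrite -EFinD => -[] /esym/eqP; rewrite addr_eq0 => /eqP ->.
Qed.
End integration_by_parts.

(** * Membership and convergence in L^p in terms of integrals *)

Section Lp_facts.
Context {R : realType} {n : nat}.
Local Notation mu := (@lebesgue_rV R n).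
Implicit Types (p : R) (D : set 'rV[R]_n) (u phi : 'rV[R]_n -> R).

Lemma integral_powR_restrict p D u : 0 < p ->
  (\int[mu]_x (`|(EFin \o (u \_ D)) x| `^ p) = \int[mu]_(x in D) (`|u x| `^ p)%:E)%E.
Proof.
move=> p0; rewrite [RHS]integral_mkcond; apply: eq_integral => x _ /=.
rewrite !patchE; case: ifPn => // _.
by rewrite normr0 powR0// gt_eqF.
Qed.

Lemma in_LpP p D u : 0 < p -> measurable D ->
  in_Lp p D u <-> measurable_fun D u /\ (\int[mu]_(x in D) (`|u x| `^ p)%:E < +oo)%E.
Proof.
move=> p0 mD; have pn : p != 0 by rewrite gt_eqF.
have E : (\int[mu]_(x in D) (`|u x| `^ p)%:E)%E = ('N[mu]_p%:E [EFin \o (u \_ D)] `^ p)%E.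
  exact: (etrans (esym (integral_powR_restrict D u p0)) (esym (poweR_Lnorm _ _ pn))).
rewrite E; split=> [|[mu_ fin]].
  rewrite /in_Lp => /andP[]; rewrite !inE /= => mu_ fin; split.
    exact/(measurable_restrictT u mD).
  exact: poweR_lty.
rewrite /in_Lp; apply/andP; rewrite !inE /=; split.
  exact/(measurable_restrictT u mD).
exact: lty_poweRy pn fin.
Qed.

Lemma Lp_dist_powR p D u phi : 0 < p ->
  (Lp_dist p D u phi `^ p = \int[mu]_(x in D) (`|u x - phi x| `^ p)%:E)%E.
Proof.
move=> p0; have pn : p != 0 by rewrite gt_eqF.
exact: (etrans (poweR_Lnorm _ _ pn) (integral_powR_restrict D (fun x => u x - phi x) p0)).
Qed.

Lemma poweR_lt_inv p (x : \bar R) (e : R) : 0 < p -> 0 < e -> (0 <= x)%E ->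
  (x `^ p < (e `^ p)%:E)%E = (x < e%:E)%E.
Proof.
move=> p0 e0; case: x => [r||]//=; last by rewrite (gt_eqF p0).
rewrite lee_fin !lte_fin => r0; apply/idP/idP => [|re].
  rewrite !ltNge; apply: contra => er.
  by apply: ge0_ler_powR; rewrite ?nnegrE// ltW.
by rewrite gt0_ltr_powR// nnegrE// ltW.
Qed.

Lemma Lp_dist_cvg0P p D (psi : nat -> 'rV[R]_n -> R) phi : 0 < p ->
  (Lp_dist p D (psi k) phi @[k --> \oo] --> 0%E) <->
  (forall eta : R, 0 < eta ->
     \forall k \near \oo, (\int[mu]_(x in D) (`|psi k x - phi x| `^ p)%:E < eta%:E)%E).
Proof.
move=> p0; have L0 k : (0 <= Lp_dist p D (psi k) phi)%E by exact: Lnorm_ge0.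
split=> [h eta eta0|h].
  have e0 : 0 < eta `^ p^-1 by rewrite powR_gt0.
  have := ecvg_lt h (_ : (0 < (eta `^ p^-1)%:E)%E); rewrite lte_fin => /(_ e0).
  apply: filterS => k; rewrite -(poweR_lt_inv p0 e0)// Lp_dist_powR//.
  by rewrite -powRrM mulVf ?gt_eqF// powRr1// ltW.
have H (e : R) : 0 < e -> \forall k \near \oo, (Lp_dist p D (psi k) phi < e%:E)%E.
  move=> e0; have := h (e `^ p) (powR_gt0 _ e0).
  by apply: filterS => k; rewrite -Lp_dist_powR// poweR_lt_inv.
apply/fine_cvgP; split.
  by apply: filterS (H 1 ltr01) => k k1; rewrite ge0_fin_numE// (lt_trans k1)// ltry.
apply/cvgrPdist_lt => e e0; apply: filterS (H e e0) => k ke /=.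
rewrite sub0r normrN ger0_norm ?fine_ge0//.
by rewrite -lte_fin fineK// ge0_fin_numE// (lt_trans ke)// ltry.
Qed.

(** Either |t| <= d, or |t|^p >= d^(p-1) |t|. Integrated over a set of finite measure, it does the
    work of Hölder's inequality in passing from L^p to L^1, with d free to be small. *)
Lemma norm_le_powR p (d t : R) : 1 <= p -> 0 < d ->
  `|t| <= d + d `^ (1 - p) * `|t| `^ p.
Proof.
move=> p1 d0; have [td|dt] := leP `|t| d.
  by rewrite (le_trans td)// lerDl mulr_ge0// powR_ge0.
apply: ler_wpDl; first exact: ltW.
have t0 : 0 < `|t| by exact: lt_trans dt.
have -> : `|t| `^ p = `|t| `^ (p - 1) * `|t|.
  by rewrite -[X in _ * X]powRr1 ?normr_ge0// -powRD ?subrK// (gt_eqF t0) implybT.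
rewrite mulrA; apply: ler_peMl; first exact: ltW.
rewrite -(opprB p 1) powRN mulrC ler_pdivlMr ?powR_gt0// mul1r.
by apply: ge0_ler_powR; rewrite ?nnegrE ?subr_ge0// ltW.
Qed.

Lemma integral_norm_le p D u (d : R) : 1 <= p -> 0 < d -> measurable D ->
  measurable_fun D u ->
  (\int[mu]_(x in D) `|u x|%:E <=
     d%:E * mu D + (d `^ (1 - p))%:E * \int[mu]_(x in D) (`|u x| `^ p)%:E)%E.
Proof.
move=> p1 d0 mD mu_; have mp := measurable_norm_powR p mu_.
rewrite -integral_cst// -ge0_integralZl//; last first.
  by rewrite lee_fin powR_ge0.
rewrite -ge0_integralD//; first last.
- exact: measurable_funeM.
- by move=> x _; rewrite mule_ge0// lee_fin powR_ge0.
- by move=> x _; rewrite lee_fin ltW.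
apply: ge0_le_integral => //.
- by apply/measurable_EFinP; exact: measurableT_comp.
- by apply: emeasurable_funD => //; exact: measurable_funeM.
by move=> x _; rewrite -EFinM -EFinD lee_fin norm_le_powR.
Qed.

Lemma Lp_integrable p D u : 1 <= p -> measurable D -> (mu D < +oo)%E ->
  in_Lp p D u -> mu.-integrable D (EFin \o u).
Proof.
move=> p1 mD Df; have p0 : 0 < p by exact: lt_le_trans p1.
move=> /(in_LpP _ p0 mD)[mu_ ui]; apply/integrableP; split; first exact/measurable_EFinP.
apply: (le_lt_trans (integral_norm_le p1 ltr01 mD mu_)).
rewrite lte_add_pinfty//; first by rewrite mul1e.
by rewrite lte_mul_pinfty// lee_fin powR_ge0.
Qed.

Lemma Lp_cvg_L1 p D (psi : nat -> 'rV[R]_n -> R) phi : 1 <= p -> measurable D ->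
  (mu D < +oo)%E -> (forall k, measurable_fun D (psi k)) -> measurable_fun D phi ->
  Lp_dist p D (psi k) phi @[k --> \oo] --> 0%E ->
  forall eta : R, 0 < eta ->
    \forall k \near \oo, (\int[mu]_(x in D) `|psi k x - phi x|%:E < eta%:E)%E.
Proof.
move=> p1 mD Df mpsi mphi; have p0 : 0 < p by exact: lt_le_trans p1.
move=> /(Lp_dist_cvg0P _ _ _ p0) h eta eta0.
have [a Da] : exists a, mu D = a%:E.
  by exists (fine (mu D)); rewrite fineK// ge0_fin_numE.
have a0 : 0 <= a by rewrite -lee_fin -Da.
pose d := eta / 2 / (a + 1).
have d0 : 0 < d by rewrite !divr_gt0// ltr_wpDl.
pose c := d `^ (1 - p); have c0 : 0 < c by exact: powR_gt0.
have e0 : 0 < eta / 2 / c by rewrite !divr_gt0.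
apply: filterS (h _ e0) => k hk.
have mf : measurable_fun D (fun x => psi k x - phi x) by exact: measurable_funB.
apply: (le_lt_trans (integral_norm_le p1 d0 mD mf)).
rewrite Da -/c.
have I0 : (0 <= \int[mu]_(x in D) (`|psi k x - phi x| `^ p)%:E)%E.
  by apply: integral_ge0 => x _; rewrite lee_fin powR_ge0.
case: (integral _ _ _) hk I0 => [r||]//; rewrite lte_fin lee_fin => hr r0.
rewrite -!EFinM -EFinD lte_fin.
have {hr} : c * r < eta / 2 by rewrite mulrC -ltr_pdivlMr.
suff : d * a <= eta / 2 by move=> ? ?; lra.
rewrite /d mulrAC ler_pdivrMr ?ltr_wpDl// ler_wpM2l ?divr_ge0 ?ltW//.
by rewrite ltrDl.
Qed.

End Lp_facts.

(** * Neighbourhoods of compact sets *)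

Section neighbourhoods.
Context {R : realType} {n : nat}.
Implicit Types (K O A : set 'rV[R]_n) (x y : 'rV[R]_n).

Definition thicken K (s : R) : set 'rV[R]_n := \bigcup_(x in K) ball x s.

Lemma thicken_open K s : open (thicken K s).
Proof. by apply: bigcup_open => x _; exact: ball_open. Qed.

Lemma sub_thicken K s : 0 < s -> K `<=` thicken K s.
Proof. by move=> s0 x Kx; exists x => //; exact: ballxx. Qed.

Lemma thicken_le K s t : s <= t -> thicken K s `<=` thicken K t.
Proof. by move=> st x [y Ky yx]; exists y => //; exact: le_ball yx. Qed.

Lemma thicken_ball K s t x y : thicken K s x -> ball x t y -> thicken K (s + t) y.
Proof. by move=> [z Kz zx] xy; exists z => //; exact: ball_triangle xy. Qed.

Lemma closure_thicken A K s t : 0 < t -> A `<=` thicken K s -> closure A `<=` thicken K (s + t).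
Proof.
move=> t0 AK x /(_ (ball x t) (nbhsx_ballx x t t0))[y [/AK yK xy]].
by apply: (thicken_ball yK); exact: ball_sym.
Qed.

(** The indicator of O is locally constant at the points of K; uniform continuity with tolerance 1/2
    turns this into a uniform radius. *)
Lemma thicken_sub K O : compact K -> open O -> K `<=` O -> exists2 r, 0 < r & thicken K r `<=` O.
Proof.
move=> cK oO KO.
have c1 x : K x -> {for x, continuous (\1_O : 'rV[R]_n -> R)}.
  move=> /KO Ox; apply: (@near_cst_continuous _ _ _ 1).
  by apply: filterS (oO _ Ox) => y Oy; rewrite indicE mem_set.
have d0 : 0 < 2^-1 :> R by rewrite invr_gt0.
have [r r0 h] := compact_uniform cK c1 d0.
exists r => // y [x Kx xy]; apply: contrapT => nO.
have := h x y Kx xy; rewrite !indicE (mem_set (KO _ Kx)) memNset// sub0r normrN normr1.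
by rewrite leNgt invf_lt1// ltr1n.
Qed.

Lemma bounded_closure_compact A (M : R) : A `<=` ball 0 M -> compact (closure A).
Proof.
move=> AM; apply: (subclosed_compact _ (@cube_compact R n M)); first exact: closed_closure.
have cl : closed [set x : 'rV[R]_n | forall i, `|x 0 i| <= M].
  by apply: compact_closed (@cube_compact R n M); exact: norm_hausdorff.
apply: (subset_trans _ (cl : closure _ `<=` _)); apply: closure_subset.
by move=> x /AM /ball_cube h i; exact: ltW.
Qed.

Lemma thicken_compactly_inside K O : compact K -> open O -> K `<=` O ->
  exists2 r, 0 < r & forall s, 0 < s -> s <= r -> compactly_inside (thicken K s) O.
Proof.
move=> cK oO KO; have [r r0 rO] := thicken_sub cK oO KO.
have [M M0 KM] := compact_ball0 cK.
exists (r / 2); first by rewrite divr_gt0.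
move=> s s0 sr; split; first exact: thicken_open.
  apply: (@bounded_closure_compact _ (M + s)) => x [y /KM yM yx].
  exact: ball_triangle yx.
apply: subset_trans rO; apply: (subset_trans (@closure_thicken _ K s s s0 _)) => //.
by apply: thicken_le; rewrite (splitr r) lerD.
Qed.

End neighbourhoods.

(** * Mollification of weak derivatives *)

Section mollified_derivatives.
Context {R : realType} {n : nat}.
Local Notation mu := (@lebesgue_rV R n).
Local Notation supp := Defs.support.
Implicit Types (f g h eta : 'rV[R]_n -> R) (x y : 'rV[R]_n) (D K : set 'rV[R]_n).

Lemma nice_reflect eta x : nice eta -> nice (fun y => eta (x - y)).
Proof.
elim=> {eta} [c|Q i s c|f g _ hf _ hg|f g _ hf _ hg].
- exact: nice_cst.
- rewrite (_ : (fun _ => _) = (fun y => flat_exp Q ((c + s * x 0 i) + (- s) * y 0 i))).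
    exact: nice_flat.
  by apply/funext => y; rewrite !mxE; congr flat_exp; ring.
- exact: nice_mul.
- exact: nice_add.
Qed.

Lemma pderiv_reflect eta x y i : nice eta ->
  pderiv i (fun z => eta (x - z)) y = - pderiv i eta (x - y).
Proof.
move=> ne; have dn := nice_differentiable (x - y) ne.
have H : is_derive y (delta_mx 0 i) (fun z => eta (x - z)) ('D_(- delta_mx 0 i) eta (x - y)).
  rewrite -[y in is_derive y]addr0 -[X in _ + X](scale0r (delta_mx 0 i)); apply/is_derive_line.
  have := @is_derive_along _ _ eta (x - y) (- delta_mx 0 i) 0; rewrite scale0r addr0 => /(_ dn).
  by congr is_derive; apply/funext => s; congr eta; rewrite scalerN opprD addrA.
case: H => _; rewrite /pderiv => ->; rewrite derive_pderiv// (bigD1 i)//= big1 => [|j ji].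
  by rewrite !mxE !eqxx addr0 mulN1r.
by rewrite !mxE eqxx (negbTE ji) oppr0 mul0r.
Qed.

Lemma nice_smooth eta : nice eta -> smooth eta.
Proof. by move=> ne s x; apply: nice_differentiable; exact: iter_pderiv_nice. Qed.

Variables (e : R) (rho : 'rV[R]_n -> R) (e0 : 0 < e) (hrho : mollifying e rho).
Let nrho : nice rho. Proof. by case: hrho. Qed.

Lemma mollifier_far x y : ~ ball x e y -> rho (x - y) = 0.
Proof.
case: hrho => _ _ _ + _ nb; apply=> /ball_cube h; apply: nb; apply/ball_rV => // i.
by have := h i; rewrite !mxE.
Qed.

Lemma mollifier_test_function x D : ball x (e + e) `<=` D -> test_function D (fun y => rho (x - y)).
Proof.
move=> xD; have s1 : [set y | rho (x - y) != 0] `<=` thicken [set x] e.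
  move=> y /= ny; exists x => //; apply: contrapT => /mollifier_far h.
  by rewrite h eqxx in ny.
have s2 := closure_thicken e0 s1.
have s3 : supp (fun y => rho (x - y)) `<=` ball x (e + e).
  by apply: (subset_trans s2) => y [_ ->].
split; first exact/nice_smooth/nice_reflect.
  have [M M0 xM] := compact_ball0 (@compact_set1 _ x).
  apply: (@bounded_closure_compact _ _ _ (M + e)) => y /s1[_ -> xy].
  exact: ball_triangle (xM x erefl) xy.
exact: subset_trans xD.
Qed.

(** The function y -> rho(x - y) is itself a test function in D, and the weak identity tested with
    it is the claim. The radius 2e instead of e leaves room for the closure in the definition of the
    support. *)
Lemma conv_weak_pderiv x D f g i : measurable D -> ball x (e + e) `<=` D ->
  mu.-integrable setT (EFin \o f) -> weak_pderiv D i f g ->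
  pderiv i (conv f rho) x = conv g rho x.
Proof.
move=> mD xD fi wfg.
have [_ ->] := conv_pderiv fi x nrho.
have := wfg _ (mollifier_test_function xD) => H.
have far y : ~ D y -> ~ ball x e y.
  by move=> nD xy; apply: nD; apply: xD; apply: le_ball xy; rewrite lerDl ltW.
have far' y : ~ D y -> rho (x - y) = 0 by move=> /far/mollifier_far.
have far2 y : ~ D y -> pderiv i rho (x - y) = 0.
  move=> nD; have := @pderiv_supportN _ _ (fun z => rho (x - z)) i y.
  rewrite pderiv_reflect// => /(_ _)/eqP; rewrite oppr_eq0 => /(_ _)/eqP; apply.
  move=> ys; apply: nD; apply: xD.
  by case: (mollifier_test_function (fun y (h : ball x (e + e) y) => h)) => _ _; apply.
rewrite /conv /Rintegral.
rewrite (integral_supp (B := D)); last by move=> y nD; rewrite far2 ?mulr0.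
rewrite [in RHS](integral_supp (B := D)); last by move=> y nD; rewrite far' ?mulr0.
congr fine; apply/eqP; rewrite -eqe_opp; apply/eqP; rewrite -H.
have ic := integrableS measurableT mD (@subsetT _ _) (conv_integrable fi x (nice_pderiv i nrho)).
have E : (\int[mu]_(y in D) (f y * pderiv i (fun z => rho (x - z)) y)%:E =
    \int[mu]_(y in D) ((-1)%:E * (EFin \o (fun y => (f y * pderiv i rho (x - y))%R)) y))%E.
  by apply: eq_integral => y _; rewrite pderiv_reflect// /= -EFinM mulN1r mulrN.
by rewrite E (integralZl mD ic (-1)) EFinN mulN1e.
Qed.

End mollified_derivatives.

Section W1p0.
Context {R : realType} {n : nat}.
Local Notation mu := (@lebesgue_rV R n).
Local Notation supp := Defs.support.

(** The approximating test functions are mollifications at scales tending to 0: the compact K keeps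
    their supports in D, and their derivatives are the mollifications of G. *)
Lemma W1p_0_compact_support (p : R) (D K : set 'rV[R]_n) (F : 'rV[R]_n -> R)
    (G : 'rV[R]_n -> 'rV[R]_n) : 1 <= p -> open D -> compact K -> K `<=` D ->
  mu.-integrable setT (EFin \o F) -> (\int[mu]_x (`|F x| `^ p)%:E < +oo)%E ->
  (forall x, ~ K x -> F x = 0) ->
  (forall i, mu.-integrable setT (EFin \o (fun x => G x 0 i))) ->
  (forall i, \int[mu]_x (`|G x 0 i| `^ p)%:E < +oo)%E ->
  (forall i x, ~ K x -> G x 0 i = 0) ->
  (forall i, weak_pderiv D i F (fun x => G x 0 i)) ->
  W1p_0 p D F G.
Proof.
move=> p1 oD cK KD iF Fp F0 iG Gp G0 wFG.
have p0 : 0 < p by exact: lt_le_trans p1.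
have mD := open_measurable_rV oD.
have inLp f : mu.-integrable setT (EFin \o f) -> (\int[mu]_x (`|f x| `^ p)%:E < +oo)%E ->
    in_Lp p D f.
  move=> fi fp; have mf : measurable_fun setT f by apply/measurable_EFinP; exact: measurable_int fi.
  apply/(in_LpP _ p0 mD); split; first exact: measurable_funTS.
  apply: le_lt_trans fp; apply: ge0_subset_integral => //.
  exact: measurable_norm_powR.
split.
  split; first exact: inLp iF Fp.
  by move=> i; split; [exact: inLp (iG i) (Gp i)|exact: wFG].
have [r r0 rD] := thicken_sub cK oD KD.
have [M M0 KM] := compact_ball0 cK.
have KM' x : ~ ball 0 M x -> ~ K x by move=> h /KM.
(* The quarter is needed for derivatives: at a point within 2e of K, the ball of radius 2e must lie
   in D, which holds once 4e <= r. *)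
pose e (k : nat) : R := r / 4 / k.+1%:R.
have e0 k : 0 < e k by rewrite !divr_gt0.
have er k : e k * 4 <= r.
  by rewrite /e mulrAC divfK// ler_pdivrMr// ler_peMr ?ler1n// ltW.
have /choice[rho hrho] : forall k, exists rho : 'rV[R]_n -> R, mollifying (e k) rho.
  by move=> k; have [rho h] := @mollifier R n _ (e0 k); exists rho.
have nrho k : nice (rho k) by case: (hrho k).
have s0 k : [set x | conv F (rho k) x != 0] `<=` thicken K (e k).
  move=> x /= nx; apply: contrapT => nK; move/negP: nx; apply; apply/eqP.
  apply: (conv_eq0 (hrho k)) => y xy; apply: F0 => Ky; apply: nK.
  by exists y => //; exact: ball_sym.
have s1 k := closure_thicken (e0 k) (s0 k).
have s1D k : closure [set x | conv F (rho k) x != 0] `<=` D.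
  apply: (subset_trans (s1 k)); apply: subset_trans rD; apply: thicken_le.
  by have := er k; have := e0 k; lra.
have pE k i x : pderiv i (conv F (rho k)) x = conv (fun x => G x 0 i) (rho k) x.
  have [[z [Kz xz]]|nK] := pselect (exists z, K z /\ ball x (e k + e k) z).
    apply: (conv_weak_pderiv (e0 k) (hrho k) mD) => //.
    move=> y xy; apply: rD; exists z => //.
    apply: (@le_ball _ _ _ ((e k + e k) + (e k + e k))); first by have := er k; have := e0 k; lra.
    exact: ball_triangle (ball_sym xz) xy.
  rewrite pderiv_supportN.
    rewrite (conv_eq0 (hrho k))// => y xy; apply: G0 => Ky; apply: nK; exists y; split => //.
    by apply: le_ball xy; rewrite lerDl ltW.
  by move=> /s1[z Kz zx]; apply: nK; exists z; split=> //; exact: ball_sym.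
exists (fun k => conv F (rho k)); split.
- move=> k; split; [exact: conv_smooth|apply: (@bounded_closure_compact _ _ _ (M + e k))|exact: s1D].
  move=> x /s0[y /KM yM yx]; exact: ball_triangle yx.
- apply/Lp_dist_cvg0P => // eta eta0.
  have [d d0 hd] := conv_Lp_approx p1 M0 iF (fun x h => F0 _ (KM' _ h)) Fp eta0.
  have [N _ hN] := near_infty_natSinv_lt (PosNum (divr_gt0 d0 r0)).
  exists N => // k /hN /= kd.
  apply: (le_lt_trans _ (hd (e k) (rho k) (e0 k) _ (hrho k))).
    apply: ge0_subset_integral => //; apply: measurable_norm_powR.
    apply: measurable_funB; first exact: (measurable_conv (hrho k) iF).
    by apply/measurable_EFinP; exact: measurable_int iF.
  rewrite /e -ler_pdivlMl ?divr_gt0// (le_trans (ltW kd))//.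
  by rewrite [leRHS]mulrC ler_pM2l// lef_pV2 ?posrE ?divr_gt0//; lra.
move=> i; apply/Lp_dist_cvg0P => // eta eta0.
have [d d0 hd] := conv_Lp_approx p1 M0 (iG i) (fun x h => G0 i _ (KM' _ h)) (Gp i) eta0.
have [N _ hN] := near_infty_natSinv_lt (PosNum (divr_gt0 d0 r0)).
exists N => // k /hN /= kd.
under eq_integral do rewrite pE.
apply: (le_lt_trans _ (hd (e k) (rho k) (e0 k) _ (hrho k))).
  apply: ge0_subset_integral => //; apply: measurable_norm_powR.
  apply: measurable_funB; first exact: (measurable_conv (hrho k) (iG i)).
  by apply/measurable_EFinP; exact: measurable_int (iG i).
rewrite /e -ler_pdivlMl ?divr_gt0// (le_trans (ltW kd))//.
by rewrite [leRHS]mulrC ler_pM2l// lef_pV2 ?posrE ?divr_gt0//; lra.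
Qed.

End W1p0.

(** * Chain rule for the square of the positive part *)

Section positive_part_square.
Context {R : realType}.
Implicit Types t s : R.

Lemma quadratic_is_derive (f : R -> R) t (a C : R) :
  (forall s, `|f s - f t - a * (s - t)| <= C * (s - t) ^+ 2) -> is_derive t 1 f a.
Proof.
move=> h.
have C0 : 0 <= C.
  have E : t + 1 - t = 1 by ring.
  by have := le_trans (normr_ge0 _) (h (t + 1)); rewrite E expr1n mulr1.
have H : (fun k : R => k^-1 *: ((f \o shift t) (k *: (1 : R)) - f t)) k @[k --> 0^'] --> a.
  apply/cvgrPdist_lt => e e0; near=> k.
  have k0 : k != 0 by near: k; exact: nbhs_dnbhs_neq.
  have := h (k + t); rewrite /shift /= -[k *: 1]/(k * 1) mulr1 -[_ *: _]/(k^-1 * _) addrK => hk.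
  have -> : a - k^-1 * (f (k + t) - f t) = - (k^-1 * (f (k + t) - f t - a * k)).
    by field.
  rewrite normrN normrM normfV ltr_pdivrMl ?normr_gt0//.
  rewrite (le_lt_trans hk)// -real_normK ?num_real// expr2 mulrCA ltr_pM2l ?normr_gt0//.
  rewrite (@le_lt_trans _ _ ((C + 1) * `|k|))// ?ler_wpM2r// ?lerDl//.
  rewrite -ltr_pdivlMl ?ltr_wpDl//.
  near: k; apply: dnbhs0_lt; rewrite mulr_gt0// invr_gt0 ltr_wpDl//.
by split; [apply/cvg_ex; exists a|exact/cvg_lim].
Unshelve. all: by end_near. Qed.

Lemma is_derive_max_sqr t : is_derive t 1 (fun s => Num.max s 0 ^+ 2) (2 * Num.max t 0).
Proof.
apply: (@quadratic_is_derive _ _ _ 1) => s; rewrite mul1r ler_norml.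
have := sqr_ge0 (s - t); have := sqr_ge0 s; have := sqr_ge0 t.
by case: (leP s 0) => s0; case: (leP t 0) => t0 ? ? ?; apply/andP; split; nra.
Qed.

Lemma max0_continuous : continuous (fun t : R => Num.max t 0).
Proof. by move=> t; apply: continuous_max => //; exact: cst_continuous. Qed.

Lemma ler_dist_max0 t s : `|Num.max t 0 - Num.max s 0| <= `|t - s|.
Proof.
rewrite ler_norml.
by case: (leP s 0) => s0; case: (leP t 0) => t0; have := ler_norm (t - s);
   have := ler_norm (- (t - s)); rewrite normrN => ? ?; apply/andP; split; lra.
Qed.

Lemma max0_norm t : `|Num.max t 0| <= `|t|.
Proof. by have := ler_dist_max0 t 0; rewrite maxxx !subr0. Qed.

Context {n : nat}.
Local Notation mu := (@lebesgue_rV R n).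
Local Notation supp := Defs.support.

Lemma is_derive_max_sqr_comp (w : 'rV[R]_n -> R) x i : differentiable w x ->
  is_derive x (delta_mx 0 i) (fun y => Num.max (w y) 0 ^+ 2) (2 * Num.max (w x) 0 * pderiv i w x).
Proof.
move=> dw; rewrite -[x in is_derive x]addr0 -[X in _ + X](scale0r (delta_mx 0 i)).
apply/is_derive_line.
have h1 := @is_derive_along _ _ w x (delta_mx 0 i) 0.
rewrite scale0r addr0 in h1; have {}h1 := h1 dw.
have h2 := is_derive_max_sqr (w (x + 0 *: delta_mx 0 i)).
have := is_derive1_comp h2 h1; rewrite /comp scale0r addr0.
by move=> h; apply: is_derive_eq h _; rewrite /GRing.scale/=.
Qed.

(** Because of the square, t -> max(t, 0)^2 is C^1 with a Lipschitz derivative. Mollify w, integrate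
    by parts classically, and let the scale tend to 0: w converges uniformly on the support of phi
    by continuity, g converges in L^1. *)
Lemma weak_pderiv_max_sqr (D : set 'rV[R]_n) (w g : 'rV[R]_n -> R) (M : R) i : open D -> 0 < M ->
  mu.-integrable setT (EFin \o w) -> mu.-integrable setT (EFin \o g) ->
  (forall x, ~ ball 0 M x -> g x = 0) -> (forall x, D x -> {for x, continuous w}) ->
  weak_pderiv D i w g ->
  weak_pderiv D i (fun x => Num.max (w x) 0 ^+ 2) (fun x => 2 * Num.max (w x) 0 * g x).
Proof.
move=> oD M0 iw ig g0 cw wg phi tphi; have [sphi cphi phiD] := tphi.
have mD := open_measurable_rV oD.
have [r r0 rD] := thicken_sub cphi oD phiD.
have [M1 M10 phiM] := compact_ball0 cphi.
have dphi x : differentiable phi x by exact: (sphi [::] x).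
have dpphi x : differentiable (pderiv i phi) x by exact: (sphi [:: i] x).
have cph : continuous phi by move=> x; exact: differentiable_continuous.
have cpph : continuous (pderiv i phi) by move=> x; exact: differentiable_continuous.
have [B1 B10 hB1] := compact_bounded_fun cphi (fun x _ => cph x).
have [B2 B20 hB2] := compact_bounded_fun cphi (fun x _ => cpph x).
have [C2 C20 hC2] := compact_bounded_fun cphi (fun x Kx => cw x (phiD x Kx)).
pose C1 := B1 + B2 + 1.
have C10 : 0 < C1 by rewrite ltr_wpDl// addr_ge0.
pose A x := Num.max (w x) 0 ^+ 2 * pderiv i phi x.
pose A' x := 2 * Num.max (w x) 0 * g x * phi x.
have cmw x : D x -> {for x, continuous (fun x => Num.max (w x) 0)}.
  by move=> Dx; exact: (@continuous_comp _ _ _ w (fun t => Num.max t 0) x (cw x Dx) (@max0_continuous (w x))).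
have cA : continuous A.
  apply: (glue_continuous phiD) => [x Dx|x _|x]; [|exact: cpph|exact: near_pderiv_supportN].
  by rewrite (_ : (fun _ => _) = (fun x => Num.max (w x) 0 * Num.max (w x) 0)) //;
     apply: continuousM; exact: cmw.
have A0 x : ~ supp phi x -> A x = 0 by move=> nx; rewrite /A pderiv_supportN ?mulr0.
have A'0 x : ~ supp phi x -> A' x = 0 by move=> nx; rewrite /A' (supportN nx) mulr0.
have nM x : ~ ball 0 M1 x -> ~ supp phi x by move=> h /phiM.
have iA : mu.-integrable setT (EFin \o A).
  by apply: (continuous_supp_integrable M10 cA) => x /nM; exact: A0.
have ceta : continuous (fun x => Num.max (w x) 0 * phi x).
  by apply: (glue_continuous phiD) => [x Dx|x _|x]; [exact: cmw|exact: cph|exact: near_supportN].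
have meta : measurable_fun setT (fun x => Num.max (w x) 0 * phi x).
  by apply: (continuous_measurable_rV openT) => x _; exact: ceta.
have phiB x : `|phi x| <= C1.
  have [Kx|nK] := pselect (supp phi x); last by rewrite (supportN nK) normr0 ltW.
  by rewrite (le_trans (hB1 x Kx))// /C1 -addrA lerDl addr_ge0.
have pphiB x : `|pderiv i phi x| <= C1.
  have [Kx|nK] := pselect (supp phi x); last by rewrite pderiv_supportN// normr0 ltW.
  by rewrite (le_trans (hB2 x Kx))// /C1 addrAC lerDr addr_ge0.
have mwB x : supp phi x -> `|Num.max (w x) 0| <= C2.
  by move=> Kx; rewrite (le_trans (max0_norm _))// hC2.
have iA' : mu.-integrable setT (EFin \o A').
  have := @bounded_mul_integrable _ _ g ig (fun x => 2 * (Num.max (w x) 0 * phi x)) (2 * (C2 * C1)).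
  rewrite (_ : (fun y => g y * _) = A'); last by apply/funext => x; rewrite /A'; ring.
  apply; first exact: measurable_funM.
  move=> y; rewrite normrM ger0_norm// ler_pM2l//.
  have [Ky|nK] := pselect (supp phi y).
    by rewrite normrM ler_pM// mwB.
  by rewrite (supportN nK) mulr0 normr0 mulr_ge0// ltW.
pose C := 2 * C1 * (C2 + 1).
have C0 : 0 < C by rewrite !mulr_gt0// ltr_wpDl.
pose B := ball (0 : 'rV[R]_n) M1.
have mB : measurable B by apply: open_measurable_rV; exact: ball_open.
have [V V0 BV] : exists2 V, 0 <= V & mu B = V%:E.
  exists ((2 * M1) ^+ n); first by rewrite exprn_ge0// mulr_ge0// ltW.
  exact: lebesgue_rV_ball.
have [G G0 gG] : exists2 G, 0 <= G & (\int[mu]_x `|g x|%:E)%E = G%:E.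
  have /integrableP[_] := ig; have : (0 <= \int[mu]_x `|g x|%:E)%E by apply: integral_ge0 => x _; rewrite lee_fin.
  by rewrite /comp; case: (integral _ _ _) => [G||]// G0 _; exists G.
(* A quantitative form of the limit: a mollification accurate to d leaves a defect of at most C (d V
   + d G + d), where V is the measure of a ball containing the support and G the L^1 norm of g. *)
have key d : 0 < d -> d <= 1 -> (`|\int[mu]_x (A x + A' x)%:E| <= (C * (d * V + d * G + d))%:E)%E.
  move=> d0 d1.
  have [r1 r10 hr1] := compact_uniform cphi (fun x Kx => cw x (phiD x Kx)) d0.
  have g1 : (\int[mu]_x (`|g x| `^ 1)%:E < +oo)%E.
    by under eq_integral do rewrite powRr1//; rewrite gG ltry.
  have [r2 r20 hr2] := conv_Lp_approx (lexx 1) M0 ig g0 g1 d0.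
  pose e := Num.min (r / 2) (Num.min r1 r2).
  have e0 : 0 < e by rewrite !lt_min r10 r20 divr_gt0.
  have er : e + e <= r by rewrite [leRHS](splitr r) lerD// ge_min lexx.
  have er1 : e <= r1 by rewrite !ge_min lexx !orbT.
  have er2 : e <= r2 by rewrite !ge_min lexx !orbT.
  have [rho hrho'] := @mollifier R n _ e0.
  have hrho : mollifying e rho := hrho'.
  have nrho : nice rho by case: hrho.
  set we := conv w rho; set ge := conv g rho.
  have swe := conv_smooth iw nrho.
  have weE x : supp phi x -> pderiv i we x = ge x.
    move=> Kx; apply: (conv_weak_pderiv e0 hrho mD) => //.
    by move=> y xy; apply: rD; exists x => //; exact: le_ball xy.
  have wed x : supp phi x -> `|we x - w x| <= d.
    move=> Kx; apply: (conv_near hrho iw) => y xy; apply: hr1 => //; exact: le_ball xy.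
  have dwe x : differentiable we x by exact: (swe [::] x).
  have dpwe x : differentiable (pderiv i we) x by exact: (swe [:: i] x).
  have cwe x : {for x, continuous (fun x => Num.max (we x) 0)}.
    exact: (@continuous_comp _ _ _ we (fun t => Num.max t 0) x (differentiable_continuous (dwe x)) (@max0_continuous (we x))).
  have c2 (x : 'rV[R]_n) : {for x, continuous (fun _ : 'rV[R]_n => 2 : R)} by exact: cst_continuous.
  have [j1 j2 j3] := integration_by_parts_rV (O := D) (i := i) tphi
    (fun x _ => is_derive_max_sqr_comp i (dwe x))
    (fun x _ => continuousM (cwe x) (cwe x))
    (fun x _ => continuousM (continuousM (c2 x) (cwe x)) (differentiable_continuous (dpwe x))).
  pose Ae x := Num.max (we x) 0 ^+ 2 * pderiv i phi x.
  pose Ae' x := 2 * Num.max (we x) 0 * pderiv i we x * phi x.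
  have jj : mu.-integrable setT (EFin \o (fun x => Ae x + Ae' x)).
    exact: (integrableD measurableT j1 j2).
  have jA : mu.-integrable setT (EFin \o (fun x => A x + A' x)).
    exact: (integrableD measurableT iA iA').
  have I0 : (\int[mu]_x (Ae x + Ae' x)%:E = 0)%E.
    have := integralD_EFin measurableT j1 j2; rewrite /comp /= j3 => E.
    apply: (eq_trans E); rewrite addeC subee//.
    exact: (integrable_fin_num measurableT j2).
  have -> : (\int[mu]_x (A x + A' x)%:E = \int[mu]_x ((A x + A' x) - (Ae x + Ae' x))%:E)%E.
    have := integralB_EFin measurableT jA jj; rewrite /comp /= I0 sube0 => E.
    by apply/esym; exact: E.
  have jB := integrableB measurableT jA jj.
  apply: (le_trans (le_abse_integral _ measurableT (measurable_int _ jB))) => /=.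
  have mge : measurable_fun setT ge by exact: (measurable_conv hrho ig).
  have mg : measurable_fun setT g by apply/measurable_EFinP; exact: measurable_int ig.
  have mB' : measurable_fun setT (fun x => (d * \1_B x)%:E).
    by apply/measurable_EFinP; apply: measurable_funM => //; exact: measurable_indic.
  have mg' : measurable_fun setT (fun x => (d * `|g x|)%:E).
    by apply/measurable_EFinP; apply: measurable_funM => //; exact: measurableT_comp.
  have mgg : measurable_fun setT (fun x => (`|ge x - g x|)%:E).
    by apply/measurable_EFinP; apply: measurableT_comp => //; exact: measurable_funB.
  have pB x : (0 <= (d * \1_B x)%:E)%E by rewrite lee_fin mulr_ge0 // ltW.
  have pg x : (0 <= (d * `|g x|)%:E)%E by rewrite lee_fin mulr_ge0 // ltW.
  apply: (@le_trans _ _ (\int[mu]_x (C%:E * ((d * \1_B x)%:E + ((d * `|g x|)%:E + (`|ge x - g x|)%:E))))%E).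
    apply: ge0_le_integral => //.
    - apply/measurable_EFinP; apply: measurableT_comp => //; apply/measurable_EFinP.
      exact: (measurable_int _ jB).
    - by apply: measurable_funeM; apply: emeasurable_funD => //; exact: emeasurable_funD.
    move=> x _; rewrite -!EFinD -EFinM lee_fin.
    have [Kx|nK] := pselect (supp phi x); last first.
      rewrite A0// A'0// /Ae /Ae' (pderiv_supportN i nK) (supportN nK) !mulr0 !addr0 subr0 normr0.
      apply: mulr_ge0; first exact: ltW.
      by rewrite !addr_ge0// mulr_ge0// ltW.
    rewrite indicE mem_set ?mulr1; last exact: phiM.
    rewrite /A /A' /Ae /Ae' weE//.
    have := wed x Kx; have := mwB x Kx; have := phiB x; have := pphiB x.
    have := ler_dist_max0 (we x) (w x).
    move: (Num.max (w x) 0) (Num.max (we x) 0) (phi x) (pderiv i phi x) (ge x) (g x) => a b f df G1 G2.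
    move=> h1 h2 h3 h4 h5; have {h1 h5} ab := le_trans h1 h5.
    have hb : `|b| <= C2 + 1.
      have -> : b = (b - a) + a by ring.
      by rewrite (le_trans (ler_normD _ _))// addrC lerD// (le_trans ab).
    (* Three sources of error, bounded separately below: the square itself, the factor max(w, 0),
       and the gradient. *)
    have -> : a ^+ 2 * df + 2 * a * G2 * f - (b ^+ 2 * df + 2 * b * G1 * f) =
      - ((b - a) * (b + a) * df + (2 * ((b - a) * G2 * f) + 2 * (b * (G1 - G2) * f))) by ring.
    have k1 : `|(b - a) * (b + a) * df| <= C * d.
      rewrite !normrM (_ : C * d = d * (2 * (C2 + 1)) * C1); last by rewrite /C; ring.
      apply: ler_pM; rewrite ?mulr_ge0//; apply: ler_pM => //.
      by rewrite (le_trans (ler_normD _ _))// mulr_natl mulr2n lerD// (le_trans h4)// lerDl.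
    have k2 : `|2 * ((b - a) * G2 * f)| <= C * (d * `|G2|).
      rewrite !normrM [`|2|]ger0_norm//.
      rewrite (_ : C * (d * `|G2|) = 2 * (d * `|G2| * ((C2 + 1) * C1))); last by rewrite /C; ring.
      rewrite ler_pM2l//; apply: ler_pM; rewrite ?mulr_ge0//; first by rewrite ler_wpM2r.
      by apply: (le_trans h3); rewrite ler_peMl ?(ltW C10)// lerDr.
    have k3 : `|2 * (b * (G1 - G2) * f)| <= C * `|G1 - G2|.
      rewrite !normrM [`|2|]ger0_norm//.
      rewrite (_ : C * `|G1 - G2| = 2 * ((C2 + 1) * `|G1 - G2| * C1)); last by rewrite /C; ring.
      by rewrite ler_pM2l//; apply: ler_pM; rewrite ?mulr_ge0// ler_wpM2r.
    rewrite normrN (le_trans (ler_normD _ _))// [leRHS]mulrDr lerD//.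
    by rewrite (le_trans (ler_normD _ _))// [leRHS]mulrDr lerD.
  rewrite ge0_integralZl//; first last.
  - by rewrite lee_fin ltW.
  - by move=> x _; rewrite !adde_ge0.
  - by apply: emeasurable_funD => //; exact: emeasurable_funD.
  rewrite [leRHS]EFinM lee_wpmul2l ?lee_fin ?(ltW C0)//.
  have mS : measurable_fun setT (fun x => (d * `|g x|)%:E + (`|ge x - g x|)%:E)%E.
    exact: emeasurable_funD.
  rewrite ge0_integralD//; last by move=> x _; rewrite adde_ge0.
  rewrite ge0_integralD//.
  have -> : d * V + d * G + d = d * V + (d * G + d) by rewrite addrA.
  rewrite [leRHS]EFinD; apply: leeD; last first.
    rewrite [leRHS]EFinD; apply: leeD; last first.
      apply: ltW; apply: le_lt_trans (hr2 e rho e0 er2 hrho).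
      by apply: ge0_le_integral => //; [exact: (measurable_norm_powR 1 (measurable_funB mge mg))
        |move=> x _; rewrite lee_fin powRr1].
    under eq_integral do rewrite EFinM.
    rewrite ge0_integralZl//; first last.
    - by rewrite lee_fin ltW.
    - by apply/measurable_EFinP; exact: measurableT_comp.
    by rewrite gG -EFinM.
  under eq_integral do rewrite EFinM.
  rewrite ge0_integralZl//; first last.
  - by rewrite lee_fin ltW.
  - by apply/measurable_EFinP; exact: measurable_indic.
  rewrite integral_indic// setIT.
  have E : (d%:E * mu B = (d * V)%:E)%E by rewrite BV EFinM.
  by rewrite le_eqVlt; apply/orP; left; apply/eqP; exact: E.
have T0 : (\int[mu]_x (A x + A' x)%:E = 0)%E.
  have jA : mu.-integrable setT (EFin \o (fun x => A x + A' x)).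
    exact: (integrableD measurableT iA iA').
  have := integrable_fin_num measurableT jA; rewrite /comp.
  case E : (integral _ _ _) => [T||]// _; congr EFin; apply/eqP.
  rewrite -normr_eq0 eq_le normr_ge0 andbT; apply/ler_addgt0Pr => eps eps0; rewrite add0r.
  pose L := C * (V + G + 1).
  have L0 : 0 < L by rewrite mulr_gt0// ltr_wpDl// addr_ge0.
  have := key (Num.min 1 (eps / L)); rewrite E /= lee_fin.
  have m0 : 0 < Num.min 1 (eps / L) by rewrite lt_min ltr01 divr_gt0.
  move=> /(_ m0); rewrite ge_min lexx => /(_ isT) /le_trans; apply.
  set d := Num.min _ _.
  rewrite (_ : C * _ = d * L); last by rewrite /L; ring.
  by rewrite -ler_pdivlMr// ge_min lexx orbT.
have -> : (\int[mu]_(x in D) (Num.max (w x) 0 ^+ 2 * pderiv i phi x)%:E = \int[mu]_x (A x)%:E)%E.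
  by rewrite [RHS](integral_supp (B := D))// => x nD; rewrite A0// => /phiD.
have -> : (\int[mu]_(x in D) (2 * Num.max (w x) 0 * g x * phi x)%:E = \int[mu]_x (A' x)%:E)%E.
  by rewrite [RHS](integral_supp (B := D))// => x nD; rewrite A'0// => /phiD.
have := integralD_EFin measurableT iA iA'; rewrite /comp T0.
have := integrable_fin_num measurableT iA; have := integrable_fin_num measurableT iA'; rewrite /comp.
move: (integral _ _ _) (integral _ _ _) => -[a||]// [b||]// _ _.
by rewrite -EFinD => -[] /esym/eqP; rewrite addr_eq0 => /eqP ->; rewrite ?EFinN ?oppeK.
Qed.

End positive_part_square.

(** * Comparison principle for the p-Laplacian *)

Section weak_forms.
Context {R : realType} {n : nat}.
Local Notation mu := (@lebesgue_rV R n).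
Local Notation supp := Defs.support.
Implicit Types (D O : set 'rV[R]_n) (c u phi : 'rV[R]_n -> R) (p : R).

Lemma compactly_inside_measure D O : compactly_inside D O ->
  measurable D /\ (mu D < +oo)%E.
Proof.
move=> [oD cD _]; have mD := open_measurable_rV oD; split => //.
have [M M0 DM] := compact_ball0 cD.
by apply: (lebesgue_rV_bounded M0 mD); apply: subset_trans DM; exact: subset_closure.
Qed.

Lemma compactly_inside_continuous D O c : compactly_inside D O ->
  (forall x, O x -> {for x, continuous c}) ->
  measurable_fun D c /\ exists2 C, 0 <= C & forall x, D x -> `|c x| <= C.
Proof.
move=> [oD cD DO] cc; have Dc x : D x -> closure D x by exact: subset_closure.
split; first by apply: (continuous_measurable_rV oD) => x /Dc/DO; exact: cc.
have [C C0 h] := compact_bounded_fun cD (fun x Dx => cc x (DO x Dx)).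
by exists C => // x /Dc; exact: h.
Qed.

Lemma mul_bounded_integrable D u c (C : R) : measurable D ->
  mu.-integrable D (EFin \o u) -> measurable_fun D c -> (forall x, D x -> `|c x| <= C) ->
  mu.-integrable D (EFin \o (fun x => u x * c x)).
Proof.
move=> mD iu mc cC; have mu_ : measurable_fun D u by apply/measurable_EFinP; exact: (measurable_int _ iu).
apply: (@le_integrable _ _ _ mu D mD _ (fun y => C%:E * (EFin \o u) y)%E).
- by apply/measurable_EFinP; exact: measurable_funM.
- move=> y Dy; rewrite /= lee_fin !normrM mulrC ler_wpM2r//.
  by rewrite (le_trans (cC y Dy))// ler_norm.
- exact: (integrableZl mD C iu).
Qed.

Lemma bounded_integrable D c (C : R) : measurable D -> (mu D < +oo)%E ->
  measurable_fun D c -> (forall x, D x -> `|c x| <= C) -> mu.-integrable D (EFin \o c).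
Proof.
move=> mD Df mc cC; apply: measurable_bounded_integrable => //.
by exists C; split; rewrite ?num_real// => M CM x Dx /=; rewrite (le_trans (cC x Dx))// ltW.
Qed.

Lemma bounded_in_Lp p D c (C : R) : 0 < p -> measurable D -> (mu D < +oo)%E ->
  measurable_fun D c -> (forall x, D x -> `|c x| <= C) -> in_Lp p D c.
Proof.
move=> p0 mD Df mc cC; apply/(in_LpP _ p0 mD); split => //.
have i1 : mu.-integrable D (EFin \o (fun x => `|c x| `^ p)).
  apply: (@bounded_integrable _ _ (C `^ p)) => //.
    by apply/measurable_EFinP; exact: measurable_norm_powR.
  move=> x Dx; rewrite ger0_norm ?powR_ge0//.
  have C0 := le_trans (normr_ge0 _) (cC x Dx).
  by apply: ge0_ler_powR (cC x Dx); rewrite ?nnegrE// ltW.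
have /integrableP[_] := i1; apply: le_lt_trans.
by apply: ge0_le_integral => //;
  [exact: measurable_norm_powR|apply/measurable_EFinP/measurableT_comp => //;
   apply/measurable_EFinP; exact: measurable_norm_powR
  |move=> x _; rewrite /= lee_fin ler_norm].
Qed.

Lemma integral_test D (f : 'rV[R]_n -> R) : (forall x, ~ D x -> f x = 0) ->
  (\int[mu]_(x in D) (f x)%:E = \int[mu]_x (f x)%:E)%E.
Proof. by move=> f0; rewrite [RHS](integral_supp (B := D))// => x /f0 ->. Qed.

Lemma C1_W1p_loc p O u (Du : 'rV[R]_n -> 'rV[R]_n) : 0 < p ->
  (forall x, O x -> {for x, continuous u}) ->
  (forall i x, O x -> is_derive x (delta_mx 0 i) u (Du x 0 i)) ->
  (forall i x, O x -> {for x, continuous (fun x => Du x 0 i)}) -> W1p_loc p O u Du.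
Proof.
move=> p0 cu du cdu D DO; have [mD Df] := compactly_inside_measure DO.
have inLp c : (forall x, O x -> {for x, continuous c}) -> in_Lp p D c.
  move=> cc; have [mc [C C0 hC]] := compactly_inside_continuous DO cc.
  exact: bounded_in_Lp hC.
split; first exact: inLp.
move=> i; split; first exact: inLp (cdu i).
move=> phi tphi.
have tO : test_function O phi.
  case: tphi DO => ? ? h [_ _ DO]; split=> //; apply: (subset_trans h).
  by apply: subset_trans DO; exact: subset_closure.
have [_ _] := integration_by_parts_rV tO (du i) cu (cdu i).
case: tphi => _ _ sD.
have E1 : forall x, ~ D x -> u x * pderiv i phi x = 0.
  by move=> x nD; rewrite pderiv_supportN ?mulr0// => /sD.
have E2 : forall x, ~ D x -> Du x 0 i * phi x = 0.
  by move=> x nD; rewrite (@supportN _ _ phi) ?mulr0// => /sD.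
by move=> E; exact: (etrans (integral_test E1) (etrans E (congr1 oppe (esym (integral_test E2))))).
Qed.

(** With bounded coefficients and finite measure, an identity valid for test functions passes to
    W^{1,p}_0: convergence in L^p implies convergence in L^1, and each side is continuous in L^1. *)
Lemma W1p_0_limit p D (A : 'I_n -> 'rV[R]_n -> R) c (C : R) : 1 <= p ->
  measurable D -> (mu D < +oo)%E ->
  (forall i, measurable_fun D (A i)) -> measurable_fun D c ->
  (forall i x, D x -> `|A i x| <= C) -> (forall x, D x -> `|c x| <= C) ->
  (forall psi, test_function D psi ->
     (\int[mu]_(x in D) (\sum_i A i x * pderiv i psi x + c x * psi x)%:E = 0)%E) ->
  forall phi Dphi, W1p_0 p D phi Dphi ->
  mu.-integrable D (EFin \o (fun x => \sum_i A i x * Dphi x 0 i)) /\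
  mu.-integrable D (EFin \o (fun x => c x * phi x)) /\
  (\int[mu]_(x in D) (\sum_i A i x * Dphi x 0 i + c x * phi x)%:E = 0)%E.
Proof.
move=> p1 mD Df mA mc AC cC H phi Dphi [[phiL DphiL] [psi [tpsi psiL DpsiL]]].
have p0 : 0 < p by exact: lt_le_trans p1.
have mLp u : in_Lp p D u -> measurable_fun D u by move=> /(in_LpP _ p0 mD)[].
have iLp u : in_Lp p D u -> mu.-integrable D (EFin \o u) by exact: Lp_integrable.
have iS (U : 'I_n -> 'rV[R]_n -> R) u : (forall i, mu.-integrable D (EFin \o U i)) ->
    mu.-integrable D (EFin \o u) ->
    mu.-integrable D (EFin \o (fun x => \sum_i A i x * U i x)) /\
    mu.-integrable D (EFin \o (fun x => c x * u x)).
  move=> iU iu; split.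
    rewrite (_ : _ \o _ = (fun x => \sum_i (A i x * U i x)%:E)%E); last first.
      by apply/funext => x; rewrite /= sumEFin.
    apply: integrable_sum => // i _.
    rewrite (_ : (fun x => _) = EFin \o (fun x => U i x * A i x)).
      exact: (mul_bounded_integrable mD (iU i) (mA i) (AC i)).
    by apply/funext => x /=; rewrite mulrC.
  rewrite (_ : (fun x => c x * _) = (fun x => u x * c x)).
    exact: (mul_bounded_integrable mD iu mc cC).
  by apply/funext => x /=; rewrite mulrC.
have iphi := iLp _ phiL.
have iDphi i := iLp _ (DphiL i).1.
have [i1 i2] := iS (fun i x => Dphi x 0 i) phi iDphi iphi.
do 2 split => //.
have tD k x : psi k x = psi k x by [].
have spsi k : smooth (psi k) by case: (tpsi k).
have cint u : (forall x, differentiable u x) -> mu.-integrable D (EFin \o u) -> True by [].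
have ipsi k : mu.-integrable D (EFin \o psi k) /\ forall i, mu.-integrable D (EFin \o pderiv i (psi k)).
  have [sp cp pD] := tpsi k; have [M M0 KM] := compact_ball0 cp.
  split=> [|i]; apply: (integrableS measurableT mD (@subsetT _ _)).
    apply: (continuous_supp_integrable M0) => [x|x nx].
      by apply: differentiable_continuous; exact: (sp [::] x).
    by apply: supportN => /KM.
  apply: (continuous_supp_integrable M0) => [x|x nx].
    by apply: differentiable_continuous; exact: (sp [:: i] x).
  by apply: pderiv_supportN => /KM.
have mI (u : 'rV[R]_n -> R) : mu.-integrable D (EFin \o u) -> measurable_fun D u.
  by move=> iu; apply/measurable_EFinP; exact: (measurable_int _ iu).
have iT : mu.-integrable D (EFin \o (fun x => \sum_i A i x * Dphi x 0 i + c x * phi x)).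
  exact: (integrableD mD i1 i2).
have := integrable_fin_num mD iT; rewrite /comp.
case E : (integral _ _ _) => [T||]// _; congr EFin; apply/eqP.
rewrite -normr_eq0 eq_le normr_ge0 andbT; apply/ler_addgt0Pr => eps eps0; rewrite add0r.
pose C1 := `|C| + 1.
have C10 : 0 < C1 by rewrite ltr_wpDl.
(* There are n + 1 error terms, n for the gradient and one for the function, each multiplied by at
   most C1. *)
pose d := eps / (C1 * n.+1%:R).
have d0 : 0 < d by rewrite divr_gt0// mulr_gt0.
have mphi := mI _ iphi.
have near1 := Lp_cvg_L1 p1 mD Df (fun k => mI _ (ipsi k).1) mphi psiL d0.
have near2 i := Lp_cvg_L1 p1 mD Df (fun k => mI _ ((ipsi k).2 i)) (mI _ (iDphi i)) (DpsiL i) d0.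
have near3 : \forall k \near \oo, forall i,
    (\int[mu]_(x in D) (`|pderiv i (psi k) x - Dphi x 0 i|)%:E < d%:E)%E.
  exact: filter_forall.
have [k [h1 h2]] := @filter_ex _ _ _ _ (filterI near1 near3).
have [ik1 ik2] := iS (fun i x => pderiv i (psi k) x) (psi k) (ipsi k).2 (ipsi k).1.
have iTk : mu.-integrable D (EFin \o (fun x => \sum_i A i x * pderiv i (psi k) x + c x * psi k x)).
  exact: (integrableD mD ik1 ik2).
have ED : (\int[mu]_(x in D) ((\sum_i A i x * Dphi x 0 i + c x * phi x)
    - (\sum_i A i x * pderiv i (psi k) x + c x * psi k x))%:E = T%:E)%E.
  by have := integralB_EFin mD iT iTk; rewrite /comp E (H _ (tpsi k)) sube0.
rewrite -lee_fin -[(`|T|)%:E]/(`|T%:E|)%E -ED.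
have iB := integrableB mD iT iTk.
apply: (le_trans (le_abse_integral _ mD (measurable_int _ iB))) => /=.
have mgi i : measurable_fun D (fun x => (`|pderiv i (psi k) x - Dphi x 0 i|)%:E).
  by apply/measurable_EFinP/measurableT_comp => //; apply: measurable_funB;
    [exact: (mI _ ((ipsi k).2 i))|exact: (mI _ (iDphi i))].
have mg0 : measurable_fun D (fun x => (`|psi k x - phi x|)%:E).
  by apply/measurable_EFinP/measurableT_comp => //; apply: measurable_funB => //; exact: (mI _ (ipsi k).1).
have mgs : measurable_fun D (fun x => \sum_i (`|pderiv i (psi k) x - Dphi x 0 i|)%:E)%E.
  exact: emeasurable_sum.
have mgt : measurable_fun D (fun x => \sum_i (`|pderiv i (psi k) x - Dphi x 0 i|)%:E + (`|psi k x - phi x|)%:E)%E.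
  exact: emeasurable_funD.
have gs0 x : (0 <= \sum_i (`|pderiv i (psi k) x - Dphi x 0 i|)%:E)%E.
  by apply: sume_ge0 => i _; rewrite lee_fin.
apply: (@le_trans _ _ (\int[mu]_(x in D) (C1%:E *
   (\sum_i (`|pderiv i (psi k) x - Dphi x 0 i|)%:E + (`|psi k x - phi x|)%:E)))%E).
  apply: ge0_le_integral => //.
  - apply/measurable_EFinP; apply: measurableT_comp => //; apply/measurable_EFinP.
    exact: (measurable_int _ iB).
  - exact: measurable_funeM.
  move=> x Dx; rewrite sumEFin -EFinD -EFinM lee_fin.
  have CC1 : C <= C1 by rewrite (le_trans (ler_norm _))// lerDl.
  have -> : \sum_i A i x * Dphi x 0 i + c x * phi x - (\sum_i A i x * pderiv i (psi k) x + c x * psi k x)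
     = - (\sum_i A i x * (pderiv i (psi k) x - Dphi x 0 i) + c x * (psi k x - phi x)).
    under [in RHS]eq_bigr do rewrite mulrBr.
    by rewrite sumrB mulrBr; ring.
  rewrite normrN (le_trans (ler_normD _ _))// [leRHS]mulrDr lerD//.
    rewrite (le_trans (ler_norm_sum _ _ _))// mulr_sumr ler_sum// => i _.
    by rewrite normrM ler_wpM2r// (le_trans (AC i x Dx)).
  by rewrite normrM ler_wpM2r// (le_trans (cC x Dx)).
rewrite ge0_integralZl//; first last.
- by rewrite lee_fin ltW.
- by move=> x _; rewrite adde_ge0// lee_fin.
rewrite ge0_integralD//.
rewrite ge0_integral_sum//.
apply: (@le_trans _ _ (C1%:E * ((\sum_(i < n) d%:E) + d%:E))%E).
  rewrite lee_wpmul2l ?lee_fin ?(ltW C10)// leeD//; last exact: ltW h1.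
  by apply: lee_sum => i _; exact: ltW (h2 i).
rewrite sumEFin -EFinD -EFinM lee_fin sumr_const card_ord -mulrSr -mulr_natr.
by rewrite mulrCA /d divfK// gt_eqF// mulr_gt0.
Qed.

(* Each component of [A] is differentiated in its own direction only: [A] itself need not be
   differentiable. *)
Lemma divergence_weak p O D (A : 'rV[R]_n -> 'rV[R]_n) (dA : 'I_n -> 'rV[R]_n -> R) (g : 'rV[R]_n -> R) :
  1 <= p -> compactly_inside D O ->
  (forall i x, O x -> {for x, continuous (fun x => A x 0 i)}) ->
  (forall i x, O x -> is_derive x (delta_mx 0 i) (fun x => A x 0 i) (dA i x)) ->
  (forall i x, O x -> {for x, continuous (dA i)}) ->
  (forall x, O x -> \sum_i dA i x = g x) ->
  forall phi Dphi, W1p_0 p D phi Dphi ->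
  (- (\int[mu]_(x in D) (dot (A x) (Dphi x))%:E) = \int[mu]_(x in D) (g x * phi x)%:E)%E.
Proof.
move=> p1 DO cA dAE cdA gE phi Dphi w0.
have [mD Df] := compactly_inside_measure DO.
have DsO x : D x -> O x by move=> Dx; case: DO => _ _; apply; exact: subset_closure.
pose c x := \sum_i dA i x.
have hA i := compactly_inside_continuous DO (cA i).
have hdA i := compactly_inside_continuous DO (cdA i).
have /choice[CA hCA] : forall i, exists C, forall x, D x -> `|A x 0 i| <= C.
  by move=> i; have [_ [C _ h]] := hA i; exists C.
have /choice[CD hCD] : forall i, exists C, forall x, D x -> `|dA i x| <= C.
  by move=> i; have [_ [C _ h]] := hdA i; exists C.
pose C := \sum_i `|CA i| + \sum_i `|CD i|.
have CA0 : 0 <= \sum_i `|CA i| by exact: sumr_ge0.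
have CD0 : 0 <= \sum_i `|CD i| by exact: sumr_ge0.
have mc : measurable_fun D c by apply: measurable_sum => i; case: (hdA i).
have AC i x : D x -> `|A x 0 i| <= C.
  move=> Dx; rewrite (le_trans (hCA i x Dx))// (le_trans (ler_norm _))// /C (bigD1 i)//=.
  by rewrite -!addrA lerDl addr_ge0// sumr_ge0.
have cC x : D x -> `|c x| <= C.
  move=> Dx; rewrite (le_trans (ler_norm_sum _ _ _))//.
  apply: (@le_trans _ _ (\sum_i `|CD i|)); last by rewrite lerDr.
  by apply: ler_sum => i _; rewrite (le_trans (hCD i x Dx))// ler_norm.
have [||i1 [i2]] := @W1p_0_limit p D (fun i x => A x 0 i) c C p1 mD Df _ mc AC cC _ phi Dphi w0.
- by move=> i; case: (hA i).
- move=> psi [s1 s2 s3].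
  have tO : test_function O psi by split=> // x /s3/DsO.
  have H i := integration_by_parts_rV tO (dAE i) (cA i) (cdA i).
  rewrite integral_test; last first.
    move=> x nD; rewrite (supportN (phi := psi)) ?mulr0 ?addr0; last by move=> /s3.
    by rewrite big1// => i _; rewrite pderiv_supportN ?mulr0// => /s3.
  rewrite (eq_integral (fun x => \sum_i ((A x 0 i * pderiv i psi x)%:E + (dA i x * psi x)%:E))%E); last first.
    move=> x _; rewrite EFinD mulr_suml -!sumEFin -big_split/=.
      by apply: eq_bigr.
  rewrite integral_sum//; last by move=> i; have [h1 h2 _] := H i; exact: (integrableD measurableT h1 h2).
  apply: big1 => i _; have [h1 h2 h3] := H i; rewrite (integralD measurableT h1 h2) h3.
  by rewrite addeC subee//; exact: (integrable_fin_num measurableT h2).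
move=> E0.
have -> : (\int[mu]_(x in D) (dot (A x) (Dphi x))%:E = \int[mu]_(x in D) (\sum_i A x 0 i * Dphi x 0 i)%:E)%E by [].
have -> : (\int[mu]_(x in D) (g x * phi x)%:E = \int[mu]_(x in D) (c x * phi x)%:E)%E.
  by apply: eq_integral => x /set_mem/DsO Ox; rewrite -gE.
have := integralD_EFin mD i1 i2; rewrite /comp E0.
have := integrable_fin_num mD i1; have := integrable_fin_num mD i2; rewrite /comp.
move: (integral _ _ _) (integral _ _ _) => -[a||]// [b||]// _ _.
by rewrite -EFinD => -[] /esym/eqP; rewrite addr_eq0 => /eqP ->; rewrite ?EFinN ?oppeK.
Qed.

End weak_forms.

Lemma near_eq_continuous {R : realType} (T : topologicalType) (f g : T -> R) x :
  (\near x, f x = g x) -> {for x, continuous f} -> {for x, continuous g}.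
Proof.
move=> E cf B; rewrite /= -(nbhs_singleton E) => Bf.
have h : nbhs x (fun y => B (f y)) := cf B Bf.
by apply: filterS2 h E => y /= + <-.
Qed.

Section comparison.
Context {R : realType} {n : nat}.
Local Notation mu := (@lebesgue_rV R n).
Implicit Types (D O K : set 'rV[R]_n) (u g phi : 'rV[R]_n -> R) (p : R).
Implicit Types (Du Dphi : 'rV[R]_n -> 'rV[R]_n) (a b : 'rV[R]_n).

(** The right-hand side is an arbitrary function of x rather than f(u), so solutions and barriers
    fall under one notion and are compared through their right-hand sides. *)
Definition plaplace_weak p O u Du g : Prop :=
  W1p_loc p O u Du /\
  forall D, compactly_inside D O -> forall phi Dphi, W1p_0 p D phi Dphi ->
    (- (\int[mu]_(x in D) (enorm (Du x) `^ (p - 2) * dot (Du x) (Dphi x))%:E)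
     = \int[mu]_(x in D) (g x * phi x)%:E)%E.

Lemma dot_ge0 a : 0 <= dot a a.
Proof. by apply: sumr_ge0 => i _; rewrite -expr2 sqr_ge0. Qed.

Lemma enorm_ge0 a : 0 <= enorm a. Proof. exact: sqrtr_ge0. Qed.

Lemma sqr_enorm a : enorm a ^+ 2 = dot a a.
Proof. by rewrite /enorm sqr_sqrtr// dot_ge0. Qed.

Lemma dotC a b : dot a b = dot b a.
Proof. by apply: eq_bigr => i _; rewrite mulrC. Qed.

(** With s and t the powers of |a| and |b|, twice the sum equals (s + t)|a - b|^2 + (s - t)(|a|^2 -
    |b|^2). For p >= 2 the powers are ordered like the norms, so both terms are nonnegative. *)
Lemma plaplace_monotone p a b : 2 <= p ->
  0 <= \sum_i (enorm a `^ (p - 2) * a 0 i - enorm b `^ (p - 2) * b 0 i) * (a 0 i - b 0 i).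
Proof.
move=> p2; set s := enorm a `^ _; set t := enorm b `^ _.
have -> : \sum_i (s * a 0 i - t * b 0 i) * (a 0 i - b 0 i) =
    2^-1 * (s + t) * dot (a - b) (a - b) + 2^-1 * ((s - t) * (dot a a - dot b b)).
  rewrite /dot -sumrB !mulr_sumr -big_split/=; apply: eq_bigr => i _; rewrite !mxE.
  by field.
have s0 : 0 <= s by exact: powR_ge0.
have t0 : 0 <= t by exact: powR_ge0.
have p0 : 0 <= p - 2 by rewrite subr_ge0.
apply: addr_ge0; first by apply: mulr_ge0 (dot_ge0 _); rewrite mulr_ge0 ?addr_ge0.
apply: mulr_ge0; first by rewrite invr_ge0.
rewrite -!sqr_enorm subr_sqr.
have [ab|/ltW ba] := leP (enorm a) (enorm b).
  rewrite mulr_le0// ?subr_le0.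
    by apply: ge0_ler_powR ab; rewrite ?nnegrE ?enorm_ge0.
  by rewrite mulr_le0_ge0// ?subr_le0// addr_ge0 ?enorm_ge0.
rewrite mulr_ge0// ?subr_ge0.
  by apply: ge0_ler_powR ba; rewrite ?nnegrE ?enorm_ge0.
by rewrite mulr_ge0// ?subr_ge0// addr_ge0 ?enorm_ge0.
Qed.

Lemma in_LpB p D u g : 1 <= p -> in_Lp p D u -> in_Lp p D g ->
  in_Lp p D (fun x => u x - g x).
Proof.
move=> p1 hu hg; have p1' : (1 <= p%:E)%E by rewrite lee_fin.
have := (@Lfun_addr_closed _ _ _ mu _ p1').2 _ _ hu (@Lfun_oppr_closed _ _ _ mu p%:E _ hg).
rewrite (_ : u \_ D - g \_ D = (fun x => u x - g x) \_ D)//; apply/funext => x.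
rewrite /patch -[LHS]/((if x \in D then u x else 0) - (if x \in D then g x else 0)).
by case: ifPn => // _; rewrite subrr.
Qed.

Lemma W1p_measurable p D u Du : 0 < p -> measurable D -> W1p p D u Du ->
  measurable_fun D u /\ forall i, measurable_fun D (fun x => Du x 0 i).
Proof.
move=> p0 mD [/(in_LpP _ p0 mD)[mu_ _] h]; split=> // i.
by have [/(in_LpP _ p0 mD)[]] := h i.
Qed.

Lemma measurable_fun_dot D (v w : 'rV[R]_n -> 'rV[R]_n) :
  (forall i, measurable_fun D (fun x => v x 0 i)) -> (forall i, measurable_fun D (fun x => w x 0 i)) ->
  measurable_fun D (fun x => dot (v x) (w x)).
Proof. by move=> mv mw; apply: measurable_sum => i; exact: measurable_funM. Qed.

Lemma measurable_fun_enorm_powR D (v : 'rV[R]_n -> 'rV[R]_n) (q : R) :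
  (forall i, measurable_fun D (fun x => v x 0 i)) -> measurable_fun D (fun x => enorm (v x) `^ q).
Proof.
move=> mv; apply: (measurableT_comp (measurable_powR q)).
have E : (fun x => enorm (v x)) = (fun x => dot (v x) (v x) `^ 2^-1).
  by apply/funext => x; rewrite powR12_sqrt// dot_ge0.
rewrite E; apply: (measurableT_comp (measurable_powR _)); exact: measurable_fun_dot.
Qed.

(** Lets the weak identity supply the integrability of its own gradient term: the other side is
    visibly finite, so both the positive and the negative part of the integrand have finite
    integral. *)
Lemma fin_num_integrable D (h : 'rV[R]_n -> R) : measurable D -> measurable_fun D h ->
  (\int[mu]_(x in D) (h x)%:E)%E \is a fin_num -> mu.-integrable D (EFin \o h).
Proof.
move=> mD mh; rewrite integralE fin_numB => /andP[f1 f2].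
apply/integrableP; split; first exact/measurable_EFinP.
under eq_integral do rewrite -/((abse \o (EFin \o h)) _) fune_abse.
have mE : measurable_fun D (EFin \o h) by exact/measurable_EFinP.
rewrite ge0_integralD//; last 2 first.
- exact: measurable_funepos.
- exact: measurable_funeneg.
by rewrite lte_add_pinfty// -ge0_fin_numE//; apply: integral_ge0.
Qed.

(** Both equations are tested with F, the square of the positive part of u1 - u2, which vanishes off
    K. Monotonicity gives the gradient terms a sign, so the integral of F (g1 - g2) is at most 0.
    Yet this integrand is nonnegative, and by continuity it is bounded below near a point where u1 >
    u2: a contradiction. *)
Lemma plaplace_comparison p O K u1 u2 Du1 Du2 g1 g2 : 2 <= p -> open O -> compact K -> K `<=` O ->
  (forall x, O x -> {for x, continuous u1}) -> (forall x, O x -> {for x, continuous u2}) ->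
  (forall x, O x -> {for x, continuous g1}) -> (forall x, O x -> {for x, continuous g2}) ->
  plaplace_weak p O u1 Du1 g1 -> plaplace_weak p O u2 Du2 g2 ->
  (forall x, O x -> ~ K x -> u1 x <= u2 x) ->
  (forall x, O x -> u2 x < u1 x -> g2 x < g1 x) ->
  forall x, O x -> u1 x <= u2 x.
Proof.
move=> p2 oO cK KO cu1 cu2 cg1 cg2 [W1 E1] [W2 E2] offK gg x0 Ox0.
have p1 : 1 <= p by rewrite (le_trans _ p2)// ler1n.
have p0 : 0 < p by exact: lt_le_trans p1.
rewrite leNgt; apply/negP => u12.
have Kx0 : K x0 by apply: contrapT => /(offK _ Ox0); rewrite leNgt u12.
have [r r0 hr] := thicken_compactly_inside cK oO KO.
pose D := thicken K r.
have DO : compactly_inside D O by exact: hr.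
have KD : K `<=` D by exact: sub_thicken.
have oD : open D by exact: thicken_open.
have [mD Df] := compactly_inside_measure DO.
have DsO x : D x -> O x by move=> Dx; case: DO => _ _; apply; exact: subset_closure.
have [M M0 DM] : exists2 M, 0 < M & D `<=` ball 0 M.
  have [M M0 h] := compact_ball0 (let: And3 _ c _ := DO in c).
  by exists M => //; apply: subset_trans h; exact: subset_closure.
have nM x : ~ ball 0 M x -> ~ D x by move=> h /DM.
have w1 := W1 _ DO; have w2 := W2 _ DO.
have [mu1 mDu1] := W1p_measurable p0 mD w1.
have [mu2 mDu2] := W1p_measurable p0 mD w2.
have cuu x : O x -> {for x, continuous (fun x => u1 x - u2 x)}.
  by move=> Ox; exact: (continuousB (cu1 x Ox) (cu2 x Ox)).
have [muu [C C0 hC]] := compactly_inside_continuous DO cuu.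
pose w := (fun x => u1 x - u2 x) \_ D.
have wE x : D x -> w x = u1 x - u2 x by move=> Dx; rewrite /w patchE mem_set.
have w0 x : ~ D x -> w x = 0 by move=> nD; rewrite /w patchE memNset.
have wK x : ~ K x -> Num.max (w x) 0 = 0.
  move=> nK; have [Dx|nD] := pselect (D x); last by rewrite w0// maxxx.
  by rewrite wE// max_r// subr_le0 offK//; exact: DsO.
have wC x : `|w x| <= C.
  by have [Dx|nD] := pselect (D x); [rewrite wE// hC|rewrite w0// normr0].
have mw : measurable_fun setT w by exact/(measurable_restrictT _ mD).
have iw : mu.-integrable setT (EFin \o w).
  by apply: (bounded_supp_integrable M0 mw wC) => x /nM; exact: w0.
pose g i := (fun x => Du1 x 0 i - Du2 x 0 i) \_ D.
have gE i x : D x -> g i x = Du1 x 0 i - Du2 x 0 i by move=> Dx; rewrite /g patchE mem_set.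
have gn i x : ~ D x -> g i x = 0 by move=> nD; rewrite /g patchE memNset.
have gLp i : in_Lp p D (fun x => Du1 x 0 i - Du2 x 0 i).
  by apply: in_LpB => //; [exact: (w1.2 i).1|exact: (w2.2 i).1].
have mg i : measurable_fun setT (g i).
  by apply/(measurable_restrictT _ mD); exact: (measurable_funB (mDu1 i) (mDu2 i)).
have igD i : mu.-integrable D (EFin \o (fun x => Du1 x 0 i - Du2 x 0 i)) by exact: Lp_integrable (gLp i).
have ig i : mu.-integrable setT (EFin \o g i).
  have := igD i; rewrite (integrable_mkcond _ mD).
  by rewrite restrict_EFin.
have gp i : (\int[mu]_x (`|g i x| `^ p)%:E < +oo)%E.
  have [_] := (in_LpP _ p0 mD).1 (gLp i).
  rewrite -(integral_test (D := D) (f := fun x => `|g i x| `^ p)); last first.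
    by move=> x nD; rewrite gn// normr0 powR0// gt_eqF.
  have -> : (\int[mu]_(x in D) (`|g i x| `^ p)%:E =
      \int[mu]_(x in D) (`|Du1 x 0 i - Du2 x 0 i| `^ p)%:E)%E.
    by apply: eq_integral => x /set_mem Dx; rewrite gE.
  exact.
pose F x := Num.max (w x) 0 ^+ 2.
pose G x : 'rV[R]_n := \row_i (2 * Num.max (w x) 0 * g i x).
have GE x i : G x 0 i = 2 * Num.max (w x) 0 * g i x by rewrite mxE.
have mmw : measurable_fun setT (fun x => Num.max (w x) 0) by exact: measurable_funrpos.
have mwC x : `|Num.max (w x) 0| <= C by rewrite (le_trans (max0_norm _)).
have mF : measurable_fun setT F by exact: measurable_funX.
have FC x : `|F x| <= C ^+ 2 by rewrite /F normrX lerXn2r ?nnegrE.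
have F0 x : ~ K x -> F x = 0 by move=> nK; rewrite /F wK// expr0n.
have nKM x : ~ ball 0 M x -> ~ K x by move=> h /KD/DM.
have iF : mu.-integrable setT (EFin \o F).
  by apply: (bounded_supp_integrable M0 mF FC) => x /nKM/F0.
have Fp : (\int[mu]_x (`|F x| `^ p)%:E < +oo)%E.
  have iFp : mu.-integrable setT (EFin \o (fun x => `|F x| `^ p)).
    apply: (@bounded_supp_integrable _ _ _ ((C ^+ 2) `^ p) M M0).
    - by apply/measurable_EFinP; exact: measurable_norm_powR.
    - move=> x; rewrite ger0_norm ?powR_ge0//.
      by apply: ge0_ler_powR (FC x); rewrite ?nnegrE ?(ltW p0)// exprn_ge0.
    - by move=> x /nKM/F0 ->; rewrite normr0 powR0// gt_eqF.
  have /integrableP[_] := iFp; rewrite (eq_integral (fun x => (`|F x| `^ p)%:E))//.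
  by move=> x _; rewrite /= ger0_norm// powR_ge0.
have iG i : mu.-integrable setT (EFin \o (fun x => G x 0 i)).
  have := @bounded_mul_integrable _ _ (g i) (ig i) (fun x => 2 * Num.max (w x) 0) (2 * C).
  rewrite (_ : (fun y => g i y * _) = (fun x => G x 0 i)); last first.
    by apply/funext => x; rewrite GE mulrC.
  apply; first exact: measurable_funM.
  by move=> y; rewrite normrM ger0_norm// ler_pM2l.
have mG i : measurable_fun setT (fun x => G x 0 i).
  by apply/measurable_EFinP; exact: (measurable_int _ (iG i)).
have Gp i : (\int[mu]_x (`|G x 0 i| `^ p)%:E < +oo)%E.
  have mgp := measurable_norm_powR p (mg i).
  apply: (@le_lt_trans _ _ (\int[mu]_x (((2 * C) `^ p)%:E * (`|g i x| `^ p)%:E))%E).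
    apply: ge0_le_integral => //.
    - exact: measurable_norm_powR.
    - exact: measurable_funeM.
    move=> x _; rewrite -EFinM lee_fin -powRM ?mulr_ge0//.
    apply: ge0_ler_powR; rewrite ?nnegrE ?(ltW p0) ?mulr_ge0//.
    by rewrite GE normrM ler_wpM2r// normrM ger0_norm// ler_pM2l.
  rewrite ge0_integralZl//; last by rewrite lee_fin powR_ge0.
  by apply: lte_mul_pinfty (gp i) => //; rewrite lee_fin powR_ge0.
have G0 i x : ~ K x -> G x 0 i = 0 by move=> nK; rewrite GE wK// mulr0 mul0r.
have weakw i : weak_pderiv D i w (g i).
  move=> phi tphi; have [sp cp pD] := tphi.
  have [_ /(_ i)[_ /(_ phi tphi) e1]] := w1.
  have [_ /(_ i)[_ /(_ phi tphi) e2]] := w2.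
  have cphi x : {for x, continuous phi} by apply: differentiable_continuous; exact: (sp [::] x).
  have cpphi x : {for x, continuous (pderiv i phi)}.
    by apply: differentiable_continuous; exact: (sp [:: i] x).
  have [mphi [C1 _ hC1]] := compactly_inside_continuous DO (fun x _ => cphi x).
  have [mpphi [C2 _ hC2]] := compactly_inside_continuous DO (fun x _ => cpphi x).
  have iu1 := Lp_integrable p1 mD Df w1.1.
  have iu2 := Lp_integrable p1 mD Df w2.1.
  have iD1 := Lp_integrable p1 mD Df (w1.2 i).1.
  have iD2 := Lp_integrable p1 mD Df (w2.2 i).1.
  have j1 := mul_bounded_integrable mD iu1 mpphi hC2.
  have j2 := mul_bounded_integrable mD iu2 mpphi hC2.
  have j3 := mul_bounded_integrable mD iD1 mphi hC1.
  have j4 := mul_bounded_integrable mD iD2 mphi hC1.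
  rewrite (eq_integral (fun x => ((EFin \o (fun x => u1 x * pderiv i phi x)%R) x -
     (EFin \o (fun x => u2 x * pderiv i phi x)%R) x)%E)); last first.
    by move=> x /set_mem Dx; rewrite wE//= -EFinB -mulrBl.
  rewrite [in RHS](eq_integral (fun x => ((EFin \o (fun x => Du1 x 0 i * phi x)%R) x -
     (EFin \o (fun x => Du2 x 0 i * phi x)%R) x)%E)); last first.
    by move=> x /set_mem Dx; rewrite gE//= -EFinB -mulrBl.
  rewrite (integralB mD j1 j2) (integralB mD j3 j4) /comp e1 e2.
  have f3 := integrable_fin_num mD j3; have f4 := integrable_fin_num mD j4.
  move: f3 f4; rewrite /comp.
  by move: (integral _ _ _) (integral _ _ _) => -[a||]// [b||]// _ _; rewrite -!EFinN -!EFinD; congr EFin; ring.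
have cwD x : D x -> {for x, continuous w}.
  move=> Dx; have E : \near x, u1 x - u2 x = w x.
    by apply: filterS (oD _ Dx) => y Dy; rewrite wE.
  exact: near_eq_continuous E (cuu x (DsO x Dx)).
have weakF i : weak_pderiv D i F (fun x => G x 0 i).
  rewrite (_ : (fun x => G x 0 i) = (fun x => 2 * Num.max (w x) 0 * g i x)); last first.
    by apply/funext => x; rewrite GE.
  by apply: (weak_pderiv_max_sqr oD M0 iw (ig i)) => // x /nM; exact: gn.
have w0F := W1p_0_compact_support p1 oD cK KD iF Fp F0 iG Gp G0 weakF.
have e1 := E1 _ DO _ _ w0F; have e2 := E2 _ DO _ _ w0F.
have [mg1 [B1 B10 hB1]] := compactly_inside_continuous DO cg1.
have [mg2 [B2 B20 hB2]] := compactly_inside_continuous DO cg2.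
have iFD : mu.-integrable D (EFin \o F) := integrableS measurableT mD (@subsetT _ _) iF.
have ig1 := mul_bounded_integrable mD iFD mg1 hB1.
have ig2 := mul_bounded_integrable mD iFD mg2 hB2.
pose h1 x := enorm (Du1 x) `^ (p - 2) * dot (Du1 x) (G x).
pose h2 x := enorm (Du2 x) `^ (p - 2) * dot (Du2 x) (G x).
have mGD i : measurable_fun D (fun x => G x 0 i) by apply: measurable_funTS.
have mh1 : measurable_fun D h1.
  by apply: measurable_funM; [exact: measurable_fun_enorm_powR|exact: measurable_fun_dot].
have mh2 : measurable_fun D h2.
  by apply: measurable_funM; [exact: measurable_fun_enorm_powR|exact: measurable_fun_dot].
have E1' : (- (\int[mu]_(x in D) (h1 x)%:E) = \int[mu]_(x in D) (EFin \o (fun x => F x * g1 x)%R) x)%E.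
  by apply: (etrans e1); apply: eq_integral => x _ /=; rewrite mulrC.
have E2' : (- (\int[mu]_(x in D) (h2 x)%:E) = \int[mu]_(x in D) (EFin \o (fun x => F x * g2 x)%R) x)%E.
  by apply: (etrans e2); apply: eq_integral => x _ /=; rewrite mulrC.
have ih1 : mu.-integrable D (EFin \o h1).
  by apply: fin_num_integrable => //; rewrite -fin_numN E1' integrable_fin_num.
have ih2 : mu.-integrable D (EFin \o h2).
  by apply: fin_num_integrable => //; rewrite -fin_numN E2' integrable_fin_num.
have hpos : (0 <= \int[mu]_(x in D) (h1 x - h2 x)%:E)%E.
  apply: integral_ge0 => x Dx; rewrite lee_fin /h1 /h2 /dot !mulr_sumr -sumrB.
  rewrite (eq_bigr (fun i => 2 * Num.max (w x) 0 *
    ((enorm (Du1 x) `^ (p - 2) * Du1 x 0 i - enorm (Du2 x) `^ (p - 2) * Du2 x 0 i) * (Du1 x 0 i - Du2 x 0 i)))).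
    rewrite -mulr_sumr mulr_ge0 ?plaplace_monotone// mulr_ge0// le_max lexx orbT//.
  by move=> i _; rewrite GE gE//; ring.
have gneg : (\int[mu]_(x in D) (F x * g1 x - F x * g2 x)%:E <= 0)%E.
  have := integralB_EFin mD ih1 ih2; rewrite /comp => I1; rewrite I1 in hpos.
  have := integralB_EFin mD ig1 ig2; rewrite /comp => ->.
  have f1 := integrable_fin_num mD ih1; have f2 := integrable_fin_num mD ih2.
  move: E1' E2' hpos f1 f2; rewrite /comp => <- <-.
  by move: (integral _ _ _) (integral _ _ _) => -[a||]// [b||]//; rewrite -!EFinN -!EFinB !lee_fin => ? _ _; lra.
pose H := (fun x => F x * g1 x - F x * g2 x) \_ D.
have HE x : D x -> H x = F x * (g1 x - g2 x) by move=> Dx; rewrite /H patchE mem_set// mulrBr.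
have H0 x : 0 <= H x.
  have [Dx|nD] := pselect (D x); last by rewrite /H patchE memNset.
  rewrite HE//; have [u12x|u21] := ltP (u2 x) (u1 x).
    by rewrite mulr_ge0 ?sqr_ge0// subr_ge0 ltW// gg//; exact: DsO.
  by rewrite /F wE// max_r ?subr_le0// expr0n mul0r.
have Dx0 : D x0 := KD _ Kx0.
have cH : {for x0, continuous (fun x => Num.max (u1 x - u2 x) 0 ^+ 2 * (g1 x - g2 x))}.
  have cm : {for x0, continuous (fun x => Num.max (u1 x - u2 x) 0)}.
    exact: (@continuous_comp _ _ _ (fun x => u1 x - u2 x) (fun t => Num.max t 0) x0 (cuu x0 Ox0) (@max0_continuous _ _)).
  exact: (continuousM (continuousM cm cm) (continuousB (cg1 x0 Ox0) (cg2 x0 Ox0))).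
set c := Num.max (u1 x0 - u2 x0) 0 ^+ 2 * (g1 x0 - g2 x0).
have c0 : 0 < c.
  by rewrite mulr_gt0 ?subr_gt0 ?gg// exprn_gt0// lt_max subr_gt0 u12.
have nearU : \forall x \near x0, D x /\ c / 2 < F x * (g1 x - g2 x).
  have c2 : 0 < c / 2 by rewrite divr_gt0.
  have /cvgrPdist_lt/(_ _ c2) := cH.
  apply: filterS2 (oD _ Dx0) => x Dx; rewrite -/c => hx; split=> //.
  rewrite /F wE//; move: hx; rewrite ltr_norml => /andP[_]; set z := _ * _; lra.
have := @integral_rV_gt0 _ _ (interior (fun x => D x /\ c / 2 < F x * (g1 x - g2 x))) H (c / 2) x0.
move=> /(_ (@open_interior _ _) nearU).
have c2 : 0 < c / 2 by rewrite divr_gt0.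
have mH : measurable_fun setT H.
  apply/(measurable_restrictT _ mD); apply: measurable_funB.
    exact: (measurable_funM (measurable_funTS mF) mg1).
  exact: (measurable_funM (measurable_funTS mF) mg2).
move=> /(_ c2 mH H0).
have HU y : interior (fun x => D x /\ c / 2 < F x * (g1 x - g2 x)) y -> c / 2 <= H y.
  by move=> /nbhs_singleton[Dy hy]; rewrite HE// ltW.
move=> /(_ HU); rewrite ltNge => /negP; apply.
rewrite -(integral_test (D := D) (f := H)); last by move=> x nD; rewrite /H patchE memNset.
rewrite (eq_integral (fun x => (F x * g1 x - F x * g2 x)%:E))//.
by move=> x /set_mem Dx; rewrite HE// mulrBr.
Qed.

End comparison.

(** * Radial solutions *)

Section real_calculus.
Context {R : realType}.
Implicit Types (f g df : R -> R) (x a b c : R).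

Lemma is_deriveM_fun f g x a b : is_derive x 1 f a -> is_derive x 1 g b ->
  is_derive x 1 (fun t => f t * g t) (a * g x + f x * b).
Proof.
move=> fa gb; apply: is_derive_eq (is_deriveM fa gb) _.
by rewrite /GRing.scale/= addrC (mulrC (g x)).
Qed.

Lemma is_deriveD_fun f g x a b : is_derive x 1 f a -> is_derive x 1 g b ->
  is_derive x 1 (fun t => f t + g t) (a + b).
Proof. by move=> fa gb; exact: (is_deriveD fa gb). Qed.

Lemma is_deriveB_fun f g x a b : is_derive x 1 f a -> is_derive x 1 g b ->
  is_derive x 1 (fun t => f t - g t) (a - b).
Proof. by move=> fa gb; exact: (is_deriveB fa gb). Qed.

Lemma is_deriveZ_fun f x a c : is_derive x 1 f a -> is_derive x 1 (fun t => c * f t) (c * a).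
Proof. by move=> fa; exact: (is_deriveZ c fa). Qed.

Lemma is_derive_comp_fun f g x a b : is_derive (g x) 1 f a -> is_derive x 1 g b ->
  is_derive x 1 (fun t => f (g t)) (a * b).
Proof. by move=> fa gb; exact: (is_derive1_comp fa gb). Qed.

Lemma is_deriveX_fun n x : is_derive x 1 (fun t : R => t ^+ n) (n%:R * x ^+ n.-1).
Proof.
elim: n => [|n IH].
  by rewrite mul0r; exact: (is_derive_cst (1 : R) x 1).
have -> : (fun t : R => t ^+ n.+1) = (fun t => t * t ^+ n) by apply: funext => t; rewrite exprS.
apply: is_derive_eq (is_deriveM_fun (is_derive_id x (1 : R)) IH) _.
case: n {IH} => [|n] /=; first by rewrite mul0r mulr0 addr0.
by rewrite mulrCA -exprS -mulrDl nat1r.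
Qed.

Lemma is_deriveV_fun f x a : f x != 0 -> is_derive x 1 f a ->
  is_derive x 1 (fun t => (f t)^-1) (- a / f x ^+ 2).
Proof.
move=> fx fa; apply: is_derive_eq (is_deriveV fx fa) _.
by rewrite /GRing.scale/= mulNr mulNr mulrC.
Qed.

Lemma is_derive_powR_fun f x a q : 0 < f x -> is_derive x 1 f a ->
  is_derive x 1 (fun t => f t `^ q) (q * f x `^ (q - 1) * a).
Proof. by move=> fx fa; exact: (is_derive_comp_fun (is_derive1_powR q fx) fa). Qed.

Lemma is_derive_cont f x a : is_derive x 1 f a -> {for x, continuous f}.
Proof. by case=> h _; apply: differentiable_continuous; apply/derivable1_diffP. Qed.

Lemma continuous_within_itv f a b :
  (forall x, a <= x <= b -> {for x, continuous f}) -> {within `[a, b], continuous f}.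
Proof.
move=> cf; apply: continuous_in_subspaceT => x; rewrite inE/= in_itv/= => h; exact: cf.
Qed.

Lemma derive_ge0_le f df a b : a <= b -> (forall x, a <= x <= b -> {for x, continuous f}) ->
  (forall x, a < x < b -> is_derive x 1 f (df x)) -> (forall x, a < x < b -> 0 <= df x) ->
  f a <= f b.
Proof.
rewrite le_eqVlt => /orP[/eqP ->//|ab] cf fdf df0.
have [x xab E] : exists2 c, c \in `]a, b[ & f b - f a = df c * (b - a).
  apply: MVT => //; exact: continuous_within_itv.
by rewrite -subr_ge0 E mulr_ge0 ?subr_ge0 ?(ltW ab)//; apply: df0; move: xab; rewrite in_itv.
Qed.

Lemma derive_ge0_gt f df a b : a < b -> (forall x, a <= x <= b -> {for x, continuous f}) ->
  (forall x, a < x < b -> is_derive x 1 f (df x)) -> (forall x, a < x < b -> 0 < df x) ->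
  f a < f b.
Proof.
move=> ab cf fdf df0.
have [x xab E] : exists2 c, c \in `]a, b[ & f b - f a = df c * (b - a).
  apply: MVT => //; exact: continuous_within_itv.
by rewrite -subr_gt0 E mulr_gt0 ?subr_gt0//; apply: df0; move: xab; rewrite in_itv.
Qed.

Lemma derive_dist_le f df a b c : a <= b -> (forall x, a <= x <= b -> {for x, continuous f}) ->
  (forall x, a < x < b -> is_derive x 1 f (df x)) -> (forall x, a < x < b -> `|df x| <= c) ->
  `|f b - f a| <= c * (b - a).
Proof.
rewrite le_eqVlt => /orP[/eqP ->|ab] cf fdf dfc; first by rewrite !subrr normr0 mulr0.
have [x xab ->] : exists2 c, c \in `]a, b[ & f b - f a = df c * (b - a).
  apply: MVT => //; exact: continuous_within_itv.
rewrite normrM (ger0_norm (_ : 0 <= b - a)) ?subr_ge0 ?(ltW ab)//.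
by rewrite ler_wpM2r ?subr_ge0 ?(ltW ab)//; apply: dfc; move: xab; rewrite in_itv.
Qed.

(** Integration starts at -1 so that the primitive has a two-sided derivative at 0, the centre of
    the radial variable. *)
Lemma antiderivative g : continuous g ->
  exists F : R -> R, F 0 = 0 /\ forall x, -1 < x -> is_derive x 1 F (g x).
Proof.
move=> cg; pose F x := (\int[@lebesgue_measure R]_(t in `[(-1)%R, x]) g t)%R.
exists (fun x => F x - F 0); split; first by rewrite subrr.
move=> x x1; have xx : x < x + 1 by rewrite ltrDl.
have ig : (@lebesgue_measure R).-integrable `[-1, (x + 1)] (EFin \o g).
  apply: (@continuous_compact_integrable R g); first exact: segment_compact.
  exact: (continuous_subspaceT cg).
have [dF EF] := @continuous_FTC1_closed R g (-1) x (x + 1) xx ig x1 (cg x).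
have h : is_derive x 1 F (g x).
  by rewrite derive1E in EF; exact: (DeriveDef dF EF).
by have := is_deriveB_fun h (is_derive_cst (F 0) x 1); rewrite subr0.
Qed.

(** For 0 < s <= 1 and q <= 1 one has s <= s^q; apply this to the two ratios a/(a+b) and b/(a+b),
    whose sum is 1. *)
Lemma powR_subadditive (q a b : R) : 0 <= q -> q <= 1 -> 0 <= a -> 0 <= b ->
  (a + b) `^ q <= a `^ q + b `^ q.
Proof.
move=> q0 q1 a0 b0; have [->|an] := eqVneq a 0.
  by rewrite add0r lerDr powR_ge0.
have S0 : 0 < a + b by rewrite ltr_wpDr// lt0r an.
have key c : 0 <= c -> c <= a + b -> (a + b) `^ q * (c / (a + b)) <= c `^ q.
  move=> c0 cS; have [->|cn] := eqVneq c 0; first by rewrite mul0r mulr0 powR_ge0.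
  have s0 : 0 < c / (a + b) by rewrite divr_gt0// lt0r cn.
  have -> : c `^ q = (a + b) `^ q * (c / (a + b)) `^ q.
    by rewrite -powRM ?(ltW s0) ?(ltW S0)// mulrCA divff ?mulr1// gt_eqF.
  rewrite ler_wpM2l ?powR_ge0// -[X in X <= _]powRr1 ?(ltW s0)//.
  by apply: ger_powR q1; rewrite s0 ler_pdivrMr// mul1r.
have -> : (a + b) `^ q = (a + b) `^ q * (a / (a + b)) + (a + b) `^ q * (b / (a + b)).
  by rewrite -mulrDr -mulrDl divff ?mulr1// gt_eqF.
by rewrite lerD// key// ?lerDl ?lerDr.
Qed.

(** With q = 1/(p-1) this replaces a Lipschitz estimate when a slope is recovered from a flux. *)
Lemma powR_holder (q a b : R) : 0 < q -> q <= 1 -> 0 <= a -> 0 <= b ->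
  `|a `^ q - b `^ q| <= `|a - b| `^ q.
Proof.
move=> q0 q1; wlog ab : a b / b <= a.
  move=> H a0 b0; have [ab|/ltW ba] := leP b a; first exact: H.
  by rewrite distrC (distrC a) H.
move=> a0 b0; rewrite !ger0_norm ?subr_ge0//; last first.
  by apply: ge0_ler_powR; rewrite ?nnegrE ?(ltW q0).
rewrite lerBlDr addrC (le_trans _ (powR_subadditive (ltW q0) q1 b0 _)) ?subr_ge0//.
by rewrite addrC subrK.
Qed.

Lemma powR_lt_inv_base (q a b : R) : 0 < q -> 0 <= a -> 0 <= b -> a `^ q < b `^ q -> a < b.
Proof.
move=> q0 a0 b0; rewrite !ltNge; apply: contra => ba.
by apply: ge0_ler_powR; rewrite ?nnegrE ?(ltW q0).
Qed.

Lemma first_nonpos f a b : a <= b -> (forall x, a <= x <= b -> {for x, continuous f}) ->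
  0 < f a -> f b <= 0 ->
  exists c, [/\ a < c, c <= b, f c <= 0 & forall x, a <= x -> x < c -> 0 < f x].
Proof.
move=> ab cf fa fb; pose S := [set x | a <= x <= b /\ f x <= 0].
have Sb : S b by split=> //; rewrite ab lexx.
have lbS : lbound S a by move=> x [/andP[]].
have hi : has_inf S by split; [exists b|exists a].
pose c := inf S.
have ac : a <= c by apply: lb_le_inf => //; exists b.
have cb : c <= b by apply: ge_inf => //; exists a.
have cc : {for c, continuous f} by apply: cf; rewrite ac cb.
have fc : f c <= 0.
  rewrite leNgt; apply/negP => fc0.
  have /cvgrPdist_lt/(_ _ fc0)/nbhs_ballP[e /= e0 he] := cc.
  have [x Sx xe] := inf_adherent e0 hi.
  have cx : c <= x by apply: ge_inf => //; exists a.
  have := he x; rewrite /ball/= distrC ger0_norm ?subr_ge0// ltrBlDl => /(_ xe).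
  case: Sx => _ fx; rewrite ltr_norml => /andP[_]; lra.
exists c; split => //.
  by rewrite lt_neqAle ac andbT; apply: contraTneq fc => <-; rewrite -ltNge.
move=> x ax xc; rewrite ltNge; apply/negP => fx.
have : c <= x by apply: ge_inf; [exists a|split=> //; rewrite ax (le_trans (ltW xc))].
by rewrite leNgt xc.
Qed.

End real_calculus.

(** * The radial equation in flux form *)

Section radial_ode.
Context {R : realType}.
Variables (d : nat) (d0 : (0 < d)%N).
Implicit Types (k G z : R -> R) (r s rho rad a M : R).

Let dR : 0 < d%:R :> R. Proof. by rewrite ltr0n. Qed.

(* [k r] is r^-d times the integral of t^(d-1) G t over [0, r]; hence r * k r is the
   radial flux of the divergence-form equation in dimension d with right-hand side G. *)
Definition averages rad k G : Prop :=
  (forall r, 0 <= r < rad -> {for r, continuous k}) /\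
  (forall r, 0 < r < rad -> is_derive r 1 k ((G r - d%:R * k r) / r)).

Lemma averages_sub rad rad' k G : rad' <= rad -> averages rad k G -> averages rad' k G.
Proof.
move=> rr [h1 h2]; split=> r /andP[r0 rr'].
  by apply: h1; rewrite r0 (lt_le_trans rr').
by apply: h2; rewrite r0 (lt_le_trans rr').
Qed.

Lemma averagesB rad k1 k2 G1 G2 : averages rad k1 G1 -> averages rad k2 G2 ->
  averages rad (fun r => k1 r - k2 r) (fun r => G1 r - G2 r).
Proof.
move=> [c1 e1] [c2 e2]; split=> r hr; first exact: (continuousB (c1 r hr) (c2 r hr)).
apply: is_derive_eq (is_deriveB_fun (e1 r hr) (e2 r hr)) _.
by rewrite -mulrBl; congr (_ / _); ring.
Qed.

Lemma averages_cst rad M : averages rad (fun=> M / d%:R) (fun=> M).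
Proof.
split=> r hr; first exact: cst_continuous.
apply: is_derive_eq (is_derive_cst (M / d%:R) r 1) _.
by rewrite mulrCA divff ?gt_eqF// mulr1 subrr mul0r.
Qed.

Lemma averages_scaled rad k G r : averages rad k G -> 0 < r < rad ->
  is_derive r 1 (fun t => t ^+ d * k t) (r ^+ d.-1 * G r).
Proof.
move=> [_ e] hr; have r0 : r != 0 by case/andP: hr => r0 _; rewrite gt_eqF.
apply: is_derive_eq (is_deriveM_fun (is_deriveX_fun d r) (e r hr)) _.
by case: d d0 => // d' _ /=; rewrite exprS; field.
Qed.

Lemma averages_ge0_at rad k G r : averages rad k G -> 0 < r < rad ->
  (forall s, 0 < s < r -> 0 <= G s) -> 0 <= k r.
Proof.
move=> h /andP[r0 rrad] G0.
have hx (x : R) : 0 <= x <= r -> 0 <= x < rad by move=> /andP[-> xr] /=; rewrite (le_lt_trans xr).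
have hx' (x : R) : 0 < x < r -> 0 < x < rad by move=> /andP[-> xr] /=; rewrite (lt_trans xr).
have : 0 ^+ d * k 0 <= r ^+ d * k r.
  apply: (@derive_ge0_le _ (fun t => t ^+ d * k t) (fun t => t ^+ d.-1 * G t)); first exact: ltW.
  - move=> x /hx hx1; apply: continuousM; last exact: (h.1 x hx1).
    exact: (is_derive_cont (is_deriveX_fun d x)).
  - by move=> x /hx' hx1; exact: averages_scaled h hx1.
  - by move=> x /andP[x0 xr]; rewrite mulr_ge0 ?exprn_ge0 ?(ltW x0)// G0// x0.
by rewrite expr0n gtn_eqF// mul0r pmulr_rge0// exprn_gt0.
Qed.

Lemma averages_ge0 rad rho k G : averages rad k G -> rho <= rad ->
  (forall s, 0 < s < rho -> 0 <= G s) -> forall r, 0 <= r < rho -> 0 <= k r.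
Proof.
move=> h rr G0.
have pos r : 0 < r < rho -> 0 <= k r.
  move=> /andP[r0 rrho]; apply: (averages_ge0_at h); first by rewrite r0 (lt_le_trans rrho).
  by move=> s /andP[s0 sr]; rewrite G0// s0 (lt_trans sr).
move=> r /andP[]; rewrite le_eqVlt => /orP[/eqP <-|r0] rrho; last by rewrite pos// r0.
rewrite leNgt; apply/negP => k0.
have /cvgrPdist_lt/(_ (- k 0)) : {for 0, continuous k} by apply: h.1; rewrite lexx (lt_le_trans rrho).
rewrite oppr_gt0 => /(_ k0)/nbhs_ballP[e /= e0 he].
pose s := Num.min (e / 2) (rho / 2).
have s0 : 0 < s by rewrite lt_min !divr_gt0.
have srho : s < rho by rewrite gt_min orbC (_ : rho / 2 < rho)//; lra.
have se : s < e by rewrite gt_min (_ : e / 2 < e)//; lra.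
have ks : 0 <= k s by rewrite pos// s0 srho.
have := he s; rewrite /ball/= sub0r normrN ger0_norm ?(ltW s0)// => /(_ se).
by rewrite ltr_norml => /andP[]; lra.
Qed.

Lemma averages_le rad rho k1 k2 G1 G2 : averages rad k1 G1 -> averages rad k2 G2 -> rho <= rad ->
  (forall s, 0 < s < rho -> G1 s <= G2 s) -> forall r, 0 <= r < rho -> k1 r <= k2 r.
Proof.
move=> h1 h2 rr G12 r hr; rewrite -subr_ge0.
by apply: (averages_ge0 (averagesB h2 h1) rr) => // s hs; rewrite subr_ge0 G12.
Qed.

Lemma averages_ub rad rho k G M : averages rad k G -> rho <= rad ->
  (forall s, 0 < s < rho -> G s <= M) -> forall r, 0 <= r < rho -> k r <= M / d%:R.
Proof. by move=> h rr GM r hr; exact: (averages_le h (averages_cst rad M) rr GM). Qed.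

Lemma averages_lb rad rho k G M : averages rad k G -> rho <= rad ->
  (forall s, 0 < s < rho -> M <= G s) -> forall r, 0 <= r < rho -> M / d%:R <= k r.
Proof. by move=> h rr GM r hr; exact: (averages_le (averages_cst rad M) h rr GM). Qed.

Lemma averages_ub_at rad k G M r : averages rad k G -> 0 < r < rad ->
  (forall s, 0 < s < r -> G s <= M) -> k r <= M / d%:R.
Proof.
move=> h hr GM; rewrite -subr_ge0.
by apply: (averages_ge0_at (averagesB (averages_cst rad M) h) hr) => s hs; rewrite subr_ge0 GM.
Qed.

Lemma averages_dist rad rho k1 k2 G1 G2 e : averages rad k1 G1 -> averages rad k2 G2 -> rho <= rad ->
  (forall s, 0 < s < rho -> `|G1 s - G2 s| <= e) ->
  forall r, 0 <= r < rho -> `|k1 r - k2 r| <= e / d%:R.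
Proof.
move=> h1 h2 rr G12 r hr; rewrite ler_norml -mulNr.
rewrite (averages_lb (averagesB h1 h2) rr _ hr) ?(averages_ub (averagesB h1 h2) rr _ hr)//.
  by move=> s /G12; rewrite ler_norml => /andP[].
by move=> s /G12; rewrite ler_norml => /andP[].
Qed.

(** The weighted integral of G divided by r^d, continued by its limit G(0)/d for r <= 0. Continuity
    at 0 comes from squeezing G between G(0) - d e and G(0) + d e near the centre. *)
Lemma averages_exists G : continuous G -> exists k : R -> R,
  [/\ continuous k, forall rad, averages rad k G & k 0 = G 0 / d%:R].
Proof.
move=> cG; have cg : continuous (fun t : R => t ^+ d.-1 * G t).
  by move=> t; apply: continuousM (cG t); exact: (is_derive_cont (is_deriveX_fun d.-1 t)).
have [Q [Q0 dQ]] := antiderivative cg.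
pose k r := if r <= 0 then G 0 / d%:R else Q r / r ^+ d.
have k0 : k 0 = G 0 / d%:R by rewrite /k lexx.
have dk r : 0 < r -> is_derive r 1 k ((G r - d%:R * k r) / r).
  move=> r0; have rn : r != 0 by rewrite gt_eqF.
  have near : \near r, Q r / r ^+ d = k r.
    near=> t; rewrite /k leNgt; have -> // : 0 < t by near: t; exact: lt_nbhsr.
  apply: (@near_eq_is_derive _ _ _ (fun r => Q r / r ^+ d) k r 1 _ near).
  have rd : r ^+ d != 0 by rewrite expf_neq0.
  have r1 : -1 < r by rewrite (lt_trans _ r0).
  have H := is_deriveM_fun (dQ r r1) (@is_deriveV_fun _ (fun t => t ^+ d) r _ rd (is_deriveX_fun d r)).
  apply: is_derive_eq H _.
  rewrite /k leNgt r0 /=; case: d d0 rd => // d' _ rd /=; rewrite exprS; rewrite exprS in rd.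
  by field; rewrite expf_neq0// rn.
have c0 : {for 0, continuous k}.
  apply/cvgrPdist_le => e e0; rewrite k0.
  have de : 0 < d%:R * e by rewrite mulr_gt0.
  have /cvgrPdist_lt/(_ _ de)/nbhs_ballP[h /= h0 hh] := cG 0.
  apply/nbhs_ballP; exists (Num.min h 1) => /=; first by rewrite lt_min h0 ltr01.
  move=> t; rewrite /ball/= sub0r normrN lt_min => /andP[th _].
  rewrite /k; case: (leP t 0) => t0; first by rewrite subrr normr0 ltW.
  rewrite gtr0_norm// in th.
  have td : 0 < t ^+ d by rewrite exprn_gt0.
  (* The boolean selects the upper or the lower estimate of [Q] by a multiple of t^d / d, so that
     both share one proof. *)
  have key (c : R) (b : bool) : (forall x : R, 0 < x < t -> if b then G x <= c else c <= G x) ->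
      if b then Q t <= c * (t ^+ d / d%:R) else c * (t ^+ d / d%:R) <= Q t.
    move=> hc; pose f (x : R) : R := c * (x ^+ d / d%:R) - Q x.
    have df (x : R) : -1 < x -> is_derive x 1 f (x ^+ d.-1 * (c - G x)).
      move=> x1; have H1 := is_deriveM_fun (is_deriveX_fun d x) (is_derive_cst (d%:R^-1 : R) x 1).
      have H := is_deriveB_fun (is_deriveZ_fun c H1) (dQ x x1); apply: is_derive_eq H _.
      by rewrite /cst mulr0 addr0 mulrBr mulrAC divff ?gt_eqF// mul1r (mulrC c).
    have cf (x : R) : 0 <= x <= t -> {for x, continuous f}.
      by move=> /andP[x0 _]; apply: is_derive_cont (df x _); rewrite (lt_le_trans _ x0).
    have f0 : f 0 = 0 by rewrite /f Q0 expr0n gtn_eqF// mul0r mulr0 subr0.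
    have x1 (x : R) : 0 < x < t -> -1 < x by move=> /andP[x0 _]; rewrite (lt_trans _ x0).
    case: b hc => hc.
      rewrite -subr_ge0 -[X in _ <= X]/(f t) -f0.
      apply: (derive_ge0_le (ltW t0) cf (fun x hx => df x (x1 x hx))) => x hx.
      by rewrite mulr_ge0 ?subr_ge0 ?hc// exprn_ge0//; case/andP: hx => /ltW.
    suff : - f 0 <= - f t by rewrite f0 oppr0 /f opprB subr_ge0.
    apply: (@derive_ge0_le _ (fun x => - f x) (fun x => - (x ^+ d.-1 * (c - G x))) 0 t (ltW t0)).
    - by move=> x hx; apply: continuousN; exact: cf.
    - by move=> x hx; exact: (is_deriveN (df x (x1 x hx))).
    - move=> x hx; rewrite oppr_ge0 mulr_ge0_le0 ?subr_le0 ?hc// exprn_ge0//.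
      by case/andP: hx => /ltW.
  have GB (x : R) : 0 < x < t -> G 0 - d%:R * e <= G x <= G 0 + d%:R * e.
    move=> /andP[x0 xt]; have := hh x; rewrite /ball/= sub0r normrN gtr0_norm//.
    move=> /(_ (lt_trans xt th)); rewrite ltr_norml => /andP[]; lra.
  have := key (G 0 + d%:R * e) true (fun x hx => proj2 (andP (GB x hx))).
  have := key (G 0 - d%:R * e) false (fun x hx => proj1 (andP (GB x hx))).
  move=> h1 h2; rewrite ler_norml; apply/andP; split.
    rewrite lerBrDl -[leLHS]/(_ / _ - _) lerBlDr ler_pdivrMr//.
    by apply: (le_trans h2); rewrite le_eqVlt; apply/orP; left; apply/eqP; field; rewrite gt_eqF.
  rewrite lerBlDr -lerBlDl ler_pdivlMr//.
  by apply: le_trans h1; rewrite le_eqVlt; apply/orP; left; apply/eqP; field; rewrite gt_eqF.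
have ck : continuous k.
  move=> r; have [r0|r0|->] := ltgtP r 0; last exact: c0.
    apply: (@near_cst_continuous _ _ _ (G 0 / d%:R)).
    near=> t; rewrite /k; have -> // : t <= 0 by apply: ltW; near: t; exact: lt_nbhsl.
  exact: is_derive_cont (dk r r0).
exists k; split=> // rad; split=> r; first by move=> _; exact: ck.
by move=> /andP[r0 _]; exact: dk.
Unshelve. all: by end_near. Qed.

Variables (p : R) (p2 : 2 <= p).
Local Notation q := (p - 1)^-1.

Let p1 : 0 < p - 1. Proof. by rewrite subr_gt0 (lt_le_trans _ p2)// ltr1n. Qed.

Lemma conj_exp_gt0 : 0 < q. Proof. by rewrite invr_gt0. Qed.

Lemma conj_exp_le1 : q <= 1.
Proof. by rewrite invf_le1// lerBrDr (le_trans _ p2)// -[1 + 1]/(2%:R). Qed.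

(** The flux |z'|^(p-2) z' is r k(r), whence the exponent 1/(p-1) and the monotonicity of z. Using k
    instead of the flux as unknown keeps the divergence identity meaningful at the centre, where
    k(0) = G(0)/d. *)
Definition radial_solution rad z k G : Prop :=
  [/\ averages rad k G, forall r, 0 <= r < rad -> is_derive r 1 z ((r * k r) `^ q),
      forall r, 0 <= r < rad -> 0 <= k r & k 0 = G 0 / d%:R].

Lemma radial_solution_sub rad rad' z k G : rad' <= rad ->
  radial_solution rad z k G -> radial_solution rad' z k G.
Proof.
move=> rr [h1 h2 h3 h4]; split=> //; first exact: averages_sub h1.
  by move=> r /andP[r0 rr']; apply: h2; rewrite r0 (lt_le_trans rr').
by move=> r /andP[r0 rr']; apply: h3; rewrite r0 (lt_le_trans rr').
Qed.

Lemma radial_solution_cont rad z k G r : radial_solution rad z k G -> 0 <= r < rad ->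
  {for r, continuous z}.
Proof. by case=> _ h _ _ /h/is_derive_cont. Qed.

(** With G a given function of r the equation is solved by two quadratures, first for k and then for
    z. *)
Lemma radial_solution_exists G a : continuous G -> (forall r, 0 <= G r) ->
  exists z k, z 0 = a /\ forall rad, radial_solution rad z k G.
Proof.
move=> cG G0; have [k [ck ak k0]] := averages_exists cG.
have kge0 r : 0 <= r -> 0 <= k r.
  move=> r0; apply: (averages_ge0 (ak (r + 1)) (lexx _)) => [s _|]; first exact: G0.
  by rewrite r0 ltrDl ltr01.
have cg : continuous (fun r : R => Num.max (r * k r) 0 `^ q).
  move=> r; have h : {for r, continuous (fun r => r * k r)} by apply: continuousM (ck r).
  move=> A /(continuous_powR_pos conj_exp_gt0) hA; exact: h hA.
have [F [F0 dF]] := antiderivative cg.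
exists (fun r => F r + a), k; split=> [|rad]; first by rewrite F0 add0r.
split=> // [r /andP[r0 _]|r /andP[/kge0//]].
have r1 : -1 < r by rewrite (lt_le_trans _ r0).
apply: is_derive_eq (is_deriveD_fun (dF r r1) (is_derive_cst a r 1)) _.
by rewrite addr0 max_l// mulr_ge0// kge0.
Qed.

Lemma radial_solution_slope rad rho z k G M r : radial_solution rad z k G -> rho <= rad ->
  (forall s, 0 < s < rho -> G s <= M) -> 0 <= r < rho ->
  0 <= (r * k r) `^ q <= (rho * (M / d%:R)) `^ q.
Proof.
move=> [h1 h2 h3 _] rr GM hr; have /andP[r0 rrho] := hr; rewrite powR_ge0 /=.
have hr' : 0 <= r < rad by rewrite r0 (lt_le_trans rrho).
have kM := averages_ub h1 rr GM hr.
apply: ge0_ler_powR; rewrite ?nnegrE ?(ltW conj_exp_gt0)//.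
- by rewrite mulr_ge0 ?h3.
- rewrite mulr_ge0 ?(le_trans r0 (ltW rrho))//.
  by rewrite (le_trans (h3 _ hr') kM).
- by apply: ler_pM => //; [exact: h3|exact: ltW].
Qed.

Lemma radial_solution_mono rad z k G r s : radial_solution rad z k G -> 0 <= r -> r <= s -> s < rad ->
  z r <= z s.
Proof.
move=> hs r0 rs srad; have [h1 h2 h3 _] := hs.
have hx x : r <= x <= s -> 0 <= x < rad.
  by move=> /andP[rx xs]; rewrite (le_trans r0 rx) (le_lt_trans xs).
apply: (derive_ge0_le rs (df := fun r => (r * k r) `^ q)).
- by move=> x /hx; exact: radial_solution_cont hs.
- by move=> x /andP[/ltW rx /ltW xs]; apply: h2; apply: hx; rewrite rx.
- by move=> x _; exact: powR_ge0.
Qed.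

Lemma radial_solution_lip rad rho z k G M r s : radial_solution rad z k G -> rho <= rad ->
  (forall t, 0 < t < rho -> G t <= M) -> 0 <= r < rho -> 0 <= s < rho ->
  `|z r - z s| <= (rho * (M / d%:R)) `^ q * `|r - s|.
Proof.
move=> hs rr GM; wlog sr : r s / s <= r.
  move=> H hr hs'; have [sr|/ltW rs] := leP s r; first exact: H.
  by rewrite distrC (distrC r) H.
move=> hr hs'; rewrite [X in _ * X]ger0_norm ?subr_ge0//.
have hx x : s <= x <= r -> 0 <= x < rho.
  move=> /andP[sx xr]; case/andP: hr => _ /(le_lt_trans xr) ->.
  by case/andP: hs' => /le_trans ->.
have hx' x : s <= x <= r -> 0 <= x < rad.
  by move=> /hx/andP[-> /lt_le_trans ->].
apply: (derive_dist_le sr (df := fun r => (r * k r) `^ q)).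
- by move=> x /hx'; exact: radial_solution_cont hs.
- by move=> x /andP[/ltW rx /ltW xs]; case: hs => _ h2 _ _; apply: h2; apply: hx'; rewrite rx.
- move=> x /andP[/ltW rx /ltW xs]; rewrite ger0_norm ?powR_ge0//.
  have hh : 0 <= x < rho by apply: hx; rewrite rx.
  by case/andP: (radial_solution_slope hs rr GM hh).
Qed.

Lemma radial_solution_stable rad rho z1 z2 k1 k2 G1 G2 e r :
  radial_solution rad z1 k1 G1 -> radial_solution rad z2 k2 G2 -> rho <= rad ->
  (forall s, 0 < s < rho -> `|G1 s - G2 s| <= e) -> 0 <= r < rho ->
  `|(z1 r - z2 r) - (z1 0 - z2 0)| <= (rho * (e / d%:R)) `^ q * rho.
Proof.
move=> hs1 hs2 rr G12 hr; have /andP[r0 rrho] := hr.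
have [a1 e1 k1p _] := hs1; have [a2 e2 k2p _] := hs2.
have hx x : 0 <= x <= r -> 0 <= x < rad.
  by move=> /andP[-> xr] /=; rewrite (lt_le_trans (le_lt_trans xr rrho)).
have rho0 : 0 <= rho by rewrite (le_trans r0 (ltW rrho)).
have kd := averages_dist a1 a2 rr G12.
have ed0 : 0 <= e / d%:R by rewrite (le_trans _ (kd r hr)).
apply: (@le_trans _ _ ((rho * (e / d%:R)) `^ q * (r - 0))); last first.
  by rewrite subr0 ler_wpM2l ?powR_ge0// ltW.
apply: (@derive_dist_le _ (fun r => z1 r - z2 r) (fun r => (r * k1 r) `^ q - (r * k2 r) `^ q)) => //.
- by move=> x /hx h; apply: continuousB; [exact: radial_solution_cont hs1 h|exact: radial_solution_cont hs2 h].
- move=> x /andP[/ltW x0 /ltW xr]; have h : 0 <= x < rad by apply: hx; rewrite x0 xr.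
  exact: (is_deriveB_fun (e1 x h) (e2 x h)).
- move=> x /andP[/ltW x0 /ltW xr]; have h : 0 <= x < rad by apply: hx; rewrite x0 xr.
  apply: (le_trans (powR_holder conj_exp_gt0 conj_exp_le1 _ _)); rewrite ?mulr_ge0 ?k1p ?k2p//.
  apply: ge0_ler_powR; rewrite ?nnegrE ?(ltW conj_exp_gt0)//; first by rewrite mulr_ge0.
  rewrite -mulrBr normrM ger0_norm// ler_pM//.
    by rewrite (le_trans xr)// ltW.
  by apply: kd; rewrite x0 (le_lt_trans xr).
Qed.

(* At an interior maximum of [z1 - z2] the fluxes agree, and afterwards that of [z1] stays
   ahead as long as [z1 > z2], so the difference could never return to a smaller value. *)
Lemma radial_comparison rad b z1 z2 k1 k2 G1 G2 :
  radial_solution rad z1 k1 G1 -> radial_solution rad z2 k2 G2 -> 0 <= b -> b < rad ->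
  z1 b <= z2 b -> (forall r, 0 < r < b -> z2 r < z1 r -> G2 r <= G1 r) ->
  forall r, 0 <= r <= b -> z1 r <= z2 r.
Proof.
move=> hs1 hs2 b0 brad zb GG r0 hr0.
have [a1 e1 k1p _] := hs1; have [a2 e2 k2p _] := hs2.
have hx x : 0 <= x <= b -> 0 <= x < rad.
  by move=> /andP[-> xr] /=; rewrite (le_lt_trans xr).
pose w x := z1 x - z2 x.
have cw x : 0 <= x <= b -> {for x, continuous w}.
  by move=> /hx h; apply: continuousB; [exact: radial_solution_cont hs1 h|exact: radial_solution_cont hs2 h].
have dw x : 0 <= x <= b -> is_derive x 1 w ((x * k1 x) `^ q - (x * k2 x) `^ q).
  by move=> /hx h; exact: (is_deriveB_fun (e1 x h) (e2 x h)).
have [c cb cmax] := EVT_max b0 (continuous_within_itv cw).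
rewrite in_itv/= in cb.
rewrite -subr_le0 -[X in X <= _]/(w r0) (le_trans (cmax r0 _)) ?in_itv//.
rewrite leNgt; apply/negP => wc0.
have wb : w b <= 0 by rewrite /w subr_le0.
have /andP[c0 cb'] := cb.
have cw' x : c <= x <= b -> {for x, continuous w}.
  by move=> /andP[cx xb]; apply: cw; rewrite (le_trans c0 cx).
have [t [ct tb wt wpos]] := first_nonpos cb' cw' wc0 wb.
have cltb : c < b by rewrite (lt_le_trans ct).
have flux_c : (c * k1 c) = (c * k2 c).
  have [->|cn] := eqVneq c 0; first by rewrite !mul0r.
  have cpos : 0 < c by rewrite lt0r cn.
  have : is_derive c 1 w 0.
    apply: (@derive1_at_max _ w 0 b c) => //.
    - by move=> x; rewrite in_itv/= => /andP[x0 xb]; case: (dw x) => //; rewrite (ltW x0) ltW.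
    - by rewrite in_itv/= cpos cltb.
    - by move=> x; rewrite in_itv/= => /andP[x0 xb]; apply: cmax; rewrite in_itv/= (ltW x0) ltW.
  case=> _ E0; have [_ E1] := dw c cb.
  have E : (c * k1 c) `^ q = (c * k2 c) `^ q by apply/eqP; rewrite -subr_eq0 -E1 E0.
  have := congr1 (fun t => t `^ (p - 1)) E.
  have pn : p - 1 != 0 by rewrite gt_eqF.
  by rewrite -!powRrM mulVf// !powRr1// mulr_ge0// ?k1p ?k2p ?hx.
have cx_rad x : c <= x <= t -> 0 <= x < rad.
  by move=> /andP[cx xt]; apply: hx; rewrite (le_trans c0 cx) (le_trans xt tb).
have flux x : c <= x <= t -> x * k2 x <= x * k1 x.
  move=> /andP[cx xt]; have x0 := le_trans c0 cx.
  have [->|xn] := eqVneq x 0; first by rewrite !mul0r.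
  have xpos : 0 < x by rewrite lt0r xn.
  rewrite ler_pM2l// -(ler_pM2l (exprn_gt0 d xpos)) -subr_ge0.
  have E0 : 0 = c ^+ d * k1 c - c ^+ d * k2 c.
    by case: d d0 => // d' _; rewrite !exprSr -!mulrA flux_c subrr.
  rewrite [leLHS]E0.
  have ab := averagesB a1 a2.
  have hh y : c <= y <= x -> 0 <= y < rad by move=> /andP[cy yx]; apply: cx_rad; rewrite cy (le_trans yx).
  rewrite -!mulrBr.
  apply: (@derive_ge0_le _ (fun y => y ^+ d * (k1 y - k2 y)) (fun y => y ^+ d.-1 * (G1 y - G2 y))) => //.
  - move=> y /hh hy; apply: continuousM; last exact: (ab.1 y hy).
    exact: (is_derive_cont (is_deriveX_fun d y)).
  - move=> y /andP[cy yx]; apply: averages_scaled ab _.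
    have /andP[_ yr] : 0 <= y < rad by apply: hh; rewrite !ltW.
    by rewrite (le_lt_trans c0 cy).
  - move=> y /andP[cy yx]; have y0 := le_lt_trans c0 cy.
    rewrite mulr_ge0 ?exprn_ge0 ?(ltW y0)// subr_ge0 GG//.
      by rewrite y0 (lt_le_trans yx)// (le_trans xt).
    by rewrite -subr_gt0 -[X in _ < X]/(w y) wpos ?(ltW cy)// (lt_le_trans yx).
have : w c <= w t.
  apply: (derive_ge0_le (ltW ct) (df := fun x => (x * k1 x) `^ q - (x * k2 x) `^ q)).
  - by move=> x /andP[cx xt]; apply: cw'; rewrite cx (le_trans xt).
  - by move=> x /andP[cx xt]; apply: dw; rewrite (le_trans c0 (ltW cx)) (le_trans (ltW xt)).
  - move=> x /andP[/ltW cx /ltW xt]; have hxx : c <= x <= t by rewrite cx xt.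
    have /andP[x0 _] := cx_rad x hxx.
    rewrite subr_ge0; apply: ge0_ler_powR (flux x hxx);
      by rewrite ?nnegrE ?(ltW conj_exp_gt0)// mulr_ge0// ?k1p ?k2p ?cx_rad.
by move=> h; have := lt_le_trans wc0 (le_trans h wt); rewrite ltxx.
Qed.

End radial_ode.

Lemma nonexpansive_continuous {R : realType} (f : R -> R) :
  (forall x y : R, `|f x - f y| <= `|x - y|) -> continuous f.
Proof.
move=> h x; apply/cvgrPdist_lt => e e0; apply/nbhs_ballP; exists e => //= y xy.
exact: le_lt_trans (h x y) xy.
Qed.

Lemma heine_segment {R : realType} (g : R -> R) (M e : R) : continuous g -> 0 < e ->
  exists2 dl : R, 0 < dl & forall x y : R, `|x| <= M -> `|x - y| <= dl -> `|g x - g y| <= e.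
Proof.
move=> cg e0; pose c (x : 'rV[R]_1) : R := g (x 0 0).
have cc x : {for x, continuous c}.
  by move=> A /cg hA; exact: (@coord_continuous _ _ _ 0 0 x _ hA).
have [r r0 hr] := compact_uniform (@cube_compact R 1 M) (fun x _ => cc x) e0.
exists (r / 2); first by rewrite divr_gt0.
move=> x y xM xy; have := hr (const_mx x) (const_mx y).
rewrite /c !mxE distrC; apply; first by move=> i; rewrite mxE.
by apply/ball_rV => // i; rewrite !mxE (le_lt_trans xy)//; lra.
Qed.

(** * Shooting for an equation with delay *)

Section truncated_problem.
Context {R : realType}.
Implicit Types (r s t e a b c : R).
Variables (d : nat) (d0 : (0 < d)%N) (p : R) (p2 : 2 <= p).
Local Notation q := (p - 1)^-1.
Local Notation radial_solution := (radial_solution d p).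

Let dR : 0 < d%:R :> R. Proof. by rewrite ltr0n. Qed.
Let q0 : 0 < q. Proof. exact: conj_exp_gt0. Qed.

Lemma powR_small (c e : R) : 0 <= c -> 0 < e -> exists2 t, 0 < t & (c * t) `^ q * c <= e.
Proof.
move=> c0 e0; exists ((e / (c + 1)) `^ (p - 1) / (c + 1)).
  by rewrite divr_gt0 ?powR_gt0 ?divr_gt0// ltr_wpDl.
have c1 : 0 < c + 1 by rewrite ltr_wpDl.
have p1 : p - 1 != 0 by rewrite -invr_eq0 gt_eqF.
have ec : 0 < e / (c + 1) by rewrite divr_gt0.
apply: (@le_trans _ _ (e / (c + 1) * c)); last first.
  by rewrite mulrAC ler_pdivrMr// ler_pM2l// lerDl.
rewrite ler_wpM2r//.
rewrite [leRHS](_ : _ = ((e / (c + 1)) `^ (p - 1)) `^ q); last by rewrite -powRrM mulfV// powRr1// ltW.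
apply: ge0_ler_powR; rewrite ?nnegrE ?(ltW q0) ?powR_ge0//.
  by rewrite mulr_ge0// mulr_ge0 ?powR_ge0// invr_ge0 ltW.
set Z := _ `^ (p - 1).
by rewrite mulrCA ler_piMr ?powR_ge0// ler_pdivrMr// mul1r lerDl.
Qed.

Lemma radial_solution_cst rad (a : R) : radial_solution rad (fun=> a) (fun=> 0) (fun=> 0).
Proof.
split=> //; last by rewrite mul0r.
  by have := averages_cst d0 rad 0; rewrite mul0r.
by move=> r _; rewrite mulr0 powR0 ?gt_eqF//; exact: (is_derive_cst a r 1).
Qed.

Variables (g : R -> R) (M rad h : R) (cg : continuous g) (g0 : forall t, 0 <= g t)
  (gM : forall t, g t <= M) (h0 : 0 < h) (rad0 : 0 < rad).
Variable ug : forall e, 0 < e -> exists2 dl : R, 0 < dl &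
  forall x y : R, `|x - y| <= dl -> `|g x - g y| <= e.

Let delay (r : R) := Num.max (r - h) 0.

(** Method of steps: at r the right-hand side involves only the value at r - h, so j quadratures
    solve the delayed equation on [0, j h). Each step is a continuous operation, so the solution
    depends continuously on the initial value a, uniformly on [0, rad). Mere continuity of g would
    not give this for the equation without delay. *)
Lemma delayed_iterate (j : nat) : exists v k G : R -> R -> R,
  [/\ forall a, v a 0 = a, forall a rad', radial_solution rad' (v a) (k a) (G a),
     forall a, continuous (G a) /\ forall r, 0 <= G a r <= M,
     forall a r, 0 <= r -> r < j%:R * h -> G a r = g (v a (delay r)) &
     forall e, 0 < e -> exists2 dl : R, 0 < dl & forall a a' : R, `|a - a'| <= dl ->
       forall r, 0 <= r < rad -> `|v a r - v a' r| <= e].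
Proof.
elim: j => [|j [v [k [G [v0 vs cG G_ cv]]]]].
  exists (fun a _ => a), (fun _ _ => 0), (fun _ _ => 0); split => //.
  - by move=> a rad'; exact: radial_solution_cst.
  - move=> a; split; first by move=> x; exact: cst_continuous.
    by move=> _; rewrite lexx (le_trans (g0 0) (gM 0)).
  - by move=> a r r0; rewrite mul0r ltNge r0.
  - by move=> e e0; exists e.
pose G' a r := g (v a (delay r)).
have cd : continuous delay.
  apply: nonexpansive_continuous => x y; apply: (le_trans (ler_dist_max0 _ _)).
  by rewrite opprB addrA subrK.
have del0 r : 0 <= delay r by rewrite le_max lexx orbT.
have cG' a : continuous (G' a).
  move=> r A /cg hA.
  have cva : {for delay r, continuous (v a)}.
    apply: (radial_solution_cont (vs a (delay r + 1))).
    by rewrite del0 ltrDl ltr01.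
  exact: (cd r _ (cva _ hA)).
have G'0 a r : 0 <= G' a r by exact: g0.
have /choice[F hF] : forall a, exists zk : (R -> R) * (R -> R), zk.1 0 = a /\
    forall rad', radial_solution rad' zk.1 zk.2 (G' a).
  by move=> a; have [z [kk [h1 h2]]] := radial_solution_exists d0 p2 a (cG' a) (G'0 a); exists (z, kk).
exists (fun a => (F a).1), (fun a => (F a).2), G'; split.
- by move=> a; case: (hF a).
- by move=> a rad'; case: (hF a).
- by move=> a; split=> // r; rewrite G'0 gM.
- move=> a r r0 rj; rewrite /G'; congr g.
  have [Fa0 Fs] := hF a.
  have [->|dn] := eqVneq (delay r) 0; first by rewrite v0 Fa0.
  have dpos : 0 < delay r by rewrite lt0r dn del0.
  have dj : delay r < j%:R * h.
    rewrite /delay gt_max; move: dpos; rewrite lt_max ltxx orbF => rh.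
    have -> : r - h < j%:R * h by move: rj; rewrite -natr1 mulrDl mul1r ltrBlDr.
    by rewrite (lt_trans rh)//; move: rj; rewrite -natr1 mulrDl mul1r ltrBlDr.
  (* The new iterate agrees with the old one on [0, j h): same right-hand side there and same
     initial value, so the stability estimate applies with error 0. *)
  have H := radial_solution_stable d0 p2 (e := 0) (vs a (j%:R * h)) (Fs (j%:R * h)) (lexx _).
  have /H : forall s, 0 < s < j%:R * h -> `|G a s - G' a s| <= 0.
    by move=> s /andP[s0 sj]; rewrite (G_ _ _ (ltW s0) sj) subrr normr0.
  have hd : 0 <= delay r < j%:R * h by rewrite del0 dj.
  move=> /(_ _ hd); rewrite mul0r mulr0 powR0 ?gt_eqF// mul0r v0 Fa0 subrr subr0.
  by rewrite normr_le0 subr_eq0 => /eqP.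
- move=> e e0.
  have e2 : 0 < e / 2 by rewrite divr_gt0.
  have [t t0 ht] := powR_small (ltW rad0) e2.
  have dt : 0 < d%:R * t by rewrite mulr_gt0.
  have [dl1 dl10 hg] := ug dt.
  have [dl2 dl20 hv] := cv _ dl10.
  exists (Num.min dl2 (e / 2)); first by rewrite lt_min dl20 e2.
  move=> a a'; rewrite le_min => /andP[aa1 aa2] r hr.
  have [Fa0 Fs] := hF a; have [Fa0' Fs'] := hF a'.
  have H := radial_solution_stable d0 p2 (e := d%:R * t) (Fs rad) (Fs' rad) (lexx _).
  have /H/(_ hr) : forall s, 0 < s < rad -> `|G' a s - G' a' s| <= d%:R * t.
    move=> s /andP[s0 srad]; apply: hg; apply: hv => //; rewrite del0 /delay gt_max rad0 andbT.
    by rewrite (lt_trans _ srad)// ltrBlDr ltrDl.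
  rewrite Fa0 Fa0' mulrAC divff ?gt_eqF// mul1r => H'.
  have -> : (F a).1 r - (F a').1 r = ((F a).1 r - (F a').1 r - (a - a')) + (a - a') by ring.
  by rewrite (le_trans (ler_normD _ _))// [leRHS](splitr e) lerD// (le_trans H').
Qed.

(** Shooting: the value at b depends continuously on the initial value a and lies in [a, a + L], L
    bounding the total rise. Hence some a in [c - L, c] reaches c at b. *)
Lemma delayed_solution (b c : R) : 0 < b < rad -> exists z k G : R -> R,
  [/\ forall rad', radial_solution rad' z k G, z b = c, continuous G,
      forall r, 0 <= G r <= M & forall r, 0 <= r < rad -> G r = g (z (delay r))].
Proof.
move=> /andP[b0 brad].
pose j := (Num.trunc (rad / h)).+1.
have jh : rad <= j.+1%:R * h.
  by rewrite -ler_pdivrMr// ltW// (lt_le_trans (truncnS_gt _))// ler_nat.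
have [v [k [G [v0 vs cG G_ cv]]]] := delayed_iterate j.+1.
have M0 : 0 <= M := le_trans (g0 0) (gM 0).
pose L := (rad * (M / d%:R)) `^ q * b.
have L0 : 0 <= L by rewrite mulr_ge0 ?powR_ge0// ltW.
have vb a : a <= v a b <= a + L.
  have m := radial_solution_mono (vs a rad) (lexx 0) (ltW b0) brad.
  rewrite v0 in m; rewrite m /=.
  have GM : forall t, 0 < t < rad -> G a t <= M by move=> t _; have [_ /(_ t)/andP[]] := cG a.
  have hb : 0 <= b < rad by rewrite (ltW b0).
  have h00 : 0 <= (0:R) < rad by rewrite lexx.
  have := radial_solution_lip d0 p2 (vs a rad) (lexx _) GM hb h00.
  rewrite v0 subr0 (ger0_norm (ltW b0)) -/L ger0_norm ?subr_ge0//.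
  by rewrite lerBlDl.
have cphi : continuous (fun a => v a b).
  move=> a; apply/cvgrPdist_le => e e0; have [dl dl0 hdl] := cv e e0.
  apply/nbhs_ballP; exists dl => //= a' aa'; apply: hdl; first exact: ltW.
  by rewrite (ltW b0).
have cL : c - L <= c by rewrite gerBl.
have hI : Num.min (v (c - L) b) (v c b) <= c <= Num.max (v (c - L) b) (v c b).
  have /andP[h1 h2] := vb c; have /andP[h3 h4] := vb (c - L).
  by rewrite ge_min le_max h1 orbT andbT; apply/orP; left; rewrite (le_trans h4)// subrK.
have [a _ vac] := @IVT R (fun a => v a b) (c - L) c c cL (continuous_subspaceT cphi) hI.
exists (v a), (k a), (G a); split => //; first by case: (cG a).
  by case: (cG a).
by move=> r /andP[r0 rr]; apply: G_ => //; exact: lt_le_trans jh.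
Qed.

End truncated_problem.

Section bounded_subsolutions.
Context {R : realType}.
Implicit Types (r s t e a b c rad : R).
Variables (d : nat) (d0 : (0 < d)%N) (p : R) (p2 : 2 <= p).
Local Notation radial_solution := (radial_solution d p).
Variables (fb : R -> R) (cf : continuous fb) (f_mono : forall s t, s <= t -> fb s <= fb t)
  (f_neg : forall t, t <= 0 -> fb t = 0).

Lemma fb_ge0 t : 0 <= fb t.
Proof.
have [t0|/ltW t0] := leP t 0; first by rewrite f_neg.
by rewrite -(f_neg (lexx 0)) f_mono.
Qed.

(** The number 1/(n+1) acts twice: as a surplus it makes z a strict subsolution of the equation for
    [fb], and as an upper error it forces limits to solve that equation exactly. The boundary value
    n + 1 tends to infinity. *)
Definition approximate_solution rad (n : nat) (z k G : R -> R) : Prop :=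
  [/\ forall rad', radial_solution rad' z k G, z rad = n.+1%:R, continuous G,
      forall r, 0 <= r <= rad ->
        fb (z r) + n.+1%:R^-1 <= G r <= fb (z r + n.+1%:R^-1) + n.+1%:R^-1 &
      forall r s, 0 <= r -> r <= s -> s <= rad -> G r <= G s].

Lemma approximate_solution_exists rad n : 0 < rad -> exists z k G, approximate_solution rad n z k G.
Proof.
move=> rad0; set e : R := n.+1%:R^-1.
have e0 : 0 < e by rewrite invr_gt0.
have e1 : e <= 1 by rewrite invf_le1// ler1n.
(* The cap makes g bounded and has no effect while z <= n + 1. The shift by e compensates the delay,
   since z(r - h) + e >= z(r) for h small. *)
pose g t := fb (Num.min (t + e) (n.+1%:R + e)) + e.
have cg : continuous g.
  have cm : continuous (fun t : R => Num.min (t + e) (n.+1%:R + e)).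
    apply: nonexpansive_continuous => x y; rewrite ler_norml.
    have := ler_norm (x - y); have := ler_norm (- (x - y)); rewrite normrN.
    move: (n.+1%:R : R) => N.
    by case: (leP (x + e) (N + e)) => h1; case: (leP (y + e) (N + e)) => h2 h3 h4; apply/andP; split; lra.
  move=> t; have h1 : {for t, continuous (fun t => fb (Num.min (t + e) (n.+1%:R + e)))}.
    by move=> A /cf hA; exact: (cm t _ hA).
  have h2 : {for t, continuous (fun _ : R => e)} by exact: cst_continuous.
  exact: (continuousD h1 h2).
have g0 t : 0 <= g t by rewrite addr_ge0 ?fb_ge0// ltW.
pose M := fb (n.+1%:R + e) + e.
have gM t : g t <= M by rewrite lerD2r f_mono// ge_min lexx orbT.
have g_mono s t : s <= t -> g s <= g t.
  by move=> st; rewrite lerD2r f_mono// le_min !ge_min lexx orbT andbT lerD2r st.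
(* As e <= 1 and [fb] vanishes on negative numbers, g is constant below -1, and it is constant above
   n + 1. It factors through the clamp onto a compact interval and is therefore uniformly
   continuous. *)
pose cl (t : R) := Num.min (Num.max t (-1)) n.+1%:R.
have gcl t : g (cl t) = g t.
  rewrite /g /cl; congr (_ + _); have [t1|t1] := leP (-1) t.
    have [tn|nt] := leP t n.+1%:R => //.
    by rewrite minxx min_r// lerD2r ltW.
  have n1 : (-1 : R) <= n.+1%:R by rewrite (le_trans _ (ler0n _ _))// lerN10.
  rewrite (min_l n1); rewrite !min_l ?lerD2r// ?(le_trans (ltW t1))//.
  by rewrite !f_neg//; lra.
have cl_lip s t : `|cl s - cl t| <= `|s - t|.
  rewrite /cl !ler_norml; have := ler_norm (s - t); have := ler_norm (- (s - t)); rewrite normrN.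
  have n1 : (-1 : R) < n.+1%:R by rewrite (lt_le_trans _ (ler0n _ _))// ltrN10.
  move: n1; move: (n.+1%:R : R) => N n1.
  case: (leP s (-1)) => s1; case: (leP t (-1)) => t1; rewrite ?(min_l (ltW n1)).
  - by move=> *; apply/andP; split; lra.
  - by case: (leP t N) => t2 h1 h2; apply/andP; split; lra.
  - by case: (leP s N) => s2 h1 h2; apply/andP; split; lra.
  - by case: (leP t N) => t2; case: (leP s N) => s2 h1 h2; apply/andP; split; lra.
have clM t : `|cl t| <= n.+1%:R + 1.
  have n0 : 0 <= n.+1%:R :> R by [].
  move: n0; rewrite /cl; move: (n.+1%:R : R) => N n0.
  rewrite ler_norml; case: (leP t (-1)) => t1.
    by case: (leP (-1) N) => t2; apply/andP; split; lra.
  by case: (leP t N) => t2; apply/andP; split; lra.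
have ug eps : 0 < eps -> exists2 dl : R, 0 < dl & forall x y : R, `|x - y| <= dl -> `|g x - g y| <= eps.
  move=> eps0; have [dl dl0 hdl] := heine_segment (n.+1%:R + 1) cg eps0.
  exists dl => // x y xy; rewrite -(gcl x) -(gcl y); apply: hdl; first exact: clM.
  exact: le_trans (cl_lip _ _) xy.
pose rad1 := rad + 1.
have r10 : 0 < rad1 by rewrite ltr_wpDr.
have M0 : 0 <= M := le_trans (g0 0) (gM 0).
pose Q := (rad1 * (M / d%:R)) `^ (p - 1)^-1.
have Q0 : 0 <= Q by exact: powR_ge0.
(* Q bounds the slope of the solution independently of the delay, so z moves by at most e over a
   length h. *)
pose h := e / (Q + 1).
have Q1 : 0 < Q + 1 by rewrite ltr_wpDl.
have h0 : 0 < h by rewrite divr_gt0.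
have hb : 0 < rad < rad1 by rewrite rad0 ltrDl ltr01.
have [z [k [G [zs zb cG G0M GE]]]] := delayed_solution d0 p2 cg g0 gM h0 r10 ug n.+1%:R hb.
have GM : forall t, 0 < t < rad1 -> G t <= M by move=> t _; have /andP[] := G0M t.
have radlt r : 0 <= r <= rad -> 0 <= r < rad1.
  by move=> /andP[-> h1] /=; rewrite (le_lt_trans h1)//; case/andP: hb.
have del0 r : 0 <= Num.max (r - h) 0 by rewrite le_max lexx orbT.
have delr r : 0 <= r -> Num.max (r - h) 0 <= r by move=> r0; rewrite ge_max r0 andbT gerBl ltW.
have zmono r s : 0 <= r -> r <= s -> s <= rad -> z r <= z s.
  move=> r0 rs srad; apply: (radial_solution_mono (zs rad1)) => //.
  by rewrite (le_lt_trans srad)//; case/andP: hb.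
have zmax r : 0 <= r <= rad -> z r <= n.+1%:R by move=> /andP[r0 rr]; rewrite -zb zmono.
have GE' r : 0 <= r <= rad -> G r = fb (z (Num.max (r - h) 0) + e) + e.
  move=> hr; rewrite GE ?radlt// /g min_l// lerD2r zmax// del0.
  by case/andP: hr => r0; apply: le_trans; exact: delr.
exists z, k, G; split=> //.
  move=> r hr; rewrite GE'//; have /andP[r0 rr] := hr.
  rewrite -/e; apply/andP; split; rewrite lerD2r f_mono//; last by rewrite lerD2r zmono// delr.
  have hd : 0 <= Num.max (r - h) 0 <= rad by rewrite del0 (le_trans (delr _ r0)).
  have := radial_solution_lip d0 p2 (zs rad1) (lexx _) GM (radlt _ hr) (radlt _ hd).
  rewrite -/Q [X in X <= _]ger0_norm ?subr_ge0 ?zmono ?delr// lerBlDl => /le_trans; apply.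
  rewrite lerD2l ger0_norm ?subr_ge0 ?delr//.
  apply: (@le_trans _ _ (Q * h)).
    by rewrite ler_wpM2l// lerBlDr -lerBlDl le_max lexx.
  by rewrite /h mulrCA ler_piMr ?(ltW e0)// ler_pdivrMr// mul1r lerDl.
move=> r s r0 rs srad; rewrite !GE' ?r0 ?(le_trans rs)// ?srad ?(le_trans r0 rs)//.
rewrite lerD2r f_mono// lerD2r zmono//; last by rewrite (le_trans (delr _ _))// (le_trans r0).
by rewrite ge_max !le_max lexx orbT andbT lerD2r rs.
Qed.

End bounded_subsolutions.

(** * The Keller-Osserman bound and large radial solutions *)

Lemma powR_split {R : realType} (b p : R) : 0 < b -> b `^ p = b `^ (p - 1) * b.
Proof.
by move=> b0; rewrite -[X in _ * X]powRr1 ?(ltW b0)// -powRD ?subrK// (gt_eqF b0) implybT.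
Qed.

Section keller_osserman_bound.
Context {R : realType}.
Implicit Types (r s t e a b c x y K B : R).
Variables (p : R) (p2 : 2 <= p) (f : R -> R) (hF : condition_F p f).

Let p0 : 0 < p. Proof. by rewrite (lt_le_trans _ p2). Qed.

(** Since f(0) = 0, this is the continuous nondecreasing extension of f to the whole line that
    vanishes on negative numbers. *)
Definition extend_by_zero t : R := f (Num.max t 0).
Local Notation fb := extend_by_zero.

Lemma fb_continuous : continuous fb.
Proof.
move=> t B hB; have t0 : `[0, +oo[%classic (Num.max t 0) by rewrite /= in_itv/= andbT le_max lexx orbT.
have /subspace_continuousP/(_ _ t0)/(_ B hB) := F_continuous hF.
rewrite /nbhs/= => h.
have H : nbhs t (fun s => `[0, +oo[%classic (Num.max s 0) -> B (f (Num.max s 0))) :=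
  @max0_continuous R t _ h.
by apply: filterS H => s /=; apply; rewrite in_itv/= andbT le_max lexx orbT.
Qed.

Lemma fb_mono s t : s <= t -> fb s <= fb t.
Proof.
move=> st; apply: (F_increasing hF); first by rewrite le_max lexx orbT.
by rewrite ge_max !le_max st lexx !orbT.
Qed.

Lemma fb_neg t : t <= 0 -> fb t = 0.
Proof. by move=> t0; rewrite /fb max_r// (F_zero hF). Qed.

Lemma fb_pos t : 0 < t -> 0 < fb t.
Proof. by move=> t0; rewrite /fb max_l ?(ltW t0)//; exact: (F_positive hF). Qed.

Lemma fbE t : 0 <= t -> fb t = f t.
Proof. by move=> t0; rewrite /fb max_l. Qed.

Lemma integral_derive_segment (g dg : R -> R) a b : a < b ->
  (forall t, a <= t <= b -> is_derive t 1 g (dg t)) -> continuous dg ->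
  (\int[@lebesgue_measure R]_(t in `[a, b]) (dg t)%:E = (g b - g a)%:E)%E.
Proof.
move=> ab gdg cdg.
have hc t : a <= t <= b -> {for t, continuous g} by move=> /gdg/is_derive_cont.
rewrite (@continuous_FTC2 _ dg g)//.
- exact: continuous_subspaceT.
- split.
  + by move=> x; rewrite in_itv/= => /andP[ax xb]; case: (gdg x) => //; rewrite !ltW.
  + by apply/cvg_at_right_filter/hc; rewrite lexx ltW.
  + by apply/cvg_at_left_filter/hc; rewrite lexx ltW.
- move=> x; rewrite in_itv/= => /andP[ax xb]; rewrite derive1E.
  by case: (gdg x) => //; rewrite !ltW.
Qed.

Variables (F : R -> R) (F0 : F 0 = 0) (dF : forall x, -1 < x -> is_derive x 1 F (fb x)).

Let gtN1 x : 0 <= x -> -1 < x. Proof. by move=> x0; rewrite (lt_le_trans _ x0). Qed.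

Lemma F_le x y : 0 <= x -> x <= y -> F x <= F y.
Proof.
move=> x0 xy; apply: (derive_ge0_le xy (df := fb)) => z /andP[xz zy].
- by apply: is_derive_cont (dF _); apply: gtN1; exact: le_trans xz.
- by apply: dF; apply: gtN1; rewrite (le_trans x0) ?ltW.
- by rewrite -(fb_neg (lexx 0)) fb_mono// (le_trans x0)// ltW.
Qed.

Lemma F_gt0 x : 0 < x -> 0 < F x.
Proof.
move=> x0; rewrite -F0; apply: (derive_ge0_gt x0 (df := fb)) => z /andP[z0 zx].
- by apply: is_derive_cont (dF _); exact: gtN1.
- by apply: dF; apply: gtN1; rewrite ltW.
- exact: fb_pos.
Qed.

Lemma F_growth b x : 0 <= b -> b <= x -> fb b * (x - b) <= F x - F b.
Proof.
move=> b0 bx; rewrite -subr_ge0.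
have -> : F x - F b - fb b * (x - b) = (F x - fb b * x) - (F b - fb b * b) by ring.
rewrite subr_ge0; apply: (derive_ge0_le bx (f := fun z => F z - fb b * z) (df := fun z => fb z - fb b)).
- move=> z /andP[bz zx]; have z1 := gtN1 (le_trans b0 bz).
  apply: is_derive_cont (is_deriveB_fun (dF z1) (is_deriveZ_fun (fb b) (is_derive_id z (1 : R)))).
- move=> z /andP[bz zx]; have z1 := gtN1 (le_trans b0 (ltW bz)).
  have := is_deriveB_fun (dF z1) (is_deriveZ_fun (fb b) (is_derive_id z (1 : R))).
  by rewrite mulr1.
- by move=> z /andP[bz zx]; rewrite subr_ge0 fb_mono// ltW.
Qed.

Lemma F_upper b : 0 <= b -> F b <= b * fb b.
Proof.
move=> b0; have : fb b * 0 - F 0 <= fb b * b - F b.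
  apply: (derive_ge0_le b0 (f := fun z => fb b * z - F z) (df := fun z => fb b - fb z)).
  - move=> z /andP[bz zx]; have z1 := gtN1 bz.
    exact: is_derive_cont (is_deriveB_fun (is_deriveZ_fun (fb b) (is_derive_id z (1 : R))) (dF z1)).
  - move=> z /andP[bz zx]; have z1 := gtN1 (ltW bz).
    have := is_deriveB_fun (is_deriveZ_fun (fb b) (is_derive_id z (1 : R))) (dF z1).
    by rewrite mulr1.
  - by move=> z /andP[bz zx]; rewrite subr_ge0 fb_mono// ltW.
by rewrite F0 mulr0 subr0 subr_ge0 mulrC.
Qed.

Lemma primitiveE x : 0 < x -> primitive f x = F x.
Proof.
move=> x0; rewrite /primitive /Rintegral.
have -> : (\int[@lebesgue_measure R]_(s in `[0%R, x]) (f s)%:E =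
           \int[@lebesgue_measure R]_(s in `[0%R, x]) (fb s)%:E)%E.
  apply: eq_integral => s; rewrite inE/= in_itv/= => /andP[s0 _].
  by rewrite fbE.
have H t : 0 <= t <= x -> is_derive t 1 F (fb t) by move=> /andP[t0 _]; apply: dF; exact: gtN1.
by rewrite (integral_derive_segment x0 H fb_continuous) F0 subr0.
Qed.

(** The Keller-Osserman condition says that a primitive of F^(-1/p) is bounded at infinity; being
    nondecreasing it then has small increments far out, which is the form used below. *)
Lemma keller_osserman_primitive : exists Th : R -> R,
  (forall x, 1 <= x -> is_derive x 1 Th (F x `^ p^-1)^-1) /\
  (forall e, 0 < e -> exists2 B, 1 <= B & forall x y, B <= x -> x <= y -> Th y - Th x <= e).
Proof.
(* The maximum keeps the argument away from 0, where F^(-1/p) is singular. *)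
pose g t := (F (Num.max t 1) `^ p^-1)^-1.
have m1 t : 1 <= Num.max t 1 by rewrite le_max lexx orbT.
have m0 t : 0 < Num.max t 1 by rewrite (lt_le_trans _ (m1 t)).
have cmax1 : continuous (fun t : R => Num.max t 1).
  apply: nonexpansive_continuous => x y; rewrite ler_norml.
  have := ler_norm (x - y); have := ler_norm (- (x - y)); rewrite normrN.
  by case: (leP x 1) => h1; case: (leP y 1) => h2 h3 h4; apply/andP; split; lra.
have cg : continuous g.
  move=> t A hA.
  have dg : is_derive (Num.max t 1) 1 (fun x => (F x `^ p^-1)^-1)
      (- (p^-1 * F (Num.max t 1) `^ (p^-1 - 1) * fb (Num.max t 1)) / (F (Num.max t 1) `^ p^-1) ^+ 2).
    have Fp := F_gt0 (m0 t).
    have h1 := is_derive_powR_fun p^-1 Fp (dF (gtN1 (ltW (m0 t)))).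
    have h2 : F (Num.max t 1) `^ p^-1 != 0 by rewrite gt_eqF// powR_gt0.
    exact: (@is_deriveV_fun _ (fun x => F x `^ p^-1) _ _ h2 h1).
  exact: (cmax1 t _ (is_derive_cont dg hA)).
have gpos t : 0 < g t by rewrite invr_gt0 powR_gt0// F_gt0.
have [Th [_ dTh]] := antiderivative cg.
have dTh1 x : 1 <= x -> is_derive x 1 Th (F x `^ p^-1)^-1.
  by move=> x1; have := dTh x (gtN1 (le_trans ler01 x1)); rewrite /g max_l.
exists Th; split => // e e0.
have Thm x y : 1 <= x -> x <= y -> Th x <= Th y.
  move=> x1 xy; apply: (derive_ge0_le xy (df := g)) => z /andP[xz zy].
  - by apply: is_derive_cont (dTh _ _); apply: gtN1; rewrite (le_trans _ (le_trans x1 xz)).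
  - by apply: dTh; apply: gtN1; rewrite (le_trans _ (le_trans x1 (ltW xz))).
  - exact: ltW.
have [L hL] : exists L : R, forall x, 1 <= x -> Th x <= L.
  have := F_keller_osserman hF (ltr01 : 0 < (1 : R)).
  rewrite /Psi; set c := _ `^ _; set I := integral _ _ _.
  have c0 : 0 < c.
    by rewrite powR_gt0// subr_gt0 invf_lt1// (lt_le_trans _ p2)// ltr1n.
  have IE : I = (\int[@lebesgue_measure R]_(s in `]1%R, +oo[) (g s)%:E)%E.
    apply: eq_integral => s; rewrite inE/= in_itv/= andbT => s1.
    by rewrite /g max_l ?(ltW s1)// primitiveE// (lt_trans _ s1).
  have I0 : (0 <= I)%E by rewrite IE; apply: integral_ge0 => s _; rewrite lee_fin ltW.
  have mg : measurable_fun setT g by apply: continuous_measurable_fun.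
  move=> cI; have : (I < +oo)%E.
    by move: cI I0; case: I IE => [i||]// _; rewrite ?ltry// gt0_muley ?lte_fin.
  case: I IE I0 {cI} => [i||]// IE _ _.
  exists (Th 2 + i) => x x1; have [x2|x2] := leP x 2.
    rewrite (le_trans (Thm x 2 x1 x2))// lerDl -lee_fin IE.
    by apply: integral_ge0 => s _; rewrite lee_fin ltW.
  rewrite -lerBlDl -lee_fin IE.
  have H t : 2 <= t <= x -> is_derive t 1 Th (g t).
    by move=> /andP[t2 _]; apply: dTh; apply: gtN1; rewrite (le_trans _ t2).
  rewrite -(integral_derive_segment x2 H cg).
  apply: ge0_subset_integral => //.
  - by apply/measurable_EFinP; exact: measurable_funTS.
  - by move=> t _; rewrite lee_fin ltW.
  - move=> t /=; rewrite !in_itv/= andbT => /andP[t2 _].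
    by rewrite (lt_le_trans _ t2)// ltr1n.
pose S := [set Th x | x in [set x | 1 <= x]].
have hs : has_sup S by split; [exists (Th 1); exists 1 => //=|exists L => _ [x /= x1 <-]; exact: hL].
have [_ [B /= B1 <-] hB] := sup_adherent e0 hs.
exists B => // x y Bx xy.
have hy : Th y <= sup S by apply: ub_le_sup; [case: hs|exists y => //=; rewrite (le_trans B1)// (le_trans Bx)].
have := Thm B x B1 Bx; lra.
Qed.

(** On [b/2, b] the integrand F^(-1/p) is at least F(b)^(-1/p). A small tail of the integral thus
    gives b^p <= F(b)/K, and F(b) <= b f(b) because f is nondecreasing. *)
Lemma superlinear K : 0 < K -> exists2 B, 1 <= B & forall b, B <= b -> K * b `^ (p - 1) <= fb b.
Proof.
move=> K0; have [Th [dTh hTh]] := keller_osserman_primitive.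
pose e := (K `^ p^-1)^-1 / 2.
have Kp : 0 < K `^ p^-1 by exact: powR_gt0.
have e0 : 0 < e by rewrite divr_gt0// invr_gt0.
have [B B1 hB] := hTh e e0.
exists (2 * B); first by rewrite (le_trans B1)// ler_peMl ?ler1n// (le_trans _ B1).
move=> b Bb; have B0 : 0 < B := lt_le_trans ltr01 B1.
have b0 : 0 < b by rewrite (lt_le_trans _ Bb)// mulr_gt0.
have hb2 : B <= b / 2 by rewrite ler_pdivlMr// mulrC.
have bb : b / 2 <= b by rewrite ler_pdivrMr// ler_peMr ?ler1n// ltW.
have h1 := hB _ _ hb2 bb.
have Fb := F_gt0 b0.
set Y := (F b `^ p^-1)^-1.
have Y0 : 0 < Y by rewrite invr_gt0 powR_gt0.
have h2 : Y * (b - b / 2) <= Th b - Th (b / 2).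
  rewrite -subr_ge0 (_ : _ - _ = (Th b - Y * b) - (Th (b / 2) - Y * (b / 2))); last by ring.
  rewrite subr_ge0.
  have x1 z : b / 2 <= z -> 1 <= z by move=> h; rewrite (le_trans B1)// (le_trans hb2).
  have dd z : b / 2 <= z -> is_derive z 1 (fun z => Th z - Y * z) ((F z `^ p^-1)^-1 - Y).
    move=> hz; have := is_deriveB_fun (dTh z (x1 _ hz)) (is_deriveZ_fun Y (is_derive_id z (1 : R))).
    by rewrite mulr1.
  apply: (derive_ge0_le bb (f := fun z => Th z - Y * z) (df := fun z => (F z `^ p^-1)^-1 - Y)) => z /andP[h3 h4].
  - exact: is_derive_cont (dd z h3).
  - exact: dd (ltW h3).
  - have z0 : 0 < z by rewrite (lt_le_trans ltr01)// x1// ltW.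
    have Fz := F_gt0 z0.
    rewrite subr_ge0 lef_pV2 ?posrE ?powR_gt0//.
    by apply: ge0_ler_powR; rewrite ?nnegrE ?invr_ge0 ?(ltW p0)// ?(ltW Fz) ?(ltW Fb)// F_le// ltW.
have h3 : b <= (K `^ p^-1)^-1 * F b `^ p^-1.
  have := le_trans h2 h1; rewrite /Y mulrC ler_pdivrMr ?powR_gt0// /e => h; lra.
have h4 : b `^ p <= K^-1 * F b.
  have := ge0_ler_powR (ltW p0) _ _ h3; rewrite !nnegrE => /(_ (ltW b0)).
  have pos : 0 <= (K `^ p^-1)^-1 * F b `^ p^-1 by rewrite mulr_ge0 ?invr_ge0 ?powR_ge0.
  move=> /(_ pos); rewrite powRM ?invr_ge0 ?powR_ge0// -[(K `^ p^-1)^-1]powRN -!powRrM.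
  by rewrite mulNr mulVf ?gt_eqF// powRr1 ?(ltW Fb)// powRN powRr1// ltW.
have h5 := F_upper (ltW b0).
have h6 : b `^ p = b * b `^ (p - 1).
  by rewrite mulrC powR_split.
rewrite -ler_pdivlMl//; rewrite -(ler_pM2l b0) -h6 (le_trans h4)// mulrCA.
by rewrite ler_pM2l ?invr_gt0// (le_trans h5).
Qed.

End keller_osserman_bound.

Lemma powR_invr {R : realType} (x a : R) : 0 < x -> x^-1 `^ a = (x `^ a)^-1.
Proof.
move=> x0; have xa : x `^ a != 0 by rewrite gt_eqF// powR_gt0.
apply: (mulIf xa); rewrite mulVf// -powRM ?invr_ge0 ?(ltW x0)// mulVf ?gt_eqF//.
by rewrite powR1.
Qed.

Section large_solutions.
Context {R : realType}.
Implicit Types (r s t e a b c x y rho : R).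
Variables (p : R) (p2 : 2 <= p) (f : R -> R) (hF : condition_F p f) (d : nat) (d0 : (0 < d)%N).
Local Notation fb := (extend_by_zero f).
Local Notation q := (p - 1)^-1.
Local Notation radial_solution := (radial_solution d p).

Let dR : 0 < d%:R :> R. Proof. by rewrite ltr0n. Qed.
Let p0 : 0 < p. Proof. by rewrite (lt_le_trans _ p2). Qed.
Let p1 : 0 < p - 1. Proof. by rewrite subr_gt0 (lt_le_trans _ p2)// ltr1n. Qed.
Let q0 : 0 < q. Proof. exact: conj_exp_gt0. Qed.
Let cfb : continuous fb := fb_continuous hF.
Let mfb s t : s <= t -> fb s <= fb t := fb_mono hF (s := s) (t := t).
Let fb0 t : 0 <= fb t.
Proof. by apply: fb_ge0; [exact: mfb|exact: (fb_neg hF)]. Qed.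

Lemma is_derive_flux rad k G r : averages d rad k G -> 0 < r < rad ->
  is_derive r 1 (fun r => r * k r) (G r - (d%:R - 1) * k r).
Proof.
move=> [_ h] hr; have r0 : r != 0 by case/andP: hr => r0 _; rewrite gt_eqF.
apply: is_derive_eq (is_deriveM_fun (is_derive_id r (1 : R)) (h r hr)) _.
by field.
Qed.

(** For nondecreasing G the average satisfies k <= G(r)/d, so the curvature term (d-1) k consumes at
    most the fraction (d-1)/d of G(r). This reduces the radial equation to the one-dimensional
    inequality P' >= G/d for the flux P. *)
Lemma flux_derive_ge rad k G r : averages d rad k G -> 0 < r < rad ->
  (forall s, 0 < s < r -> G s <= G r) -> G r / d%:R <= G r - (d%:R - 1) * k r.
Proof.
move=> h hr Gm; have := averages_ub_at d0 h hr Gm; rewrite ler_pdivlMr// => h1.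
have d1 : 1 <= d%:R :> R by rewrite ler1n.
rewrite -subr_ge0 (_ : _ - _ = (d%:R - 1) / d%:R * (G r - k r * d%:R)); last by field; rewrite gt_eqF.
by rewrite mulr_ge0 ?subr_ge0// divr_ge0// subr_ge0.
Qed.

(** The length e is cut into four pieces t. Over the first one the flux becomes positive; over the
    next two superlinearity triples z; from then on the energy inequality gives z' >= c F(z)^(1/p),
    and a convergent integral of F^(-1/p) leaves no room for the last piece. B depends neither on
    the solution nor on the radius, hence the uniformity. *)
Lemma keller_osserman_bound e : 0 < e -> exists B, forall rad b z k G,
  radial_solution rad z k G -> b < rad ->
  (forall r s, 0 <= r -> r <= s -> s <= b -> G r <= G s) ->
  (forall r, 0 <= r <= b -> fb (z r) <= G r) ->
  forall r, 0 <= r -> r + e <= b -> z r < B.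
Proof.
move=> e0; pose t := e / 4; have t0 : 0 < t by rewrite divr_gt0.
have [F [F0 dF]] := antiderivative cfb.
have [Th [dTh hTh]] := keller_osserman_primitive p2 hF F0 dF.
(* Chosen so that a flux of fb(z) t / d, built up over a length t, yields a slope of at least 2 z /
   t. *)
pose K := (2 / t) `^ (p - 1) * d%:R / t.
have t2 : 0 < 2 / t by rewrite divr_gt0.
have K0 : 0 < K by rewrite divr_gt0// mulr_gt0// powR_gt0.
have [B1 B11 hB1] := superlinear p2 hF F0 dF K0.
pose c := ((2 * d%:R) `^ p^-1)^-1.
have c0 : 0 < c by rewrite invr_gt0 powR_gt0// mulr_gt0.
have ct0 : 0 < c * t / 2 by rewrite divr_gt0// mulr_gt0.
have [B2 B21 hB2] := hTh _ ct0.
exists (Num.max B1 B2) => rad b z k G hs brad Gm fG r0 r00 re.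
rewrite ltNge ge_max; apply/negP => /andP[zB1 zB2].
have [ak dz k0 _] := hs.
have inb (x : R) : r0 <= x -> x <= b -> 0 <= x < rad.
  by move=> h1 h2; rewrite (le_trans r00 h1) (le_lt_trans h2).
have inbo (x : R) : r0 < x -> x <= b -> 0 < x < rad.
  by move=> h1 h2; rewrite (le_lt_trans r00 h1) (le_lt_trans h2).
have zm (x y : R) : r0 <= x -> x <= y -> y <= b -> z x <= z y.
  by move=> h1 h2 h3; apply: (radial_solution_mono hs) => //; [exact: le_trans h1|exact: le_lt_trans brad].
have Pm (x : R) : r0 < x -> x <= b -> G x / d%:R <= G x - (d%:R - 1) * k x.
  move=> h1 h2; apply: flux_derive_ge ak (inbo _ h1 h2) _ => s /andP[s0 sx].
  by apply: Gm => //; exact: ltW.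
have cP (x : R) : r0 <= x -> x <= b -> {for x, continuous (fun r => r * k r)}.
  move=> h1 h2; have hk : {for x, continuous k} by case: ak => h _; apply: h; exact: inb.
  by have := continuousM (@cvg_id _ (nbhs x)) hk.
have Pgrow (x y : R) : r0 <= x -> x <= y -> y <= b -> fb (z x) / d%:R * (y - x) <= y * k y - x * k x.
  move=> h1 h2 h3; rewrite -subr_ge0.
  rewrite (_ : _ - _ = (y * k y - fb (z x) / d%:R * y) - (x * k x - fb (z x) / d%:R * x)); last by ring.
  rewrite subr_ge0.
  apply: (derive_ge0_le h2 (f := fun r => r * k r - fb (z x) / d%:R * r)
    (df := fun r => G r - (d%:R - 1) * k r - fb (z x) / d%:R)) => w /andP[h4 h5].
  - apply: continuousB; first by apply: cP; [exact: le_trans h4|exact: le_trans h3].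
    exact: is_derive_cont (is_deriveZ_fun (fb (z x) / d%:R) (is_derive_id w (1 : R))).
  - have := is_deriveB_fun (is_derive_flux ak (inbo w (le_lt_trans h1 h4) (le_trans (ltW h5) h3)))
      (is_deriveZ_fun (fb (z x) / d%:R) (is_derive_id w (1 : R))).
    by rewrite mulr1.
  - rewrite subr_ge0; apply: le_trans (Pm w (le_lt_trans h1 h4) (le_trans (ltW h5) h3)).
    rewrite ler_wpM2r ?invr_ge0 ?(ltW dR)//.
    have wb : w <= b := le_trans (ltW h5) h3.
    have hw : 0 <= w <= b by rewrite wb (le_trans r00)// (le_trans h1)// ltW.
    apply: le_trans (fG w hw); apply: mfb.
    by apply: zm => //; exact: ltW.
have Pge0 (x : R) : r0 <= x -> x <= b -> 0 <= x * k x.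
  by move=> h1 h2; rewrite mulr_ge0 ?k0 ?inb// (le_trans r00).
have cz (x : R) : r0 <= x -> x <= b -> {for x, continuous z}.
  by move=> h1 h2; apply: (radial_solution_cont hs); exact: inb.
have z00 : 1 <= z r0 by rewrite (le_trans B11).
(* Over the first length t the flux grows, over the second z gains at least 2 z(x). *)
have step (x : R) : r0 <= x -> x + t + t <= b -> 3 * z x <= z (x + t + t).
  move=> h1 h2; have xt : x <= x + t by rewrite lerDl ltW.
  have xtt : x + t <= x + t + t by rewrite lerDl ltW.
  have zx1 : 1 <= z x by rewrite (le_trans z00)// zm// (le_trans (le_trans xt xtt)).
  have zx0 : 0 < z x by rewrite (lt_le_trans _ zx1).
  have zxB : B1 <= z x by rewrite (le_trans zB1)// zm// (le_trans (le_trans xt xtt)).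
  have hK := hB1 _ zxB.
  have h3 := Pgrow x (x + t) h1 xt (le_trans xtt h2).
  rewrite addrAC subrr add0r in h3.
  have h4 : fb (z x) / d%:R * t <= (x + t) * k (x + t).
    by apply: (le_trans h3); rewrite gerBl Pge0// (le_trans (le_trans xt xtt)).
  have Pmono (y : R) : x + t <= y -> y <= b -> fb (z x) / d%:R * t <= y * k y.
    move=> h5 h6; apply: (le_trans h4); rewrite -subr_ge0.
    apply: le_trans (Pgrow (x + t) y (le_trans h1 xt) h5 h6).
    by rewrite mulr_ge0 ?subr_ge0// divr_ge0// ltW.
  have Q2 : 2 / t * z x <= (fb (z x) / d%:R * t) `^ q.
    have pn : p - 1 != 0 by rewrite gt_eqF.
    rewrite [leLHS](_ : _ = ((2 / t * z x) `^ (p - 1)) `^ q); last first.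
      by rewrite -powRrM mulfV// powRr1// mulr_ge0// ltW.
    apply: ge0_ler_powR; rewrite ?nnegrE ?(ltW q0) ?powR_ge0//.
      by rewrite mulr_ge0 ?(ltW t0)// divr_ge0// ltW.
    rewrite powRM ?(ltW t2) ?(ltW zx0)// -ler_pdivrMr// ler_pdivlMr//.
    by rewrite (_ : _ * d%:R = K * z x `^ (p - 1))//; rewrite /K; ring.
  have h5 : 2 / t * z x * (x + t + t - (x + t)) <= z (x + t + t) - z (x + t).
    rewrite -subr_ge0 (_ : _ - _ = (z (x + t + t) - 2 / t * z x * (x + t + t)) -
      (z (x + t) - 2 / t * z x * (x + t))); last by ring.
    rewrite subr_ge0; apply: (derive_ge0_le xtt (f := fun r => z r - 2 / t * z x * r)
      (df := fun r => (r * k r) `^ q - 2 / t * z x)) => w /andP[h6 h7].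
    - apply: continuousB; first by apply: cz; [rewrite (le_trans h1)// (le_trans xt)|exact: le_trans h2].
      exact: is_derive_cont (is_deriveZ_fun (2 / t * z x) (is_derive_id w (1 : R))).
    - have hw : 0 <= w < rad.
        by apply: inb; [rewrite (le_trans h1)// (le_trans xt)// ltW|rewrite (le_trans _ h2)// ltW].
      have := is_deriveB_fun (dz w hw) (is_deriveZ_fun (2 / t * z x) (is_derive_id w (1 : R))).
      by rewrite mulr1.
    - rewrite subr_ge0 (le_trans Q2)//.
      have hw := Pmono w (ltW h6) (le_trans (ltW h7) h2).
      apply: ge0_ler_powR hw; rewrite ?nnegrE ?(ltW q0)//.
        by rewrite mulr_ge0 ?(ltW t0)// divr_ge0// ltW.
      by rewrite Pge0// ?(le_trans (ltW h7))// (le_trans h1)// (le_trans xt)// ltW.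
  have zxt : z x <= z (x + t) by rewrite zm// (le_trans xtt).
  have E : 2 / t * z x * (x + t + t - (x + t)) = 2 * z x by field; rewrite gt_eqF.
  rewrite E in h5; lra.
pose rm := r0 + t; pose r1 := rm + t + t.
have e4 : e = t + t + t + t by rewrite /t; field.
have r0m : r0 <= rm by rewrite lerDl ltW.
have rm1 : rm <= r1 by rewrite /r1 -addrA lerDl addr_ge0// ltW.
have r1b : r1 + t <= b by move: re; rewrite e4 /r1 /rm !addrA.
have r1b' : r1 <= b by rewrite (le_trans _ r1b)// lerDl ltW.
have z3 : 3 * z rm <= z r1 by apply: step => //.
have zrm1 : 1 <= z rm by rewrite (le_trans z00)// zm// (le_trans rm1).
have Ppos (x : R) : rm <= x -> x <= b -> 0 < x * k x.
  move=> h1 h2; have h3 := Pgrow r0 x (lexx _) (le_trans r0m h1) h2.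
  have h4 : 0 < fb (z r0) / d%:R * (x - r0).
    rewrite mulr_gt0 ?divr_gt0 ?(fb_pos hF) ?(lt_le_trans _ z00)// subr_gt0.
    by rewrite (lt_le_trans _ h1)// ltrDl.
  have h5 := Pge0 r0 (lexx _) (le_trans r0m (le_trans rm1 r1b')).
  by rewrite (lt_le_trans h4)// (le_trans h3)// gerBl.
have q1 : 0 < 1 + q by rewrite ltr_wpDr// ltW.
(* The energy of the equation P' = fb(z)/d with z' = P^q. Since P' >= fb(z)/d here, it is
   nondecreasing. *)
pose E r := (r * k r) `^ (1 + q) / (1 + q) - F (z r) / d%:R.
have dE (x : R) : rm <= x -> x <= b -> is_derive x 1 E
    ((x * k x) `^ q * (G x - (d%:R - 1) * k x - fb (z x) / d%:R)).
  move=> h1 h2; have hx1 : r0 < x by rewrite (lt_le_trans _ h1)// ltrDl.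
  have zx1 : 1 <= z x by rewrite (le_trans zrm1)// zm.
  have H1 := @is_derive_powR_fun _ (fun r => r * k r) x _ (1 + q) (Ppos x h1 h2) (is_derive_flux ak (inbo x hx1 h2)).
  have H2 := is_derive_comp_fun (dF (z x) (lt_le_trans (ltrN10 R) (le_trans ler01 zx1))) (dz x (inb x (ltW hx1) h2)).
  have H := is_deriveB_fun (is_deriveM_fun H1 (is_derive_cst ((1 + q)^-1 : R) x 1))
    (is_deriveM_fun H2 (is_derive_cst ((d%:R)^-1 : R) x 1)).
  apply: is_derive_eq H _; rewrite /cst !mulr0 !addr0 [1 + q - 1](_ : _ = q); last by ring.
  have q1n : 1 + q != 0 by rewrite gt_eqF.
  have dn : d%:R != 0 :> R by rewrite gt_eqF.
  by move: (1 + q) q1n ((x * k x) `^ q) => s sn Y; field; rewrite sn dn.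
have energy (x : R) : r1 <= x -> x <= b -> F (z x) / (2 * d%:R) <= (x * k x) `^ (1 + q).
  move=> h1 h2; have rmx := le_trans rm1 h1.
  have : E rm <= E x.
    apply: (derive_ge0_le rmx (df := fun x => (x * k x) `^ q * (G x - (d%:R - 1) * k x - fb (z x) / d%:R))) => w /andP[h3 h4].
    - exact: is_derive_cont (dE w h3 (le_trans h4 h2)).
    - exact: dE (ltW h3) (le_trans (ltW h4) h2).
    - have wb : w <= b := le_trans (ltW h4) h2.
      have r0w : r0 < w := le_lt_trans r0m h3.
      rewrite mulr_ge0 ?powR_ge0// subr_ge0 (le_trans _ (Pm w r0w wb))// ler_pM2r ?invr_gt0//.
      by apply: fG; rewrite (le_trans r00 (ltW r0w)).
  rewrite /E; set A := _ `^ _ / _; set A' := (x * k x) `^ (1 + q).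
  have A0 : 0 <= A by rewrite divr_ge0 ?powR_ge0// ltW.
  have zrm0 : 0 <= z rm by rewrite (le_trans _ zrm1).
  (* By convexity of F and F(b) <= b f(b), tripling z at least doubles F(z), which absorbs the
     energy term at the starting point. *)
  have zx : 3 * z rm <= z x by rewrite (le_trans z3)// zm// (le_trans r0m rm1).
  have zx' : z rm <= z x by rewrite (le_trans _ zx)// ler_peMl// ler1n.
  have g1 := F_growth hF dF zrm0 zx'.
  have g2 := F_upper hF F0 dF zrm0.
  have g3 : z rm * fb (z rm) <= fb (z rm) * (z x - z rm).
    by rewrite mulrC ler_wpM2l//; lra.
  have g4 : 2 * F (z rm) <= F (z x) by lra.
  move=> EE; have h5 : (F (z x) - F (z rm)) / d%:R <= A' / (1 + q).
    by rewrite mulrBl; lra.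
  have h6 : A' / (1 + q) <= A'.
    by rewrite ler_pdivrMr// ler_peMr ?powR_ge0// lerDl ltW.
  apply: le_trans h6; apply: le_trans h5.
  by rewrite invfM mulrA ler_pM2r ?invr_gt0//; lra.
have bridge : c * (b - r1) <= Th (z b) - Th (z r1).
  rewrite -subr_ge0 (_ : _ - _ = (Th (z b) - c * b) - (Th (z r1) - c * r1)); last by ring.
  rewrite subr_ge0.
  have zx1 (x : R) : r1 <= x -> x <= b -> 1 <= z x.
    by move=> h1 h2; rewrite (le_trans zrm1)// zm// (le_trans rm1).
  have dd (x : R) : r1 <= x -> x <= b -> is_derive x 1 (fun x => Th (z x) - c * x)
      ((F (z x) `^ p^-1)^-1 * (x * k x) `^ q - c).
    move=> h1 h2; have hx : r0 <= x by rewrite (le_trans r0m)// (le_trans rm1).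
    have := is_deriveB_fun (is_derive_comp_fun (dTh (z x) (zx1 x h1 h2)) (dz x (inb x hx h2)))
      (is_deriveZ_fun c (is_derive_id x (1 : R))).
    by rewrite mulr1.
  apply: (derive_ge0_le r1b' (f := fun x => Th (z x) - c * x)
    (df := fun x => (F (z x) `^ p^-1)^-1 * (x * k x) `^ q - c)) => w /andP[h3 h4].
  - exact: is_derive_cont (dd w h3 h4).
  - exact: dd (ltW h3) (ltW h4).
  - have Fw : 0 < F (z w) by apply: (F_gt0 hF F0 dF); rewrite (lt_le_trans ltr01)// zx1// ltW.
    rewrite subr_ge0 ler_pdivlMl ?powR_gt0// /c.
    (* 1 + q = p/(p-1), hence (1 + q)/p = q. *)
    have -> : (w * k w) `^ q = ((w * k w) `^ (1 + q)) `^ p^-1.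
      by rewrite -powRrM; congr (_ `^ _); field; rewrite !gt_eqF.
    have d2 : 0 < 2 * d%:R :> R by rewrite mulr_gt0.
    rewrite -powR_invr// -powRM ?(ltW Fw) ?invr_ge0 ?(ltW d2)//.
    apply: ge0_ler_powR; rewrite ?nnegrE ?invr_ge0 ?(ltW p0) ?powR_ge0//.
      by rewrite divr_ge0 ?(ltW Fw)// mulr_ge0// ltW.
    by apply: energy; exact: ltW.
have zB2' : B2 <= z r1 by rewrite (le_trans zB2)// zm// (le_trans r0m rm1).
have hb2 := hB2 _ _ zB2' (zm r1 b (le_trans r0m rm1) r1b' (lexx _)).
have : c * t <= c * (b - r1) by rewrite ler_pM2l// lerBrDl.
move: ct0; lra.
Qed.

End large_solutions.

Lemma clamp_dist {R : realType} (rho r s : R) :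
  `|Num.min (Num.max r 0) rho - Num.min (Num.max s 0) rho| <= `|r - s|.
Proof.
apply: (le_trans _ (ler_dist_max0 r s)); move: (Num.max r 0) (Num.max s 0) => a b.
rewrite ler_norml; have := ler_norm (a - b); have := ler_norm (- (a - b)); rewrite normrN.
by case: (leP a rho) => h1; case: (leP b rho) => h2 h3 h4; apply/andP; split; lra.
Qed.

(** Profiles matter for r >= 0 only, but derivatives at 0 are two-sided. Constant continuation to
    the left is compatible with this because the slope at the centre is 0. *)
Lemma is_derive_max0_comp {R : realType} (z : R -> R) :
  is_derive (0 : R) 1 z 0 -> is_derive (0 : R) 1 (fun t => z (Num.max t 0)) 0.
Proof.
case=> dz z0; have h : h^-1 *: ((z \o shift 0) (h *: (1 : R)) - z 0) @[h --> 0^'] --> 'D_1 z 0.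
  exact: dz.
rewrite z0 in h.
have H : h^-1 *: (((fun t => z (Num.max t 0)) \o shift 0) (h *: (1 : R)) - z (Num.max 0 0)) @[h --> 0^'] --> (0 : R).
  apply/cvgrPdist_lt => e e0; move/cvgrPdist_lt : h => /(_ e e0); apply: filterS => t.
  rewrite /shift /= !addr0 -[t *: 1]/(t * 1) mulr1 maxxx => ht.
  by case: (leP t 0) => // t0; rewrite subrr scaler0 subrr normr0.
split; first by apply/cvg_ex; exists 0; exact: H.
by apply/cvg_lim; [|exact: H].
Qed.

(** * Gluing and limits of radial solutions *)

Section construction.
Context {R : realType}.
Implicit Types (r s t e a b c x y rho rad : R).
Variables (p : R) (p2 : 2 <= p) (f : R -> R) (hF : condition_F p f) (d : nat) (d0 : (0 < d)%N).
Local Notation fb := (extend_by_zero f).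
Local Notation q := (p - 1)^-1.
Local Notation radial_solution := (radial_solution d p).
Local Notation approximate_solution := (approximate_solution d p fb).

Let dR : 0 < d%:R :> R. Proof. by rewrite ltr0n. Qed.
Let q0 : 0 < q. Proof. exact: conj_exp_gt0. Qed.
Let cfb : continuous fb := fb_continuous hF.
Let mfb s t : s <= t -> fb s <= fb t := fb_mono hF (s := s) (t := t).
Let fb0 t : 0 <= fb t.
Proof. by apply: fb_ge0; [exact: mfb|exact: (fb_neg hF)]. Qed.

Lemma radial_solution_congr rad z z' k k' G G' :
  (forall r, 0 < r < rad -> z r = z' r) -> (forall r, 0 < r < rad -> k r = k' r) ->
  (forall r, 0 <= r < rad -> G r = G' r) -> k 0 = k' 0 ->
  (forall r, r <= 0 -> z' r = z' 0) -> z 0 = z' 0 -> {for 0, continuous k'} -> 0 < rad ->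
  radial_solution rad z k G -> radial_solution rad z' k' G'.
Proof.
move=> zz kk GG k00 z'0 z00 ck' rad0 [[h1 h2] h3 h4 h5].
have pos r : 0 < r < rad -> 0 <= r < rad by move=> /andP[/ltW -> ->].
have near r : 0 < r < rad -> \forall s \near r, 0 < s < rad.
  move=> /andP[r0 rrad]; near=> s; apply/andP; split; near: s; [exact: lt_nbhsr|exact: lt_nbhsl].
split.
- split=> r.
    move=> /andP[]; rewrite le_eqVlt => /orP[/eqP <- _//|r0 rr].
    have hr : 0 < r < rad by rewrite r0.
    by apply: near_eq_continuous (h1 r (pos r hr)); apply: filterS (near r hr) => s; exact: kk.
  move=> hr; rewrite -(GG r (pos r hr)) -(kk r hr).
  by apply: (near_eq_is_derive _ (h2 r hr)); apply: filterS (near r hr) => s; exact: kk.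
- move=> r /andP[]; rewrite le_eqVlt => /orP[/eqP <- _|r0 rr].
    rewrite mul0r powR0 ?gt_eqF//.
    have hz0 : is_derive (0 : R) 1 z 0.
      by have := h3 0; rewrite lexx rad0 mul0r powR0 ?gt_eqF//; exact.
    apply: near_eq_is_derive (is_derive_max0_comp hz0).
    near=> s; have [s0|s0] := leP s 0; first by rewrite z00 (z'0 s s0).
    by apply: zz; rewrite s0/=; near: s; exact: lt_nbhsl.
  have hr : 0 < r < rad by rewrite r0.
  rewrite -(kk r hr); apply: (near_eq_is_derive _ (h3 r (pos r hr))).
  by apply: filterS (near r hr) => s; exact: zz.
- move=> r /andP[]; rewrite le_eqVlt => /orP[/eqP <- _|r0 rr].
    by rewrite -k00 h4// lexx.
  by rewrite -kk ?h4 ?r0// (ltW r0).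
- by rewrite -k00 h5 GG// lexx.
Unshelve. all: by end_near. Qed.

(** The averaged flux is determined by G, so the choices made on different intervals agree where
    both are defined. At r the glued one uses the interval ending midway between r and rad. *)
Lemma radial_solution_glue rad V G : 0 < rad -> (forall r, r <= 0 -> V r = V 0) ->
  (forall rho, 0 < rho < rad -> exists k, radial_solution rho V k G) ->
  exists k, radial_solution rad V k G.
Proof.
move=> rad0 V0 H.
have /choice[K hK] : forall rho, exists k, 0 < rho < rad -> radial_solution rho V k G.
  move=> rho; have [/H[k hk]|h] := pselect (0 < rho < rad); first by exists k.
  by exists (fun=> 0).
pose m r := (Num.max r 0 + rad) / 2.
pose k r := K (m r) (Num.max r 0).
have agree rho rho' r : 0 < rho < rad -> 0 < rho' < rad -> 0 <= r -> r < rho -> r < rho' ->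
    K rho r = K rho' r.
  move=> h1 h2 r0 r1 r2; pose rh := Num.min rho rho'.
  have [a1 _ _ _] := hK rho h1; have [a2 _ _ _] := hK rho' h2.
  have a1' := averages_sub (_ : rh <= rho) a1; have a2' := averages_sub (_ : rh <= rho') a2.
  have hr : 0 <= r < rh by rewrite r0 lt_min r1.
  have := averages_dist d0 (e := 0) (a1' _) (a2' _) (lexx _) _ hr.
  rewrite mul0r !ge_min !lexx orbT => /(_ isT isT) h.
  apply/eqP; rewrite -subr_eq0 -normr_le0; apply: h => s _.
  by rewrite subrr normr0.
have mb r : 0 <= r < rad -> 0 < m r < rad /\ r < m r.
  by move=> /andP[r0 rr]; rewrite /m max_l//; split; [apply/andP; split|]; lra.
have kE rho r : 0 < rho < rad -> 0 <= r -> r < rho -> k r = K rho r.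
  move=> h1 r0 rr; have hr : 0 <= r < rad by rewrite r0 (lt_trans rr)//; case/andP: h1.
  by have [h2 h3] := mb r hr; rewrite /k max_l//; exact: agree.
exists k.
have sol rho : 0 < rho < rad -> radial_solution rho V k G.
  move=> hrho; have hs := hK rho hrho; have hs' := hs; have rho0 : 0 < rho by case/andP: hrho.
  apply: radial_solution_congr hs => //.
  - by move=> r /andP[r0 rr]; rewrite (kE rho)// ltW.
  - by rewrite (kE rho)// lexx.
  - have [[c0 _] _ _ _] := hs'.
    have c00 : {for 0, continuous (K rho)} by apply: c0; rewrite lexx.
    have c1 : {for 0, continuous (fun r => K rho (Num.max r 0))}.
      have c00' : {for Num.max (0 : R) 0, continuous (K rho)} by rewrite maxxx.
      exact: (@continuous_comp _ _ _ (fun r => Num.max r 0) (K rho) 0 (@max0_continuous R 0) c00').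
    apply: near_eq_continuous c1; near=> s.
    have h : 0 <= Num.max s 0 by rewrite le_max lexx orbT.
    rewrite -(kE rho)//; first by rewrite /k /m (max_l h).
    by rewrite gt_max rho0 andbT; near: s; exact: lt_nbhsl.
have inside r : 0 <= r < rad -> exists2 rho, 0 < rho < rad & r < rho.
  by move=> /mb[h1 h2]; exists (m r).
split.
- split=> r hr.
    have [|rho hrho rr] := inside r; first by case/andP: hr => ? ?; apply/andP.
    have [[h1 _] _ _ _] := sol rho hrho; apply: h1.
    by case/andP: hr => ->.
  have hr' : 0 <= r < rad by case/andP: hr => /ltW ->.
  have [rho hrho rr] := inside r hr'; have [[_ h1] _ _ _] := sol rho hrho; apply: h1.
  by case/andP: hr => ->.
- move=> r hr; have [rho hrho rr] := inside r hr; have [_ h1 _ _] := sol rho hrho; apply: h1.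
  by case/andP: hr => ->.
- move=> r hr; have [rho hrho rr] := inside r hr; have [_ _ h1 _] := sol rho hrho; apply: h1.
  by case/andP: hr => ->.
- have h0 : 0 <= (0 : R) < rad by rewrite lexx.
  have [rho hrho rr] := inside 0 h0.
  by have [_ _ _ h1] := sol rho hrho.
Unshelve. all: by end_near. Qed.

(** A common Lipschitz bound upgrades pointwise to uniform convergence on [0, rho], so the
    right-hand sides converge uniformly to fb(V). By stability V then coincides with the solution
    obtained by quadrature from fb(V). *)
Lemma radial_limit rho rho' (z_ k_ G_ : nat -> R -> R) (e_ : nat -> R) V B :
  0 < rho -> rho < rho' -> (forall n, radial_solution rho' (z_ n) (k_ n) (G_ n)) ->
  (forall n r, 0 <= r < rho' -> fb (z_ n r) <= G_ n r <= fb (z_ n r + e_ n) + e_ n) ->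
  (forall n, 0 <= e_ n <= 1) -> e_ n @[n --> \oo] --> (0 : R) ->
  (forall n r, 0 <= r < rho' -> `|z_ n r| <= B) ->
  (forall r, 0 <= r < rho' -> z_ n r @[n --> \oo] --> V r) ->
  (forall r, r <= 0 -> V r = V 0) ->
  exists k, radial_solution rho V k (fun r => fb (V r)).
Proof.
move=> rho0 rr zs Gb e01 e_0 zB zV V0.
have hr0 : 0 <= (0 : R) < rho' by rewrite lexx (lt_trans rho0).
have B0 : 0 <= B := le_trans (normr_ge0 _) (zB 0%N 0 hr0).
pose M := fb (B + 1) + 1.
have M0 : 0 <= M by rewrite addr_ge0.
have GM n t : 0 < t < rho' -> G_ n t <= M.
  move=> /andP[/ltW t0 tr]; have ht : 0 <= t < rho' by rewrite t0.
  have /andP[_ h] := Gb n t ht; have /andP[e0 e1] := e01 n.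
  rewrite (le_trans h)// lerD// mfb// lerD//.
  exact: le_trans (ler_norm _) (zB n t ht).
pose L := (rho' * (M / d%:R)) `^ q.
have L0 : 0 <= L by exact: powR_ge0.
have zL n r s : 0 <= r < rho' -> 0 <= s < rho' -> `|z_ n r - z_ n s| <= L * `|r - s|.
  exact: (radial_solution_lip d0 p2 (zs n) (lexx _) (GM n)).
have VL r s : 0 <= r < rho' -> 0 <= s < rho' -> `|V r - V s| <= L * `|r - s|.
  move=> hr hs; apply/ler_addgt0Pr => eps eps0.
  have e2 : 0 < eps / 2 by rewrite divr_gt0.
  have /cvgrPdist_lt/(_ _ e2) n1 := zV r hr; have /cvgrPdist_lt/(_ _ e2) n2 := zV s hs.
  have [n [h1 h2]] := filter_ex (filterI n1 n2).
  have -> : V r - V s = (V r - z_ n r) + (z_ n r - z_ n s) - (V s - z_ n s) by ring.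
  have h3 := zL n r s hr hs.
  rewrite (le_trans (ler_normB _ _))//; have := ler_normD (V r - z_ n r) (z_ n r - z_ n s).
  move: h1 h2; set A := `|V r - z_ n r|; set A' := `|V s - z_ n s| => h1 h2; lra.
pose cl r := Num.min (Num.max r 0) rho.
have clr r : 0 <= cl r < rho'.
  by rewrite /cl le_min (ltW rho0) le_max lexx orbT gt_min rr orbT.
have cle r : 0 <= r <= rho -> cl r = r by move=> /andP[h1 h2]; rewrite /cl max_l// min_l.
have cl_lip r s : `|cl r - cl s| <= `|r - s| := clamp_dist rho r s.
have unif eps : 0 < eps -> \forall n \near \oo, forall r, 0 <= r <= rho -> `|z_ n r - V r| <= eps.
  move=> eps0.
  have H : \forall n \near \oo, `[0, rho]%classic `<=` [set r | `|z_ n (cl r) - V (cl r)| <= eps].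
    have cK := @segment_compact R 0 rho.
    apply: ((@compact_near_coveringP _ _).1 cK nat \oo (fun n r => `|z_ n (cl r) - V (cl r)| <= eps) _).
    move=> x _.
    have e3 : 0 < eps / 3 by rewrite divr_gt0.
    have /cvgrPdist_lt/(_ _ e3) hx := zV (cl x) (clr x).
    pose dl := eps / 3 / (L + 1).
    have L1 : 0 < L + 1 by rewrite ltr_wpDl.
    have dl0 : 0 < dl by rewrite divr_gt0.
    exists ([set y | `|x - y| < dl], [set n | `|V (cl x) - z_ n (cl x)| < eps / 3]).
      by split => //=; apply/nbhs_ballP; exists dl.
    move=> [y n] /= [xy hn].
    have Lxy : L * `|cl x - cl y| <= eps / 3.
      apply: (@le_trans _ _ ((L + 1) * dl)); last by rewrite /dl mulrC divfK// gt_eqF.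
      apply: ler_pM => //; first by rewrite lerDl.
      by rewrite (le_trans (cl_lip x y))// ltW.
    have h1 := zL n (cl x) (cl y) (clr x) (clr y).
    have h2 := VL (cl x) (cl y) (clr x) (clr y).
    have -> : z_ n (cl y) - V (cl y) = (V (cl x) - V (cl y)) - (V (cl x) - z_ n (cl x)) - (z_ n (cl x) - z_ n (cl y)) by ring.
    rewrite (le_trans (ler_normB _ _))//.
    have := ler_normB (V (cl x) - V (cl y)) (V (cl x) - z_ n (cl x)).
    move: hn; set A := `|V (cl x) - z_ n (cl x)|; lra.
  by apply: filterS H => n h r hr; have := h r; rewrite /= cle// in_itv/=; exact.
pose G r := fb (V (cl r)).
have cVcl : continuous (fun r => V (cl r)).
  move=> r; apply/cvgrPdist_lt => e e0; apply/nbhs_ballP; exists (e / (L + 1)) => /=.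
    by rewrite divr_gt0// ltr_wpDl.
  move=> s; rewrite /ball/= => rs.
  rewrite (le_lt_trans (VL _ _ (clr r) (clr s)))//.
  apply: (@le_lt_trans _ _ (L * `|r - s|)); first by rewrite ler_wpM2l.
  apply: (@le_lt_trans _ _ ((L + 1) * `|r - s|)); first by rewrite ler_wpM2r// lerDl.
  by rewrite mulrC -ltr_pdivlMr// ltr_wpDl.
have cG : continuous G by move=> r A /cfb hA; exact: (cVcl r _ hA).
(* V is already known, so this is an equation with a prescribed right-hand side; it remains to
   identify its solution with V. *)
have [zi [ki [zi0 zis]]] := radial_solution_exists d0 p2 (V 0) cG (fun r => fb0 _).
have VB r : 0 <= r < rho' -> `|V r| <= B.
  move=> hr; apply/ler_addgt0Pr => eps eps0.
  have /cvgrPdist_lt/(_ _ eps0)/filter_ex[n hn] := zV r hr.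
  have -> : V r = z_ n r + (V r - z_ n r) by ring.
  by rewrite (le_trans (ler_normD _ _))// lerD ?zB// ltW.
have Vzi r : 0 <= r < rho -> V r = zi r.
  move=> hr; apply/eqP; rewrite -subr_eq0 -normr_le0; apply/ler_addgt0Pr => eps eps0; rewrite add0r.
  have eps3 : 0 < eps / 3 by rewrite divr_gt0.
  have [t t0 ht] := powR_small p2 (ltW rho0) eps3.
  have dt : 0 < d%:R * t / 2 by rewrite divr_gt0// mulr_gt0.
  have [dl dl0 hdl] := heine_segment B cfb dt.
  have dl2 : 0 < Num.min (dl / 2) (eps / 3) by rewrite lt_min divr_gt0.
  have n1 := unif _ dl2.
  have edl : 0 < Num.min (dl / 2) (d%:R * t / 2) by rewrite lt_min dt divr_gt0.
  have /cvgrPdist_lt/(_ _ edl) n2 := e_0.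
  have [n [h1 h2]] := filter_ex (filterI n1 n2).
  rewrite sub0r normrN lt_min in h2.
  have /andP[en0 en1] := e01 n.
  rewrite ger0_norm// in h2; have /andP[e1 e2] := h2.
  have hr' : 0 <= r <= rho by case/andP: hr => -> /ltW ->.
  have Gd s : 0 < s < rho -> `|G_ n s - G s| <= d%:R * t.
    move=> /andP[/ltW s0 /ltW srho].
    have hs : 0 <= s <= rho by rewrite s0.
    have hs' : 0 <= s < rho' by rewrite s0 (le_lt_trans srho).
    have := h1 s hs; rewrite le_min => /andP[z1 _].
    have /andP[g1 g2] := Gb n s hs'.
    rewrite /G cle//.
    have k1 : `|fb (V s) - fb (z_ n s)| <= d%:R * t / 2.
      by apply: hdl; [exact: VB|rewrite distrC (le_trans z1)//; lra].
    have k2 : `|fb (V s) - fb (z_ n s + e_ n)| <= d%:R * t / 2.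
      apply: hdl; first exact: VB.
      have -> : V s - (z_ n s + e_ n) = - ((z_ n s - V s) + e_ n) by ring.
      rewrite normrN (le_trans (ler_normD _ _))// (ger0_norm en0) [leRHS](splitr dl).
      by rewrite lerD// ltW.
    move: k1 k2; rewrite !ler_norml => /andP[] ? ? /andP[] ? ?; apply/andP; split; lra.
  have := radial_solution_stable d0 p2 (zs n) (zis rho') (ltW rr) Gd hr.
  rewrite mulrAC divff ?gt_eqF// mul1r zi0 => h3.
  have k1 := h1 r hr'; have k2 : `|z_ n 0 - V 0| <= Num.min (dl / 2) (eps / 3).
    by apply: h1; rewrite lexx ltW.
  rewrite le_min in k1; rewrite le_min in k2.
  have /andP[_ k1'] := k1; have /andP[_ k2'] := k2.
  have -> : V r - zi r = (z_ n r - zi r - (z_ n 0 - V 0)) + (z_ n 0 - V 0) - (z_ n r - V r) by ring.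
  have h4 := le_trans h3 ht.
  rewrite (le_trans (ler_normB _ _))//.
  have := ler_normD (z_ n r - zi r - (z_ n 0 - V 0)) (z_ n 0 - V 0); lra.
exists ki.
have ki00 : {for 0, continuous ki} by have [[h _] _ _ _] := zis rho; apply: h; rewrite lexx.
apply: radial_solution_congr (zis rho) => //.
- by move=> r /andP[r0 rrho]; rewrite Vzi// (ltW r0).
- by move=> r /andP[r0 rrho]; rewrite /G cle// r0 ltW.
Qed.

End construction.

(** * Existence of minimal large radial solutions *)

Section large_radial_solutions.
Context {R : realType}.
Implicit Types (r s t e a b c x y rho rad M : R).
Variables (p : R) (p2 : 2 <= p) (f : R -> R) (hF : condition_F p f) (d : nat) (d0 : (0 < d)%N).
Local Notation fb := (extend_by_zero f).
Local Notation radial_solution := (radial_solution d p).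
Local Notation approximate_solution := (approximate_solution d p fb).

Let mfb s t : s <= t -> fb s <= fb t := fb_mono hF (s := s) (t := t).
Let fb0 t : 0 <= fb t.
Proof. by apply: fb_ge0; [exact: mfb|exact: (fb_neg hF)]. Qed.

Definition large_solution rad V k : Prop :=
  [/\ radial_solution rad V k (fun r => fb (V r)), forall r, 0 <= r < rad -> 0 <= V r &
      forall M, exists2 rho, 0 < rho < rad & forall r, rho <= r -> r < rad -> M < V r].

Lemma radial_solutionD rad z k G c : radial_solution rad z k G ->
  radial_solution rad (fun r => z r + c) k G.
Proof.
case=> h1 h2 h3 h4; split=> // r hr.
by have := is_deriveD_fun (h2 r hr) (is_derive_cst c r 1); rewrite addr0.
Qed.

(** The upper bound for G2 evaluates [fb] at z2 + 1/(j+1); comparing z1 with z2 shifted by exactly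
    this amount orders the right-hand sides, the surplus of z1 being the larger one. *)
Lemma approximate_solution_le rad1 rad2 n j z1 k1 G1 z2 k2 G2 :
  approximate_solution rad1 n z1 k1 G1 -> approximate_solution rad2 j z2 k2 G2 ->
  0 < rad2 -> rad2 <= rad1 -> (n <= j)%N -> forall r, 0 <= r <= rad2 -> z1 r <= z2 r + j.+1%:R^-1.
Proof.
move=> [s1 e1 _ b1 m1] [s2 e2 _ b2 m2] r20 r21 nj.
have nj' : j.+1%:R^-1 <= n.+1%:R^-1 :> R by rewrite lef_pV2 ?posrE// ler_nat.
apply: (radial_comparison d0 p2 (s1 (rad2 + 1)) (radial_solutionD _ (s2 (rad2 + 1))) (ltW r20)).
- by rewrite ltrDl.
- apply: (@le_trans _ _ n.+1%:R).
    rewrite -e1; apply: (radial_solution_mono (s1 (rad1 + 1)) (ltW r20) r21).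
    by rewrite ltrDl.
  by rewrite e2 ler_wpDr ?invr_ge0// ler_nat.
- move=> r /andP[r0 rr] zz.
  have hr1 : 0 <= r <= rad1 by rewrite (ltW r0) (le_trans (ltW rr)).
  have hr2 : 0 <= r <= rad2 by rewrite !ltW.
  have /andP[h1 _] := b1 r hr1; have /andP[_ h2] := b2 r hr2.
  rewrite (le_trans h2)// (le_trans _ h1)// lerD//.
  by apply: mfb; exact: ltW.
Qed.

Lemma large_solution_nonneg rad V k : radial_solution rad V k (fun r => fb (V r)) ->
  (forall r, r < rad -> exists2 b, r < b < rad & 0 <= V b) ->
  forall r, 0 <= r < rad -> 0 <= V r.
Proof.
move=> hs hb r /andP[r0 rr]; have [b /andP[rb brad] Vb] := hb r rr.
have b0 : 0 <= b := le_trans r0 (ltW rb).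
apply: (radial_comparison d0 p2 (radial_solution_cst d0 p2 rad 0) hs b0 brad Vb).
  by move=> s _ /ltW Vs; rewrite (fb_neg hF).
by rewrite r0 ltW.
Qed.

(** V is a supremum of approximate solutions. The two extra clauses record its minimality: V is
    reached from below by strict subsolutions of the same radius, and it dominates those of any
    larger radius. They order large solutions of different radii and supply the lower barriers. *)
Lemma large_solution_exists rad : 0 < rad -> exists V k, [/\ large_solution rad V k,
  forall r c, 0 <= r < rad -> c < V r ->
    exists n z k' G, approximate_solution rad n z k' G /\ c < z r &
  forall rad' n z k' G, rad <= rad' -> approximate_solution rad' n z k' G ->
    forall r, 0 <= r < rad -> z r <= V r].
Proof.
move=> rad0.
have /choice[w hw] : forall n, exists zkG : (R -> R) * (R -> R) * (R -> R),
    approximate_solution rad n zkG.1.1 zkG.1.2 zkG.2.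
  move=> n; have [z [k [G h]]] :=
    approximate_solution_exists d0 p2 (fb_continuous hF) mfb (fb_neg hF) n rad0.
  by exists (z, k, G).
pose z_ n := (w n).1.1; pose k_ n := (w n).1.2; pose G_ n := (w n).2.
have zs n rad' : radial_solution rad' (z_ n) (k_ n) (G_ n) by case: (hw n).
have Gm n r s : 0 <= r -> r <= s -> s <= rad -> G_ n r <= G_ n s by case: (hw n) => _ _ _ _; apply.
have Gb n r : 0 <= r <= rad -> fb (z_ n r) + n.+1%:R^-1 <= G_ n r <= fb (z_ n r + n.+1%:R^-1) + n.+1%:R^-1.
  by case: (hw n) => _ _ _ + _; apply.
have zle n j r : (n <= j)%N -> 0 <= r <= rad -> z_ n r <= z_ j r + j.+1%:R^-1.
  by move=> nj hr; exact: (approximate_solution_le (hw n) (hw j) rad0 (lexx _) nj hr).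
have inv01 n : 0 <= (n.+1%:R^-1 : R) <= 1 by rewrite invr_ge0 ler0n/= invf_le1// ler1n.
have bnd r : 0 <= r < rad -> exists B, forall n s, 0 <= s <= r -> z_ n s <= B.
  move=> /andP[r0 rr]; have e0 : 0 < rad - r by rewrite subr_gt0.
  have [B hB] := keller_osserman_bound p2 hF d0 e0.
  exists B => n s /andP[s0 sr].
  have zsr : z_ n s <= z_ n r by apply: (radial_solution_mono (zs n rad)).
  rewrite (le_trans zsr)// ltW//.
  apply: (hB (rad + 1) rad (z_ n) (k_ n) (G_ n)) => //; last by rewrite addrC subrK.
  - by rewrite ltrDl.
  - exact: Gm.
  - move=> t /(Gb n)/andP[h _]; apply: le_trans h; rewrite lerDl.
    by case/andP: (inv01 n).
(* The truncation makes V constant for r <= 0, as gluing and limits require. *)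
pose V r := sup [set z_ n (Num.max r 0) | n in setT].
have Vsup r : 0 <= r < rad -> has_sup [set z_ n r | n in setT].
  move=> hr; split; first by exists (z_ 0%N r); exists 0%N.
  have [B hB] := bnd r hr; exists B => _ [n _ <-]; apply: hB.
  by case/andP: hr => -> _; rewrite lexx.
have VE r : 0 <= r -> V r = sup [set z_ n r | n in setT] by move=> r0; rewrite /V max_l.
have zV n r : 0 <= r < rad -> z_ n r <= V r.
  move=> hr; rewrite VE; last by case/andP: hr.
  by apply: ub_le_sup; [case: (Vsup r hr)|exists n].
have Vadh r c : 0 <= r < rad -> c < V r -> exists n, c < z_ n r.
  move=> hr cV; have e0 : 0 < V r - c by rewrite subr_gt0.
  have [_ [n _ <-]] := sup_adherent e0 (Vsup r hr).
  by rewrite -VE ?subKr//; [exists n|case/andP: hr].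
(* The sequence increases only up to the error 1/(j+1), which tends to 0; this still forces
   convergence to the supremum. *)
have zlim r : 0 <= r < rad -> z_ n r @[n --> \oo] --> V r.
  move=> hr; apply/cvgrPdist_lt => e e0.
  have e2 : 0 < e / 2 by rewrite divr_gt0.
  have Ve : V r - e / 2 < V r by rewrite gtrBl.
  have [n hn] := Vadh r (V r - e / 2) hr Ve.
  have [N _ hN] := near_infty_natSinv_lt (PosNum e2).
  near=> j; have nj : (n <= j)%N by near: j; exact: nbhs_infty_ge.
  have Nj : (N <= j)%N by near: j; exact: nbhs_infty_ge.
  have hj := hN j Nj; rewrite /= in hj.
  rewrite ger0_norm ?subr_ge0 ?zV//.
  have hr' : 0 <= r <= rad by case/andP: hr => -> /ltW ->.
  have := zle n j r nj hr'; move: hj hn; set i := _^-1; lra.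
have V0 r : r <= 0 -> V r = V 0 by move=> r0; rewrite /V max_r// maxxx.
have zlow n r : 0 <= r < rad -> z_ 0%N 0 - 1 <= z_ n r.
  move=> /andP[r0 rr]; have h0 : 0 <= (0 : R) <= rad by rewrite lexx ltW.
  have h1 := zle 0%N n 0 (leq0n n) h0.
  have h2 : z_ n 0 <= z_ n r by apply: (radial_solution_mono (zs n rad)).
  have /andP[_ h3] := inv01 n; move: h1 h3; set i := _^-1; lra.
have loc rho : 0 < rho < rad -> exists k, radial_solution rho V k (fun r => fb (V r)).
  move=> /andP[rho0 rr]; pose rho' := (rho + rad) / 2.
  have h1 : rho < rho' by rewrite /rho'; lra.
  have h2 : rho' < rad by rewrite /rho'; lra.
  have hrho' : 0 <= rho' < rad by rewrite h2 (le_trans (ltW rho0) (ltW h1)).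
  have [B hB] := bnd rho' hrho'.
  have inr r : 0 <= r < rho' -> 0 <= r < rad by move=> /andP[-> h] /=; exact: lt_trans h2.
  apply: (radial_limit p2 hF d0 (z_ := z_) (k_ := k_) (G_ := G_) (e_ := fun n => n.+1%:R^-1)
    (B := `|B| + `|z_ 0%N 0 - 1|) rho0 h1) => //.
  - move=> n r hr; have hr' : 0 <= r <= rad by have /andP[-> /ltW ->] := inr r hr.
    have /andP[g1 ->] := Gb n r hr'; rewrite andbT (le_trans _ g1)// lerDl.
    by case/andP: (inv01 n).
  - exact: (@cvg_harmonic R).
  - move=> n r hr; rewrite ler_norml; apply/andP; split.
      have := zlow n r (inr r hr); have := ler_norm (- (z_ 0%N 0 - 1)); rewrite normrN.
      have := normr_ge0 B; lra.
    have hr' : 0 <= r <= rho' by case/andP: hr => -> /ltW ->.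
    have := hB n r hr'; have := ler_norm B; have := normr_ge0 (z_ 0%N 0 - 1); lra.
  - by move=> r /inr; exact: zlim.
have [k hk] := radial_solution_glue p2 d0 rad0 V0 loc.
have blow M : exists2 rho, 0 < rho < rad & forall r, rho <= r -> r < rad -> M < V r.
  pose n := (Num.trunc (`|M| + 1)).+1.
  have Mn : M < n.+1%:R - 1.
    have h1 : `|M| + 1 < n%:R by exact: truncnS_gt.
    have := ler_norm M; rewrite -natr1 addrK; lra.
  have zn : z_ n rad = n.+1%:R by case: (hw n).
  have cz : {for rad, continuous (z_ n)}.
    by apply: (radial_solution_cont (zs n (rad + 1))); rewrite (ltW rad0) ltrDl ltr01.
  have /cvgrPdist_lt/(_ _ ltr01)/nbhs_ballP[e /= e0 he] := cz.
  pose rho := Num.max (rad - e / 2) (rad / 2).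
  have rho1 : rho < rad by rewrite gt_max; apply/andP; split; lra.
  have rho0 : 0 < rho by rewrite lt_max; apply/orP; right; lra.
  exists rho; first by rewrite rho0.
  move=> r rr rrad; have r0 : 0 <= r := le_trans (ltW rho0) rr.
  apply: (lt_le_trans _ (zV n r _)); last by rewrite r0.
  have := he r; rewrite /ball/= ger0_norm ?subr_ge0 ?(ltW rrad)//.
  have : rad - r < e by move: rr; rewrite ge_max => /andP[]; lra.
  move=> h1 /(_ h1); rewrite zn ltr_norml => /andP[]; lra.
have Vnn r : 0 <= r < rad -> 0 <= V r.
  apply: (large_solution_nonneg hk) => s srad; have [rho /andP[rho0 rhor] hrho] := blow 0.
  exists (Num.max ((s + rad) / 2) ((rho + rad) / 2)).
    by rewrite lt_max gt_max; apply/andP; split; [apply/orP; left|apply/andP; split]; lra.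
  apply: ltW; apply: hrho; first by rewrite le_max; apply/orP; right; lra.
  by rewrite gt_max; apply/andP; split; lra.
exists V, k; split => //.
- move=> r c hr /(Vadh r c hr)[n hn]; exists n, (z_ n), (k_ n), (G_ n).
  by split; [exact: hw|exact: hn].
- move=> rad' n z k' G rr hz r hr; apply/ler_addgt0Pr => e e0.
  have [N _ hN] := near_infty_natSinv_lt (PosNum e0).
  pose j := maxn n N.
  have hj := hN j (leq_maxr n N); rewrite /= in hj.
  have hr' : 0 <= r <= rad by case/andP: hr => -> /ltW ->.
  rewrite (le_trans (approximate_solution_le hz (hw j) rad0 rr (leq_maxl n N) hr'))//.
  by rewrite lerD// ?zV// ltW.
Unshelve. all: by end_near. Qed.

End large_radial_solutions.

(** * Uniqueness of the large radial solution *)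

(* Two large solutions are compared through their inverse functions r1 <= r2 of the common
   value v: the energy gap D = Y1 - Y2 grows only through the gap e = r1 - r2, which in turn is
   controlled by D / Y2; near the boundary this gives D^2 = O(Y2), hence a vanishing difference. *)
Lemma boundary_gap_absurd {R : realType} (r1 r2 Y1 Y2 q1 q2 g b1 b2 : R -> R) (v1 rad K C0 c : R) :
  0 < c -> 0 <= K -> 0 <= C0 ->
  (forall v, v1 <= v -> is_derive v 1 r1 (q1 v)^-1 /\ is_derive v 1 r2 (q2 v)^-1) ->
  (forall v, v1 <= v -> 0 < q1 v /\ 0 < q2 v) ->
  (forall v, v1 <= v -> is_derive v 1 Y1 (b1 v * g v) /\ is_derive v 1 Y2 (b2 v * g v)) ->
  (forall v, v1 <= v -> 0 <= g v /\ 0 < Y2 v) ->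
  (forall v, v1 <= v -> [/\ 0 <= b2 v, b2 v <= b1 v & b1 v - b2 v <= K * (r1 v - r2 v) * b2 v]) ->
  (forall v, v1 <= v -> q2 v < q1 v -> q1 v * Y2 v <= q2 v * Y1 v) ->
  (forall v, v1 <= v -> q1 v ^+ 2 <= 1 + C0 * Y1 v) ->
  (forall v, v1 <= v -> r2 v <= r1 v /\ r1 v < rad) ->
  (forall e : R, 0 < e -> exists2 u : R, v1 <= u & forall v, u <= v -> rad - r2 v < e) ->
  (forall v, v1 <= v -> c <= q1 v * (r1 v - r2 v)) -> False.
Proof.
move=> c0 K0 C00 dr qpos dY gY bb qq qY rr rlim gap.
have idn1 (a b : R) : 0 < b -> (1 - a / b) * (b + a) = b - a ^+ 2 / b.
  by move=> h; field; rewrite gt_eqF.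
have idn2 (a b x y z : R) : 0 < b ->
    (x * z * a + a * (x * z)) / b + a * a * (- (y * z) / b ^+ 2) =
    2 * (a / b) * (x * z - 2^-1 * (a / b) * y * z).
  by move=> h; field; rewrite gt_eqF.
have idn3 (a b x y : R) : 0 < b ->
    4 * y ^+ 2 * x ^+ 2 * (a ^+ 2 / b ^+ 2) = (x * (2 * y * (a / b))) ^+ 2.
  by move=> h; field; rewrite gt_eqF.
have idn4 (a b : R) : 0 < b -> a * b = a / b * b ^+ 2 by move=> h; field; rewrite gt_eqF.
have idn5 (a b x y : R) : 0 < b -> 4 * y ^+ 2 * (b * x) * (a / b) = y ^+ 2 * (4 * a * x).
  by move=> h; field; rewrite gt_eqF.
pose D (v : R) := Y1 v - Y2 v.
(* D shifted by a constant: same derivative, still above D, and at least 1, so that it can be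
   divided by. *)
pose H (v : R) := D v + (1 + `|D v1| - D v1).
pose dl (v : R) := r1 v - r2 v.
pose ep (v : R) := rad - r2 v.
have dl0 (v : R) : v1 <= v -> 0 <= dl v by move=> /rr[h _]; rewrite subr_ge0.
have dlep (v : R) : v1 <= v -> dl v <= ep v by move=> /rr[_ h]; rewrite lerD2r ltW.
have ep0 (v : R) : v1 <= v -> 0 < ep v by move=> /rr[h1 h2]; rewrite subr_gt0 (le_lt_trans h1).
have dD (v : R) : v1 <= v -> is_derive v 1 D ((b1 v - b2 v) * g v).
  by move=> hv; have [h1 h2] := dY v hv; rewrite mulrBl; exact: (is_deriveB_fun h1 h2).
have dH (v : R) : v1 <= v -> is_derive v 1 H ((b1 v - b2 v) * g v).
  move=> hv; have := is_deriveD_fun (dD v hv) (is_derive_cst (1 + `|D v1| - D v1) v 1).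
  by rewrite addr0.
have dD0 (v : R) : v1 <= v -> 0 <= (b1 v - b2 v) * g v.
  by move=> hv; have [h1 h2 _] := bb v hv; have [h3 _] := gY v hv; rewrite mulr_ge0// subr_ge0.
have Dm (u v : R) : v1 <= u -> u <= v -> D u <= D v.
  move=> h1 h2; apply: (derive_ge0_le h2 (df := fun v => (b1 v - b2 v) * g v)) => w /andP[h3 h4].
  - exact: is_derive_cont (dD w (le_trans h1 h3)).
  - exact: dD (le_trans h1 (ltW h3)).
  - exact: dD0 (le_trans h1 (ltW h3)).
have Y2m (u v : R) : v1 <= u -> u <= v -> Y2 u <= Y2 v.
  move=> h1 h2; apply: (derive_ge0_le h2 (df := fun v => b2 v * g v)) => w /andP[h3 h4].
  - exact: is_derive_cont (dY w (le_trans h1 h3)).2.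
  - exact: (dY w (le_trans h1 (ltW h3))).2.
  - have hw := le_trans h1 (ltW h3); have [h5 _ _] := bb w hw; have [h6 _] := gY w hw.
    exact: mulr_ge0.
have r2m (u v : R) : v1 <= u -> u <= v -> r2 u <= r2 v.
  move=> h1 h2; apply: (derive_ge0_le h2 (df := fun v => (q2 v)^-1)) => w /andP[h3 h4].
  - exact: is_derive_cont (dr w (le_trans h1 h3)).2.
  - exact: (dr w (le_trans h1 (ltW h3))).2.
  - by have [_ h5] := qpos w (le_trans h1 (ltW h3)); rewrite invr_ge0 ltW.
have H1 (v : R) : v1 <= v -> 1 <= H v.
  by move=> hv; have := Dm v1 v (lexx _) hv; have := normr_ge0 (D v1); rewrite /H; lra.
have HD (v : R) : D v <= H v by have := ler_norm (D v1); rewrite /H; lra.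
(* The energies control the ratio of slopes: q1 exceeds q2 by at most the factor Y1/Y2, and Y1 <= Y2
   + H. *)
have qH (v : R) : v1 <= v -> (q2 v)^-1 * (1 - H v / Y2 v) <= (q1 v)^-1.
  move=> hv; have [a1 a2] := qpos v hv; have [_ y2] := gY v hv.
  have HY : 0 < H v / Y2 v by rewrite divr_gt0// (lt_le_trans _ (H1 v hv)).
  have [q12|q21] := leP (q1 v) (q2 v).
    have h : (q2 v)^-1 <= (q1 v)^-1 by rewrite lef_pV2.
    by rewrite (le_trans _ h)// ler_piMr ?invr_ge0 ?(ltW a2)//; lra.
  rewrite ler_pdivrMl// -[leRHS]/(q2 v * (q1 v)^-1) ler_pdivlMr//.
  have h := qq v hv q21; have y1 : Y1 v <= Y2 v + H v by have := HD v; rewrite /D; lra.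
  have h3 : q1 v * Y2 v <= q2 v * (Y2 v + H v) by rewrite (le_trans h)// ler_pM2l.
  have h4 : (1 - H v / Y2 v) * (Y2 v + H v) <= Y2 v.
    rewrite idn1//.
    by rewrite gerBl divr_ge0 ?sqr_ge0// ltW.
  rewrite -(ler_pM2r y2) mulrAC; have h5 := H1 v hv.
  have [n0|p0] := leP (1 - H v / Y2 v) 0.
    apply: (@le_trans _ _ 0); last by rewrite mulr_ge0// ltW.
    by rewrite -mulrA mulr_le0_ge0// mulr_ge0// ltW.
  apply: (@le_trans _ _ ((1 - H v / Y2 v) * (q2 v * (Y2 v + H v)))).
    by rewrite -mulrA ler_pM2l// (mulrC (Y2 v)).
  by rewrite mulrCA ler_pM2l.
(* A bootstrap. With M the largest gap beyond v, H grows at most K M times as fast as Y2, so H/Y2 <=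
   A beyond v. Integrating r1' - r2' >= - A r2' up to the boundary gives M <= A ep(v), and K ep(v)
   <= 1/2 absorbs the part of A containing M. *)
have small (v : R) : v1 <= v -> K * ep v <= 2^-1 -> dl v <= 2 * ep v * (H v / Y2 v).
  move=> hv Kep; pose S := [set dl u | u in [set u | v <= u]].
  have hS : has_sup S.
    split; first by exists (dl v); exists v => //=.
    exists (ep v) => _ [u /= vu <-]; rewrite (le_trans (dlep u (le_trans hv vu)))//.
    by rewrite lerD2l lerN2 r2m.
  pose M := sup S.
  have dlM (u : R) : v <= u -> dl u <= M by move=> vu; apply: ub_le_sup => //; [case: hS|exists u].
  have M0 : 0 <= M := le_trans (dl0 v hv) (dlM v (lexx v)).
  have [_ y2] := gY v hv.
  pose A := H v / Y2 v + K * M.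
  have HA (u : R) : v <= u -> H u / Y2 u <= A.
    move=> vu; have hu := le_trans hv vu; have [_ yu] := gY u hu; have yvu := Y2m v u hv vu.
    have h : K * M * Y2 v - H v <= K * M * Y2 u - H u.
      apply: (derive_ge0_le vu (f := fun u => K * M * Y2 u - H u)
        (df := fun u => K * M * (b2 u * g u) - (b1 u - b2 u) * g u)) => w /andP[h3 h4].
      - have hw := le_trans hv h3.
        exact: is_derive_cont (is_deriveB_fun (is_deriveZ_fun (K * M) (dY w hw).2) (dH w hw)).
      - have hw := le_trans hv (ltW h3).
        exact: (is_deriveB_fun (is_deriveZ_fun (K * M) (dY w hw).2) (dH w hw)).
      - have hw := le_trans hv (ltW h3); have [h5 _ h6] := bb w hw; have [h7 _] := gY w hw.
        rewrite mulrA -mulrBl mulr_ge0// subr_ge0 (le_trans h6)// ler_wpM2r// ler_wpM2l//.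
        by apply: dlM; exact: ltW.
    rewrite ler_pdivrMr// /A mulrDl.
    have h8 : H v <= H v / Y2 v * Y2 u.
      rewrite mulrAC ler_pdivlMr// ler_pM2l// (lt_le_trans _ (H1 v hv))//.
    have h9 : 0 <= K * M * Y2 v by rewrite !mulr_ge0// ltW.
    lra.
  have A0 : 0 <= A.
    apply: addr_ge0; last exact: mulr_ge0.
    by rewrite divr_ge0 ?(ltW y2)// (le_trans ler01 (H1 v hv)).
  have grow (u : R) : v <= u -> dl u <= A * ep v.
    move=> vu; have hu := le_trans hv vu; apply/ler_addgt0Pr => e e0.
    have [u' v1u' hu'] := rlim e e0; pose t := Num.max u u'.
    have ut : u <= t by rewrite le_max lexx.
    have v1t : v1 <= t := le_trans hu ut.
    have h : dl u + A * r2 u <= dl t + A * r2 t.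
      apply: (derive_ge0_le ut (f := fun u => dl u + A * r2 u)
        (df := fun u => (q1 u)^-1 - (q2 u)^-1 + A * (q2 u)^-1)) => w /andP[h3 h4].
      - have [d1 d2] := dr w (le_trans hu h3).
        exact: is_derive_cont (is_deriveD_fun (is_deriveB_fun d1 d2) (is_deriveZ_fun A d2)).
      - have [d1 d2] := dr w (le_trans hu (ltW h3)).
        exact: (is_deriveD_fun (is_deriveB_fun d1 d2) (is_deriveZ_fun A d2)).
      - have hw := le_trans hu (ltW h3); have [_ a2] := qpos w hw.
        have h5 := qH w hw; have h6 := HA w (le_trans vu (ltW h3)).
        have h7 : 0 <= (q2 w)^-1 * (A - H w / Y2 w) by rewrite mulr_ge0 ?invr_ge0 ?(ltW a2)// subr_ge0.
        move: h5 h7; rewrite mulrBr mulr1 mulrBr mulrC; lra.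
    have h1 : dl t <= e.
      by rewrite (le_trans (dlep t v1t))// ltW// hu'// le_max lexx orbT.
    have h2 : A * r2 t <= A * rad.
      by rewrite ler_wpM2l//; have := ep0 t v1t; rewrite /ep subr_gt0 => /ltW.
    have h3 : A * r2 v <= A * r2 u by rewrite ler_wpM2l// r2m.
    rewrite /ep mulrBr; lra.
  have MA : M <= A * ep v.
    by apply: ge_sup; [case: hS|move=> _ [u /= vu <-]; exact: grow].
  have h1 : K * M * ep v <= M / 2.
    by rewrite mulrAC mulrC ler_wpM2l.
  have h2 : M <= 2 * ep v * (H v / Y2 v).
    by move: MA; rewrite /A mulrDl; lra.
  exact: le_trans (dlM v (lexx v)) h2.
have K1 : 0 < K + 1 by rewrite ltr_wpDl.
have e40 : 0 < 4^-1 / (K + 1) by rewrite divr_gt0.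
have [v2 v12 hv2] := rlim _ e40.
have Kep (v : R) : v2 <= v -> K * ep v <= 4^-1.
  move=> hv; have h1 := hv2 v hv; rewrite ltr_pdivlMr// in h1.
  rewrite mulrC (le_trans _ (ltW h1))// ler_pM2l ?lerDl//.
  by apply: ep0; exact: le_trans hv.
have Kep' (v : R) : v2 <= v -> K * ep v <= 2^-1.
  by move=> /Kep h; rewrite (le_trans h)// lef_pV2 ?posrE// ler_nat.
pose C := H v2 ^+ 2 / Y2 v2.
have C1 : 0 <= C by have [_ h] := gY v2 v12; rewrite divr_ge0 ?sqr_ge0// ltW.
(* H^2/Y2 is nonincreasing: with K ep <= 1/4 the bound [small] makes the derivative of H at most
   half of H/Y2 times that of Y2. *)
have HC (v : R) : v2 <= v -> H v ^+ 2 <= C * Y2 v.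
  move=> hv; have [_ yv] := gY v (le_trans v12 hv).
  rewrite -ler_pdivrMr// -lerN2.
  apply: (derive_ge0_le hv (f := fun v => - (H v ^+ 2 / Y2 v))
    (df := fun v => - (((b1 v - b2 v) * g v * H v + H v * ((b1 v - b2 v) * g v)) / Y2 v +
       H v * H v * (- (b2 v * g v) / Y2 v ^+ 2)))).
  - move=> w /andP[h3 h4]; have hw := le_trans v12 h3; have [_ yw] := gY w hw.
    have yn : Y2 w != 0 by rewrite gt_eqF.
    have h5 := is_deriveM_fun (is_deriveM_fun (dH w hw) (dH w hw)) (is_deriveV_fun yn (dY w hw).2).
    by apply: continuousN; exact: is_derive_cont h5.
  - move=> w /andP[h3 h4]; have hw := le_trans v12 (ltW h3); have [_ yw] := gY w hw.
    have yn : Y2 w != 0 by rewrite gt_eqF.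
    have h5 := is_deriveM_fun (is_deriveM_fun (dH w hw) (dH w hw)) (is_deriveV_fun yn (dY w hw).2).
    exact: (is_deriveN h5).
  - move=> w /andP[h3 h4]; have hw := le_trans v12 (ltW h3); have [gw yw] := gY w hw.
    have [h5 _ h6] := bb w hw; have h7 := small w hw (Kep' w (ltW h3)).
    have hH := H1 w hw.
    have h8 : b1 w - b2 w <= 2^-1 * (H w / Y2 w) * b2 w.
      rewrite (le_trans h6)// ler_wpM2r//.
      apply: (@le_trans _ _ (K * (2 * ep w * (H w / Y2 w)))); first by rewrite ler_wpM2l.
      rewrite (_ : K * _ = 2 * (K * ep w) * (H w / Y2 w)); last by ring.
      have h9 := Kep w (ltW h3).
      rewrite ler_wpM2r//; last by lra.
      by rewrite divr_ge0 ?(ltW yw)// (le_trans _ hH).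
    have h9 : (b1 w - b2 w) * g w <= 2^-1 * (H w / Y2 w) * b2 w * g w by rewrite ler_wpM2r.
    have H0 : 0 <= H w by rewrite (le_trans _ hH).
    rewrite oppr_ge0.
    rewrite idn2//.
    by rewrite mulr_ge0_le0 ?subr_le0// mulr_ge0// divr_ge0// ltW.
pose Z := (Y2 v2)^-1 + C0 * (1 + C).
have y2p : 0 < Y2 v2 by case: (gY v2 v12).
have Z0 : 0 < Z by rewrite ltr_pwDl ?invr_gt0// mulr_ge0// addr_ge0.
have E0 : 0 < 4 * C * Z + 1 by rewrite ltr_wpDl// mulr_ge0 ?(ltW Z0)// mulr_ge0.
(* Inserting the previous bounds in the gap inequality gives c^2 <= 4 C Z ep(v)^2, which this choice
   of e makes impossible. *)
pose e := Num.min 1 (c ^+ 2 / (4 * C * Z + 1)).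
have e0 : 0 < e by rewrite lt_min ltr01 divr_gt0// exprn_gt0.
have [u v1u hu] := rlim e e0; pose v := Num.max u v2.
have uv : u <= v by rewrite le_max lexx.
have v2v : v2 <= v by rewrite le_max lexx orbT.
have hv : v1 <= v := le_trans v12 v2v.
have [_ yv] := gY v hv; have [a1 _] := qpos v hv.
have h1 := gap v hv; have h2 := small v hv (Kep' v v2v); have h3 := HC v v2v.
have hH := H1 v hv; have eh := hu v uv; rewrite -/(ep v) in eh.
have epv := ep0 v hv.
have h4 : c <= q1 v * (2 * ep v * (H v / Y2 v)) by rewrite (le_trans h1)// ler_pM2l.
have h5 : c ^+ 2 <= 4 * ep v ^+ 2 * (q1 v ^+ 2) * (H v ^+ 2 / Y2 v ^+ 2).
  rewrite idn3//.
  by rewrite lerXn2r ?nnegrE ?(ltW c0)// (le_trans (ltW c0)).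
have h6 : H v ^+ 2 / Y2 v ^+ 2 <= C / Y2 v.
  rewrite ler_pdivrMr ?exprn_gt0// (le_trans h3)// -idn4//.
have h7 : q1 v ^+ 2 <= Y2 v * Z.
  rewrite (le_trans (qY v hv))// /Z mulrDr lerD//.
    by rewrite ler_pdivlMr// mul1r Y2m.
  rewrite mulrCA ler_wpM2l//.
  have hHH : H v <= H v ^+ 2 by rewrite expr2 ler_peMl// (le_trans _ hH).
  have := HD v; rewrite /D; lra.
have h8 : c ^+ 2 <= 4 * ep v ^+ 2 * (Y2 v * Z) * (C / Y2 v).
  apply: (le_trans h5); apply: ler_pM => //.
  - exact: (mulr_ge0 (mulr_ge0 (ler0n _ 4) (sqr_ge0 _)) (sqr_ge0 _)).
  - by rewrite divr_ge0// sqr_ge0.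
  - by rewrite ler_wpM2l// mulr_ge0// sqr_ge0.
rewrite idn5// in h8.
have e1 : ep v <= 1 by move: eh; rewrite /e lt_min => /andP[/ltW].
have e2 : ep v < c ^+ 2 / (4 * C * Z + 1) by move: eh; rewrite /e lt_min => /andP[].
have A0 : 0 <= 4 * C * Z := mulr_ge0 (mulr_ge0 (ler0n _ 4) C1) (ltW Z0).
have h9 : ep v ^+ 2 * (4 * C * Z) <= ep v * (4 * C * Z + 1).
  rewrite expr2 -mulrA ler_pM2l// (le_trans _ (_ : 4 * C * Z <= _)) ?lerDl//.
  by rewrite -[leRHS]mul1r ler_wpM2r.
move: e2; rewrite ltr_pdivlMr// => e2.
by have := le_lt_trans (le_trans h8 h9) e2; rewrite ltxx.
Qed.

Section large_solution_uniqueness.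
Context {R : realType}.
Implicit Types (r s t e a b c x y v rho rad M : R).
Variables (p : R) (p2 : 2 <= p) (f : R -> R) (hF : condition_F p f) (d : nat) (d0 : (0 < d)%N).
Local Notation fb := (extend_by_zero f).
Local Notation radial_solution := (radial_solution d p).
Local Notation approximate_solution := (approximate_solution d p fb).
Local Notation large_solution := (large_solution p f d).
Local Notation q := ((p - 1)^-1).

Lemma increasing_inverse rad (V dV : R -> R) r0 : r0 < rad ->
  (forall r, r0 <= r < rad -> is_derive r 1 V (dV r)) ->
  (forall r, r0 <= r < rad -> 0 < dV r) ->
  (forall M, exists2 rho : R, r0 < rho < rad & M < V rho) ->
  (forall r s, r0 <= r -> r < s -> s < rad -> V r < V s) /\
  exists g : R -> R, forall v, V r0 < v ->
    [/\ r0 < g v < rad, V (g v) = v & is_derive v 1 g (dV (g v))^-1].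
Proof.
move=> r0rad hV dV0 blow.
have mon r s : r0 <= r -> r < s -> s < rad -> V r < V s.
  move=> r0r rs srad; apply: (derive_ge0_gt rs (df := dV)) => x /andP[h1 h2].
  - by apply: is_derive_cont (hV x _); rewrite (le_trans r0r h1) (le_lt_trans h2).
  - by apply: hV; rewrite (le_trans r0r (ltW h1)) (lt_trans h2).
  - by apply: dV0; rewrite (le_trans r0r (ltW h1)) (lt_trans h2).
split=> //.
have /choice[g hg] : forall v, exists r, V r0 < v -> r0 < r < rad /\ V r = v.
  move=> v; have [lev|ltv] := leP v (V r0); first by exists 0.
  have [rho /andP[h1 h2] h3] := blow v.
  have cV : {within `[r0, rho], continuous V}.
    apply: continuous_within_itv => x /andP[h4 h5].
    by apply: is_derive_cont (hV x _); rewrite h4 (le_lt_trans h5).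
  have hv : Num.min (V r0) (V rho) <= v <= Num.max (V r0) (V rho).
    by rewrite ge_min le_max (ltW ltv) (ltW h3) orbT.
  have [x] := IVT (ltW h1) cV hv; rewrite in_itv/= => /andP[h4 h5] Vx.
  exists x => _; split=> //; rewrite (le_lt_trans h5 h2) andbT lt_neqAle h4 andbT.
  by apply/eqP => E; move: ltv; rewrite -Vx E ltxx.
exists g => v ltv; have [/andP[h1 h2] Vg] := hg v ltv; rewrite h1 h2; split=> //.
rewrite -{1}Vg; apply: (@is_derive_inverse R V g).
- near=> x.
  have hx1 : r0 < x by near: x; exact: lt_nbhsr.
  have hx2 : x < rad by near: x; exact: lt_nbhsl.
  have hVx : V r0 < V x by exact: mon.
  have [/andP[h3 h4] h5] := hg (V x) hVx.
  have [xg|gx|//] := ltgtP (g (V x)) x.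
  - by have := mon _ _ (ltW h3) xg hx2; rewrite h5 ltxx.
  - by have := mon _ _ (ltW hx1) gx h4; rewrite h5 ltxx.
- near=> x; apply: is_derive_cont (hV x _); apply/andP; split.
    by apply: ltW; near: x; exact: lt_nbhsr.
  by near: x; exact: lt_nbhsl.
- by apply: hV; rewrite (ltW h1) h2.
- by rewrite gt_eqF// dV0// (ltW h1) h2.
Unshelve. all: by end_near. Qed.

(** A gap c between the solutions never shrinks towards the boundary, since V1 <= V2 orders the
    averaged fluxes. As functions of the value v the positions satisfy g2 <= g1, and the energies
    have derivatives bb(g v) fb(v): they differ only through a weight that is Lipschitz in the
    position. These are the hypotheses of [boundary_gap_absurd], and the persistent gap contradicts
    it. *)
Lemma large_solution_unique rad V1 k1 V2 k2 : 0 < rad ->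
  large_solution rad V1 k1 -> large_solution rad V2 k2 ->
  (forall r, 0 <= r < rad -> V1 r <= V2 r) -> forall r, 0 <= r < rad -> V2 r <= V1 r.
Proof.
move=> rad0 [s1 _ l1] [s2 _ l2] V12 rs /andP[rs0 rsrad]; rewrite leNgt; apply/negP => ltrs.
have q0 : 0 < q by rewrite invr_gt0; move: p2; lra.
have q1 : q <= 1 by rewrite invf_le1; move: p2; lra.
have [a1 e1 k10 _] := s1; have [a2 e2 k20 _] := s2.
have k12 r : 0 <= r < rad -> k1 r <= k2 r.
  apply: (averages_le d0 a1 a2 (lexx _)) => s /andP[h1 h2].
  by apply: (fb_mono hF); apply: V12; rewrite (ltW h1).
pose c := V2 rs - V1 rs.
have c0 : 0 < c by rewrite subr_gt0.
have gap0 r : rs <= r < rad -> c <= V2 r - V1 r.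
  move=> /andP[h1 h2]; apply: (derive_ge0_le h1 (f := fun r => V2 r - V1 r)
    (df := fun r => (r * k2 r) `^ q - (r * k1 r) `^ q)) => x /andP[h3 h4].
  - have hx : 0 <= x < rad by rewrite (le_trans rs0 h3) (le_lt_trans h4).
    exact: is_derive_cont (is_deriveB_fun (e2 x hx) (e1 x hx)).
  - have hx : 0 <= x < rad by rewrite (le_trans rs0 (ltW h3)) (lt_trans h4).
    exact: (is_deriveB_fun (e2 x hx) (e1 x hx)).
  - have hx : 0 <= x < rad by rewrite (le_trans rs0 (ltW h3)) (lt_trans h4).
    have x0 : 0 <= x by case/andP: hx.
    rewrite subr_ge0; apply: ge0_ler_powR; rewrite ?nnegrE ?(ltW q0)//.
    + by rewrite mulr_ge0// k10.
    + by rewrite mulr_ge0// k20.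
    + by rewrite ler_wpM2l// k12.
(* Beyond rho the solution V1 is positive, so from r0 on both fluxes are positive and the profiles
   can be inverted. *)
have [rho /andP[rho0 rhorad] hrho] := l1 0.
pose rh := Num.max rho rs; pose r0 := (rh + rad) / 2.
have rhrad : rh < rad by rewrite gt_max rhorad.
have rhr0 : rh < r0 by rewrite /r0; move: rhrad; lra.
have r0rad : r0 < rad by rewrite /r0; move: rhrad; lra.
have rhorh : rho <= rh by rewrite le_max lexx.
have rsrh : rs <= rh by rewrite le_max lexx orbT.
have r00 : 0 < r0 := lt_trans (lt_le_trans rho0 rhorh) rhr0.
have k1p r : r0 <= r < rad -> 0 < k1 r.
  move=> /andP[h1 h2]; have hr : 0 < r := lt_le_trans r00 h1.
  rewrite -(pmulr_rgt0 _ (exprn_gt0 d hr)).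
  have h : rho ^+ d * k1 rho < r ^+ d * k1 r.
    have rr : rho < r := le_lt_trans rhorh (lt_le_trans rhr0 h1).
    apply: (derive_ge0_gt rr (f := fun t => t ^+ d * k1 t) (df := fun t => t ^+ d.-1 * fb (V1 t)))
      => x /andP[h3 h4].
    - apply: is_derive_cont (averages_scaled d0 a1 _).
      by rewrite (lt_le_trans rho0 h3) (le_lt_trans h4).
    - apply: (averages_scaled d0 a1).
      by rewrite (lt_trans rho0 h3) (lt_trans h4).
    - rewrite mulr_gt0 ?exprn_gt0 ?(lt_trans rho0 h3)//; apply: (fb_pos hF).
      by apply: hrho; [exact: ltW|exact: lt_trans h2].
  apply: le_lt_trans h; rewrite mulr_ge0 ?exprn_ge0 ?(ltW rho0)// k10// (ltW rho0)//.
have k2p r : r0 <= r < rad -> 0 < k2 r.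
  move=> hr; apply: lt_le_trans (k1p r hr) (k12 r _).
  by case/andP: hr => h1 ->; rewrite (le_trans (ltW r00)).
have in0 r : r0 <= r < rad -> 0 <= r < rad by case/andP=> h1 ->; rewrite (le_trans (ltW r00)).
have pos0 r : r0 <= r -> 0 < r by move=> h1; exact: lt_le_trans h1.
have blow (V : R -> R) :
    (forall M, exists2 rho : R, 0 < rho < rad & forall r, rho <= r -> r < rad -> M < V r) ->
    forall M, exists2 rho : R, r0 < rho < rad & M < V rho.
  move=> hl M; have [t /andP[t0 tr] ht] := hl M.
  exists (Num.max ((r0 + rad) / 2) t).
    by rewrite lt_max gt_max tr; apply/andP; split; [apply/orP; left|apply/andP; split]; lra.
  by apply: ht; rewrite ?le_max ?lexx ?orbT// gt_max tr andbT; lra.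
have [mon1 [g1 hg1]] : _ /\ _ := increasing_inverse r0rad (fun r hr => e1 r (in0 r hr))
  (fun r hr => powR_gt0 q (mulr_gt0 (pos0 r (proj1 (andP hr))) (k1p r hr))) (blow _ l1).
have [mon2 [g2 hg2]] : _ /\ _ := increasing_inverse r0rad (fun r hr => e2 r (in0 r hr))
  (fun r hr => powR_gt0 q (mulr_gt0 (pos0 r (proj1 (andP hr))) (k2p r hr))) (blow _ l2).
pose v1 := V2 r0 + 1.
have r0in : 0 <= r0 < rad by rewrite (ltW r00).
have V2v v : v1 <= v -> V2 r0 < v by move=> h; rewrite (lt_le_trans _ h)// ltrDl.
have V1v v : v1 <= v -> V1 r0 < v by move=> /V2v; apply: le_lt_trans; exact: V12.
pose sg := 1 + q.
have sg0 : 0 < sg by rewrite /sg; move: q0; lra.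
have sgq : sg - 1 = q by rewrite /sg addrC addKr.
pose bb t := (t ^+ d.-1) `^ sg.
pose S (k : R -> R) (t : R) := t ^+ d * k t.
have SE (k : R -> R) t : S k t = t ^+ d.-1 * (t * k t) by rewrite /S -(prednK d0) exprSr mulrA.
(* The factor r^(d-1), put on the flux before taking the power 1 + q, removes the curvature term:
   r^d k has derivative r^(d-1) f, and dY/dv is bb(g v) fb(v). *)
pose Y (k g : R -> R) (v : R) := sg^-1 * S k (g v) `^ sg.
have bp t : 0 < t -> 0 < bb t by move=> t0; rewrite powR_gt0// exprn_gt0.
have YE k g v : 0 < g v -> 0 <= k (g v) ->
    Y k g v = sg^-1 * (bb (g v) * ((g v * k (g v)) `^ q * (g v * k (g v)))).
  move=> gp kp; rewrite /Y SE powRM ?exprn_ge0 ?(ltW gp)//; last by rewrite mulr_ge0// ltW.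
  congr (_ * (_ * _)); have : 0 <= g v * k (g v) by rewrite mulr_ge0// ltW.
  rewrite le_eqVlt => /orP[/eqP <-|h]; first by rewrite !powR0 ?mul0r// gt_eqF.
  by rewrite powR_split// sgq.
have dY V k g v : averages d rad k (fun r => fb (V r)) ->
    r0 < g v < rad -> V (g v) = v -> 0 < k (g v) ->
    is_derive v 1 g ((g v * k (g v)) `^ q)^-1 ->
    is_derive v 1 (Y k g) (bb (g v) * fb v).
  move=> ha /andP[h1 h2] Vg kp dg; have gp : 0 < g v := lt_trans r00 h1.
  have gr : 0 < g v < rad by rewrite gp.
  have h3 := is_derive_comp_fun (f := S k) (averages_scaled d0 ha gr) dg.
  have Sp : 0 < S k (g v) by rewrite mulr_gt0 ?exprn_gt0.
  have h4 := is_deriveZ_fun sg^-1 (is_derive_powR_fun (f := fun t => S k (g t)) sg Sp h3).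
  apply: is_derive_eq h4 _; rewrite Vg sgq SE powRM ?exprn_ge0 ?(ltW gp)//; last first.
    by rewrite mulr_ge0// ltW.
  rewrite /bb (@powR_split _ _ sg (exprn_gt0 _ gp)) sgq.
  have : (g v * k (g v)) `^ q != 0 by rewrite gt_eqF// powR_gt0// mulr_gt0.
  have : sg != 0 by rewrite gt_eqF.
  move: (g v ^+ d.-1) ((g v ^+ d.-1) `^ q) ((g v * k (g v)) `^ q) (fb v) => D A B C sn Bn.
  by field; rewrite sn Bn.
have Lip : exists2 K0, 0 <= K0 & forall s t, r0 <= s -> s <= t -> t < rad -> bb t - bb s <= K0 * (t - s).
  pose L := sg * (rad ^+ d.-1) `^ q * (d.-1%:R * rad ^+ d.-1.-1).
  exists L; first by rewrite !mulr_ge0 ?(ltW sg0) ?powR_ge0 ?exprn_ge0 ?(ltW rad0).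
  move=> s t r0s st trad; rewrite (le_trans (ler_norm _))//.
  have dx x : r0 <= x -> is_derive x 1 bb (sg * (x ^+ d.-1) `^ q * (d.-1%:R * x ^+ d.-1.-1)).
    move=> h; have xp : 0 < x ^+ d.-1 by rewrite exprn_gt0// pos0.
    have h' := @is_derive_powR_fun R (fun t => t ^+ d.-1) x _ sg xp (is_deriveX_fun d.-1 x).
    by rewrite sgq in h'; exact: h'.
  apply: (derive_dist_le st (df := fun x => sg * (x ^+ d.-1) `^ q * (d.-1%:R * x ^+ d.-1.-1)))
    => x /andP[h1 h2].
  - exact: is_derive_cont (dx x (le_trans r0s h1)).
  - exact: (dx x (le_trans r0s (ltW h1))).
  - have x0 : 0 <= x := ltW (pos0 x (le_trans r0s (ltW h1))).
    have xr : x <= rad by rewrite ltW// (lt_trans h2).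
    rewrite ger0_norm; last by rewrite !mulr_ge0 ?(ltW sg0) ?powR_ge0 ?exprn_ge0.
    apply: ler_pM.
    + by rewrite mulr_ge0 ?(ltW sg0) ?powR_ge0.
    + by rewrite mulr_ge0 ?exprn_ge0.
    + rewrite ler_pM2l//; apply: ge0_ler_powR; rewrite ?nnegrE ?(ltW q0) ?exprn_ge0 ?(ltW rad0)//.
      by rewrite lerXn2r ?nnegrE ?(ltW rad0).
    + by rewrite ler_wpM2l// lerXn2r ?nnegrE ?(ltW rad0).
have [K0 K00 hK0] := Lip.
have bmon s t : r0 <= s -> s <= t -> bb s <= bb t.
  move=> h1 h2; have s0 := ltW (pos0 s h1); have t0 := le_trans s0 h2.
  apply: ge0_ler_powR; rewrite ?nnegrE ?(ltW sg0) ?exprn_ge0//.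
  by rewrite lerXn2r ?nnegrE.
have bm0 := bp r0 r00.
have g21 v : v1 <= v -> g2 v <= g1 v.
  move=> hv; have [/andP[h1 h2] E1 _] := hg1 v (V1v v hv); have [/andP[h3 h4] E2 _] := hg2 v (V2v v hv).
  rewrite leNgt; apply/negP => lt21.
  have h5 := mon1 _ _ (ltW h1) lt21 h4.
  have h6 : V1 (g2 v) <= V2 (g2 v) by rewrite V12// h4 (ltW (lt_trans r00 h3)).
  by move: (lt_le_trans h5 h6); rewrite E1 E2 ltxx.
have flux_mono s t : r0 <= s -> s <= t -> t < rad -> s * k1 s <= t * k1 t.
  move=> h1 h2 h3; apply: (derive_ge0_le h2 (f := fun r => r * k1 r)
    (df := fun r => fb (V1 r) - (d%:R - 1) * k1 r)) => x /andP[h4 h5].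
  - have hx : 0 < x < rad by rewrite (pos0 x (le_trans h1 h4)) (le_lt_trans h5).
    exact: is_derive_cont (is_derive_flux a1 hx).
  - have hx : 0 < x < rad by rewrite (pos0 x (le_trans h1 (ltW h4))) (lt_trans h5).
    exact: (is_derive_flux a1 hx).
  - have hx : 0 < x < rad by rewrite (pos0 x (le_trans h1 (ltW h4))) (lt_trans h5).
    apply: le_trans (flux_derive_ge d0 a1 hx _).
      by rewrite divr_ge0// fb_ge0//; [exact: (fb_mono hF)|exact: (fb_neg hF)].
    move=> y /andP[y0 yx]; apply: (fb_mono hF).
    by apply: (radial_solution_mono s1 (ltW y0) (ltW yx)); case/andP: hx.
apply: (@boundary_gap_absurd R g1 g2 (Y k1 g1) (Y k2 g2)
  (fun v => (g1 v * k1 (g1 v)) `^ q) (fun v => (g2 v * k2 (g2 v)) `^ q) fb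
  (fun v => bb (g1 v)) (fun v => bb (g2 v)) v1 rad (K0 / bb r0) (sg / bb r0) c) => //.
- by rewrite divr_ge0// ltW.
- by rewrite divr_ge0// ltW.
- by move=> v hv; have [_ _ h1] := hg1 v (V1v v hv); have [_ _ h2] := hg2 v (V2v v hv).
- move=> v hv; have [/andP[h1 h2] _ _] := hg1 v (V1v v hv); have [/andP[h3 h4] _ _] := hg2 v (V2v v hv).
  split; apply: powR_gt0; apply: mulr_gt0; rewrite ?(pos0 _ (ltW h1)) ?(pos0 _ (ltW h3))//.
    by rewrite k1p// (ltW h1).
  by rewrite k2p// (ltW h3).
- move=> v hv; have [h1 E1 d1] := hg1 v (V1v v hv); have [h2 E2 d2] := hg2 v (V2v v hv).
  split.
    by apply: (dY V1) => //; rewrite k1p//; case/andP: h1 => /ltW ->.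
  by apply: (dY V2) => //; rewrite k2p//; case/andP: h2 => /ltW ->.
- move=> v hv; have [/andP[h1 h2] _ _] := hg2 v (V2v v hv).
  split; first by rewrite fb_ge0//; [exact: (fb_mono hF)|exact: (fb_neg hF)].
  rewrite /Y mulr_gt0 ?invr_gt0// powR_gt0// mulr_gt0 ?exprn_gt0 ?(lt_trans r00 h1)//.
  by rewrite k2p// (ltW h1).
- move=> v hv; have [/andP[h1 h2] _ _] := hg1 v (V1v v hv); have [/andP[h3 h4] _ _] := hg2 v (V2v v hv).
  have h5 := g21 v hv; split.
  + exact: ltW (bp _ (lt_trans r00 h3)).
  + exact: bmon (ltW h3) h5.
  + rewrite (le_trans (hK0 _ _ (ltW h3) h5 h2))//.
    have h6 : 1 <= bb (g2 v) / bb r0 by rewrite ler_pdivlMr// mul1r; exact: bmon (lexx _) (ltW h3).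
    rewrite (_ : K0 / bb r0 * _ * _ = K0 * (g1 v - g2 v) * (bb (g2 v) / bb r0)); last by ring.
    by rewrite ler_peMr// mulr_ge0// subr_ge0.
- move=> v hv; have [/andP[h1 h2] _ _] := hg1 v (V1v v hv); have [/andP[h3 h4] _ _] := hg2 v (V2v v hv).
  have gp1 := lt_trans r00 h1; have gp2 := lt_trans r00 h3.
  have kk1 : 0 < k1 (g1 v) by rewrite k1p// (ltW h1).
  have kk2 : 0 < k2 (g2 v) by rewrite k2p// (ltW h3).
  move=> /(powR_lt_inv_base q0); rewrite !YE ?(ltW kk1) ?(ltW kk2)//.
  have P1 : 0 < g1 v * k1 (g1 v) := mulr_gt0 gp1 kk1.
  have P2 : 0 < g2 v * k2 (g2 v) := mulr_gt0 gp2 kk2.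
  move=> /(_ (ltW P2) (ltW P1)) P12.
  have b12 := bmon _ _ (ltW h3) (g21 v hv); have b2p := bp _ gp2.
  have Q1 := powR_gt0 q P1; have Q2 := powR_gt0 q P2; have isg : 0 < sg^-1 by rewrite invr_gt0.
  move: (_ `^ q) Q1 ((g2 v * k2 (g2 v)) `^ q) Q2 => Q1 Q10 Q2 Q20.
  move: (bb (g2 v)) (bb (g1 v)) b12 b2p => B2 B1 B12 B20.
  rewrite (_ : Q1 * _ = sg^-1 * Q1 * Q2 * (B2 * (g2 v * k2 (g2 v)))); last by ring.
  rewrite (_ : Q2 * _ = sg^-1 * Q1 * Q2 * (B1 * (g1 v * k1 (g1 v)))); last by ring.
  rewrite ler_pM2l ?mulr_gt0//; apply: ler_pM => //; exact: ltW.
- move=> v hv; have [/andP[h1 h2] _ _] := hg1 v (V1v v hv).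
  have gp1 := lt_trans r00 h1; have kk1 : 0 < k1 (g1 v) by rewrite k1p// (ltW h1).
  rewrite YE ?(ltW kk1)//; have P1 : 0 < g1 v * k1 (g1 v) := mulr_gt0 gp1 kk1.
  have Q1 := powR_gt0 q P1.
  have b1 : bb r0 <= bb (g1 v) := bmon _ _ (lexx _) (ltW h1).
  have b2 : 1 <= bb (g1 v) / bb r0 by rewrite ler_pdivlMr// mul1r.
  rewrite (_ : sg / bb r0 * _ = (bb (g1 v) / bb r0) * ((g1 v * k1 (g1 v)) `^ q * (g1 v * k1 (g1 v)))); last first.
    have : sg != 0 by rewrite gt_eqF.
    have : bb r0 != 0 by rewrite gt_eqF.
    move: (_ `^ q) (bb r0) (bb (g1 v)) => A B C Bn sn.
    by field; rewrite Bn sn.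
  have h3 : (g1 v * k1 (g1 v)) `^ q * (g1 v * k1 (g1 v)) <=
     bb (g1 v) / bb r0 * ((g1 v * k1 (g1 v)) `^ q * (g1 v * k1 (g1 v))).
    by rewrite ler_peMl// mulr_ge0// ltW.
  apply: le_trans (_ : _ <= 1 + (g1 v * k1 (g1 v)) `^ q * (g1 v * k1 (g1 v))) _; last by rewrite lerD2l.
  move: (g1 v * k1 (g1 v)) P1 Q1 => P P0 Q0.
  have [P1|P1] := leP P 1.
    have h4 : P `^ q <= 1.
      have e1q : 1 `^ q = 1 :> R by rewrite powR1.
      by rewrite -[leRHS]e1q; apply: ge0_ler_powR; rewrite ?nnegrE ?(ltW q0) ?(ltW P0).
    have h5 : P `^ q ^+ 2 <= 1 by rewrite exprn_ile1// ltW.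
    by rewrite (le_trans h5)// lerDl mulr_ge0// ltW.
  have h4 : P `^ q <= P by rewrite -[leRHS]powRr1 ?(ltW P0)//; apply: ler_powR => //; exact: ltW.
  by rewrite ler_wpDl// expr2 ler_pM2l.
- by move=> v hv; have [/andP[_ ->] _ _] := hg1 v (V1v v hv); split=> //; exact: g21.
- move=> e e0; pose r' := Num.max ((r0 + rad) / 2) (rad - e / 2).
  have h1 : r' < rad by rewrite gt_max; apply/andP; split; lra.
  have h2 : r0 < r' by rewrite lt_max; apply/orP; left; lra.
  exists (Num.max v1 (V2 r' + 1)); first by rewrite le_max lexx.
  move=> v; rewrite ge_max => /andP[hv hv'].
  have [/andP[h3 h4] E2 _] := hg2 v (V2v v hv).
  have h5 : r' <= g2 v.
    rewrite leNgt; apply/negP => lt.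
    by have := mon2 _ _ (ltW h3) lt h1; rewrite E2; lra.
  have h6 : rad - e / 2 <= r' by rewrite le_max lexx orbT.
  by move: h5 h6 e0; lra.
- move=> v hv; have [/andP[h1 h2] E1 _] := hg1 v (V1v v hv); have [/andP[h3 h4] E2 _] := hg2 v (V2v v hv).
  have h5 := g21 v hv.
  have h6 : c <= V2 (g2 v) - V1 (g2 v).
    by apply: gap0; rewrite h4 andbT (le_trans rsrh)// ltW// (lt_trans rhr0).
  rewrite (le_trans h6)// E2 -{1}E1 (le_trans (ler_norm _))//.
  apply: (derive_dist_le h5 (df := fun r => (r * k1 r) `^ q)) => x /andP[h7 h8].
  - by apply: is_derive_cont (e1 x _); apply: in0; rewrite (le_trans (ltW h3) h7) (le_lt_trans h8).
  - by apply: e1; apply: in0; rewrite (ltW (lt_trans h3 h7)) (lt_trans h8).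
  - have xr0 : r0 <= x := ltW (lt_trans h3 h7).
    have xr : r0 <= x < rad by rewrite xr0 (lt_trans h8).
    rewrite ger0_norm ?powR_ge0//; apply: ge0_ler_powR; rewrite ?nnegrE ?(ltW q0)//.
    + by rewrite mulr_ge0 ?(ltW (pos0 x xr0))// ltW// k1p.
    + by rewrite mulr_ge0 ?(ltW (lt_trans r00 h1))// ltW// k1p// (ltW h1).
    + exact: flux_mono (ltW h8) h2.
Qed.

(** Argue by contradiction along radii increasing to rad: if every minimal large solution stayed
    above c at r, so would their decreasing limit W. But W is a large solution of radius rad above
    V, hence equal to V by uniqueness. *)
Lemma large_solution_inner rad r c V k : 0 <= r < rad -> large_solution rad V k ->
  (forall rad' n z k' G, rad <= rad' -> approximate_solution rad' n z k' G ->
    forall r, 0 <= r < rad -> z r <= V r) ->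
  V r < c -> exists rad' V' k', [/\ r < rad' < rad, large_solution rad' V' k' & V' r < c].
Proof.
move=> hr hV Vub Vc; have /andP[r0 rrad] := hr; have rad0 : 0 < rad := le_lt_trans r0 rrad.
apply: contrapT => noV.
(* Starting the denominators at 2 keeps every radius strictly above r. *)
pose R_ n := rad - (rad - r) / n.+2%:R.
have iv n : 0 < (n.+2%:R^-1 : R) <= 2^-1 by rewrite invr_gt0 ltr0n/= lef_pV2 ?posrE// ler_nat.
have Rn n : r < R_ n < rad.
  have /andP[h1 h2] := iv n; rewrite /R_; move: h1 h2; set i := _^-1 => h1 h2.
  have h3 : 0 < (rad - r) * i by rewrite mulr_gt0// subr_gt0.
  have h4 : (rad - r) * i <= (rad - r) * 2^-1 by rewrite ler_pM2l// subr_gt0.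
  by apply/andP; split; lra.
have R0 n : 0 < R_ n by case/andP: (Rn n) => h _; exact: le_lt_trans h.
have Rm n j : (n <= j)%N -> R_ n <= R_ j.
  move=> nj; rewrite /R_ lerD2l lerN2 ler_pM2l ?subr_gt0// lef_pV2 ?posrE// ler_nat.
  exact: nj.
have Rc t : t < rad -> exists n, t < R_ n.
  move=> trad; have e0 : 0 < (rad - t) / (rad - r) by rewrite divr_gt0// subr_gt0.
  have [N _ hN] := near_infty_natSinv_lt (PosNum e0).
  exists N; have := hN N (leqnn N); rewrite /= ltr_pdivlMr ?subr_gt0// => h.
  have h1 : N.+2%:R^-1 <= N.+1%:R^-1 :> R by rewrite lef_pV2 ?posrE// ler_nat.
  have h2 : (rad - r) * N.+2%:R^-1 <= (rad - r) * N.+1%:R^-1 by rewrite ler_pM2l// subr_gt0.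
  have h3 : (rad - r) / N.+2%:R < rad - t by apply: le_lt_trans h2 _; rewrite mulrC.
  by rewrite /R_ ltrBrDr addrC -ltrBrDr.
have /choice[w hw] : forall n, exists Vk : (R -> R) * (R -> R),
    [/\ large_solution (R_ n) Vk.1 Vk.2,
     forall s c, 0 <= s < R_ n -> c < Vk.1 s ->
      exists j z k' G, approximate_solution (R_ n) j z k' G /\ c < z s &
     forall rad' j z k' G, R_ n <= rad' -> approximate_solution rad' j z k' G ->
      forall s, 0 <= s < R_ n -> z s <= Vk.1 s].
  by move=> n; have [V' [k' h]] := large_solution_exists p2 hF d0 (R0 n); exists (V', k').
pose V_ n := (w n).1; pose k_ n := (w n).2.
have Vl n : large_solution (R_ n) (V_ n) (k_ n) by case: (hw n).
(* By minimality: V_j is reached from below by strict subsolutions of radius R_j >= R_n, and all of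
   these lie below V_n. *)
have Vm n j s : (n <= j)%N -> 0 <= s < R_ n -> V_ j s <= V_ n s.
  move=> nj hs; rewrite leNgt; apply/negP => lt.
  have [_ hj _] := hw j; have [_ _ hn] := hw n.
  have hs' : 0 <= s < R_ j by case/andP: hs => -> h; rewrite (lt_le_trans h (Rm _ _ nj)).
  have [i [z [k' [G [ha lt']]]]] := hj s _ hs' lt.
  by have := hn _ _ _ _ _ (Rm _ _ nj) ha s hs; rewrite leNgt lt'.
have cV n : c <= V_ n r.
  rewrite leNgt; apply/negP => lt; apply: noV; exists (R_ n), (V_ n), (k_ n); split=> //.
pose W s := inf [set V_ n (Num.max s 0) | n in [set n | Num.max s 0 < R_ n]].
have hinf s : 0 <= s < rad -> has_inf [set V_ n s | n in [set n | s < R_ n]].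
  move=> /andP[s0 sr]; have [n hn] := Rc s sr; split; first by exists (V_ n s); exists n.
  exists 0 => _ [j /= sj <-]; have [_ h _] := Vl j; apply: h.
  by rewrite s0.
have WE s : 0 <= s -> W s = inf [set V_ n s | n in [set n | s < R_ n]] by move=> s0; rewrite /W max_l.
have WV n s : 0 <= s -> s < R_ n -> W s <= V_ n s.
  move=> s0 sn; rewrite WE//; apply: ge_inf; last by exists n.
  have sr : 0 <= s < rad by rewrite s0 (lt_trans sn)//; case/andP: (Rn n).
  by case: (hinf s sr).
have Wlim s : 0 <= s < rad -> V_ n s @[n --> \oo] --> W s.
  move=> hs; have /andP[s0 _] := hs; apply/cvgrPdist_lt => e e0.
  have [_ [n /= sn <-]] := inf_adherent e0 (hinf s hs); rewrite -WE// => hn.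
  near=> j; have nj : (n <= j)%N by near: j; exact: nbhs_infty_ge.
  have sj : s < R_ j := lt_le_trans sn (Rm _ _ nj).
  rewrite ler0_norm ?subr_le0 ?WV//; have := Vm n j s nj; rewrite s0 sn => /(_ isT); lra.
(* V is not assumed to be reached from below by subsolutions, so the argument goes through a large
   solution V' that is; V <= V' by uniqueness, since minimality gives V' <= V. *)
have V1W s : 0 <= s < rad -> V s <= W s.
  move=> hs; have /andP[s0 _] := hs; rewrite WE//; apply: lb_le_inf; first by case: (hinf s hs).
  move=> _ [n /= sn <-]; have /andP[_ /ltW Rr] := Rn n.
  have [hl _ hub] := hw n; rewrite leNgt; apply/negP => lt.
  have [V' [k' [hl' hlow hub']]] := large_solution_exists p2 hF d0 rad0.
  have VV' : V s <= V' s.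
    apply: (large_solution_unique rad0 hl' hV _ hs) => t ht.
    rewrite leNgt; apply/negP => lt2.
    have [i [z [k2 [G [ha lt']]]]] := hlow t _ ht lt2.
    by have := Vub _ _ _ _ _ (lexx _) ha t ht; rewrite leNgt lt'.
  have [i [z [k2 [G [ha lt']]]]] := hlow s _ hs (lt_le_trans lt VV').
  have sn0 : 0 <= s < R_ n by rewrite s0 sn.
  by have := hub _ _ _ _ _ Rr ha s sn0; rewrite leNgt lt'.
have W0 s : s <= 0 -> W s = W 0 by move=> s0; rewrite /W max_r// maxxx.
have loc rho : 0 < rho < rad -> exists k, radial_solution rho W k (fun r => fb (W r)).
  move=> /andP[rho0 rr]; pose rho' := (rho + rad) / 2.
  have h1 : rho < rho' by rewrite /rho'; lra.
  have h2 : rho' < rad by rewrite /rho'; lra.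
  have [N hN'] := Rc rho' h2.
  have inR n t : 0 <= t < rho' -> 0 <= t < R_ (n + N)%N.
    by move=> /andP[-> h] /=; rewrite (lt_trans h)// (lt_le_trans hN')// Rm// leq_addl.
  apply: (radial_limit p2 hF d0 (z_ := fun n => V_ (n + N)%N) (k_ := fun n => k_ (n + N)%N)
    (G_ := fun n r => fb (V_ (n + N)%N r)) (e_ := fun=> 0)
    (B := `|V_ N rho'|) rho0 h1) => //.
  - move=> n; have [hs _ _] := Vl (n + N)%N; apply: radial_solution_sub hs.
    by rewrite (le_trans (ltW hN'))// Rm// leq_addl.
  - by move=> n t ht; rewrite !addr0 lexx.
  - by move=> n; rewrite lexx ler01.
  - exact: cvg_cst.
  - move=> n t ht; have [_ hnn _] := Vl (n + N)%N; rewrite ger0_norm ?hnn ?inR//.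
    rewrite (le_trans _ (ler_norm _))// (le_trans (Vm N (n + N)%N t (leq_addl _ _) _))//.
      by case/andP: ht => -> h; rewrite (lt_trans h).
    have [hs _ _] := Vl N; apply: (radial_solution_mono hs) => //; by case/andP: ht => // _ /ltW.
  - move=> t ht; have ht' : 0 <= t < rad by case/andP: ht => -> h; rewrite (lt_trans h).
    exact: (cvg_comp (addn^~ N) (fun n => V_ n t) (cvg_addnr N) (Wlim t ht')).
have [kW hkW] := radial_solution_glue p2 d0 rad0 W0 loc.
have hW : large_solution rad W kW.
  split=> //.
  - by move=> t ht; have [_ hnn _] := hV; exact: le_trans (hnn t ht) (V1W t ht).
  - move=> M; have [_ _ hl] := hV; have [t /andP[t0 tr] ht] := hl M.
    exists t; first by rewrite t0.
    move=> s h1 h2; apply: lt_le_trans (ht s h1 h2) (V1W s _).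
    by rewrite h2 (le_trans (ltW t0)).
have h1 := large_solution_unique rad0 hV hW V1W hr.
have h2 : c <= W r.
  rewrite WE//; apply: lb_le_inf; first by case: (hinf r hr).
  by move=> _ [n _ <-].
by move: Vc; rewrite ltNge (le_trans h2 h1).
Unshelve. all: by end_near. Qed.

End large_solution_uniqueness.

(** * Radial functions in several variables *)

Section radial_calculus.
Context {R : realType} {n : nat}.
Implicit Types (x z : 'rV[R]_n) (S : {set 'I_n}) (i j : 'I_n) (r t s rad : R).

Lemma squeeze0_continuous (T : topologicalType) (f b : T -> R) (x : T) :
  (\near x, `|f x| <= b x) -> {for x, continuous b} -> b x = 0 -> {for x, continuous f}.
Proof.
move=> fb cb b0; have f0 : f x = 0.
  by apply/eqP; rewrite -normr_le0 -b0; exact: nbhs_singleton fb.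
apply/cvgrPdist_lt => e e0; move/cvgrPdist_lt : cb => /(_ e e0) cb.
near=> y; rewrite f0 sub0r normrN.
apply: (@le_lt_trans _ _ (b y)); first by near: y.
have : `|b x - b y| < e by near: y.
by rewrite b0 sub0r normrN; apply: le_lt_trans; exact: ler_norm.
Unshelve. all: by end_near. Qed.

Lemma sum_continuous (T : topologicalType) (F : 'I_n -> T -> R) (x : T) :
  (forall i, {for x, continuous (F i)}) -> {for x, continuous (fun y => \sum_i F i y)}.
Proof.
move=> cF; have -> : (fun y => \sum_i F i y) = \sum_i F i by apply: funext => y; rewrite fct_sumE.
apply: (big_ind (fun f : T -> R => {for x, continuous f})); first exact: cst_continuous.
  by move=> f g cf cg; exact: (continuousD cf cg).
by move=> i _; exact: cF.
Qed.

Lemma is_derive_rV (F : 'rV[R]_n -> R) x i df :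
  is_derive x (delta_mx 0 i) F df <-> is_derive (0 : R) 1 (fun s : R => F (x + s *: delta_mx 0 i)) df.
Proof. by have := is_derive_line F x (delta_mx 0 i) 0 df; rewrite scale0r addr0. Qed.

Lemma is_derive_rV_comp (F : R -> R) (g : 'rV[R]_n -> R) x i a b :
  is_derive (g x) 1 F a -> is_derive x (delta_mx 0 i) g b ->
  is_derive x (delta_mx 0 i) (fun y => F (g y)) (a * b).
Proof.
move=> hF /is_derive_rV hg; apply/is_derive_rV.
apply: (is_derive_comp_fun (g := fun s => g (x + s *: delta_mx 0 i)) _ hg).
by rewrite scale0r addr0.
Qed.

Lemma is_derive_rVM (f g : 'rV[R]_n -> R) x i a b :
  is_derive x (delta_mx 0 i) f a -> is_derive x (delta_mx 0 i) g b ->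
  is_derive x (delta_mx 0 i) (fun y => f y * g y) (a * g x + f x * b).
Proof.
move=> /is_derive_rV hf /is_derive_rV hg; apply/is_derive_rV.
by apply: is_derive_eq (is_deriveM_fun hf hg) _; rewrite scale0r addr0.
Qed.

Lemma line_continuous (f : 'rV[R]_n -> R) x h : {for x, continuous f} ->
  {for (0 : R), continuous (fun s : R => f (x + s *: h))}.
Proof.
move=> cf; apply: (@continuous_comp _ _ _ (fun s : R => x + s *: h) f).
  apply: cvgD; first exact: cvg_cst.
  by apply: cvgZr_tmp; exact: cvg_id.
by rewrite /= scale0r addr0.
Qed.

(* A product whose second factor vanishes at the point is differentiable as soon as the first
   factor is continuous: this covers the degenerate points of the p-Laplacian flux. *)
Lemma is_derive_rV_mul0 (f g : 'rV[R]_n -> R) x i b : {for x, continuous f} -> g x = 0 ->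
  is_derive x (delta_mx 0 i) g b -> is_derive x (delta_mx 0 i) (fun y => f y * g y) (f x * b).
Proof.
move=> cf g0 /is_derive_rV/is_derive1_caratheodory[h [hE ch h0]].
apply/is_derive_rV/is_derive1_caratheodory.
exists (fun s => f (x + s *: delta_mx 0 i) * h s); split.
- move=> s; rewrite !scale0r !addr0 g0 mulr0 !subr0 -mulrA; congr (_ * _).
  by have := hE s; rewrite scale0r addr0 g0 !subr0.
- by apply: continuousM => //; exact: line_continuous.
- by rewrite scale0r addr0 h0.
Qed.

Lemma is_derive_coord x i j : is_derive x (delta_mx 0 i) (fun y : 'rV[R]_n => y 0 j) (i == j)%:R.
Proof.
apply/is_derive_rV.
have -> : (fun s : R => (x + s *: delta_mx 0 i) 0 j) = (fun s => x 0 j + (i == j)%:R * s).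
  by apply: funext => s; rewrite !mxE eqxx /= mulrC (eq_sym j).
have h := is_deriveD_fun (is_derive_cst (x 0 j) (0 : R) (1 : R))
  (is_deriveZ_fun (i == j)%:R (is_derive_id (0 : R) (1 : R))).
by apply: is_derive_eq h _; rewrite add0r mulr1.
Qed.

(** The set [S] selects the coordinates that enter the radius: all of them for balls, the first m
    for functions of x' continued constantly along the axis. One computation then serves balls and
    cylinders. *)
Definition offset S z x i : R := if i \in S then x 0 i - z 0 i else 0.

Definition radius S z x : R := Num.sqrt (\sum_j offset S z x j ^+ 2).

Variables (S : {set 'I_n}) (z : 'rV[R]_n).
Local Notation w := (offset S z).
Local Notation rr := (radius S z).

Lemma is_derive_offset x i j :
  is_derive x (delta_mx 0 i) (fun y => w y j) ((i == j) && (j \in S))%:R.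
Proof.
rewrite /offset; case: (j \in S); last by rewrite andbF; exact: (is_derive_cst (0 : R)).
rewrite andbT -[X in is_derive _ _ _ X]subr0.
exact: (is_deriveB (is_derive_coord x i j) (is_derive_cst (z 0 j) x (delta_mx 0 i))).
Qed.

Lemma offset_continuous j : continuous (fun x => w x j).
Proof.
rewrite /offset; case: (j \in S) => x; last exact: cst_continuous.
by apply: continuousB; [exact: coord_continuous|exact: cst_continuous].
Qed.

Lemma radius_ge0 x : 0 <= rr x. Proof. exact: sqrtr_ge0. Qed.

Let sum_ge0 x : 0 <= \sum_j w x j ^+ 2. Proof. by apply: sumr_ge0 => j _; exact: sqr_ge0. Qed.

Lemma sqr_radius x : rr x ^+ 2 = \sum_j w x j ^+ 2.
Proof. by rewrite sqr_sqrtr. Qed.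

Lemma offset_le_radius x j : `|w x j| <= rr x.
Proof.
rewrite -sqrtr_sqr ler_sqrt// (bigD1 j)//= lerDl.
by apply: sumr_ge0 => i _; exact: sqr_ge0.
Qed.

Lemma offset0 x j : rr x = 0 -> w x j = 0.
Proof. by move=> r0; apply/eqP; rewrite -normr_le0 -r0 offset_le_radius. Qed.

Lemma radius_continuous : continuous rr.
Proof.
move=> x; apply: (@continuous_comp _ _ _ (fun x => \sum_j w x j ^+ 2) Num.sqrt); last exact: sqrt_continuous.
apply: (sum_continuous (F := (fun j x => w x j ^+ 2))) => j.
by apply: (@continuousM _ _ (fun x => w x j) (fun x => w x j)); exact: offset_continuous.
Qed.

Lemma is_derive_radius x i : 0 < rr x -> is_derive x (delta_mx 0 i) rr (w x i / rr x).
Proof.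
move=> r0; have s0 : 0 < \sum_j w x j ^+ 2 by rewrite -sqrtr_gt0.
have hs : is_derive x (delta_mx 0 i) (fun y => \sum_j w y j ^+ 2) (2 * w x i).
  have -> : (fun y => \sum_j w y j ^+ 2) = \sum_j (fun y => w y j ^+ 2).
    by apply: funext => y; rewrite fct_sumE.
  have h := is_derive_sum (fun j => is_derive_rVM (is_derive_offset x i j) (is_derive_offset x i j)).
  apply: is_derive_eq h _; rewrite (bigD1 i)//= big1 ?addr0; last first.
    by move=> j /negPf ji; rewrite eq_sym ji /= mul0r mulr0 addr0.
  rewrite eqxx /= /offset; case: (i \in S); last by rewrite !mulr0 addr0.
  by rewrite mul1r mulr1 mulr_natl mulr2n.
have h := is_derive_rV_comp (is_derive1_sqrt s0) hs.
apply: is_derive_eq h _; rewrite -/(rr x) invfM mulrACA mulVf// mul1r mulrC//.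
Qed.

Lemma is_derive_radial (Z : R -> R) a x i : 0 < rr x -> is_derive (rr x) 1 Z a ->
  is_derive x (delta_mx 0 i) (fun y => Z (rr y)) (a * (w x i / rr x)).
Proof. by move=> r0 hZ; exact: (is_derive_rV_comp hZ (is_derive_radius i r0)). Qed.

(** The radius is not differentiable at the centre, but a profile of slope 0 there is: along a
    coordinate line it becomes Z(|s|), whose slope function is that of Z times a sign and tends to
    0. *)
Lemma is_derive_radial0 (Z : R -> R) x i : rr x = 0 -> is_derive (0 : R) 1 Z 0 ->
  is_derive x (delta_mx 0 i) (fun y => Z (rr y)) 0.
Proof.
move=> r0 /is_derive1_caratheodory[g [gE cg g0]]; apply/is_derive_rV.
have rE s : rr (x + s *: delta_mx 0 i) = (i \in S)%:R * `|s|.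
  have oE j : w (x + s *: delta_mx 0 i) j = w x j + s * ((i == j) && (j \in S))%:R.
    rewrite /offset; case: (j \in S); last by rewrite andbF mulr0 addr0.
    by rewrite !mxE eqxx /= andbT (eq_sym j) addrAC.
  rewrite /radius (bigD1 i)//= big1 ?addr0; last first.
    by move=> j /negPf ji; rewrite oE offset0// eq_sym ji /= mulr0 addr0 expr0n.
  rewrite oE offset0// eqxx /= add0r sqrtr_sqr normrM mulrC; congr (_ * _).
  by rewrite ger0_norm.
have -> : (fun s : R => Z (rr (x + s *: delta_mx 0 i))) = (fun s => Z ((i \in S)%:R * `|s|)).
  by apply: funext => s; rewrite rE.
case: (i \in S); last first.
  have -> : (fun s : R => Z (false%:R * `|s|)) = cst (Z 0) by apply: funext => s; rewrite mul0r.
  exact: (is_derive_cst (Z 0)).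
have -> : (fun s : R => Z (true%:R * `|s|)) = (fun s => Z `|s|) by apply: funext => s; rewrite mul1r.
apply/is_derive1_caratheodory; exists (fun s => g `|s| * Num.sg s); split.
- move=> s; rewrite normr0 gE !subr0 -mulrA; congr (_ * _).
  exact: normrEsg.
- apply: (squeeze0_continuous (b := fun s => `|g `|s| |)).
  + near=> s; rewrite normrM ler_piMr// normr_sg.
    by case: (s != 0).
  + apply: (@continuous_comp _ _ _ (fun s : R => g `|s|) Num.norm); last exact: norm_continuous.
    have cg' : {for `|0 : R|, continuous g} by rewrite normr0.
    exact: (@continuous_comp _ _ _ (@Num.norm R R) g 0 (@norm_continuous _ _ _) cg').
  + by rewrite normr0 g0 normr0.
- by rewrite sgr0 mulr0.
Unshelve. all: by end_near. Qed.

(** Writing k' as eta/r gives one formula everywhere. At the centre the quotient is 0/0, which is 0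
    by convention, and only the term k(0) remains. *)
Lemma is_derive_radial_field (k eta : R -> R) rad x i j :
  (forall r, 0 <= r < rad -> {for r, continuous k}) ->
  (forall r, 0 < r < rad -> is_derive r 1 k (eta r / r)) -> rr x < rad ->
  is_derive x (delta_mx 0 i) (fun y => k (rr y) * w y j)
    (k (rr x) * ((i == j) && (j \in S))%:R + eta (rr x) * (w x i * w x j / rr x ^+ 2)).
Proof.
move=> ck dk xrad; have := radius_ge0 x; rewrite le_eqVlt => /orP[/eqP r0|r0].
  have ckr : {for x, continuous (fun y => k (rr y))}.
    by apply: (@continuous_comp _ _ _ rr k); [exact: radius_continuous|apply: ck; rewrite radius_ge0].
  have h := is_derive_rV_mul0 ckr (offset0 j (esym r0)) (is_derive_offset x i j).
  by apply: is_derive_eq h _; rewrite (offset0 j)// mulr0 mul0r mulr0 addr0.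
have hr : 0 < rr x < rad by rewrite r0.
have h := is_derive_rVM (is_derive_radial i r0 (dk _ hr)) (is_derive_offset x i j).
apply: is_derive_eq h _; rewrite addrC; congr (_ + _).
have : rr x != 0 by rewrite gt_eqF.
by move: (rr x) (w x i) (w x j) (eta _) => a b c e an; field.
Qed.

Lemma radial_continuous (Z : R -> R) rad x : (forall r, 0 <= r < rad -> {for r, continuous Z}) ->
  rr x < rad -> {for x, continuous (fun y => Z (rr y))}.
Proof.
move=> cZ xrad; apply: (@continuous_comp _ _ _ rr Z); first exact: radius_continuous.
by apply: cZ; rewrite radius_ge0.
Qed.

(** The quotient is bounded by 1 but has no limit at the centre; eta(0) = 0 squeezes the product to
    0. *)
Lemma radial_quotient_continuous (eta : R -> R) rad x i j :
  (forall r, 0 <= r < rad -> {for r, continuous eta}) -> eta 0 = 0 -> rr x < rad ->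
  {for x, continuous (fun x => eta (rr x) * (w x i * w x j / rr x ^+ 2))}.
Proof.
move=> ce e0 xrad; have cr := radial_continuous ce xrad.
have := radius_ge0 x; rewrite le_eqVlt => /orP[/eqP r0|r0].
  apply: (squeeze0_continuous (b := fun y => `|eta (rr y)|)).
  - near=> y; rewrite normrM ler_piMr//.
    have := radius_ge0 y; rewrite le_eqVlt => /orP[/eqP <-|ry].
      by rewrite expr0n invr0 mulr0 normr0.
    rewrite normf_div [X in _ / X]ger0_norm ?sqr_ge0// ler_pdivrMr ?exprn_gt0// mul1r normrM expr2.
    by apply: ler_pM => //; exact: offset_le_radius.
  - by apply: (@continuous_comp _ _ _ (fun y => eta (rr y)) Num.norm) => //; exact: norm_continuous.
  - by rewrite -r0 e0 normr0.
apply: continuousM; first exact: cr.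
apply: continuousM; first by apply: continuousM; exact: offset_continuous.
apply: (@continuousV _ _ (fun y => rr y ^+ 2)); first by rewrite sqrf_eq0 gt_eqF.
by apply: (@continuousM _ _ rr rr); exact: radius_continuous.
Unshelve. all: by end_near. Qed.

Lemma radial_gradient_continuous (eta : R -> R) rad x i :
  (forall r, 0 <= r < rad -> {for r, continuous eta}) -> eta 0 = 0 -> rr x < rad ->
  {for x, continuous (fun x => eta (rr x) * (w x i / rr x))}.
Proof.
move=> ce e0 xrad; have cr := radial_continuous ce xrad.
have := radius_ge0 x; rewrite le_eqVlt => /orP[/eqP r0|r0].
  apply: (squeeze0_continuous (b := fun y => `|eta (rr y)|)).
  - near=> y; rewrite normrM ler_piMr//.
    have := radius_ge0 y; rewrite le_eqVlt => /orP[/eqP <-|ry].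
      by rewrite invr0 mulr0 normr0.
    rewrite normf_div [X in _ / X]gtr0_norm// ler_pdivrMr// mul1r.
    exact: offset_le_radius.
  - by apply: (@continuous_comp _ _ _ (fun y => eta (rr y)) Num.norm) => //; exact: norm_continuous.
  - by rewrite -r0 e0 normr0.
apply: continuousM; first exact: cr.
apply: continuousM; first exact: offset_continuous.
by apply: (@continuousV _ _ rr); [rewrite gt_eqF|exact: radius_continuous].
Unshelve. all: by end_near. Qed.

Lemma powR_flux (p t : R) : 2 <= p -> 0 <= t ->
  (t `^ (p - 1)^-1) `^ (p - 2) * t `^ (p - 1)^-1 = t.
Proof.
move=> p2; have p10 : p - 1 != 0 by rewrite gt_eqF//; move: p2; lra.
rewrite le_eqVlt => /orP[/eqP <-|t0]; first by rewrite powR0 ?mulr0// invr_eq0.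
have b0 : 0 < t `^ (p - 1)^-1 := powR_gt0 _ t0.
have -> : p - 2 = p - 1 - 1 by ring.
by rewrite -(powR_split (p - 1) b0) -powRrM mulVf// powRr1// ltW.
Qed.

(** The flux field is k(r) times the offset vector. It is C^1 in the sense of [divergence_weak] even
    where the gradient vanishes, so second derivatives of Z never appear. Its divergence is #|S| k +
    r k' = G. *)
Lemma radial_plaplace_weak (p rad : R) (Z k G : R -> R) (O : set 'rV[R]_n) : 2 <= p ->
  radial_solution #|S| p rad Z k G -> (forall r, 0 <= r < rad -> {for r, continuous G}) ->
  (0 < #|S|)%N -> (forall x, O x -> rr x < rad) ->
  plaplace_weak p O (fun x => Z (rr x))
    (fun x => \row_i (Num.max (rr x * k (rr x)) 0 `^ (p - 1)^-1 * (w x i / rr x)))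
    (fun x => G (rr x)).
Proof.
move=> p2 hs cG S0 Orad; have [[ck dk] dZ k0 k00] := hs.
have q0 : 0 < (p - 1)^-1 by rewrite invr_gt0; move: p2; lra.
pose dz r := Num.max (r * k r) 0 `^ (p - 1)^-1.
have dzE r : 0 <= r < rad -> dz r = (r * k r) `^ (p - 1)^-1.
  by move=> hr; rewrite /dz max_l// mulr_ge0// ?k0//; case/andP: hr.
have dz0 : dz 0 = 0 by rewrite /dz mul0r maxxx powR0// gt_eqF.
have cdz r : 0 <= r < rad -> {for r, continuous dz}.
  move=> hr; apply: (@continuous_comp _ _ _ (fun s => s * k s) (fun t => Num.max t 0 `^ (p - 1)^-1)).
    by apply: continuousM; [exact: cvg_id|exact: ck].
  exact: (@continuous_powR_pos R _ q0).
have inr x : O x -> 0 <= rr x < rad by move=> Ox; rewrite radius_ge0 Orad.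
pose Du x : 'rV[R]_n := \row_i (dz (rr x) * (w x i / rr x)).
pose A x : 'rV[R]_n := \row_i (k (rr x) * w x i).
have DuE x : enorm (Du x) = dz (rr x).
  rewrite /enorm (_ : dot _ _ = dz (rr x) ^+ 2) ?sqrtr_sqr ?ger0_norm ?powR_ge0//.
  rewrite /dot; under eq_bigr do rewrite mxE.
  have := radius_ge0 x; rewrite le_eqVlt => /orP[/eqP <-|r0].
    by rewrite dz0 expr0n/= big1// => i _; rewrite !mul0r.
  rewrite (eq_bigr (fun i => dz (rr x) ^+ 2 / rr x ^+ 2 * w x i ^+ 2)); last first.
    move=> i _; have : rr x != 0 by rewrite gt_eqF.
    by move: (rr x) (w x i) (dz _) => a b c an; field.
  by rewrite -mulr_sumr -sqr_radius divfK// sqrf_eq0 gt_eqF.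
have AE x i : O x -> dz (rr x) `^ (p - 2) * Du x 0 i = A x 0 i.
  move=> Ox; rewrite !mxE; have := radius_ge0 x; rewrite le_eqVlt => /orP[/eqP r0|r0].
    by rewrite offset0// mul0r !mulr0.
  rewrite mulrA dzE ?inr// powR_flux//; last by rewrite mulr_ge0 ?radius_ge0// k0// inr.
  have : rr x != 0 by rewrite gt_eqF.
  by move: (rr x) (w x i) (k _) => a b c an; field.
split.
  apply: C1_W1p_loc.
  - by move: p2; lra.
  - move=> x Ox; apply: (@radial_continuous _ rad); last exact: Orad.
    by move=> r hr; exact: is_derive_cont (dZ r hr).
  - move=> i x Ox; rewrite mxE; have := radius_ge0 x; rewrite le_eqVlt => /orP[/eqP r0|r0].
      rewrite -/(dz _) -r0 dz0 mul0r; apply: is_derive_radial0 => //.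
      by have := dZ (rr x) (inr x Ox); rewrite -dzE ?inr// -r0 dz0.
    by apply: is_derive_radial => //; rewrite -/(dz _) dzE ?inr//; exact: (dZ _ (inr x Ox)).
  - move=> i x Ox; have := @radial_gradient_continuous dz rad x i cdz dz0 (Orad x Ox).
    have -> // : (fun x => Du x 0 i) = (fun x => dz (rr x) * (w x i / rr x)).
    by apply: funext => y; rewrite mxE.
move=> D ci phi Dphi hphi; have [_ _ DO] := ci.
(* This is r k'; it vanishes at the centre because k(0) = G(0) / #|S|. *)
pose eta r := G r - #|S|%:R * k r.
have eta0 : eta 0 = 0 by rewrite /eta k00 mulrCA divff ?mulr1 ?subrr// pnatr_eq0 -lt0n.
have ceta r : 0 <= r < rad -> {for r, continuous eta}.
  move=> hr; apply: continuousB; first exact: cG.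
  by apply: continuousM; [exact: cst_continuous|exact: ck].
have p1 : 1 <= p by move: p2; lra.
rewrite -(@divergence_weak R n p O D A
  (fun i x => k (rr x) * ((i == i) && (i \in S))%:R + eta (rr x) * (w x i * w x i / rr x ^+ 2))
  (fun x => G (rr x)) p1 ci _ _ _ _ phi Dphi hphi).
- congr (- _)%E; apply: eq_integral => x; rewrite inE => Dx.
  have Ox : O x := DO x (subset_closure Dx).
  change ((enorm (Du x) `^ (p - 2) * dot (Du x) (Dphi x))%:E = (dot (A x) (Dphi x))%:E).
  rewrite DuE; congr (_%:E); rewrite /dot mulr_sumr; apply: eq_bigr => i _.
  by rewrite mulrA AE.
- move=> i x Ox; have -> : (fun y => A y 0 i) = (fun y => k (rr y) * w y i).
    by apply: funext => y; rewrite mxE.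
  by apply: continuousM; [exact: radial_continuous ck (Orad x Ox)|exact: offset_continuous].
- move=> i x Ox; have h := is_derive_radial_field i i ck dk (Orad x Ox).
  by have -> : (fun y => A y 0 i) = (fun y => k (rr y) * w y i) by apply: funext => y; rewrite mxE.
- move=> i x Ox; apply: continuousD; last exact: (@radial_quotient_continuous eta rad x i i ceta eta0 (Orad x Ox)).
  by apply: continuousM; [exact: radial_continuous ck (Orad x Ox)|exact: cst_continuous].
- move=> x Ox; rewrite big_split/= -!mulr_sumr.
  have -> : \sum_i ((i == i) && (i \in S))%:R = #|S|%:R :> R.
    rewrite -sum1_card natr_sum [RHS]big_mkcond/=; apply: eq_bigr => i _.
    by rewrite eqxx; case: (i \in S).
  have := radius_ge0 x; rewrite le_eqVlt => /orP[/eqP r0|r0].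
    by rewrite -r0 eta0 mul0r addr0 k00 divfK// pnatr_eq0 -lt0n.
  rewrite -mulr_suml; under [X in _ + _ * (X / _)]eq_bigr do rewrite -expr2.
  by rewrite -sqr_radius divff ?sqrf_eq0 ?gt_eqF// mulr1 /eta mulrC addrC subrK.
Qed.

End radial_calculus.

(** * The p-Laplacian of a function with C^1 gradient *)

Section smooth_flux.
Context {R : realType} {n : nat}.
Variables (p : R) (p2 : 2 <= p) (O : set 'rV[R]_n) (xi : 'rV[R]_n -> 'rV[R]_n).
Variable H : 'I_n -> 'I_n -> 'rV[R]_n -> R.
Hypothesis dxi : forall i j x, O x -> is_derive x (delta_mx 0 i) (fun y => xi y 0 j) (H i j x).
Hypothesis cxi : forall j x, O x -> {for x, continuous (fun y => xi y 0 j)}.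
Hypothesis cH : forall i j x, O x -> {for x, continuous (H i j)}.
Local Notation N x := (enorm (xi x)).

Lemma coord_le_enorm (v : 'rV[R]_n) j : `|v 0 j| <= enorm v.
Proof.
rewrite -sqrtr_sqr ler_sqrt; last by apply: sumr_ge0 => i _; rewrite -expr2 sqr_ge0.
by rewrite /dot (bigD1 j)//= -expr2 lerDl; apply: sumr_ge0 => i _; rewrite -expr2 sqr_ge0.
Qed.

Let N_continuous x : O x -> {for x, continuous (fun y => N y)}.
Proof.
move=> Ox; apply: (@continuous_comp _ _ _ (fun x => dot (xi x) (xi x)) Num.sqrt); last exact: sqrt_continuous.
apply: (sum_continuous (F := (fun j x => xi x 0 j * xi x 0 j))) => j.
by apply: (@continuousM _ _ (fun x => xi x 0 j) (fun x => xi x 0 j)); exact: cxi.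
Qed.

Let is_derive_N i x : O x -> 0 < N x ->
  is_derive x (delta_mx 0 i) (fun y => N y) ((\sum_j xi x 0 j * H i j x) / N x).
Proof.
move=> Ox N0; have s0 : 0 < dot (xi x) (xi x) by rewrite -sqrtr_gt0.
have hs : is_derive x (delta_mx 0 i) (fun y => dot (xi y) (xi y)) (2 * \sum_j xi x 0 j * H i j x).
  have -> : (fun y => dot (xi y) (xi y)) = \sum_j (fun y => xi y 0 j * xi y 0 j).
    by apply: funext => y; rewrite fct_sumE.
  have h := is_derive_sum (fun j => is_derive_rVM (dxi i j Ox) (dxi i j Ox)).
  apply: is_derive_eq h _; rewrite mulr_sumr; apply: eq_bigr => j _.
  by rewrite mulrC mulr_natl mulr2n.
have h := @is_derive_rV_comp R n Num.sqrt (fun y => dot (xi y) (xi y)) x i _ _ (is_derive1_sqrt s0) hs.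
by apply: is_derive_eq h _; rewrite -/(enorm (xi x)) invfM mulrACA mulVf// mul1r mulrC.
Qed.

Let M x := N x `^ (p - 2).

Let M_continuous x : O x -> {for x, continuous M}.
Proof.
move=> Ox; have [p20|p20] := eqVneq p 2.
  have -> : M = cst 1 by apply: funext => y; rewrite /M p20 subrr powRr0.
  exact: cst_continuous.
have p0 : 0 < p - 2 by rewrite subr_gt0 lt_neqAle eq_sym p20.
have -> : M = (fun y => Num.max (N y) 0 `^ (p - 2)).
  by apply: funext => y; rewrite max_l// enorm_ge0.
exact: (@continuous_comp _ _ _ (fun y => N y) (fun t => Num.max t 0 `^ (p - 2)) x
  (N_continuous Ox) (@continuous_powR_pos R _ p0 _)).
Qed.

(** The exponent p - 3 may be negative, but together with the two factors linear in xi and the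
    division by N the second term is of order N^(p-2); where xi vanishes its last factor makes it
    0. *)
Definition flux_pderiv i x : R := N x `^ (p - 2) * H i i x +
  (p - 2) * (N x `^ (p - 3) * ((\sum_j xi x 0 j * H i j x) / N x) * xi x 0 i).

Lemma is_derive_flux_coord i x : O x ->
  is_derive x (delta_mx 0 i) (fun y => N y `^ (p - 2) * xi y 0 i) (flux_pderiv i x).
Proof.
move=> Ox; have := enorm_ge0 (xi x); rewrite le_eqVlt => /orP[/eqP N0|N0].
  have x0 : xi x 0 i = 0 by apply/eqP; rewrite -normr_le0 N0 coord_le_enorm.
  have h := is_derive_rV_mul0 (M_continuous Ox) x0 (dxi i i Ox).
  by apply: is_derive_eq h _; rewrite /flux_pderiv x0 !mulr0 addr0.
have h1 := @is_derive_rV_comp R n (fun t => t `^ (p - 2)) (fun y => N y) x i _ _ (is_derive1_powR (p - 2) N0) (is_derive_N i Ox N0).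
apply: is_derive_eq (is_derive_rVM h1 (dxi i i Ox)) _.
by rewrite /flux_pderiv addrC (_ : p - 2 - 1 = p - 3) ?mulrA//; ring.
Qed.

(** At a zero of xi the second term is squeezed by (p-2) N^(p-2) times a sum of |H|. For p > 2 the
    power vanishes there, for p = 2 the coefficient does. *)
Lemma flux_pderiv_continuous i x : O x -> {for x, continuous (flux_pderiv i)}.
Proof.
move=> Ox; apply: continuousD.
  by apply: continuousM; [exact: M_continuous|exact: cH].
have cS : {for x, continuous (fun y => \sum_j xi y 0 j * H i j y)}.
  apply: (sum_continuous (F := (fun j x => xi x 0 j * H i j x))) => j.
  by apply: (@continuousM _ _ (fun x => xi x 0 j) (fun x => H i j x)); [exact: cxi|exact: cH].
have := enorm_ge0 (xi x); rewrite le_eqVlt => /orP[/eqP N0|N0]; last first.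
  apply: continuousM; first exact: cst_continuous.
  apply: continuousM; last exact: cxi.
  apply: continuousM.
    apply: (@continuous_comp _ _ _ (fun y => N y) (fun t => t `^ (p - 3))); first exact: N_continuous.
    exact: is_derive_cont (is_derive1_powR (p - 3) N0).
  apply: continuousM; first exact: cS.
  by apply: (@continuousV _ _ (fun y => N y)); [rewrite gt_eqF|exact: N_continuous].
apply: (squeeze0_continuous (b := fun y => (p - 2) * (M y * \sum_j `|H i j y|))).
- near=> y; rewrite normrM ger0_norm ?subr_ge0// ler_wpM2l ?subr_ge0//.
  have := enorm_ge0 (xi y); rewrite le_eqVlt => /orP[/eqP Ny|Ny].
    have -> : xi y 0 i = 0 by apply/eqP; rewrite -normr_le0 Ny coord_le_enorm.
    by rewrite mulr0 normr0 mulr_ge0 ?powR_ge0// sumr_ge0.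
  have e1 : M y = N y `^ (p - 3) * N y.
    by rewrite /M (_ : p - 3 = p - 2 - 1) -?powR_split//; ring.
  rewrite !normrM (ger0_norm (powR_ge0 _ _)) e1.
  rewrite (_ : _ * _ * \sum_j _ = N y `^ (p - 3) * (\sum_j `|H i j y|) * N y); last by ring.
  apply: ler_pM => //; [by rewrite !mulr_ge0 ?powR_ge0| |exact: coord_le_enorm].
  rewrite ler_wpM2l ?powR_ge0// normfV (gtr0_norm Ny) ler_pdivrMr//.
  rewrite (le_trans (ler_norm_sum _ _ _))// mulr_suml; apply: ler_sum => j _.
  by rewrite normrM mulrC ler_wpM2l// coord_le_enorm.
- apply: continuousM; first exact: cst_continuous.
  apply: continuousM; first exact: M_continuous.
  apply: (sum_continuous (F := (fun j x => `|H i j x|))) => j.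
  by apply: (@continuous_comp _ _ _ (H i j) Num.norm); [exact: cH|exact: norm_continuous].
- have [->|p20] := eqVneq p 2; first by rewrite subrr mul0r.
  by rewrite /M -N0 powR0 ?mul0r ?mulr0// subr_eq0.
Unshelve. all: by end_near. Qed.

Lemma C1_plaplace_weak (u : 'rV[R]_n -> R) (g : 'rV[R]_n -> R) : open O ->
  (forall x, O x -> {for x, continuous u}) ->
  (forall i x, O x -> is_derive x (delta_mx 0 i) u (xi x 0 i)) ->
  (forall x, O x -> \sum_i flux_pderiv i x = g x) -> plaplace_weak p O u xi g.
Proof.
move=> oO cu du hg; split; first by apply: C1_W1p_loc => //; move: p2; lra.
move=> D ci phi Dphi hphi; have [_ _ DO] := ci.
have p1 : 1 <= p by move: p2; lra.
rewrite -(@divergence_weak R n p O D (fun x => \row_i (N x `^ (p - 2) * xi x 0 i))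
  flux_pderiv g p1 ci _ _ _ _ phi Dphi hphi) => //.
- congr (- _)%E; apply: eq_integral => x _; congr (_%:E).
  by rewrite /dot mulr_sumr; apply: eq_bigr => i _; rewrite mxE mulrA.
- move=> i x Ox; have -> : (fun y => (\row_i (N y `^ (p - 2) * xi y 0 i)) 0 i) = (fun y => M y * xi y 0 i).
    by apply: funext => y; rewrite mxE.
  by apply: continuousM; [exact: M_continuous|exact: cxi].
- move=> i x Ox; have h := is_derive_flux_coord i Ox.
  by have -> : (fun y => (\row_i (N y `^ (p - 2) * xi y 0 i)) 0 i) = (fun y => N y `^ (p - 2) * xi y 0 i)
    by apply: funext => y; rewrite mxE.
- by move=> i x Ox; exact: flux_pderiv_continuous.
Qed.

End smooth_flux.

(** * Barriers on the capped cylinders *)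

Section radial_scaling.
Context {R : realType}.

(** Slopes scale by lam, fluxes by lam^(p-1) and right-hand sides by lam^p. With lam < 1 a solution
    becomes a supersolution on a larger ball. *)
Lemma radial_solution_scale (d : nat) (p rad lam : R) (Z k G : R -> R) : 2 <= p -> 0 < lam ->
  radial_solution d p rad Z k G ->
  radial_solution d p (rad / lam) (fun r => Z (lam * r)) (fun r => lam `^ p * k (lam * r))
    (fun r => lam `^ p * G (lam * r)).
Proof.
move=> p2 l0 [[ck dk] dZ k0 k00].
have inr (r : R) : 0 <= r < rad / lam -> 0 <= lam * r < rad.
  by move=> /andP[r0 rr]; rewrite mulr_ge0 ?(ltW l0)//= mulrC -ltr_pdivlMr.
have dl (r : R) : is_derive r 1 (fun r : R => lam * r) lam.
  by apply: is_derive_eq (is_deriveZ_fun lam (is_derive_id r (1 : R))) _; rewrite mulr1.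
split.
- split=> r hr.
    apply: continuousM; first exact: cst_continuous.
    apply: (@continuous_comp _ _ _ (fun r : R => lam * r) k); last exact: (ck _ (inr r hr)).
    exact: is_derive_cont (dl r).
  have hr' : 0 < lam * r < rad.
    by case/andP: hr => r0 rr; rewrite mulr_gt0//= mulrC -ltr_pdivlMr.
  have h := is_deriveZ_fun (lam `^ p) (is_derive_comp_fun (f := k) (dk _ hr') (dl r)).
  apply: is_derive_eq h _; have rn : r != 0 by case/andP: hr => r0 _; rewrite gt_eqF.
  have ln : lam != 0 by rewrite gt_eqF.
  by move: (lam `^ p) (G _) (k _) => A B C; field; rewrite ln rn.
- move=> r hr; have h := is_derive_comp_fun (f := Z) (dZ _ (inr r hr)) (dl r).
  apply: is_derive_eq h _; have k0r := k0 _ (inr r hr); have /andP[r0 _] := hr.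
  have p10 : p - 1 != 0 by rewrite gt_eqF//; move: p2; lra.
  rewrite (powR_split p l0) (_ : r * _ = lam `^ (p - 1) * (lam * r * k (lam * r))); last by ring.
  rewrite [RHS]powRM ?powR_ge0//; last by rewrite !mulr_ge0 ?(ltW l0).
  by rewrite -powRrM mulfV// powRr1 ?(ltW l0)// mulrC.
- by move=> r /inr hr; rewrite mulr_ge0 ?powR_ge0// k0.
- by rewrite mulr0 k00 mulrA.
Qed.

End radial_scaling.

(** * Comparison with barriers and the interior bound *)

Section solutions.
Context {R : realType} {n : nat}.
Variables (p : R) (p2 : 2 <= p) (f : R -> R) (hF : condition_F p f).
Implicit Types (O K : set 'rV[R]_n) (u W g : 'rV[R]_n -> R) (x z : 'rV[R]_n).
Local Notation fb := (extend_by_zero f).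

Definition continuous_solution O u : Prop :=
  [/\ exists Du, plaplace_weak p O u Du (fun x => fb (u x)),
      forall x, O x -> {for x, continuous u} & forall x, O x -> 0 <= u x].

Lemma weak_solution_continuous O u : open O -> weak_solution p f O u ->
  {within O, continuous u} -> continuous_solution O u.
Proof.
move=> oO [u0 [Du hW hu]]; rewrite continuous_open_subspace// => cu; split=> //.
  exists Du; split=> // D ci phi Dphi hphi; rewrite (hu D ci phi Dphi hphi).
  apply: eq_integral => x; rewrite inE => Dx; rewrite (fbE f (u0 _ _))//.
  by have [_ _ h] := ci; apply: h; exact: subset_closure.
by move=> x Ox; apply: cu; rewrite inE.
Qed.

Lemma compactly_insideS D O O' : O' `<=` O -> compactly_inside D O' -> compactly_inside D O.
Proof. by move=> OO [h1 h2 h3]; split=> //; exact: subset_trans h3 OO. Qed.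

Lemma continuous_solutionS O O' u : O' `<=` O -> continuous_solution O u -> continuous_solution O' u.
Proof.
move=> OO [[Du [h1 h2]] cu u0]; split.
- by exists Du; split=> D /(compactly_insideS OO); [exact: h1|exact: h2].
- by move=> x /OO; exact: cu.
- by move=> x /OO; exact: u0.
Qed.

Let fbu_continuous O u : (forall x, O x -> {for x, continuous u}) ->
  forall x, O x -> {for x, continuous (fun x => fb (u x))}.
Proof.
move=> cu x Ox; apply: (@continuous_comp _ _ _ u fb); first exact: cu.
exact: (fb_continuous hF).
Qed.

Lemma lower_barrier O K u W DW g : open O -> compact K -> K `<=` O -> continuous_solution O u ->
  plaplace_weak p O W DW g -> (forall x, O x -> {for x, continuous W}) ->
  (forall x, O x -> {for x, continuous g}) ->
  (forall x, O x -> ~ K x -> W x <= u x) -> (forall x, O x -> fb (W x) < g x) ->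
  forall x, O x -> W x <= u x.
Proof.
move=> oO cK KO [[Du hu] cu _] hW cW cg Wu hg.
apply: (plaplace_comparison p2 oO cK KO cW cu cg (fbu_continuous cu) hW hu Wu) => x Ox /ltW ltu.
by apply: le_lt_trans (hg x Ox); exact: (fb_mono hF).
Qed.

Lemma upper_barrier O K u W DW g : open O -> compact K -> K `<=` O -> continuous_solution O u ->
  plaplace_weak p O W DW g -> (forall x, O x -> {for x, continuous W}) ->
  (forall x, O x -> {for x, continuous g}) ->
  (forall x, O x -> ~ K x -> u x <= W x) -> (forall x, O x -> g x < fb (W x)) ->
  forall x, O x -> u x <= W x.
Proof.
move=> oO cK KO [[Du hu] cu _] hW cW cg Wu hg.
apply: (plaplace_comparison p2 oO cK KO cu cW (fbu_continuous cu) cg hu hW Wu) => x Ox /ltW ltu.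
by apply: lt_le_trans (hg x Ox) _; exact: (fb_mono hF).
Qed.

Lemma closed_bounded_compact K (M : R) : closed K -> (forall x i, K x -> `|x 0 i| <= M) -> compact K.
Proof. by move=> clK KM; apply: (subclosed_compact clK (@cube_compact R n M)) => x Kx i; exact: KM. Qed.

Lemma radius_ball_compact z (rho : R) : compact [set x | radius [set: 'I_n] z x <= rho].
Proof.
apply: (@closed_bounded_compact _ (`|z| + rho)).
  apply: (@closed_comp _ _ (radius [set: 'I_n] z) [set t : R | t <= rho]) => [x _|].
    exact: radius_continuous.
  exact: closed_le.
move=> x i /= xr; have h := offset_le_radius [set: 'I_n] z x i.
rewrite /offset inE in h; have h1 := norm_coord_le z i.
have -> : x 0 i = z 0 i + (x 0 i - z 0 i) by rewrite addrC subrK.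
by rewrite (le_trans (ler_normD _ _))// lerD// (le_trans h).
Qed.

Lemma enorm0 : enorm (0 : 'rV[R]_n) = 0.
Proof. by rewrite /enorm /dot big1 ?sqrtr0// => i _; rewrite mxE mul0r. Qed.

Lemma enorm_radius x z : enorm (x - z) = radius [set: 'I_n] z x.
Proof.
rewrite /enorm /radius /dot; congr Num.sqrt; apply: eq_bigr => i _.
by rewrite /offset inE !mxE expr2.
Qed.

(** Turns blow-up, expressed through the distance to the boundary, into the compact set required by
    the comparison principle: the points at distance at least dl from every boundary point. *)
Lemma blows_up_compact O u (M : R) : open O -> compact (closure O) -> blows_up O u ->
  exists K, [/\ compact K, K `<=` O & forall x, O x -> ~ K x -> M < u x].
Proof.
move=> oO cO hb; have [dl dl0 hdl] := hb M.
have iO : interior O = O by exact/interior_id.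
pose K := closure O `&` \bigcap_(y in boundary O) [set x | dl <= radius [set: 'I_n] y x].
have clK : closed K.
  apply: closedI; first exact: closed_closure.
  apply: closed_bigI => y _.
  apply: (@closed_comp _ _ (radius [set: 'I_n] y) [set t : R | dl <= t]) => [x _|].
    exact: radius_continuous.
  exact: closed_ge.
exists K; split.
- by apply: (subclosed_compact clK cO) => x [].
- move=> x [clx hx]; apply: contrapT => nO.
  have bx : boundary O x by split=> //; rewrite iO.
  have := hx x bx; rewrite /= -enorm_radius subrr enorm0 leNgt => /negP; apply.
  exact: dl0.
- move=> x Ox nK; apply: hdl => //; rewrite ltNge; apply/negP => dlx; apply: nK.
  split; first exact: subset_closure.
  move=> y By /=; apply: le_trans dlx _; rewrite -enorm_radius; apply: ge_inf; last by exists y.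
  by exists 0 => _ [t _ <-]; exact: sqrtr_ge0.
Qed.

Lemma radius_center z : radius [set: 'I_n] z z = 0.
Proof. by rewrite -enorm_radius subrr enorm0. Qed.

(** The large solution of radius rho/2, dilated by 2 and raised by 1, is a strict supersolution on
    the ball of radius rho: the dilation multiplies its right-hand side by 2^(-p) < 1, and the added
    1 keeps [fb] positive. Its value at the centre depends on neither the solution nor the
    domain. *)
Lemma ball_upper_bound (rho : R) : (0 < n)%N -> 0 < rho -> exists M : R, forall O u z,
  continuous_solution O u -> (forall x, radius [set: 'I_n] z x <= rho -> O x) -> u z <= M.
Proof.
move=> n0 rho0; have cd : #|[set: 'I_n]%SET| = n by rewrite cardsT card_ord.
have rho2 : 0 < rho / 2 by rewrite divr_gt0.
have [V [k [[hs V0 hl] _ _]]] := large_solution_exists p2 hF n0 rho2.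
have i20 : 0 < 2^-1 :> R by rewrite invr_gt0.
exists (V 0 + 1) => O u z hu hO.
have [_ cu u0] := hu.
have [C C0 hC] : exists2 C : R, 0 <= C & forall x, radius [set: 'I_n] z x <= rho -> `|u x| <= C.
  exact: (compact_bounded_fun (@radius_ball_compact z rho) (fun x h => cu x (hO x h))).
have [t /andP[t0 trho] ht] := hl C.
pose O' := [set x | radius [set: 'I_n] z x < rho].
pose K := [set x | radius [set: 'I_n] z x <= 2 * t].
have oO' : open O'.
  apply: (@open_comp _ _ (radius [set: 'I_n] z) [set t : R | t < rho]) => [x _|].
    exact: radius_continuous.
  exact: open_lt.
have KO : K `<=` O' by move=> x /= h; apply: le_lt_trans h _; move: trho; rewrite ltr_pdivlMr// mulrC.
have hs' : radial_solution #|[set: 'I_n]%SET| p rho (fun r => V (2^-1 * r) + 1)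
    (fun r => 2^-1 `^ p * k (2^-1 * r)) (fun r => 2^-1 `^ p * fb (V (2^-1 * r))).
  rewrite cd; have := radial_solution_scale p2 i20 hs.
  by rewrite invrK divfK// => h; exact: (radial_solutionD 1 h).
have inr (r : R) : 0 <= r < rho -> 0 <= 2^-1 * r < rho / 2.
  by move=> /andP[r0 rr]; rewrite mulr_ge0//= mulrC ltr_pM2r.
have cV (r : R) : 0 <= r < rho -> {for r, continuous (fun r : R => V (2^-1 * r))}.
  move=> hr; apply: (@continuous_comp _ _ _ (fun r : R => 2^-1 * r) V).
    by apply: continuousM; [exact: cst_continuous|exact: cvg_id].
  exact: (radial_solution_cont hs (inr r hr)).
have cG (r : R) : 0 <= r < rho -> {for r, continuous (fun r : R => 2^-1 `^ p * fb (V (2^-1 * r)))}.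
  move=> hr; apply: continuousM; first exact: cst_continuous.
  apply: (@continuous_comp _ _ _ (fun r : R => V (2^-1 * r)) fb); first exact: cV.
  exact: (fb_continuous hF).
have n0' : (0 < #|[set: 'I_n]%SET|)%N by rewrite cd.
have hW := @radial_plaplace_weak R n [set: 'I_n] z p rho _ _ _ O' p2 hs' cG n0' (fun x h => h).
have zO : O' z by rewrite /O' /= radius_center.
have := upper_barrier oO' (@radius_ball_compact z (2 * t)) KO
  (continuous_solutionS (fun x h => hO x (ltW h)) hu) hW _ _ _ _ zO.
rewrite /= radius_center mulr0; apply.
- move=> x Ox.
  have cV1 (r : R) : 0 <= r < rho -> {for r, continuous (fun r : R => V (2^-1 * r) + 1)}.
    by move=> hr; exact: (radial_solution_cont hs' hr).
  exact: (@radial_continuous R n [set: 'I_n] z (fun r => V (2^-1 * r) + 1) rho x cV1 Ox).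
- move=> x Ox.
  exact: (@radial_continuous R n [set: 'I_n] z (fun r => 2^-1 `^ p * fb (V (2^-1 * r))) rho x cG Ox).
- move=> x /= Ox /negP; rewrite -ltNge => tx.
  rewrite (le_trans (ler_norm _))// (le_trans (hC x (ltW Ox)))// ler_wpDr// ltW// ht//.
    by rewrite mulrC ler_pdivlMr// mulrC ltW.
  by rewrite mulrC ltr_pM2r.
- move=> x /= Ox; have hx := inr _ (introT andP (conj (radius_ge0 [set: 'I_n] z x) Ox)).
  have V0x := V0 _ hx; set v := V _ in V0x *.
  have h1 : 0 < fb (v + 1) by apply: (fb_pos hF); rewrite ltr_wpDl.
  have h2 : fb v <= fb (v + 1) by apply: (fb_mono hF); rewrite lerDl.
  have h3 : 2^-1 `^ p < 1 :> R.
    have e1p : 1 `^ p = 1 :> R by rewrite powR1.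
    rewrite -[ltRHS]e1p; apply: gt0_ltr_powR; rewrite ?nnegrE//.
      by move: p2; lra.
    by rewrite invf_lt1// ltr1n.
  apply: (@le_lt_trans _ _ (2^-1 `^ p * fb (v + 1))).
    by rewrite ler_wpM2l// powR_ge0.
  by rewrite gtr_pMl.
Qed.

End solutions.

(** * Geometry of the capped cylinders *)

Section capped_cylinders.
Context {R : realType} {m : nat}.
Implicit Types (x : 'rV[R]_(m + 1)) (l : R).
Local Notation s2 x := (\sum_(i < m) base x 0 i ^+ 2).

Definition base_index : {set 'I_(m + 1)} := [set lshift 1 i | i in 'I_m].

Lemma card_base_index : #|base_index| = m.
Proof. by rewrite card_imset ?card_ord//; exact: lshift_inj. Qed.

Lemma baseE x i : base x 0 i = x 0 (lshift 1 i). Proof. by rewrite mxE. Qed.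

Lemma heightE x : height x = x 0 (rshift m 0). Proof. by rewrite /height mxE. Qed.

Lemma in_base_index i : (lshift 1 i \in base_index) = true.
Proof. by apply/imsetP; exists i. Qed.

Lemma notin_base_index (i : 'I_1) : (rshift m i \in base_index) = false.
Proof. by apply/negP => /imsetP[j _ /eqP]; rewrite eq_rlshift. Qed.

Lemma offset_lshift x i : offset base_index 0 x (lshift 1 i) = base x 0 i.
Proof. by rewrite /offset in_base_index mxE subr0 baseE. Qed.

Lemma offset_rshift x (i : 'I_1) : offset base_index 0 x (rshift m i) = 0.
Proof. by rewrite /offset notin_base_index. Qed.

Lemma sqr_radius_base x : radius base_index 0 x ^+ 2 = s2 x.
Proof.
rewrite sqr_radius big_split_ord/= [X in _ + X]big1 ?addr0; last first.
  by move=> i _; rewrite offset_rshift expr0n.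
by apply: eq_bigr => i _; rewrite offset_lshift.
Qed.

Lemma radius_base x : radius base_index 0 x = enorm (base x).
Proof.
apply/eqP; rewrite -(eqrXn2 (ltn0Sn 1)) ?radius_ge0 ?sqrtr_ge0// sqr_radius_base sqr_enorm.
by apply/eqP; apply: eq_bigr => i _; rewrite expr2.
Qed.

Lemma cylinderE x : cylinder x <-> s2 x < 1.
Proof.
rewrite /cylinder /unit_ball /= -radius_base -sqr_radius_base -(ltr_pXn2r (ltn0Sn 1)) ?nnegrE ?radius_ge0//.
by rewrite expr1n.
Qed.

Lemma height_continuous : continuous (@height R m).
Proof.
move=> x; have -> : @height R m = (fun x => x 0 (rshift m 0)) by apply: funext => y; exact: heightE.
exact: coord_continuous.
Qed.

Lemma s2_continuous : continuous (fun x => s2 x).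
Proof.
move=> x; have -> : (fun x => s2 x) = (fun x => radius base_index 0 x ^+ 2).
  by apply: funext => y; rewrite sqr_radius_base.
apply: (@continuousM _ _ (radius base_index 0) (radius base_index 0)); exact: radius_continuous.
Qed.

Lemma capped_cylinder_open l : open (capped_cylinder l : set 'rV[R]_(m + 1)).
Proof.
have lt_open (g h : 'rV[R]_(m + 1) -> R) : continuous g -> continuous h -> open [set x | g x < h x].
  move=> cg ch; have -> : [set x | g x < h x] = (fun x => h x - g x) @^-1` [set t : R | 0 < t].
    by apply/seteqP; split => x /=; rewrite subr_gt0.
  apply: open_comp => [x _|]; last exact: open_gt.
  by apply: continuousB; [exact: ch|exact: cg].
have cc (c : R) : continuous (fun _ : 'rV[R]_(m + 1) => c) by move=> x; exact: cst_continuous.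
have cX k (g : 'rV[R]_(m + 1) -> R) : continuous g -> continuous (fun x => g x ^+ k).
  move=> cg x; apply: (@continuous_comp _ _ _ g (fun t => t ^+ k)); first exact: cg.
  exact: exprn_continuous.
have ccap (c : R) : open [set x : 'rV[R]_(m + 1) | s2 x ^+ 2 + (height x + c) ^+ 4 < 1].
  apply: lt_open; last exact: cc.
  have ch : continuous (fun x : 'rV[R]_(m + 1) => height x + c).
    by move=> y; exact: (continuousD (@height_continuous y) (cc c y)).
  by move=> x; exact: (continuousD (cX 2%N _ s2_continuous x) (cX 4%N _ ch x)).
apply: openU; last by apply: openU; [exact: ccap|exact: (ccap (- l))].
have -> : [set x : 'rV[R]_(m + 1) | s2 x < 1 /\ - l < height x < l] =
  [set x | s2 x < 1] `&` ([set x | - l < height x] `&` [set x | height x < l]).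
  by apply/seteqP; split=> x /= [h1]; [move=> /andP[h2 h3]|move=> [h2 h3]; split=> //; apply/andP].
apply: openI; first exact: lt_open s2_continuous (cc 1).
by apply: openI; apply: lt_open => //; [exact: height_continuous|exact: height_continuous].
Qed.

Lemma cap_bound x (c : R) : s2 x ^+ 2 + (height x + c) ^+ 4 < 1 -> s2 x < 1 /\ `|height x + c| < 1.
Proof.
move=> h; have h1 : 0 <= s2 x ^+ 2 := sqr_ge0 _.
have h2 : 0 <= (height x + c) ^+ 4 by rewrite (exprM _ 2 2) sqr_ge0.
split; rewrite ltNge; apply/negP => h3.
  have : 1 <= s2 x ^+ 2 by rewrite exprn_ege1.
  by move: h h2; lra.
have : 1 <= (height x + c) ^+ 4.
  have h4 : 1 <= (height x + c) ^+ 2 by rewrite -real_normK ?num_real// exprn_ege1.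
  by rewrite (exprM _ 2 2) exprn_ege1.
by move: h h1; lra.
Qed.

Lemma capped_cylinder_bound l x : 0 < l -> capped_cylinder l x -> s2 x < 1 /\ `|height x| < l + 1.
Proof.
move=> l0 [[h1 h2]|[/cap_bound[h1 h2]|/cap_bound[h1 h2]]]; split=> //; move: h2; rewrite ?ltr_norml;
  move=> /andP[h2 h3]; apply/andP; split; lra.
Qed.

Lemma capped_cylinder_sub l : 0 < l -> capped_cylinder l `<=` (cylinder : set 'rV[R]_(m + 1)).
Proof. by move=> l0 x /(capped_cylinder_bound l0)[h _]; apply/cylinderE. Qed.

Lemma capped_cylinder_compact l : 0 < l -> compact (closure (capped_cylinder l : set 'rV[R]_(m + 1))).
Proof.
move=> l0; apply: (@bounded_closure_compact _ _ _ (l + 1)) => x /(capped_cylinder_bound l0)[h1 h2].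
apply: cube_ball => [|i]; first by rewrite ltr_wpDl// ltW.
rewrite -[i]splitK; case: (fintype.split i) => j /=.
  rewrite -baseE; have h : `|base x 0 j| <= enorm (base x) := coord_le_enorm _ _.
  apply: le_lt_trans h _; rewrite -radius_base; move/cylinderE : h1.
  by rewrite /cylinder /unit_ball /= -radius_base => h; rewrite (lt_trans h)// ltrDr.
by rewrite (ord1 j) -heightE.
Qed.

Lemma capped_cylinder_core l x : s2 x < 1 -> `|height x| < l -> capped_cylinder l x.
Proof. by move=> h1 h2; left; split=> //; rewrite -ltr_norml. Qed.

Lemma capped_cylinder_mono l l' : 0 < l -> l <= l' ->
  capped_cylinder l `<=` (capped_cylinder l' : set 'rV[R]_(m + 1)).
Proof.
move=> l0 ll x hx; have [h1 _] := capped_cylinder_bound l0 hx.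
have [h2|h2] := ltP `|height x| l'; first exact: capped_cylinder_core.
have pw (a b : R) : `|a| <= `|b| -> a ^+ 4 <= b ^+ 4.
  move=> ab; rewrite (exprM a 2 2) (exprM b 2 2) -(real_normK (num_real a)) -(real_normK (num_real b)).
  by rewrite !lerXn2r ?nnegrE ?exprn_ge0.
have key (e : R) : (e = 1 \/ e = -1) -> s2 x ^+ 2 + (height x + e * l) ^+ 4 < 1 -> capped_cylinder l' x.
  move=> he h; case: (leP 0 (height x)) => hx0.
    right; right => /=; apply: le_lt_trans h; rewrite lerD2l; apply: pw.
    move: h2; rewrite (ger0_norm hx0) => h2; rewrite ger0_norm ?subr_ge0//.
    by case: he => ->; rewrite (le_trans _ (ler_norm _))//; move: ll l0; lra.
  right; left => /=; apply: le_lt_trans h; rewrite lerD2l; apply: pw.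
  move: h2; rewrite (ltr0_norm hx0) => h2; rewrite ler0_norm; last by move: h2; lra.
  case: he => ->; rewrite -[leRHS]normrN (le_trans _ (ler_norm _))//; move: ll l0; lra.
case: hx => [[_ /andP[a b]]|[h|h]].
- by move: h2; rewrite leNgt ltr_norml (le_lt_trans _ a) ?(lt_le_trans b)// lerN2.
- by apply: (key 1); [left|rewrite mul1r].
- by apply: (key (-1)); [right|rewrite mulN1r].
Qed.

End capped_cylinders.

(** * Regularization of the radial slope *)

Section regularized_profile.
Context {R : realType}.
Implicit Types (r s t tau rad : R).
Variables (d : nat) (d0 : (0 < d)%N) (p : R) (p2 : 2 <= p).
Local Notation q := (p - 1)^-1.

(* The slope of the solution is replaced by (r k + tau)^q - tau^q, which is C^1 down to r = 0.
   The shift tau leaves room for a transversal gradient of size at most tau^q without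
   increasing the divergence beyond G. *)
Lemma regularized_flux rad Z k G tau : radial_solution d p rad Z k G ->
  (forall r, 0 <= r < rad -> {for r, continuous G}) ->
  (forall r s, 0 <= r -> r <= s -> s < rad -> G r <= G s) -> 0 <= G 0 -> 0 < tau -> 0 < rad ->
  exists chi dq : R -> R,
  [/\ forall r, 0 <= r < rad -> {for r, continuous chi},
      forall r, 0 < r < rad -> is_derive r 1 chi ((dq r - chi r) / r),
      forall r, 0 <= r < rad -> {for r, continuous dq}, dq 0 = chi 0 &
      forall r, (r * k r + tau) `^ q - tau `^ q = chi r * r] /\
  forall r, 0 <= r < rad -> [/\ 0 <= dq r, 0 <= chi r &
    ((r * k r + tau) `^ q) `^ (p - 2) * ((p - 1) * dq r + (d%:R - 1) * chi r) <= G r].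
Proof.
move=> hs cG Gm G0 tau0 rad0; have [ha dZ k0 k00] := hs; have [ck dk] := ha.
have p10 : 0 < p - 1 by move: p2; lra.
have q0 : 0 < q by rewrite invr_gt0.
have q1 : q <= 1 by rewrite invf_le1//; move: p2; lra.
have dp : 0 < d%:R :> R by rewrite ltr0n.
have d1 : 0 <= d%:R - 1 :> R by rewrite subr_ge0 ler1n.
pose P r := r * k r; pose dP r := G r - (d%:R - 1) * k r.
have dP0 : dP 0 = k 0.
  have dn : d%:R != 0 :> R by rewrite gt_eqF.
  by rewrite /dP k00; move: (G 0) => a; field; exact: dn.
have P0 r : 0 <= r < rad -> 0 <= P r by move=> hr; rewrite mulr_ge0 ?k0//; case/andP: hr.
have Pp r : 0 <= r < rad -> 0 < P r + tau by move=> /P0 h; rewrite ltr_wpDl.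
have hdP r : 0 <= r < rad -> is_derive r 1 P (dP r).
  move=> /andP[]; rewrite le_eqVlt => /orP[/eqP <- _|r0 rr]; last first.
    by apply: (is_derive_flux ha); rewrite r0.
  apply/is_derive1_caratheodory; exists k; split.
  - by move=> z; rewrite /P mul0r !subr0 mulrC.
  - by apply: ck; rewrite lexx.
  - by rewrite dP0.
have dPge r : 0 <= r < rad -> 0 <= dP r.
  move=> /andP[]; rewrite le_eqVlt => /orP[/eqP <- _|r0 rr]; first by rewrite dP0 k0 ?lexx.
  have hr : 0 < r < rad by rewrite r0.
  apply: le_trans (flux_derive_ge d0 ha hr _).
    by rewrite divr_ge0// (le_trans G0)// Gm// ltW.
  by move=> s /andP[s0 sr]; apply: Gm => //; exact: ltW.
pose Q r := (P r + tau) `^ q - tau `^ q.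
pose dq r := q * (P r + tau) `^ (q - 1) * dP r.
have hQ r : 0 <= r < rad -> is_derive r 1 Q (dq r).
  move=> hr; have h1 := is_deriveD_fun (hdP r hr) (is_derive_cst tau r (1 : R)).
  have h2 := is_deriveB_fun (@is_derive_powR_fun R (fun t => P t + tau) r _ q (Pp r hr) h1) (is_derive_cst (tau `^ q) r (1 : R)).
  by apply: is_derive_eq h2 _; rewrite subr0 addr0.
have Q0 : Q 0 = 0 by rewrite /Q /P mul0r add0r subrr.
have h00 : 0 <= (0 : R) < rad by rewrite lexx.
(* The Caratheodory slope function of Q at 0 is Q(r)/r with its value at 0 already filled in
   continuously. *)
have /is_derive1_caratheodory[chi [chiE cchi chi0]] := hQ 0 h00.
have QE r : Q r = chi r * r by have := chiE r; rewrite Q0 !subr0.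
have nearQ r : 0 < r -> \near r, Q r / r = chi r.
  move=> r0; near=> s; have s0 : 0 < s by near: s; exact: lt_nbhsr.
  by rewrite QE mulfK// gt_eqF.
have dchi r : 0 < r < rad -> is_derive r 1 chi ((dq r - chi r) / r).
  move=> /andP[r0 rr]; apply: (near_eq_is_derive (nearQ r r0)).
  have rn : r != 0 by rewrite gt_eqF.
  have hr : 0 <= r < rad by rewrite (ltW r0).
  have h := is_deriveM_fun (hQ r hr) (is_deriveV_fun rn (is_derive_id r (1 : R))).
  apply: is_derive_eq h _; rewrite QE; move: (dq r) (chi r) => a b; field; exact: rn.
have cdP r : 0 <= r < rad -> {for r, continuous dP}.
  move=> hr; apply: continuousB; first exact: cG.
  by apply: continuousM; [exact: cst_continuous|exact: ck].
have cdq r : 0 <= r < rad -> {for r, continuous dq}.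
  move=> hr; apply: continuousM; last exact: cdP.
  apply: continuousM; first exact: cst_continuous.
  have h1 := is_deriveD_fun (hdP r hr) (is_derive_cst tau r (1 : R)).
  exact: is_derive_cont (@is_derive_powR_fun R (fun t => P t + tau) r _ (q - 1) (Pp r hr) h1).
have dq0 r : 0 <= r < rad -> 0 <= dq r.
  by move=> hr; rewrite /dq !mulr_ge0 ?powR_ge0 ?(ltW q0) ?dPge.
have tauq r : 0 <= r < rad -> tau `^ q <= (P r + tau) `^ q.
  move=> hr; apply: ge0_ler_powR; rewrite ?nnegrE ?(ltW q0) ?(ltW tau0) ?(ltW (Pp r hr))//.
  by rewrite lerDr P0.
have chi_ge r : 0 <= r < rad -> 0 <= chi r.
  move=> hr; have := hr => /andP[]; rewrite le_eqVlt => /orP[/eqP E _|r0 rr].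
    by rewrite -E chi0 dq0.
  by rewrite -(pmulr_rge0 _ r0) mulrC -QE subr_ge0 tauq.
exists chi, dq; split.
  split=> // r hr; have := hr => /andP[]; rewrite le_eqVlt => /orP[/eqP <- //|r0 rr].
  by apply: is_derive_cont (dchi r _); rewrite r0.
move=> r hr; split; [exact: dq0|exact: chi_ge|].
rewrite -/(P r); set B := _ `^ q; have PT := Pp r hr.
have B0 : 0 < B by exact: powR_gt0.
have XX : (P r + tau) `^ (q * (p - 2)) * (P r + tau) `^ (q - 1) = 1.
  rewrite -powRD; last by rewrite (gt_eqF PT) implybT.
  have pn : p - 1 != 0 by rewrite gt_eqF.
  have -> : q * (p - 2) + (q - 1) = 0 by field; exact: pn.
  by rewrite powRr0.
have e1 : B `^ (p - 2) * ((p - 1) * dq r) = dP r.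
  rewrite /dq /B -powRrM.
  rewrite (_ : _ * _ = ((P r + tau) `^ (q * (p - 2)) * (P r + tau) `^ (q - 1)) * ((p - 1) * q) * dP r).
    by rewrite XX mulfV ?gt_eqF// !mul1r.
  by ring.
(* The angular part: B^(p-2) Q = P + tau - B^(p-2) tau^q, and B^(p-2) tau^q >= tau because B >=
   tau^q. What remains is at most P = r k. *)
have e2 : B `^ (p - 2) * chi r <= k r.
  have := hr => /andP[]; rewrite le_eqVlt => /orP[/eqP E _|r0 rr].
    have -> : chi r = dq r by rewrite -E chi0.
    have -> : k r = dP r by rewrite -E dP0.
    rewrite -e1 ler_pM2l ?powR_gt0// ler_peMl ?dq0//; move: p2; lra.
  rewrite -(ler_pM2r r0) -mulrA -QE mulrBr [k r * r]mulrC -/(P r) powR_flux ?(ltW PT)//.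
  rewrite -addrA gerDl subr_le0 -{1}(powR_flux p2 (ltW tau0)).
  have BT : (tau `^ q) `^ (p - 2) <= B `^ (p - 2).
    apply: ge0_ler_powR; [by rewrite subr_ge0|exact: powR_ge0|exact: powR_ge0|exact: (tauq r hr)].
  exact: (ler_wpM2r (powR_ge0 tau q) BT).
rewrite mulrDr e1 /dP [X in _ + X]mulrCA.
have := ler_wpM2l d1 e2; lra.
Unshelve. all: by end_near. Qed.

End regularized_profile.

(** * Divergence for a radial profile with an axial parabola *)

Section cylinder_divergence.
Context {R : realType} {n : nat}.
Variables (p : R) (p2 : 2 <= p) (S : {set 'I_n}) (z : 'rV[R]_n) (l : 'I_n) (lS : l \notin S).
Implicit Types (x : 'rV[R]_n) (chi dq : R -> R) (b t : R).
Local Notation w := (offset S z).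
Local Notation rr := (radius S z).

(** The gradient of a profile of slope chi(r) r plus the parabola b (x_l - t)^2 along the axis l. In
    the Jacobian defined next, dq is the derivative of that slope. *)
Definition cylinder_gradient chi b t x : 'rV[R]_n :=
  \row_j (chi (rr x) * w x j + (j == l)%:R * (2 * b * (x 0 l - t))).

Definition cylinder_hessian chi dq b i j x : R :=
  chi (rr x) * ((i == j) && (j \in S))%:R + (dq (rr x) - chi (rr x)) * (w x i * w x j / rr x ^+ 2)
  + (j == l)%:R * (2 * b * (i == l)%:R).

Let wl x : w x l = 0. Proof. by rewrite /offset (negPf lS). Qed.

Let sum_l (F : 'I_n -> R) : \sum_i (i == l)%:R * F i = F l.
Proof.
by rewrite (bigD1 l)//= eqxx mul1r big1 ?addr0// => i /negPf ->; rewrite mul0r.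
Qed.

(** The gradient is spanned by the radial and the axial direction, which are orthogonal
    eigendirections of the Hessian with eigenvalues dq and 2b. The second-order term in the
    direction of the gradient is a mean of these two, hence at most dq + 2b; the trace contributes
    dq + 2b + (#|S| - 1) chi. *)
Lemma sum_flux_pderiv_le chi dq b t x : 0 <= b -> 0 <= dq (rr x) -> dq 0 = chi 0 ->
  let N := enorm (cylinder_gradient chi b t x) in
  \sum_i flux_pderiv p (cylinder_gradient chi b t) (cylinder_hessian chi dq b) i x <=
  N `^ (p - 2) * ((p - 1) * (dq (rr x) + 2 * b) + (#|S|%:R - 1) * chi (rr x)) /\
  N <= `|chi (rr x) * rr x| + `|2 * b * (x 0 l - t)|.
Proof.
move=> b0 dq0 dqchi N; set e := 2 * b * (x 0 l - t).
pose xi := cylinder_gradient chi b t x; pose H := cylinder_hessian chi dq b.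
set c := chi (rr x) in dq0 *; set D := dq (rr x) in dq0 *; set r := rr x.
have xiE j : xi 0 j = c * w x j + (j == l)%:R * e by rewrite mxE.
have eta0 : r = 0 -> D - c = 0.
  by move=> r0; rewrite /D /c -/r r0 dqchi subrr.
have w2 : \sum_j w x j * w x j = r ^+ 2 by rewrite sqr_radius; apply: eq_bigr => j _; rewrite expr2.
have rq : (D - c) * (r ^+ 2 / r ^+ 2) = D - c.
  have [r0|rn] := eqVneq r 0; first by rewrite eta0// mul0r.
  by rewrite divff ?mulr1// sqrf_eq0.
have lw (F : 'I_n -> R) : \sum_j (j == l)%:R * e * w x j = 0.
  under eq_bigr do rewrite -mulrA; rewrite (sum_l (fun j => e * w x j)) wl mulr0//.
have N2 : N ^+ 2 = (c * r) ^+ 2 + e ^+ 2.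
  rewrite sqr_enorm /dot.
  rewrite (eq_bigr (fun j => c ^+ 2 * (w x j * w x j) + (2 * c) * ((j == l)%:R * e * w x j) +
    (j == l)%:R * (e ^+ 2))); last first.
    move=> j _; rewrite -/xi xiE; case: (j == l); rewrite /= ?mul1r ?mul0r ?mulr0 ?addr0; ring.
  rewrite !big_split/= -!mulr_sumr w2 (lw (fun=> 0)) mulr0 addr0 (sum_l (fun=> e ^+ 2)).
  by congr (_ + _); rewrite exprMn.
have N0 : 0 <= N := enorm_ge0 _.
split; last first.
  rewrite -(@ler_pXn2r _ 2)// ?nnegrE ?addr_ge0// N2 sqrrD !real_normK ?num_real//.
  by rewrite addrAC lerDl mulrn_wge0// mulr_ge0.
have trH : \sum_i H i i x = #|S|%:R * c + (D - c) + 2 * b.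
  rewrite !big_split/= -!mulr_sumr -mulr_suml w2 rq (sum_l (fun i => 2 * b * (i == l)%:R)) eqxx mulr1.
  congr (_ + _ + _); rewrite mulrC; congr (_ * _).
  rewrite -sum1_card natr_sum [RHS]big_mkcond/=; apply: eq_bigr => i _.
  by rewrite eqxx; case: (i \in S).
have xw : \sum_j xi 0 j * w x j = c * r ^+ 2.
  rewrite (eq_bigr (fun j => c * (w x j * w x j) + (j == l)%:R * e * w x j)); last first.
    by move=> j _; rewrite xiE mulrDl mulrA.
  by rewrite big_split/= -mulr_sumr w2 (lw (fun=> 0)) addr0.
have HxE i : \sum_j xi 0 j * H i j x =
    c * (c * w x i) + (D - c) * (w x i * (c * r ^+ 2) / r ^+ 2) + (i == l)%:R * (2 * b * e).
  rewrite (eq_bigr (fun j => c * (xi 0 j * ((i == j) && (j \in S))%:R) +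
     (D - c) * w x i / r ^+ 2 * (xi 0 j * w x j) + (j == l)%:R * (xi 0 j * (2 * b * (i == l)%:R)))); last first.
    by move=> j _; rewrite /H /cylinder_hessian -/c -/D -/r; ring.
  rewrite !big_split/= -!mulr_sumr xw (sum_l (fun j => xi 0 j * (2 * b * (i == l)%:R))).
  rewrite (bigD1 i)//= big1 ?addr0; last by move=> j /negPf ji; rewrite eq_sym ji mulr0.
  rewrite eqxx /= !xiE wl eqxx mulr0 add0r mul1r; congr (_ + _ + _); last 2 first.
  - by ring.
  - by ring.
  congr (_ * _); rewrite /offset; case: ifP => [iS|]; last by rewrite !mulr0.
  have -> : (i == l) = false by apply/negP => /eqP E; move: lS; rewrite -E iS.
  by rewrite mul0r addr0 mulr1.
have QE : \sum_i (\sum_j xi 0 j * H i j x) * xi 0 i = (c * r) ^+ 2 * D + e ^+ 2 * (2 * b).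
  rewrite (eq_bigr (fun i => (c * c + (D - c) * (c * r ^+ 2) / r ^+ 2) * (xi 0 i * w x i) +
     (i == l)%:R * (2 * b * e * xi 0 i))); last first.
    by move=> i _; rewrite HxE; ring.
  rewrite big_split/= -mulr_sumr xw (sum_l (fun i => 2 * b * e * xi 0 i)) xiE wl eqxx mulr0 add0r mul1r.
  have -> : (D - c) * (c * r ^+ 2) / r ^+ 2 = c * (D - c) by rewrite -[in RHS]rq; ring.
  by ring.
rewrite /flux_pderiv big_split/= -!mulr_sumr -/H -/xi -/N.
have -> : \sum_i N `^ (p - 3) * ((\sum_j xi 0 j * H i j x) / N) * xi 0 i =
    N `^ (p - 3) / N * \sum_i (\sum_j xi 0 j * H i j x) * xi 0 i.
  by rewrite mulr_sumr; apply: eq_bigr => i _; ring.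
rewrite trH QE.
have h1 : N `^ (p - 3) / N * ((c * r) ^+ 2 * D + e ^+ 2 * (2 * b)) <= N `^ (p - 2) * (D + 2 * b).
  move: N0; rewrite le_eqVlt => /orP[/eqP <-|N0].
    by rewrite invr0 mulr0 mul0r mulr_ge0 ?powR_ge0// addr_ge0// mulr_ge0.
  have -> : N `^ (p - 2) = N `^ (p - 3) * N.
    by rewrite (powR_split (p - 2) N0); congr (_ `^ _ * _); ring.
  rewrite -mulrA -[leRHS]mulrA ler_wpM2l ?powR_ge0// ler_pdivrMl// [leRHS]mulrA -expr2 N2 [leRHS]mulrDl.
  have s1 : 0 <= (c * r) ^+ 2 := sqr_ge0 _; have s2 : 0 <= e ^+ 2 := sqr_ge0 _.
  by rewrite !mulrDr lerD// ?lerDl ?lerDr mulr_ge0// mulr_ge0.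
have p20 : 0 <= p - 2 by rewrite subr_ge0.
have := ler_wpM2l p20 h1.
move: (N `^ (p - 2)) (_ / N * _) => A B; rewrite -subr_ge0 => h; rewrite -subr_ge0.
rewrite (_ : _ - _ = (p - 2) * (A * (D + 2 * b)) - (p - 2) * B)//.
by move: (c) (D); clear; move=> c' D'; ring.
Qed.

End cylinder_divergence.

(** * The supersolution on long cylinders *)

Section cylinder_upper.
Context {R : realType} {m : nat}.
Variables (p : R) (p2 : 2 <= p) (f : R -> R) (hF : condition_F p f) (m0 : (0 < m)%N).
Implicit Types (x : 'rV[R]_(m + 1)) (r t c : R).
Local Notation fb := (extend_by_zero f).
Local Notation S := (@base_index m).
Local Notation rr := (radius S (0 : 'rV[R]_(m + 1))).
Local Notation top := (rshift m (0 : 'I_1)).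
Local Notation s2 x := (\sum_(i < m) base x 0 i ^+ 2).

(** Moving each coordinate by at most rho <= 1 changes each squared base coordinate by at most 3
    rho; rho is chosen so that m such changes stay below 1 - R2^2. *)
Lemma near_point_in_cylinder (R2 rho : R) x x' : 0 <= R2 -> rr x < R2 -> R2 < 1 ->
  rho = (1 - R2 ^+ 2) / (3 * m%:R + 1) -> radius [set: 'I_(m + 1)] x x' <= rho ->
  s2 x' < 1 /\ `|height x'| <= `|height x| + 1.
Proof.
move=> R20 xR2 R21 rhoE xx'.
have D0 : 0 < 3 * m%:R + 1 :> R by rewrite ltr_wpDl// mulr_ge0.
have R2s : R2 ^+ 2 < 1 by rewrite exprn_ilt1.
have rho0 : 0 < rho by rewrite rhoE divr_gt0// subr_gt0.
have rho1 : rho <= 1.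
  have m3 : 0 <= 3 * m%:R :> R by rewrite mulr_ge0.
  by rewrite rhoE ler_pdivrMr// mul1r; move: (sqr_ge0 R2) m3; lra.
have dx i : `|x' 0 i - x 0 i| <= rho.
  have := offset_le_radius [set: 'I_(m + 1)] x x' i; rewrite /offset inE => h.
  exact: le_trans h xx'.
split; last first.
  rewrite !heightE; have -> : x' 0 top = x 0 top + (x' 0 top - x 0 top) by rewrite addrC subrK.
  by rewrite (le_trans (ler_normD _ _))// lerD2l (le_trans (dx _)).
have xs : s2 x < R2 ^+ 2 by rewrite -sqr_radius_base ltrXn2r ?radius_ge0.
have x1 i : `|base x 0 i| <= 1.
  rewrite -offset_lshift (le_trans (offset_le_radius _ _ _ _))// ltW// (lt_trans xR2)//.
have h i : base x' 0 i ^+ 2 <= base x 0 i ^+ 2 + 3 * rho.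
  rewrite !baseE; have h1 := dx (lshift 1 i); have h2 := x1 i; rewrite baseE in h2.
  move: (x' 0 _) (x 0 _) h1 h2 => a b; rewrite !ler_norml => /andP[a1 a2] /andP[b1 b2].
  have h3 : `|(a - b) * (2 * b + (a - b))| <= rho * 3.
    rewrite normrM; apply: ler_pM => //; first by rewrite ler_norml; apply/andP; split; lra.
    by rewrite ler_norml; apply/andP; split; lra.
  have -> : a ^+ 2 = b ^+ 2 + (a - b) * (2 * b + (a - b)) by ring.
  by rewrite lerD2l (mulrC 3) (le_trans (ler_norm _)).
apply: (@le_lt_trans _ _ (s2 x + (3 * m%:R) * rho)).
  apply: (le_trans (ler_sum _ (fun i _ => h i))).
  by rewrite big_split/= sumr_const card_ord -mulr_natr; lra.
have : (3 * m%:R + 1) * rho = 1 - R2 ^+ 2 by rewrite rhoE mulrC divfK// gt_eqF.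
by move: xs rho0; lra.
Qed.

Lemma slope_bound (a b y : R) : a != 0 -> 8 * (b * y ^+ 2) / a <= y -> 0 < y -> 0 < a ->
  2 * b * (2 * y) <= a / 2.
Proof.
move=> an h y0 a0; rewrite ler_pdivrMr// in h.
have : y * (8 * (b * y)) <= y * a by rewrite (_ : y * (8 * _) = 8 * (b * y ^+ 2)); [|ring].
by rewrite ler_pM2l//; lra.
Qed.

(** The dilation by 1/lam leaves the fraction 1 - lam^p of the right-hand side unspent; this pays
    for the curvature of the parabola. One half of c covers the error of the regularized slope, the
    other keeps the argument of [fb] at least c/2, so that the unspent amount has the positive lower
    bound gam. *)
Lemma cylinder_upper_bound rad V k c t : 0 < rad -> rad < 1 -> large_solution p f m rad V k -> 0 < c ->
  exists L, forall l u, L <= l -> continuous_solution p f (capped_cylinder l) u ->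
    forall x, height x = t -> rr x < rad -> u x <= V (rr x) + c.
Proof.
move=> rad0 rad1 [hs V0 hl] c0.
(* Any lam strictly between rad and 1 would do: the dilated ball then has radius R2 = rad/lam <
   1. *)
pose lam := (rad + 1) / 2.
have lam1 : lam < 1 by rewrite /lam; lra.
have radlam : rad < lam by rewrite /lam; lra.
have lam0 : 0 < lam by exact: lt_trans radlam.
pose R2 := rad / lam.
have R20 : 0 < R2 by rewrite divr_gt0.
have R21 : R2 < 1 by rewrite ltr_pdivrMr// mul1r.
pose rho := (1 - R2 ^+ 2) / (3 * m%:R + 1) : R.
have D0 : 0 < 3 * m%:R + 1 :> R by rewrite ltr_wpDl// mulr_ge0.
have rho0 : 0 < rho by rewrite divr_gt0// subr_gt0 exprn_ilt1// ltW.
have n0 : (0 < m + 1)%N by rewrite addn1.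
have [M0 hM0] := @ball_upper_bound R (m + 1) p p2 f hF rho n0 rho0.
pose M := `|M0| + 1.
have M_pos : 0 < M by rewrite ltr_wpDl.
have M0M : M0 <= M by rewrite /M (le_trans (ler_norm M0))// lerDl.
have [t1' /andP[t1'0 t1'rad] ht1'] := hl M.
(* Beyond t1 the solution exceeds M, and t1 >= lam rad makes the dilated radius R3 at least rad. *)
pose t1 := Num.max t1' (lam * rad).
have t1rad : t1 < rad by rewrite gt_max t1'rad gtr_pMl.
have t1t : t1' <= t1 by rewrite le_max lexx.
have t1l : lam * rad <= t1 by rewrite le_max lexx orbT.
pose R3 := t1 / lam; pose R4 := (R3 + R2) / 2.
have R32 : R3 < R2 by rewrite ltr_pM2r ?invr_gt0.
have R34 : R3 < R4 by rewrite /R4; lra.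
have R42 : R4 < R2 by rewrite /R4; lra.
have radR3 : rad <= R3 by rewrite ler_pdivlMr// mulrC.
have R40 : 0 < R4 by apply: lt_trans R34; exact: lt_le_trans radR3.
have R41 : R4 < 1 := lt_trans R42 R21.
have p10 : 0 < p - 1 by move: p2; clear - p2 hF m0; lra.
have q0 : 0 < (p - 1)^-1 by rewrite invr_gt0.
have q1 : (p - 1)^-1 <= 1 by rewrite invf_le1//; move: p2; clear - p2 hF m0; lra.
(* Then tau^q = c/2, which is both the largest error in the regularized slope and the axial slope it
   can accommodate. *)
pose tau := (c / 2) `^ (p - 1).
have c2 : 0 < c / 2 by rewrite divr_gt0.
have tau0 : 0 < tau by exact: powR_gt0.
have tauq : tau `^ (p - 1)^-1 = c / 2 by rewrite /tau -powRrM mulfV ?gt_eqF// powRr1// ltW.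
have hsl := radial_solution_scale p2 lam0 hs; rewrite -/R2 in hsl.
have inr r : 0 <= r < R2 -> 0 <= lam * r < rad.
  by move=> /andP[r0 rr]; rewrite mulr_ge0 ?(ltW lam0)//= mulrC -ltr_pdivlMr.
pose v r := V (lam * r); pose kv r := lam `^ p * k (lam * r); pose Gv r := lam `^ p * fb (v r).
have lp0 : 0 < lam `^ p := powR_gt0 _ lam0.
have lp1 : lam `^ p < 1.
  have e1p : 1 `^ p = 1 :> R by rewrite powR1.
  rewrite -[ltRHS]e1p; apply: gt0_ltr_powR; rewrite ?nnegrE ?(ltW lam0)//.
  by move: p2; clear - p2 hF m0; lra.
have cv r : 0 <= r < R2 -> {for r, continuous v} by move=> hr; exact: (radial_solution_cont hsl hr).
have cGv r : 0 <= r < R2 -> {for r, continuous Gv}.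
  move=> hr; apply: continuousM; first exact: cst_continuous.
  apply: (@continuous_comp _ _ _ v fb); first exact: cv.
  exact: (fb_continuous hF).
have vm r s : 0 <= r -> r <= s -> s < R2 -> v r <= v s.
  by move=> r0 rs sR; exact: (radial_solution_mono hsl r0 rs sR).
have v0 r : 0 <= r < R2 -> 0 <= v r by move=> /inr; exact: V0.
have fb_nn s : 0 <= fb s.
  by apply: fb_ge0; [exact: (fb_mono hF)|exact: (fb_neg hF)].
have Gm r s : 0 <= r -> r <= s -> s < R2 -> Gv r <= Gv s.
  by move=> r0 rs sR; rewrite ler_pM2l//; apply: (fb_mono hF); exact: vm.
have G0 : 0 <= Gv 0 by rewrite mulr_ge0 ?(ltW lp0).
have [chi [dq [[cchi dchi cdq dq0 QE] hbd]]] := regularized_flux m0 p2 hsl cGv Gm G0 tau0 R20.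
have kv0 r : 0 <= r < R2 -> 0 <= kv r by case: hsl => _ _ h _; exact: h.
pose P r := r * kv r.
have P0 r : 0 <= r < R2 -> 0 <= P r by move=> hr; rewrite mulr_ge0 ?kv0//; case/andP: hr.
pose Q r := (P r + tau) `^ (p - 1)^-1 - tau `^ (p - 1)^-1.
have QE' r : Q r = chi r * r by exact: QE.
have cQ r : 0 <= r < R2 -> {for r, continuous Q}.
  move=> hr; have -> : Q = (fun r => chi r * r) by apply: funext.
  by apply: continuousM; [exact: cchi|exact: cvg_id].
(* The slope is frozen outside [0, R4] so that it is continuous on the whole line and has a
   primitive near 0 from both sides. *)
pose cl r := Num.min (Num.max r 0) R4.
have clE r : 0 <= r <= R4 -> cl r = r by move=> /andP[h1 h2]; rewrite /cl max_l// min_l.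
have cl_in r : 0 <= cl r < R2.
  by rewrite /cl le_min le_max lexx orbT (ltW R40)/= gt_min R42 orbT.
have ccl : continuous cl by apply: nonexpansive_continuous => r s; exact: clamp_dist.
have [F [F0 dF]] : exists F : R -> R, F 0 = 0 /\ forall r, -1 < r -> is_derive r 1 F (Q (cl r)).
  apply: antiderivative => r; apply: (@continuous_comp _ _ _ cl Q); first exact: ccl.
  by apply: cQ; exact: cl_in.
pose vh r := v 0 + F r.
have dvh r : 0 <= r <= R4 -> is_derive r 1 vh (Q r).
  move=> hr; have r1 : -1 < r by case/andP: hr => r0 _; rewrite (lt_le_trans _ r0)// ltrN10.
  have h := is_deriveD_fun (is_derive_cst (v 0) r (1 : R)) (dF r r1).
  by apply: is_derive_eq h _; rewrite add0r clE.
have in42 r : 0 <= r <= R4 -> 0 <= r < R2 by move=> /andP[-> h] /=; exact: le_lt_trans R42.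
have dv r : 0 <= r < R2 -> is_derive r 1 v (P r `^ (p - 1)^-1) by case: hsl => _ h _ _; exact: h.
have ddv r : 0 <= r <= R4 -> is_derive r 1 (fun r => v r - vh r) (P r `^ (p - 1)^-1 - Q r).
  by move=> hr; exact: (is_deriveB_fun (dv r (in42 r hr)) (dvh r hr)).
have QP r : 0 <= r < R2 -> 0 <= P r `^ (p - 1)^-1 - Q r <= c / 2.
  move=> hr; have h1 := powR_subadditive (ltW q0) q1 (P0 r hr) (ltW tau0).
  have h2 : P r `^ (p - 1)^-1 <= (P r + tau) `^ (p - 1)^-1.
    apply: ge0_ler_powR; rewrite ?nnegrE ?(ltW q0) ?P0 ?addr_ge0 ?P0 ?(ltW tau0)//.
    by rewrite lerDl ltW.
  by rewrite /Q tauq; move: h1 h2; rewrite tauq; clear - p2 hF m0; move=> h1 h2; apply/andP; split; lra.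
have vvh r : 0 <= r <= R4 -> v r - c / 2 <= vh r <= v r.
  move=> /[dup] hr /andP[r0 rR4].
  have vh0 : v 0 - vh 0 = 0 by rewrite /vh F0 addr0 subrr.
  have hw y : 0 <= y <= r -> 0 <= y <= R4 by move=> /andP[-> h]; exact: le_trans rR4.
  have h1 : v 0 - vh 0 <= v r - vh r.
    apply: (derive_ge0_le r0 (f := fun r => v r - vh r) (df := fun r => P r `^ (p - 1)^-1 - Q r)) => y hy.
    - by apply: is_derive_cont (ddv y _); exact: hw.
    - by apply: ddv; apply: hw; case/andP: hy => /ltW -> /ltW ->.
    - have hy' : 0 <= y <= r by case/andP: hy => /ltW -> /ltW ->.
      by have /andP[] := QP y (in42 y (hw y hy')).
  have h2 : c / 2 * 0 - (v 0 - vh 0) <= c / 2 * r - (v r - vh r).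
    have d2 y : 0 <= y <= R4 ->
        is_derive y 1 (fun r => c / 2 * r - (v r - vh r)) (c / 2 * 1 - (P y `^ (p - 1)^-1 - Q y)).
      by move=> hy; exact: (is_deriveB_fun (is_deriveZ_fun (c / 2) (is_derive_id y (1 : R))) (ddv y hy)).
    apply: (derive_ge0_le r0 (f := fun r => c / 2 * r - (v r - vh r))
      (df := fun y => c / 2 * 1 - (P y `^ (p - 1)^-1 - Q y))) => y hy.
    - by apply: is_derive_cont (d2 y _); exact: hw.
    - by apply: d2; apply: hw; case/andP: hy => /ltW -> /ltW ->.
    - have hy' : 0 <= y <= r by case/andP: hy => /ltW -> /ltW ->.
      by have /andP[_] := QP y (in42 y (hw y hy')); rewrite mulr1 subr_ge0.
  have h3 : c / 2 * r <= c / 2 by rewrite ler_piMr ?(ltW c2)// (le_trans rR4)// ltW.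
  by move: h1 h2 h3; rewrite vh0 mulr0; clear - p2 hF m0; move=> h1 h2 h3; apply/andP; split; lra.
pose E0 := ((P R4 + tau) `^ (p - 1)^-1) `^ (p - 2).
have E00 : 0 <= E0 := powR_ge0 _ _.
pose gam := (1 - lam `^ p) * fb (c / 2).
have gam0 : 0 < gam by rewrite mulr_gt0 ?subr_gt0//; exact: (fb_pos hF).
(* With b = M / L'^2, the second condition keeps the axial slope at most c/2 for heights within L' +
   1 of t, and the third keeps the curvature cost below gam. *)
have [L' [L'1 La Lb]] : exists L' : R, [/\ 1 <= L', 8 * M / c <= L' & 2 * M * (p - 1) * E0 / gam < L'].
  exists (1 + `|8 * M / c| + `|2 * M * (p - 1) * E0 / gam|).
  have := ler_norm (8 * M / c); have := ler_norm (2 * M * (p - 1) * E0 / gam).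
  have := normr_ge0 (8 * M / c); have := normr_ge0 (2 * M * (p - 1) * E0 / gam).
  move: (8 * M / c) (2 * M * (p - 1) * E0 / gam) => a1 a2; clear - p2 hF m0; move=> h1 h2 h3 h4; split; lra.
have L'0 : 0 < L' := lt_le_trans ltr01 L'1.
have [b [b0 bL bE]] : exists b, [/\ 0 <= b, b <= M / L' & b * L' ^+ 2 = M].
  exists (M / L' ^+ 2); split.
  - by rewrite divr_ge0 ?sqr_ge0// ltW.
  - by rewrite ler_pM2l// lef_pV2 ?posrE ?exprn_gt0// expr2 ler_peMr// ltW.
  - by rewrite divfK// sqrf_eq0 gt_eqF.
have b20 : 0 <= 2 * b := mulr_ge0 (ler0n _ 2) b0.
have bp0 : 0 <= 2 * b * (p - 1) := mulr_ge0 b20 (ltW p10).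
have small_slope y : `|y| < L' + 1 -> `|2 * b * y| <= c / 2.
  move=> hy; rewrite normrM (ger0_norm b20).
  apply: (@le_trans _ _ (2 * b * (2 * L'))).
    by rewrite (ler_wpM2l b20)// (le_trans (ltW hy))// mulr_natl mulr2n lerD2l.
  by apply: slope_bound => //; [rewrite gt_eqF|rewrite bE].
have small_curv : 2 * b * (p - 1) * E0 < gam.
  apply: (@le_lt_trans _ _ (2 * M * (p - 1) * E0 / L')).
    rewrite (_ : 2 * M * (p - 1) * E0 / L' = 2 * (M / L') * (p - 1) * E0); last by ring.
    by rewrite (ler_wpM2r E00)// (ler_wpM2r (ltW p10))// ler_wpM2l.
  by rewrite ltr_pdivrMr// (mulrC gam) -ltr_pdivrMr.
have mono_B r : 0 <= r <= R4 -> ((P r + tau) `^ (p - 1)^-1) `^ (p - 2) <= E0.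
  move=> hr; have hr2 := in42 r hr; have R4in : 0 <= R4 < R2 by rewrite (ltW R40).
  have ha : averages m R2 kv Gv by case: hsl.
  have PP : P r <= P R4.
    have /andP[r0 rR4] := hr; move: r0; rewrite le_eqVlt => /orP[/eqP <-|r0].
      by rewrite /P mul0r -/(P R4) P0.
    apply: (derive_ge0_le rR4 (f := P) (df := fun y => Gv y - (m%:R - 1) * kv y)) => y /andP[h1 h2].
    - by apply: is_derive_cont (is_derive_flux ha _); rewrite (lt_le_trans r0 h1) (le_lt_trans h2).
    - by apply: (is_derive_flux ha); rewrite (lt_trans r0 h1) (lt_trans h2).
    - have hy : 0 < y < R2 by rewrite (lt_trans r0 h1) (lt_trans h2).
      apply: le_trans (flux_derive_ge m0 ha hy _); first by rewrite divr_ge0// mulr_ge0 ?(ltW lp0).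
      by move=> s /andP[s0 sy]; apply: Gm; [exact: ltW|exact: ltW|case/andP: hy].
  apply: ge0_ler_powR; rewrite ?nnegrE ?powR_ge0 ?subr_ge0//.
  apply: ge0_ler_powR; rewrite ?nnegrE ?(ltW q0) ?addr_ge0 ?P0 ?(ltW tau0)//.
  by rewrite lerD2r.
(* Heights in O stay below |t| + L' + 1 in absolute value, and balls of radius rho <= 1 around its
   points add at most 1: all of them lie in the straight part. *)
exists (`|t| + L' + 3) => l u hl' hu x0 hx0 x0rad.
have lgt : 0 < l by apply: lt_le_trans hl'; have := normr_ge0 t; move: L'0; clear - p2 hF m0; lra.
pose O := [set x | rr x < R4] `&` [set x : 'rV[R]_(m + 1) | `|height x - t| < L' + 1].
pose K := [set x | rr x <= R3] `&` [set x : 'rV[R]_(m + 1) | `|height x - t| <= L'].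
have cht : continuous (fun x : 'rV[R]_(m + 1) => `|height x - t|).
  move=> x; apply: (@continuous_comp _ _ _ (fun x => height x - t) Num.norm); last exact: norm_continuous.
  exact: (continuousB (@height_continuous R m x) (@cst_continuous _ _ t x)).
have crr : continuous rr by move=> x; exact: radius_continuous.
have oO : open O.
  apply: openI.
    by apply: (@open_comp _ _ rr [set s : R | s < R4]) => [x _|]; [exact: crr|exact: open_lt].
  by apply: (@open_comp _ _ (fun x => `|height x - t|) [set s : R | s < L' + 1]) => [x _|];
    [exact: cht|exact: open_lt].
have cK : compact K.
  apply: (@closed_bounded_compact R (m + 1) K (`|R3| + `|t| + L')).
    apply: closedI.
      by apply: (@closed_comp _ _ rr [set s : R | s <= R3]) => [x _|]; [exact: crr|exact: closed_le].
    by apply: (@closed_comp _ _ (fun x => `|height x - t|) [set s : R | s <= L']) => [x _|];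
      [exact: cht|exact: closed_le].
  move=> x i [/= h1 h2]; rewrite -[i]splitK; case: (fintype.split i) => j /=.
    rewrite -baseE -offset_lshift (le_trans (offset_le_radius _ _ _ _))// (le_trans h1)//.
    by rewrite (le_trans (ler_norm _))// -addrA lerDl addr_ge0// ltW.
  rewrite (ord1 j) -heightE -[height x](subrK t) (le_trans (ler_normD _ _))//.
  by have := normr_ge0 R3; move: h2; clear - p2 hF m0; lra.
have KO : K `<=` O.
  move=> x [/= h1 h2]; split => /=; first exact: le_lt_trans R34.
  by apply: le_lt_trans h2 _; rewrite ltrDl.
have ball_in x : O x -> forall x', radius [set: 'I_(m + 1)] x x' <= rho -> capped_cylinder l x'.
  move=> [/= h1 h2] x' hx'; have [h3 h4] := near_point_in_cylinder (ltW R20) (lt_trans h1 R42) R21 erefl hx'.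
  apply: capped_cylinder_core => //; apply: (le_lt_trans h4); apply: lt_le_trans hl'.
  have : `|height x| <= `|height x - t| + `|t| by rewrite -{1}[height x](subrK t) ler_normD.
  by move: h2; clear - p2 hF m0; lra.
have OS : O `<=` capped_cylinder l.
  by move=> x Ox; apply: (ball_in x Ox); rewrite radius_center ltW.
have uM x : O x -> u x <= M by move=> Ox; apply: le_trans M0M; exact: (hM0 _ _ _ hu (ball_in x Ox)).
pose xi := @cylinder_gradient R (m + 1) S 0 top chi b t.
pose H := @cylinder_hessian R (m + 1) S 0 top chi dq b.
pose W x := vh (rr x) + c + b * ((height x - t) * (height x - t)).
have inO x : O x -> 0 <= rr x <= R4 by move=> [/= h1 _]; rewrite radius_ge0 ltW.
have inO2 x : O x -> rr x < R2 by move=> [/= h1 _]; exact: lt_trans R42.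
have topS : top \notin S by rewrite notin_base_index.
have dh i x : is_derive x (delta_mx 0 i) (fun x : 'rV[R]_(m + 1) => height x - t) (i == top)%:R.
  have -> : (fun x : 'rV[R]_(m + 1) => height x - t) = (fun x => x 0 top - t).
    by apply: funext => y; rewrite heightE.
  rewrite -[X in is_derive _ _ _ X]subr0.
  exact: (is_deriveB (is_derive_coord x i top) (is_derive_cst t x (delta_mx 0 i))).
have dW i x : O x -> is_derive x (delta_mx 0 i) W (xi x 0 i).
  move=> Ox; have hr := inO x Ox.
  have d1 : is_derive x (delta_mx 0 i) (fun x => vh (rr x)) (chi (rr x) * offset S 0 x i).
    have := radius_ge0 S 0 x; rewrite le_eqVlt => /orP[/eqP r0|r0].
      rewrite offset0// mulr0; apply: is_derive_radial0 => //.
      by have := dvh (rr x) hr; rewrite -r0 QE' mulr0.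
    apply: is_derive_eq (is_derive_radial i r0 (dvh _ hr)) _.
    by rewrite QE' mulrACA mulfV ?gt_eqF// mulr1.
  have d2 := is_derive_rVM (is_derive_cst b x (delta_mx 0 i)) (is_derive_rVM (dh i x) (dh i x)).
  have d3 := is_deriveD (is_deriveD d1 (is_derive_cst c x (delta_mx 0 i))) d2.
  apply: is_derive_eq d3 _; rewrite mxE addr0 mul0r add0r heightE; congr (_ + _).
  by case: (i == top); rewrite /= ?mul0r ?mulr0 ?addr0 ?mulr0//; ring.
have dxi i j x : O x -> is_derive x (delta_mx 0 i) (fun y => xi y 0 j) (H i j x).
  move=> Ox; have -> : (fun y => xi y 0 j) =
      (fun y => chi (rr y) * offset S 0 y j + (j == top)%:R * (2 * b) * (y 0 top - t)).
    by apply: funext => y; rewrite mxE; congr (_ + _); rewrite mulrA.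
  have d1 := @is_derive_radial_field R (m + 1) S 0 chi (fun r => dq r - chi r) R2 x i j cchi dchi (inO2 x Ox).
  have d2 := is_derive_rVM (is_derive_cst ((j == top)%:R * (2 * b)) x (delta_mx 0 i))
     (is_deriveB (is_derive_coord x i top) (is_derive_cst t x (delta_mx 0 i))).
  apply: is_derive_eq (is_deriveD d1 d2) _; rewrite /H /cylinder_hessian mul0r add0r subr0.
  by congr (_ + _); exact: (esym (mulrA _ _ _)).
have ceta r : 0 <= r < R2 -> {for r, continuous (fun r => dq r - chi r)}.
  by move=> hr; apply: continuousB; [exact: cdq|exact: cchi].
have eta0 : dq 0 - chi 0 = 0 by rewrite dq0 subrr.
have cH i j x : O x -> {for x, continuous (H i j)}.
  move=> Ox; apply: continuousD; last exact: cst_continuous.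
  apply: continuousD.
    by apply: continuousM; [exact: (radial_continuous cchi (inO2 x Ox))|exact: cst_continuous].
  exact: (@radial_quotient_continuous R (m + 1) S 0 (fun r => dq r - chi r) R2 x i j ceta eta0 (inO2 x Ox)).
have cxi j x : O x -> {for x, continuous (fun y => xi y 0 j)}.
  move=> Ox; have -> : (fun y => xi y 0 j) =
      (fun y => chi (rr y) * offset S 0 y j + (j == top)%:R * (2 * b) * (y 0 top - t)).
    by apply: funext => y; rewrite mxE; congr (_ + _); rewrite mulrA.
  apply: continuousD.
    by apply: continuousM; [exact: (radial_continuous cchi (inO2 x Ox))|exact: offset_continuous].
  apply: continuousM; first exact: cst_continuous.
  by apply: continuousB; [exact: coord_continuous|exact: cst_continuous].
have cW x : O x -> {for x, continuous W}.
  move=> Ox; apply: continuousD.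
    apply: continuousD; last exact: cst_continuous.
    apply: (@continuous_comp _ _ _ rr vh); first exact: crr.
    exact: is_derive_cont (dvh _ (inO x Ox)).
  apply: continuousM; first exact: cst_continuous.
  by apply: continuousM; (apply: continuousB; [exact: height_continuous|exact: cst_continuous]).
pose g x := \sum_i flux_pderiv p xi H i x.
have hW : plaplace_weak p O W xi g by exact: (C1_plaplace_weak p2 dxi cxi cH oO cW dW).
have cg x : O x -> {for x, continuous g}.
  by move=> Ox; exact: (sum_continuous (fun i => @flux_pderiv_continuous R (m + 1) p p2 O xi H cxi cH i x Ox)).
(* Off K either the radius exceeds R3, where the dilated profile is above M, or the distance of the
   height from t exceeds L', where the parabola is at least b L'^2 = M. *)
have off x : O x -> ~ K x -> u x <= W x.
  move=> Ox nK; apply: (le_trans (uM x Ox)); have hr := inO x Ox.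
  have /andP[h1 _] := vvh _ hr; have h0 := v0 _ (in42 _ hr).
  have y0 : 0 <= b * ((height x - t) * (height x - t)) by rewrite mulr_ge0// -expr2 sqr_ge0.
  have [h2|h2] := leP (rr x) R3; last first.
    have : M < v (rr x).
      apply: ht1'; last by case/andP: (inr _ (in42 _ hr)).
      by rewrite (le_trans t1t)// mulrC -ler_pdivrMr// ltW.
    by rewrite /W; move: h1 y0 c0; clear - p2 hF m0; lra.
  have [h3|h3] := leP `|height x - t| L'; first by case: nK.
  have : M <= b * ((height x - t) * (height x - t)).
    rewrite -bE ler_wpM2l// -expr2 -(real_normK (num_real (height x - t))).
    by rewrite lerXn2r ?nnegrE ?(ltW L'0)// ltW.
  by rewrite /W; move: h1 h0 c0; clear - p2 hF m0; lra.
have strict x : O x -> g x < fb (W x).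
  move=> Ox; have hr := inO x Ox; have hr2 := in42 _ hr; have [_ /= hy] := Ox.
  have [dq_nn chi_nn hB] := hbd _ hr2.
  have [h1 h2] := @sum_flux_pderiv_le R (m + 1) p p2 S 0 top topS chi dq b t x b0 dq_nn dq0.
  rewrite -/xi -/H card_base_index in h1 h2.
  set B := (P (rr x) + tau) `^ (p - 1)^-1.
  have NB : enorm (xi x) <= B.
    apply: (le_trans h2); rewrite -QE' ger0_norm; last by rewrite QE' mulr_ge0 ?radius_ge0.
    rewrite /Q -/B tauq -heightE; have := small_slope _ hy; clear - p2 hF m0; lra.
  have NBp : enorm (xi x) `^ (p - 2) <= B `^ (p - 2).
    by apply: ge0_ler_powR; rewrite ?nnegrE ?powR_ge0 ?enorm_ge0 ?subr_ge0.
  have m1 : 0 <= m%:R - 1 :> R by rewrite subr_ge0 ler1n.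
  have h3 : g x <= B `^ (p - 2) * ((p - 1) * (dq (rr x) + 2 * b) + (m%:R - 1) * chi (rr x)).
    apply: (le_trans h1); rewrite ler_wpM2r// addr_ge0//; last exact: mulr_ge0 m1 chi_nn.
    exact: mulr_ge0 (ltW p10) (addr_ge0 dq_nn b20).
  have h4 : g x <= Gv (rr x) + 2 * b * (p - 1) * E0.
    apply: (le_trans h3); have h5 := mono_B _ hr; rewrite -/B in h5.
    have h6 : 2 * b * (p - 1) * B `^ (p - 2) <= 2 * b * (p - 1) * E0.
      by rewrite (ler_wpM2l bp0).
    have h7 : B `^ (p - 2) * ((p - 1) * dq (rr x) + (m%:R - 1) * chi (rr x)) <= Gv (rr x) by exact: hB.
    rewrite (_ : B `^ (p - 2) * _ = B `^ (p - 2) * ((p - 1) * dq (rr x) + (m%:R - 1) * chi (rr x)) +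
      2 * b * (p - 1) * B `^ (p - 2)); last by ring.
    exact: lerD.
  apply: (le_lt_trans h4); have /andP[h5 _] := vvh _ hr; have h0 := v0 _ hr2.
  have y0 : 0 <= b * ((height x - t) * (height x - t)) by rewrite mulr_ge0// -expr2 sqr_ge0.
  have h6 : fb (v (rr x) + c / 2) <= fb (W x) by apply: (fb_mono hF); rewrite /W; move: h5 y0; clear - p2 hF m0; lra.
  apply: lt_le_trans h6.
  have h7 : fb (c / 2) <= fb (v (rr x) + c / 2) by apply: (fb_mono hF); rewrite lerDr.
  have h8 : fb (v (rr x)) <= fb (v (rr x) + c / 2) by apply: (fb_mono hF); rewrite lerDl ltW.
  have h9 : gam <= (1 - lam `^ p) * fb (v (rr x) + c / 2) by rewrite ler_pM2l ?subr_gt0.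
  have h10 : Gv (rr x) <= lam `^ p * fb (v (rr x) + c / 2) by rewrite ler_pM2l.
  by move: small_curv h9 h10; clear - p2 hF m0; lra.
have x0O : O x0.
  split=> /=; first by apply: lt_trans R34; exact: lt_le_trans radR3.
  by rewrite hx0 subrr normr0 ltr_wpDr// ltW.
have := upper_barrier p2 hF oO cK KO (continuous_solutionS OS hu) hW cW cg off strict x0O.
move=> /le_trans; apply; rewrite /W hx0 subrr mulr0 mulr0 addr0 lerD2r.
have /andP[_ h] := vvh _ (inO x0 x0O); apply: (le_trans h).
apply: (radial_solution_mono hs); [by rewrite mulr_ge0 ?radius_ge0 ?(ltW lam0)| |exact: x0rad].
by rewrite ler_piMl ?radius_ge0// ltW.
Qed.

End cylinder_upper.

(** * The lower envelope *)

Section euclidean_norm.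
Context {R : realType} {n : nat}.
Implicit Types a b : 'rV[R]_n.

Lemma dot_le_enorm a b : dot a b <= enorm a * enorm b.
Proof.
have z (c d : 'rV[R]_n) : 0 = enorm c -> dot c d = 0.
  move=> c0; apply: big1 => i _; have -> : c 0 i = 0; last by rewrite mul0r.
  by apply/eqP; rewrite -normr_le0 c0 coord_le_enorm.
have := enorm_ge0 a; rewrite le_eqVlt => /orP[/eqP a0|a0]; first by rewrite (z _ _ a0) -a0 mul0r.
have := enorm_ge0 b; rewrite le_eqVlt => /orP[/eqP b0|b0].
  by rewrite dotC (z _ _ b0) -b0 mulr0.
have h : 0 <= \sum_i (enorm b * a 0 i - enorm a * b 0 i) ^+ 2 by apply: sumr_ge0 => i _; exact: sqr_ge0.
have E : \sum_i (enorm b * a 0 i - enorm a * b 0 i) ^+ 2 =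
    2 * (enorm a * enorm b) * (enorm a * enorm b - dot a b).
  rewrite (eq_bigr (fun i => enorm b ^+ 2 * (a 0 i * a 0 i) + enorm a ^+ 2 * (b 0 i * b 0 i) -
     2 * (enorm a * enorm b) * (a 0 i * b 0 i))); last by move=> i _; ring.
  rewrite sumrB big_split/= -!mulr_sumr -!/(dot _ _) -!sqr_enorm; ring.
by move: h; rewrite E pmulr_rge0 ?subr_ge0// !mulr_gt0.
Qed.

Lemma enormD a b : enorm (a + b) <= enorm a + enorm b.
Proof.
rewrite -(@ler_pXn2r _ 2)// ?nnegrE ?addr_ge0 ?enorm_ge0// sqr_enorm.
have -> : dot (a + b) (a + b) = dot a a + 2 * dot a b + dot b b.
  rewrite /dot mulr_sumr -!big_split/=; apply: eq_bigr => i _; rewrite !mxE; ring.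
rewrite -!sqr_enorm sqrrD lerD2r lerD2l mulr_natl ler_pMn2r//.
exact: dot_le_enorm.
Qed.

Lemma enormZ (s : R) a : 0 <= s -> enorm (s *: a) = s * enorm a.
Proof.
move=> s0; rewrite /enorm (_ : dot _ _ = s ^+ 2 * dot a a).
  by rewrite sqrtrM ?sqr_ge0// sqrtr_sqr ger0_norm.
by rewrite /dot mulr_sumr; apply: eq_bigr => i _; rewrite !mxE; ring.
Qed.

Lemma enorm_delta (i : 'I_n) : enorm (delta_mx 0 i : 'rV[R]_n) = 1.
Proof.
rewrite /enorm /dot (bigD1 i)//= big1 ?addr0 ?mxE ?eqxx ?mulr1 ?sqrtr1// => j /negPf ji.
by rewrite mxE ji andbF mul0r.
Qed.

Lemma enorm_continuous : continuous (@enorm R n).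
Proof.
move=> x; have -> : @enorm R n = radius [set: 'I_n] 0.
  by apply: funext => y; rewrite -enorm_radius subr0.
exact: radius_continuous.
Qed.

Lemma unit_ball_open : open (unit_ball : set 'rV[R]_n).
Proof.
by apply: (@open_comp _ _ (@enorm R n) [set t : R | t < 1]) => [x _|];
  [exact: enorm_continuous|exact: open_lt].
Qed.

Lemma boundary_unit_ball_ge x : boundary (unit_ball : set 'rV[R]_n) x -> 1 <= enorm x.
Proof.
move=> [_ nx]; rewrite leNgt; apply/negP => h; apply: nx.
by rewrite (_ : interior _ = unit_ball)//; apply/interior_id; exact: unit_ball_open.
Qed.

(** Shows that the boundary is nonempty, so that the infimum defining [dist] is a genuine one. *)
Lemma boundary_unit_ball_delta (i : 'I_n) : boundary (unit_ball : set 'rV[R]_n) (delta_mx 0 i).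
Proof.
split; last by move=> /interior_subset; rewrite /unit_ball /= enorm_delta ltxx.
move=> A /nbhs_ballP[e /= e0 eA].
pose s := Num.min (e / 2) 2^-1 : R.
have s0 : 0 < s by rewrite lt_min divr_gt0//= invr_gt0.
have se : s < e by rewrite gt_min; apply/orP; left; rewrite ltr_pdivrMr// ltr_pMr// ltr1n.
have s1 : s < 1 by rewrite gt_min; apply/orP; right; rewrite invf_lt1// ltr1n.
exists ((1 - s) *: delta_mx 0 i); split.
  by rewrite /unit_ball /= enormZ ?subr_ge0 ?(ltW s1)// enorm_delta mulr1 gtrBl.
apply: eA; apply/(ball_rV _ _ e0) => j; rewrite !mxE eqxx /=.
rewrite -{1}[_%:R]mul1r -mulrBl opprB addrC subrK normrM (gtr0_norm s0).
by case: (j == i); rewrite /= ?normr1 ?normr0 ?mulr1 ?mulr0.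
Qed.

Lemma blows_up_unit_ball (n0 : (0 < n)%N) (V : R -> R) (v : 'rV[R]_n -> R) :
  (forall M, exists2 rho : R, 0 < rho < 1 & forall r, rho <= r -> r < 1 -> M < V r) ->
  (forall x, unit_ball x -> v x = V (enorm x)) -> blows_up unit_ball v.
Proof.
move=> hV vV M; have [rho /andP[rho0 rho1] h] := hV M.
exists (1 - rho); first by rewrite subr_gt0.
move=> x Ux hd; rewrite vV//; apply: h => //.
have hi : has_inf [set enorm (x - y) | y in boundary unit_ball].
  split; last by exists 0 => _ [y _ <-]; exact: enorm_ge0.
  by exists (enorm (x - delta_mx 0 (Ordinal n0))); exists (delta_mx 0 (Ordinal n0)) => //;
    exact: boundary_unit_ball_delta.
have e0 : 0 < 1 - rho - dist x (boundary unit_ball) by rewrite subr_gt0.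
have [_ [y By <-]] := inf_adherent e0 hi; rewrite -/(dist x (boundary unit_ball)) => hxy.
have h1 := boundary_unit_ball_ge By.
have h2 : enorm y <= enorm x + enorm (y - x) by rewrite -{1}[y](subrK x) addrC enormD.
have h3 : enorm (y - x) = enorm (x - y).
  by rewrite -opprB /enorm; congr Num.sqrt; apply: eq_bigr => i _; rewrite !mxE mulrNN.
by move: hxy h1 h2; rewrite h3; lra.
Qed.

End euclidean_norm.

(** * Identification of the envelope *)

Section envelope.
Context {R : realType}.

Lemma W1p_loc_congr n (p : R) (O : set 'rV[R]_n) u u' Du : (forall x, O x -> u x = u' x) ->
  W1p_loc p O u Du -> W1p_loc p O u' Du.
Proof.
move=> uu h D ci; have [h1 h2] := h D ci; have [_ _ DO] := ci.
have E x : D x -> u x = u' x by move=> Dx; apply: uu; apply: DO; exact: subset_closure.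
split.
  by move: h1; rewrite /in_Lp (_ : u \_ D = u' \_ D)//; apply: funext => x;
    rewrite /patch; case: ifPn => //; rewrite inE => /E.
move=> i; have [h3 h4] := h2 i; split=> // phi hphi; rewrite -h4//.
by apply: eq_integral => x; rewrite inE => /E ->.
Qed.

Variables (m : nat) (p : R) (p2 : 2 <= p) (f : R -> R) (hF : condition_F p f) (m0 : (0 < m)%N).
Local Notation fb := (extend_by_zero f).
Local Notation rr := (radius (@base_index m) (0 : 'rV[R]_(m + 1))).

(** If V exceeded u at a point, so would some approximate solution z. But z is at most n + 1 and
    lies below u near the whole boundary, caps included, while its surplus makes it a strict
    subsolution: comparison forbids this. *)
Lemma cylinder_lower_bound (V : R -> R) (l : R) u :
  (forall r c, 0 <= r < 1 -> c < V r ->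
    exists n z k G, approximate_solution m p fb 1 n z k G /\ c < z r) ->
  0 < l -> continuous_solution p f (capped_cylinder l) u -> blows_up (capped_cylinder l) u ->
  forall x, capped_cylinder l x -> V (rr x) <= u x.
Proof.
move=> happ l0 hu hb x Sx; rewrite leNgt; apply/negP => lt.
have cyl (y : 'rV[R]_(m + 1)) : capped_cylinder l y -> rr y < 1.
  by move=> /(capped_cylinder_sub l0); rewrite /cylinder /unit_ball /= -radius_base.
have hx : 0 <= rr x < 1 by rewrite radius_ge0 cyl.
have [n [z [k [G [[hs zE cG hG _] ltz]]]]] := happ _ _ hx lt.
have [K [cK KO hK]] := blows_up_compact n.+1%:R (@capped_cylinder_open R m l)
  (capped_cylinder_compact l0) hb.
have hs' : radial_solution #|@base_index m| p 1 z k G by rewrite card_base_index.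
have S0 : (0 < #|@base_index m|)%N by rewrite card_base_index.
have cG' (r : R) : 0 <= r < 1 -> {for r, continuous G} by move=> _; exact: cG.
have hW := @radial_plaplace_weak R (m + 1) (@base_index m) 0 p 1 z k G (capped_cylinder l) p2 hs'
  cG' S0 cyl.
have zcont (r : R) : 0 <= r < 1 -> {for r, continuous z}.
  by move=> hr; exact: (radial_solution_cont (hs 1) hr).
have h := lower_barrier p2 hF (@capped_cylinder_open R m l) cK KO hu hW _ _ _ _ Sx.
have : z (rr x) <= u x.
  apply: h.
  - by move=> y Sy; exact: (radial_continuous zcont (cyl y Sy)).
  - by move=> y Sy; exact: (radial_continuous cG' (cyl y Sy)).
  - move=> y Sy nK; apply: le_trans (ltW (hK y Sy nK)); rewrite -zE.
    by apply: (radial_solution_mono (hs 2)); rewrite ?radius_ge0 ?ltr1n// ltW// cyl.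
  - move=> y Sy; have hy : 0 <= rr y <= 1 by rewrite radius_ge0 ltW// cyl.
    have /andP[h1 _] := hG _ hy; apply: lt_le_trans h1.
    by rewrite ltrDl invr_gt0.
by rewrite leNgt ltz.
Qed.

Lemma base_point_of (y : 'rV[R]_m) t : base (point_of y t) = y.
Proof. exact: row_mxKl. Qed.

Lemma height_point_of (y : 'rV[R]_m) t : height (point_of y t) = t.
Proof. by rewrite /height /point_of row_mxKr mxE eqxx. Qed.

Lemma lower_envelope_radial (V k : R -> R) (u : R -> 'rV[R]_(m + 1) -> R) (ell : 'rV[R]_(m + 1) -> R) :
  large_solution p f m 1 V k ->
  (forall r c, 0 <= r < 1 -> c < V r ->
    exists n z k' G, approximate_solution m p fb 1 n z k' G /\ c < z r) ->
  (forall rad' n z k' G, 1 <= rad' -> approximate_solution m p fb rad' n z k' G ->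
    forall r, 0 <= r < 1 -> z r <= V r) ->
  (forall l, 0 < l -> continuous_solution p f (capped_cylinder l) (u l)) ->
  (forall l, 0 < l -> blows_up (capped_cylinder l) (u l)) ->
  (forall x, cylinder x -> 0 < ell x /\ capped_cylinder (ell x) x) ->
  forall y t, unit_ball y -> lower_envelope u ell (point_of y t) = V (enorm y).
Proof.
move=> hV happ hub hu hb hell y t Uy; set x := point_of y t.
have rx : rr x = enorm y by rewrite radius_base base_point_of.
have cx : cylinder x by rewrite /cylinder /= base_point_of.
have [ell0 ellS] := hell x cx.
have hr : 0 <= enorm y < 1 by rewrite enorm_ge0.
have low l : ell x <= l -> V (enorm y) <= u l x.
  move=> h; have l0 := lt_le_trans ell0 h; rewrite -rx.
  by apply: (cylinder_lower_bound happ l0 (hu l l0) (hb l l0)); exact: (capped_cylinder_mono ell0 h).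
have lbA : has_lbound [set u l x | l in [set l | ell x <= l]].
  by exists (V (enorm y)) => _ [l /= hl <-]; exact: low.
apply/eqP; rewrite eq_le; apply/andP; split; last first.
  apply: lb_le_inf; first by exists (u (ell x) x); exists (ell x) => //=.
  by move=> _ [l /= hl <-]; exact: low.
apply/ler_addgt0Pr => e e0; have e2 : 0 < e / 2 by rewrite divr_gt0.
have Vc : V (enorm y) < V (enorm y) + e / 2 by rewrite ltrDl.
have [rad' [V' [k' [/andP[r1 r2] hV' hlt]]]] := large_solution_inner p2 hF m0 hr hV hub Vc.
have rad0 : 0 < rad' by case/andP: hr => h _; exact: le_lt_trans r1.
have [L hL] := cylinder_upper_bound p2 hF m0 t rad0 r2 hV' e2.
(* The infimum runs over all l >= ell x, so l may be taken as long as the barrier for the height t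
   requires. *)
pose l := Num.max (ell x) L.
have l1 : ell x <= l by rewrite le_max lexx.
have l2 : L <= l by rewrite le_max lexx orbT.
have h1 : u l x <= V' (enorm y) + e / 2.
  rewrite -rx; apply: (hL l (u l) l2 (hu l (lt_le_trans ell0 l1)) x).
    exact: height_point_of.
  by rewrite rx.
have h2 : lower_envelope u ell x <= u l x by apply: ge_inf => //; exists l.
by apply: (le_trans h2); apply: (le_trans h1); move: hlt; lra.
Qed.

End envelope.

Theorem theorem4p4 (R : realType) (m : nat) (p : R) (f : R -> R)
    (u : R -> 'rV[R]_(m + 1) -> R) (ell : 'rV[R]_(m + 1) -> R)
    (n_ge2 : (2 <= m + 1)%N) (p_ge2 : 2 <= p) (hF : condition_F p f)
    (u_sol : forall l : R, 0 < l -> weak_solution p f (capped_cylinder l) (u l))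
    (u_cont : forall l : R, 0 < l -> {within capped_cylinder l, continuous (u l)})
    (u_blowup : forall l : R, 0 < l -> blows_up (capped_cylinder l) (u l))
    (ell_spec : forall x, cylinder x -> 0 < ell x /\ capped_cylinder (ell x) x) :
  (forall (y : 'rV[R]_m) (s t : R), unit_ball y ->
     lower_envelope u ell (point_of y s) = lower_envelope u ell (point_of y t)) /\
  (forall t : R,
     let v := fun y : 'rV[R]_m => lower_envelope u ell (point_of y t) in
     weak_solution p f unit_ball v /\ blows_up unit_ball v).
Proof.
have m0 : (0 < m)%N by move: n_ge2; rewrite addn1.
have [V [k [hV happ hub]]] := large_solution_exists p_ge2 hF m0 (@ltr01 R).
have hu l : 0 < l -> continuous_solution p f (capped_cylinder l) (u l).
  by move=> l0; apply: weak_solution_continuous; [exact: capped_cylinder_open|exact: u_sol|exact: u_cont].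
have key := lower_envelope_radial p_ge2 hF m0 hV happ hub hu u_blowup ell_spec.
split=> [y s t Uy|t v]; first by rewrite !key.
have [hs V0 hl] := hV.
have vE (y : 'rV[R]_m) : unit_ball y -> v y = V (enorm y) by move=> Uy; exact: key.
have rE (y : 'rV[R]_m) : radius [set: 'I_m] 0 y = enorm y by rewrite -enorm_radius subr0.
have in01 (y : 'rV[R]_m) : unit_ball y -> 0 <= enorm y < 1 by move=> Uy; rewrite enorm_ge0.
split; last exact: (blows_up_unit_ball m0 hl vE).
split; first by move=> y Uy; rewrite vE// V0// in01.
have cd : #|[set: 'I_m]%SET| = m by rewrite cardsT card_ord.
have cG (r : R) : 0 <= r < 1 -> {for r, continuous (fun r => extend_by_zero f (V r))}.
  move=> hr; apply: (@continuous_comp _ _ _ V (extend_by_zero f)).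
    exact: (radial_solution_cont hs hr).
  exact: (fb_continuous hF).
have hs' : radial_solution #|[set: 'I_m]%SET| p 1 V k (fun r => extend_by_zero f (V r)) by rewrite cd.
have S0 : (0 < #|[set: 'I_m]%SET|)%N by rewrite cd.
have sub (y : 'rV[R]_m) : unit_ball y -> radius [set: 'I_m] 0 y < 1 by rewrite rE.
have [hW hweak] := @radial_plaplace_weak R m [set: 'I_m] 0 p 1 V k _ unit_ball p_ge2 hs' cG S0 sub.
(* The weak gradient is the one of the radial function V(|y|), with which v agrees on the ball. *)
eexists; first by apply: W1p_loc_congr hW => y Uy; rewrite vE// rE.
move=> D ci phi Dphi hphi; rewrite (hweak D ci phi Dphi hphi).
apply: eq_integral => y; rewrite inE => Dy.
have Uy : unit_ball y by have [_ _ h] := ci; apply: h; exact: subset_closure.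
by rewrite rE vE// (fbE f (V0 _ (in01 y Uy))).
Qed.
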